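(* Let $G$ be the simply connected simple complex algebraic group of type $F_4$ and let $H$ be any maximal reductive subgroup of $G$ other than the one of type $B_4$. Then none of the varieties $G/P_i$, $i=1,\ldots,4$, is a spherical $H$-variety.
   Context: The ground field is $\mathbb{C}$. A maximal reductive subgroup of $G$ means a subgroup maximal among the proper closed connected reductive subgroups of $G$. Fix a Borel subgroup $B$ of $G$; with Bourbaki numbering, $P_i\supset B$ is the maximal parabolic subgroup of $G$ associated to the fundamental weight $\omega_i$ (the stabilizer of the highest weight line in the irreducible $G$-module of highest weight $\omega_i$). $H$ acts on $G/P_i$ by left multiplication. $G/P_i$ is a spherical $H$-variety if a Borel subgroup of $H$ has an open orbit in it. The subgroup of type $B_4$ is unique up to conjugacy. *)

(* Defs.v *)
From HB Require Import structures.
From mathcomp Require Import all_boot all_order all_algebra.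
From mathcomp Require Import mpoly complex.
From mathcomp Require Import classical_sets reals.

Set Implicit Arguments.
Unset Strict Implicit.
Unset Printing Implicit Defensive.

Import GRing.Theory.
Local Open Scope classical_set_scope.
Local Open Scope ring_scope.

(* Linear algebraic groups over an algebraically closed field F are identified
   with their F-points, as Zariski closed subgroups of some GL_n(F). Every
   affine algebraic group has such a realization. *)

Section ZariskiTopology.
Variables (F : closedFieldType) (n : nat).
Implicit Types (X U : set 'M[F]_n) (p : {mpoly F[n * n]}).

Definition mxeval p (A : 'M[F]_n) : F := p.@[fun k => mxvec A 0 k].

Definition zclosed X : Prop :=
  exists S : set {mpoly F[n * n]},
    X = [set A | forall p, S p -> mxeval p A = 0].

Definition zopen_in X U : Prop :=
  exists2 Z : set 'M[F]_n, zclosed Z & U = X `\` Z.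

Definition zconnected X : Prop :=
  X !=set0 /\
  forall Z1 Z2, zclosed Z1 -> zclosed Z2 ->
    X `<=` Z1 `|` Z2 -> X `&` Z1 `&` Z2 = set0 ->
    X `<=` Z1 \/ X `<=` Z2.

(* The coordinate ring of a closed subset of GL_n is generated by the matrix
   entries and the inverse of the determinant. *)
Definition regular_on X (f : 'M[F]_n -> F) : Prop :=
  exists p (k : nat), forall A, X A -> f A = mxeval p A / (\det A) ^+ k.

End ZariskiTopology.

Section AlgebraicGroups.
Variables (F : closedFieldType) (n : nat).
Implicit Types (G H B N T K P S : set 'M[F]_n).

Record subgroup K : Prop := Subgroup {
  subgroup_unit : forall A, K A -> A \in unitmx;
  subgroup_one : K 1%:M;
  subgroup_mul : forall A1 A2, K A1 -> K A2 -> K (A1 *m A2);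
  subgroup_inv : forall A, K A -> K (invmx A) }.

Definition closed_subgroup G : Prop :=
  subgroup G /\
  exists2 Z : set 'M[F]_n,
    zclosed Z & G = [set A | A \in unitmx] `&` Z.

Definition closed_connected G : Prop := closed_subgroup G /\ zconnected G.

Definition normal_in N G : Prop :=
  N `<=` G /\ forall g x, G g -> N x -> N (g *m x *m invmx g).

Definition trivial N : Prop := N = [set 1%:M].

Definition generated S : set 'M[F]_n :=
  [set A | forall K, subgroup K -> S `<=` K -> K A].

Definition derived K : set 'M[F]_n :=
  generated [set C | exists x y,
    [/\ K x, K y & C = x *m y *m invmx x *m invmx y]].

Definition solvable K : Prop := exists k : nat, trivial (iter k derived K).

Definition commutative K : Prop :=
  forall x y, K x -> K y -> x *m y = y *m x.

Definition unipotent K : Prop :=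
  forall x, K x -> exists k : nat, (x - 1%:M) ^+ k = 0.

(* The unipotent radical (resp. the radical) is the largest closed connected
   normal unipotent (resp. solvable) subgroup. *)
Definition reductive G : Prop :=
  closed_connected G /\
  forall N, closed_connected N -> normal_in N G -> unipotent N -> trivial N.

Definition semisimple G : Prop :=
  closed_connected G /\
  forall N, closed_connected N -> normal_in N G -> solvable N -> trivial N.

Definition simple_group G : Prop :=
  [/\ closed_connected G, ~ commutative G &
   forall N, closed_connected N -> normal_in N G -> trivial N \/ N = G].

Definition maximal_reductive G H : Prop :=
  [/\ H `<=` G, H <> G, reductive H &
   forall K, reductive K -> H `<=` K -> K `<=` G -> K = H \/ K = G].

Definition borel_subgroup G B : Prop :=
  [/\ B `<=` G, closed_connected B, solvable B &
   forall K, closed_connected K -> solvable K ->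
     B `<=` K -> K `<=` G -> K = B].

Definition torus T : Prop :=
  closed_connected T /\
  exists2 Q : 'M[F]_n, Q \in unitmx &
    forall t, T t -> is_diag_mx (Q *m t *m invmx Q).

Definition maximal_torus G T : Prop :=
  [/\ T `<=` G, torus T &
   forall K, torus K -> T `<=` K -> K `<=` G -> K = T].

(* A homomorphism of algebraic groups T -> GL_1. It is represented by a function
   on all matrices, of which only the values on T matter. *)
Record character T (chi : 'M[F]_n -> F) : Prop := Character {
  character_regular : regular_on T chi;
  character_neq0 : forall t, T t -> chi t != 0;
  character_mul : forall s t, T s -> T t -> chi (s *m t) = chi s * chi t }.

(* The tangent space of G at the identity. *)
Definition lie_algebra G : set 'M[F]_n :=
  [set X | forall p : {mpoly F[n * n]},
     (forall A, G A -> mxeval p A = 0) ->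
     \sum_(k < n * n) mxeval p^`M(k) 1%:M * mxvec X 0 k = 0].

(* Roots with respect to T are the non-trivial weights of T in the adjoint
   action on the Lie algebra. G need not be reductive: it may be a Borel
   subgroup. *)
Definition is_root G T (chi : 'M[F]_n -> F) : Prop :=
  [/\ character T chi, exists2 t, T t & chi t != 1 &
   exists X, [/\ lie_algebra G X, X != 0 &
     forall t, T t -> t *m X *m invmx t = chi t *: X]].

End AlgebraicGroups.

Section RootSystems.
Variable r : nat.

(* The root system of the Cartan matrix A, A i j = <alpha_i, alpha_j^vee>, in
   coordinates with respect to the simple roots: the orbit of the simple roots
   under the Weyl group. *)
Inductive cartan_root (A : 'M[int]_r) : 'rV[int]_r -> Prop :=
| cartan_simple i : cartan_root A (delta_mx 0 i)
| cartan_reflection v j : cartan_root A v ->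
    cartan_root A (v - (v *m A) 0 j *: delta_mx 0 j).

Definition cartan_positive_root (A : 'M[int]_r) (v : 'rV[int]_r) : Prop :=
  cartan_root A v /\ forall i, 0 <= v 0 i.

End RootSystems.

(* Bourbaki numbering *)
Definition cartan_F4 : 'M[int]_4 :=
  \matrix_(i, j) nth 0 (nth [::]
    [:: [::  2; -1;  0;  0];
        [:: -1;  2; -2;  0];
        [::  0; -1;  2; -1];
        [::  0;  0; -1;  2]] i) j.

Definition cartan_B4 : 'M[int]_4 :=
  \matrix_(i, j) nth 0 (nth [::]
    [:: [::  2; -1;  0;  0];
        [:: -1;  2; -1;  0];
        [::  0; -1;  2; -2];
        [::  0;  0; -1;  2]] i) j.

Section RootDatum.
Variables (F : closedFieldType) (n r : nat).
Implicit Types (G B T : set 'M[F]_n) (alpha omega : 'I_r -> 'M[F]_n -> F).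
Implicit Types (A : 'M[int]_r) (v : 'rV[int]_r).

(* The integral combination of characters with coefficients v; the group of
   characters is written multiplicatively here. *)
Definition char_comb alpha v (t : 'M[F]_n) : F :=
  \prod_(i < r) alpha i t ^ v 0 i.

(* The map v |-> char_comb alpha v is an isomorphism from the root system of the
   Cartan matrix A onto the roots of (G, T), sending the simple roots to alpha.
   Such an isomorphism preserves the Cartan integers, hence
   <alpha_i, alpha_j^vee> = A i j. *)
Record root_base A G T alpha : Prop := RootBase {
  base_char : forall i, character T (alpha i);
  base_free : forall v, (forall t, T t -> char_comb alpha v t = 1) -> v = 0;
  base_root : forall v, cartan_root A v -> is_root G T (char_comb alpha v);
  base_full : forall chi, is_root G T chi ->
    exists2 v, cartan_root A v & forall t, T t -> chi t = char_comb alpha v t }.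

(* The base alpha is the one determined by the Borel subgroup B containing T. *)
Definition borel_base A B T alpha : Prop :=
  T `<=` B /\
  (forall v, cartan_root A v ->
     is_root B T (char_comb alpha v) <-> cartan_positive_root A v).

(* omega is the family of fundamental weights for the base alpha, i.e.
   <omega_i, alpha_j^vee> = delta_ij, and all of them are characters of T.
   Since A i j = <alpha_i, alpha_j^vee>, this reads
   alpha_i = \sum_j A i j * omega_j in additive notation. *)
Definition fundamental_weights A T alpha omega : Prop :=
  (forall i, character T (omega i)) /\
  forall i t, T t -> alpha i t = char_comb omega (row i A) t.

Definition of_type A G : Prop :=
  semisimple G /\
  exists T alpha, maximal_torus G T /\ root_base A G T alpha.

(* The character group of a maximal torus is the whole weight lattice. *)
Definition simply_connected_of_type A G : Prop :=
  semisimple G /\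
  exists T alpha omega,
    [/\ maximal_torus G T, root_base A G T alpha,
        fundamental_weights A T alpha omega &
        forall chi, character T chi ->
          exists v, forall t, T t -> chi t = char_comb omega v t].

End RootDatum.

Section Parabolics.
Variables (F : closedFieldType) (n : nat).
Implicit Types (G B H T P : set 'M[F]_n).

Record rational_rep G (m : nat) (rho : 'M[F]_n -> 'M[F]_m) : Prop := RationalRep {
  rep_regular : forall i j, regular_on G (fun g => rho g i j);
  rep_unit : forall g, G g -> rho g \in unitmx;
  rep_mul : forall g h, G g -> G h -> rho (g *m h) = rho g *m rho h }.

Definition irreducible_rep G (m : nat) (rho : 'M[F]_n -> 'M[F]_m) : Prop :=
  [/\ rational_rep G rho, (0 < m)%N &
   forall W : {vspace 'cV[F]_m},
     (forall g w, G g -> w \in W -> rho g *m w \in W) ->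
     W = 0%VS \/ W = fullv].

Definition highest_weight_vector B T (chi : 'M[F]_n -> F)
    (m : nat) (rho : 'M[F]_n -> 'M[F]_m) (v : 'cV[F]_m) : Prop :=
  [/\ v != 0, forall b, B b -> rho b *m v \in <[v]>%VS &
   forall t, T t -> rho t *m v = chi t *: v].

Definition line_stabilizer G (m : nat) (rho : 'M[F]_n -> 'M[F]_m)
    (v : 'cV[F]_m) : set 'M[F]_n :=
  [set g | G g /\ rho g *m v \in <[v]>%VS].

(* P is the maximal parabolic subgroup of G containing B associated to the i-th
   fundamental weight. *)
Definition fundamental_parabolic (r : nat) (A : 'M[int]_r) G B (i : 'I_r) P :
    Prop :=
  exists T alpha omega,
    [/\ maximal_torus G T, root_base A G T alpha, borel_base A B T alpha,
        fundamental_weights A T alpha omega &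
    exists m (rho : 'M[F]_n -> 'M[F]_m) v,
      [/\ irreducible_rep G rho,
          highest_weight_vector B T (omega i) rho v &
          P = line_stabilizer G rho v]].

Definition lcoset (g : 'M[F]_n) P : set 'M[F]_n := [set g *m p | p in P].

(* The points of G/P are the left cosets, and its Zariski topology is the
   quotient topology. *)
Definition quotient_open G P (U : set (set 'M[F]_n)) : Prop :=
  U `<=` [set lcoset g P | g in G] /\
  zopen_in G [set g | G g /\ U (lcoset g P)].

Definition quotient_orbit B P (x : 'M[F]_n) : set (set 'M[F]_n) :=
  [set lcoset (b *m x) P | b in B].

Definition spherical_quotient G P H : Prop :=
  exists2 BH, borel_subgroup H BH &
  exists2 x, G x & quotient_open G P (quotient_orbit BH P x).

End Parabolics.

(* Main.v *)
Require Import Defs.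
From mathcomp Require Import all_boot all_order all_algebra.
From mathcomp Require Import perm mpoly complex.
From mathcomp Require Import boolp classical_sets reals.
From mathcomp Require Import zify ring lra.

(** A reductive subgroup [H] has a nondegenerate trace form, hence a root system [R_H] of rank
    [rho <= 4] with respect to a maximal toral subalgebra of its Lie algebra. A solvable subgroup [S]
    of [H] pairs every weight vector with its opposite to zero, so that
    [2 dim S <= dim H + rho <= 2 rho + #|R_H|]. If a Borel subgroup [S] of [H] has an open orbit in
    [G/P_i], then [dim S >= dim G/P_i >= 15]: otherwise the homogeneous functions on the orbit of the
    highest weight vector would satisfy an algebraic relation. Hence [#|R_H| >= 30 - 2 rho]. A root
    system of rank at most 3 has at most 18 roots, which excludes [rho <= 3]. For [rho = 4], [R_H] is
    a closed symmetric subset of the roots of F4 with at least 22 elements: either everything, and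
    then [H = G]; or of type B4; or contained in a strictly larger proper closed symmetric subset,
    whose group lies strictly between [H] and [G]. *)

Set Implicit Arguments.
Unset Strict Implicit.
Unset Printing Implicit Defensive.

Import Order.TTheory GRing.Theory Num.Theory.
Local Open Scope ring_scope.

(** The geometry is carried by derivations at the identity: in characteristic zero, a polynomial all
    of whose iterated invariant derivatives along [lie K] vanish at [1] vanishes on the connected
    group [K]. Inclusions between groups are therefore read off from Lie algebras, and
    irreducibility of connected groups comes from the same argument. A maximal toral subalgebra of
    [lie H] has no a priori relation to the torus of [G] in which F4 is given. Tori are not
    conjugated: weights are compared through the characteristic polynomial of [ad] and the density
    of the conjugates of a maximal toral subalgebra in [lie G]. The outcome is an integer matrix [M]
    carrying the roots of F4 to the weights of the other torus. The dimension of an orbit is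
    measured by counting: on a group of dimension [d], polynomials of degree at most [k] span a
    space of dimension at most [(C * k + 1) ^ d]. Homogeneous functions are needed because [G/P_i]
    is an orbit of lines, not of vectors. The number 15 is the least dimension of the [G/P_i],
    attained at the two end nodes. The roots of [H] are closed in those of [G] because the bracket
    of two root spaces is nonzero when the sum is a root. *)

Fixpoint dotz (u v : seq int) : int :=
  if u is x :: u' then if v is y :: v' then x * y + dotz u' v' else 0 else 0.

(** The simple reflection [i] in coordinates with respect to the simple roots. The entry [i] of [C]
    must hold the values of the [i]-th coroot on all simple roots. *)
Definition crefl (C : seq (seq int)) i (v : seq int) : seq int :=
  set_nth 0 v i (v`_i - dotz (nth [::] C i) v).

(* The list is not extended beyond 26 elements: such a system is too large to be considered. *)
Definition cstep k C (L : seq (seq int)) :=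
  if (26 < size L)%N then L else
  undup (L ++ [seq v <- [seq crefl C i v | v <- L, i <- iota 0 k] | all (>= 0) v]).

Definition cunit k i : seq int := [seq (j == i)%:R | j <- iota 0 k].

Definition cclosed k C (L : seq (seq int)) :=
  all (fun v => all (fun i => let v' := crefl C i v in ~~ all (>= 0) v' || (v' \in L)) (iota 0 k)) L.

Definition cbfs k C := iter 20 (cstep k C) [seq cunit k i | i <- iota 0 k].

(** A matrix that is not of finite type passes by overflowing the cap; the size of the root system
    excludes it later. Nine is the number of positive roots of [B3] and of [C3], the maximum in rank
    at most 3. *)
Definition ccheck k C := let L := cbfs k C in (26 < size L)%N || (cclosed k C L && (size L <= 9)%N).

(* The possible pairs of Cartan integers of two distinct simple roots. *)
Definition cpairs : seq (int * int) := [:: (0, 0); (-1, -1); (-1, -2); (-2, -1); (-1, -3); (-3, -1)].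

Lemma ccheck1 : ccheck 1 [:: [:: 2]]. Proof. by vm_compute. Qed.

Lemma ccheck2 : all (fun p => ccheck 2 [:: [:: 2; p.1]; [:: p.2; 2]]) cpairs. Proof. by vm_compute. Qed.

Lemma ccheck3 : all (fun p => all (fun q => all (fun s =>
  ccheck 3 [:: [:: 2; p.1; q.1]; [:: p.2; 2; s.1]; [:: q.2; s.2; 2]]) cpairs) cpairs) cpairs.
Proof. by vm_compute. Qed.

(** * Root systems of rank at most 3 *)

Section SmallRank.
Variables (r : nat) (dot : 'rV[int]_r -> 'rV[int]_r -> int) (R : seq 'rV[int]_r).
Implicit Types (a b c s : 'rV[int]_r).
Hypothesis r3 : (r <= 3)%N.
Hypothesis dotC : forall a b, dot a b = dot b a.
Hypothesis dotD : forall a b c, dot (a + b) c = dot a c + dot b c.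
Hypothesis dotP : forall a, a != 0 -> 0 < dot a a.
Hypothesis uR : uniq R.
Hypothesis R52 : (size R <= 52)%N.
Hypothesis R0 : forall a, a \in R -> a != 0.
Hypothesis RN : forall a, a \in R -> - a \in R.
Hypothesis Rred : forall a j, a \in R -> a *+ j \in R -> (j <= 1)%N.
Hypothesis Rrefl : forall a b, a \in R -> b \in R ->
  exists2 m : int, 2 * dot a b = m * dot a a & b - a *~ m \in R.

Lemma sdot0 a : dot 0 a = 0. Proof. by apply: (addrI (dot 0 a)); rewrite -dotD !addr0. Qed.
Lemma sdotN a b : dot (- a) b = - dot a b.
Proof. by apply: (addrI (dot a b)); rewrite -dotD !subrr sdot0. Qed.
Lemma sdotZ a b (m : int) : dot (a *~ m) b = m * dot a b.
Proof.
have E j : dot (a *+ j) b = j%:Z * dot a b.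
  by elim: j => [|j IH]; rewrite ?mulr0n ?sdot0 ?mul0r // mulrS dotD IH intS mulrDl mul1r.
by case: m => m; [rewrite -pmulrn E|rewrite NegzE mulrNz -pmulrn sdotN E mulNr].
Qed.
Lemma sdot_sum (I : Type) (l : seq I) (G : I -> 'rV[int]_r) b :
  dot (\sum_(i <- l) G i) b = \sum_(i <- l) dot (G i) b.
Proof. exact: (big_morph (fun a => dot a b) (fun x y => dotD x y b) (sdot0 b)). Qed.

Lemma sdotB a b : dot (a - b) (a - b) = dot a a + dot b b - 2 * dot a b.
Proof. rewrite dotD !(dotC _ (a - b)) !dotD !sdotN !(dotC _ (- b)) !sdotN (dotC b a); ring. Qed.

Lemma sdot_le0 a : dot a a <= 0 -> a = 0.
Proof. by move=> h; apply/eqP; apply: contraLR h => /dotP; rewrite ltNge. Qed.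

(** Vectors are read as polynomials: a point that is not a root of the product of all of them gives
    an evaluation map with no zero on [R]. *)
Lemma functional_exists : exists la : 'rV[int]_r -> int,
  (forall a b, la (a + b) = la a + la b) /\ forall a, a \in R -> la a != 0.
Proof.
pose p := \prod_(a <- R) rVpoly a.
have p0 : p != 0.
  by rewrite prodf_seq_neq0; apply/allP => a /R0; apply: contra => /eqP h; rewrite -(rVpolyK a) h linear0.
have [B hB] : exists B : int, ~~ root p B.
  apply: contrapT => H; pose rs := [seq j%:Z | j <- iota 0 (size p)].
  have := @max_poly_roots _ p rs p0; rewrite size_map size_iota ltnn => h; suff : false by []; apply: h.
    by apply/allP => _ /mapP[j _ ->]; apply/negPn/negP => h; apply: H; exists j.
  by rewrite map_inj_uniq ?iota_uniq // => ? ? [].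
exists (fun a => (rVpoly a).[B]); split=> [a b|a aR]; first by rewrite linearD hornerD.
by apply: contra hB => h; rewrite /p (big_rem a) //= rootM; rewrite /root h.
Qed.

Section Base.
Variable la : 'rV[int]_r -> int.
Hypothesis laD : forall a b, la (a + b) = la a + la b.
Hypothesis laR : forall a, a \in R -> la a != 0.

Lemma la0 : la 0 = 0. Proof. by apply: (addrI (la 0)); rewrite -laD !addr0. Qed.
Lemma laN a : la (- a) = - la a. Proof. by apply: (addrI (la a)); rewrite -laD !subrr la0. Qed.
Lemma laZ a (m : int) : la (a *~ m) = m * la a.
Proof.
have E j : la (a *+ j) = j%:Z * la a.
  by elim: j => [|j IH]; rewrite ?mulr0n ?la0 ?mul0r // mulrS laD IH intS mulrDl mul1r.
by case: m => m; [rewrite -pmulrn E|rewrite NegzE mulrNz -pmulrn laN E mulNr].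
Qed.
Lemma la_sum (I : Type) (l : seq I) (G : I -> 'rV[int]_r) : la (\sum_(i <- l) G i) = \sum_(i <- l) la (G i).
Proof. exact: (big_morph la laD la0). Qed.

Definition posroots := [seq a <- R | 0 < la a].
Definition simples := [seq a <- posroots | ~~ has (fun b => (a - b) \in posroots) posroots].

Lemma posP a : (a \in posroots) = (0 < la a) && (a \in R). Proof. by rewrite mem_filter. Qed.

Lemma pos_or a : a \in R -> a \in posroots \/ - a \in posroots.
Proof.
move=> aR; have := laR aR; rewrite !posP aR (RN aR) !andbT laN oppr_gt0; case: ltgtP => //; by [left|right].
Qed.

Lemma size_pos : size R = (2 * size posroots)%N.
Proof.
have E : perm_eq R (posroots ++ [seq - a | a <- posroots]).
  apply: uniq_perm => // [|a].
    rewrite cat_uniq map_inj_uniq ?filter_uniq //=; last exact: oppr_inj.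
    rewrite andbT -all_predC; apply/allP => _ /mapP[a ha ->] /=; rewrite !posP in ha *.
    by rewrite laN oppr_gt0 negb_and; case/andP: ha => /ltW; rewrite leNgt => ->.
  rewrite mem_cat; apply/idP/orP => [/pos_or[]|[]]; [by left| |by rewrite posP => /andP[]|].
    by move=> h; right; apply/mapP; exists (- a); rewrite ?opprK.
  by case/mapP => b; rewrite posP => /andP[_ /RN h] ->.
by rewrite (perm_size E) size_cat size_map addnn mul2n.
Qed.

Lemma simple_pos s : s \in simples -> s \in posroots. Proof. by rewrite mem_filter => /andP[]. Qed.
Lemma simple_R s : s \in simples -> s \in R. Proof. by move/simple_pos; rewrite posP => /andP[]. Qed.
Lemma simple_la s : s \in simples -> 0 < la s. Proof. by move/simple_pos; rewrite posP => /andP[]. Qed.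

Lemma simple_indec s b : s \in simples -> b \in posroots -> s - b \in posroots -> False.
Proof. by rewrite mem_filter => /andP[/hasPn h _] /h /negP. Qed.

(** If the product were positive, both Cartan integers would be. A value 1 makes the difference a
    root, and then one of the two is decomposable; if both are at least 2, then [s - s'] has
    nonpositive square. *)
Lemma simple_obtuse s s' : s \in simples -> s' \in simples -> s != s' -> dot s s' <= 0.
Proof.
move=> hs hs' ss; rewrite leNgt; apply/negP => d0; have rs := simple_R hs; have rs' := simple_R hs'.
have [m E mR] := Rrefl rs rs'; have [m' E' mR'] := Rrefl rs' rs; rewrite (dotC s') in E'.
have ds := dotP (R0 rs); have ds' := dotP (R0 rs').
have N u v : u \in simples -> v \in simples -> u - v \in R -> False.
  move=> hu hv /pos_or[h|]; first exact: simple_indec hu (simple_pos hv) h.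
  by rewrite opprB; apply: simple_indec hv (simple_pos hu).
have [m1|m1] := eqVneq m 1; first by apply: (N _ _ hs' hs); rewrite m1 mulr1z in mR.
have [m1'|m1'] := eqVneq m' 1; first by apply: (N _ _ hs hs'); rewrite m1' mulr1z in mR'.
have m2 : 2 <= m.
  have : 0 < m by rewrite -(pmulr_lgt0 _ ds) -E; apply: mulr_gt0.
  by clear -m1; lia.
have m2' : 2 <= m'.
  have : 0 < m' by rewrite -(pmulr_lgt0 _ ds') -E'; apply: mulr_gt0.
  by clear -m1'; lia.
case/eqP: ss; apply/eqP; rewrite -subr_eq0; apply/eqP/sdot_le0; rewrite sdotB.
move: E E' m2 m2' ds ds'; move: (dot s s) (dot s' s') (dot s s') => x y z; clear; nia.
Qed.

Lemma pos_comb a : a \in posroots -> exists x : 'rV[int]_r -> nat, a = \sum_(s <- simples) s *+ x s.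
Proof.
move: {2}(`|la a|%N) (leqnn `|la a|%N) => N; elim: N a => [|N IH] a le aP.
  by move: aP le; rewrite posP => /andP[h _]; lia.
have [aS|] := boolP (a \in simples).
  exists (fun s => (s == a)%N); rewrite (bigD1_seq a) ?filter_uniq //= eqxx mulr1n big1 ?addr0 //.
  by move=> s /negPf->.
rewrite mem_filter aP andbT negbK => /hasP[b bP abP].
have la_a : la a = la b + la (a - b) by rewrite -laD addrC subrK.
have [b0 ab0] : 0 < la b /\ 0 < la (a - b) by move: bP abP; rewrite !posP => /andP[-> _] /andP[-> _].
have [|x Ex] := IH b _ bP; first by clear -le la_a b0 ab0; lia.
have [|y Ey] := IH (a - b) _ abP; first by clear -le la_a b0 ab0; lia.
exists (fun s => x s + y s)%N; rewrite -[LHS](subrK b) addrC {1}Ex Ey -big_split /=.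
by apply: eq_bigr => s _; rewrite mulrnDr.
Qed.

(** With disjoint supports, the square of the common value is a nonnegative combination of products
    of distinct simple roots, so it is at most 0 by [simple_obtuse] and the value is 0. Positivity
    of [la] on the simple roots then kills every coefficient. *)
Lemma simple_free (x y : 'rV[int]_r -> nat) : (forall s, x s = 0%N \/ y s = 0%N) ->
  \sum_(s <- simples) s *+ x s = \sum_(s <- simples) s *+ y s -> forall s, s \in simples -> x s = 0%N.
Proof.
move=> xy E; pose v := \sum_(s <- simples) s *+ x s.
have v0 : v = 0.
  apply: sdot_le0; rewrite {2}/v E /v sdot_sum big_seq sumr_le0 // => s hs.
  rewrite dotC sdot_sum big_seq sumr_le0 // => s' hs'.
  rewrite !pmulrn sdotZ dotC sdotZ mulrA.
  have [->|ss] := eqVneq s s'; first by case: (xy s') => ->; rewrite ?mul0r ?mulr0 ?mul0r.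
  by apply: mulr_ge0_le0; [rewrite mulr_ge0|apply: simple_obtuse].
move=> s hs; have : la v = 0 by rewrite v0 la0.
rewrite /v la_sum big_seq => /eqP; rewrite psumr_eq0 => [/allP/(_ s hs)|s' hs'].
  by rewrite hs pmulrn laZ mulf_eq0 (negPf (lt0r_neq0 (simple_la hs))) orbF => /eqP[].
by rewrite pmulrn laZ mulr_ge0 // ltW // simple_la.
Qed.

Lemma simple_inj (x y : 'rV[int]_r -> nat) : \sum_(s <- simples) s *+ x s = \sum_(s <- simples) s *+ y s ->
  forall s, s \in simples -> x s = y s.
Proof.
have red (z z' : 'rV[int]_r -> nat) : \sum_(s <- simples) s *+ z s = \sum_(s <- simples) s *+ z' s ->
    forall s, s \in simples -> (z s <= z' s)%N.
  move=> E s hs; rewrite -subn_eq0; apply/eqP.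
  apply: (@simple_free (fun s => z s - z' s)%N (fun s => z' s - z s)%N) (hs) => [s'|]; first by lia.
  apply: (addIr (\sum_(s <- simples) s *+ minn (z s) (z' s))); rewrite -!big_split /=.
  rewrite (eq_bigr (fun s => s *+ z s)) => [|s' _]; last by rewrite -mulrnDr; congr (_ *+ _); lia.
  by rewrite E; apply: eq_bigr => s' _; rewrite -mulrnDr; congr (_ *+ _); lia.
by move=> E s hs; apply/eqP; rewrite eqn_leq !red.
Qed.

(** A rational dependence with cleared denominators, split into its positive and negative parts,
    would contradict [simple_free]. *)
Lemma size_simple : (size simples <= r)%N.
Proof.
rewrite leqNgt; apply/negP => lt; pose k := size simples.
pose A : 'M[rat]_(k, r) := \matrix_(i, j) ((nth 0 simples i) 0 j)%:~R.
have : ~~ row_free A by rewrite -row_leq_rank -ltnNge; apply: leq_ltn_trans (rank_leq_col A) lt.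
rewrite -kermx_eq0 => /rowV0Pn[v /sub_kermxP vA v0].
have [q [d d0 Eq]] := rat_poly_scale (rVpoly v).
have vq i : v 0 i = d%:~R^-1 * (q`_i)%:~R.
  by rewrite -[in LHS](rVpolyK v) mxE Eq coefZ coef_map.
have qA j : \sum_(i < k) q`_i * (nth 0 simples i) 0 j = 0.
  have : \sum_i v 0 i * A i j = 0 by have /matrixP/(_ 0 j) := vA; rewrite [RHS]mxE mxE.
  move/(congr1 ( *%R d%:~R)); rewrite mulr0 mulr_sumr => E; apply: (@intr_inj rat); rewrite rmorph_sum -[RHS]E.
  by apply: eq_bigr => i _; rewrite vq [A _ _]mxE !mulrA mulfV ?mul1r ?intr_eq0 // rmorphM.
pose x s := if q`_(index s simples) is Posz m then m else 0%N.
pose y s := if q`_(index s simples) is Negz m then m.+1 else 0%N.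
have us : uniq simples by rewrite !filter_uniq.
have E : \sum_(s <- simples) s *+ x s = \sum_(s <- simples) s *+ y s.
  apply/eqP; rewrite -subr_eq0 -sumrB; apply/eqP.
  rewrite (big_nth 0) big_mkord; apply/rowP => j; rewrite summxE [RHS]mxE -[RHS](qA j).
  apply: eq_bigr => i _; rewrite !mxE !mulmxnE /x /y index_uniq //.
  by case: (q`_i) => m; rewrite ?mulr0n ?subr0 ?sub0r ?NegzE -mulr_natl natz ?mulNr.
have xy s : x s = 0%N \/ y s = 0%N by rewrite /x /y; case: (q`_ _); [right|left].
have [x0 y0] : (forall s, s \in simples -> x s = 0%N) /\ (forall s, s \in simples -> y s = 0%N).
  split; first exact: simple_free xy E.
  by apply: (simple_free _ (esym E)) => s; case: (xy s); [right|left].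
case/eqP: v0; apply/rowP => i; rewrite vq [RHS]mxE; suff -> : q`_i = 0 by rewrite mulr0.
have hi : nth 0 simples i \in simples by rewrite mem_nth.
by move: (x0 _ hi) (y0 _ hi); rewrite /x /y index_uniq //; case: (q`_i) => // m ->.
Qed.

(** Since [a] has positive square, it pairs positively with some simple root of its expansion. The
    reflected root cannot be negative, for then [a] would be a multiple of [s], hence [s] itself by
    reducedness. This is the descent used to enumerate positive roots. *)
Lemma pos_descent a : a \in posroots -> a \notin simples -> exists s (m : int),
  [/\ s \in simples, 2 * dot s a = m * dot s s, 0 < m & a - s *~ m \in posroots].
Proof.
move=> aP aS; have [x Ex] := pos_comb aP; have [la_a aR] : 0 < la a /\ a \in R by apply/andP; rewrite -posP.
have [s hs ds] : exists2 s, s \in simples & 0 < (x s)%:Z * dot s a.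
  apply: contrapT => H; suff : dot a a <= 0 by rewrite leNgt (dotP (R0 aR)).
  rewrite {1}Ex sdot_sum big_seq sumr_le0 // => s hs; rewrite pmulrn sdotZ leNgt; apply/negP => h.
  by apply: H; exists s.
have sa : 0 < dot s a by move: ds; case: (x s) => [|m]; rewrite ?mul0r ?ltxx // pmulr_rgt0.
have [m E mR] := Rrefl (simple_R hs) aR.
have m0 : 0 < m by rewrite -(pmulr_lgt0 _ (dotP (R0 (simple_R hs)))) -E mulr_gt0.
exists s, m; split=> //; case: (pos_or mR) => // /pos_comb[y Ey]; case/negP: aS.
(* Both [a] and [s *~ m - a] are nonnegative combinations, and they add up to a multiple of [s];
   uniqueness of coordinates leaves only [s] in [a]. *)
have Em : \sum_(s <- simples) s *+ (x s + y s)%N = \sum_(s' <- simples) s' *+ ((s' == s) * `|m|)%N.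
  rewrite [RHS](bigD1_seq s) ?filter_uniq //= eqxx mul1n.
  rewrite [X in _ = _ + X]big1 ?addr0 => [|s' /negPf->]; last by rewrite mul0n mulr0n.
  under eq_bigr => s' _ do rewrite mulrnDr.
  by rewrite big_split /= -Ex -Ey opprB addrC subrK pmulrn gez0_abs // ltW.
have xs s' : s' \in simples -> s' != s -> x s' = 0%N.
  by move=> hs' ne; have := simple_inj Em hs'; rewrite (negPf ne) mul0n => /eqP; rewrite addn_eq0 => /andP[/eqP].
have aE : a = s *+ x s.
  rewrite {1}Ex (bigD1_seq s) ?filter_uniq //= big_seq_cond big1 ?addr0 // => s' /andP[h1 h2].
  by rewrite xs.
have := Rred (simple_R hs) (j := x s); rewrite -aE aR => /(_ isT).
by move: aE la_a; case: (x s) => [->|[|//]]; [rewrite la0|rewrite mulr1n => ->].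
Qed.

Let k := size simples.
Let sm i := nth 0 simples i.
Definition cart i j : int := ((2 * dot (sm i) (sm j)) %/ dot (sm i) (sm i))%Z.
Definition cmat := mkseq (fun i => mkseq (cart i) k) k.
Definition lincomb (v : seq int) := \sum_(i < k) sm i *~ v`_i.

Lemma sm_in i : (i < k)%N -> sm i \in simples. Proof. exact: mem_nth. Qed.

Lemma cartE i j : (i < k)%N -> (j < k)%N -> 2 * dot (sm i) (sm j) = cart i j * dot (sm i) (sm i).
Proof.
move=> ik jk; have ri := simple_R (sm_in ik); have [m E _] := Rrefl ri (simple_R (sm_in jk)).
by rewrite /cart E mulzK // lt0r_neq0 // dotP // R0.
Qed.

Lemma cart_diag i : (i < k)%N -> cart i i = 2.
Proof.
move=> ik; have := cartE ik ik; apply: contra_eq => h; apply: contra h => /eqP.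
by move/(mulIf (lt0r_neq0 (dotP (R0 (simple_R (sm_in ik))))))=> <-.
Qed.

(** Positivity of the form at three vectors is enough: at [sm i + sm j] it excludes that both
    integers are at most -2, and at the two vectors with coefficients 1 and 2 it bounds the other
    integer below by -3. *)
Lemma cart_pair i j : (i < k)%N -> (j < k)%N -> i != j -> (cart i j, cart j i) \in cpairs.
Proof.
move=> ik jk ij; have := cartE ik jk; have := cartE jk ik; rewrite (dotC (sm j)).
have us : uniq simples by rewrite !filter_uniq.
have ss : sm i != sm j by rewrite nth_uniq.
have := simple_obtuse (sm_in ik) (sm_in jk) ss.
have := dotP (R0 (simple_R (sm_in ik))); have := dotP (R0 (simple_R (sm_in jk))).
have P2 (p q : nat) : (p + q != 0)%N -> 0 < dot (sm i *~ p + sm j *~ q) (sm i *~ p + sm j *~ q).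
  move=> pq; apply: dotP; apply/eqP => /(congr1 la); rewrite laD !laZ la0.
  have := simple_la (sm_in ik); have := simple_la (sm_in jk); move: pq; clear; nia.
have P1 (p q : nat) : dot (sm i *~ p + sm j *~ q) (sm i *~ p + sm j *~ q) =
    p%:Z * p%:Z * dot (sm i) (sm i) + q%:Z * q%:Z * dot (sm j) (sm j) + 2 * p%:Z * q%:Z * dot (sm i) (sm j).
  by rewrite dotD !sdotZ !(dotC _ (_ + _)) !dotD !sdotZ (dotC (sm j) (sm i)); ring.
have := P2 1%N 1%N isT; have := P2 1%N 2%N isT; have := P2 2%N 1%N isT; rewrite !P1; clear.
move: (dot (sm i) (sm i)) (dot (sm j) (sm j)) (dot (sm i) (sm j)) (cart i j) (cart j i) => x y z p q.
move=> h1 h2 h3 y0 x0 z0 Eq Ep.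
have p0 : p <= 0 by nia.
have q0 : q <= 0 by nia.
case: (eqVneq z 0) => [zE|zn].
  have -> : p = 0 by clear -zE x0 Ep; nia.
  have -> : q = 0 by clear -zE y0 Eq; nia.
  exact: isT.
have p1 : p <= -1 by nia.
have q1 : q <= -1 by nia.
have : p = -1 \/ q = -1.
  have [|] := leP p (-2) => hp; last by left; lia.
  have [|] := leP q (-2) => hq; last by right; lia.
  by exfalso; nia.
case=> E; [have : -3 <= q by nia|have : -3 <= p by nia]; rewrite E.
  move=> q3; have : q = -1 \/ q = -2 \/ q = -3 by clear -q1 q3; lia.
  by case=> [->|[->|->]]; exact: isT.
move=> p3; have : p = -1 \/ p = -2 \/ p = -3 by clear -p1 p3; lia.
by case=> [->|[->|->]]; exact: isT.
Qed.

Lemma cmat_check : ccheck k cmat.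
Proof.
have := size_simple; rewrite -/k => /leq_trans/(_ r3).
have D := cart_diag; have P := cart_pair; rewrite /cmat /mkseq.
move: D P; case: k => [|[|[|[|//]]]] D P _ /=; first by vm_compute.
- by rewrite D //; exact: ccheck1.
- rewrite !D //; have /allP/(_ _ (P 0%N 1%N isT isT isT)) := ccheck2; exact.
- rewrite !D //; have /allP/(_ _ (P 0%N 1%N isT isT isT))/allP/(_ _ (P 0%N 2%N isT isT isT)) := ccheck3.
  by move/allP/(_ _ (P 1%N 2%N isT isT isT)).
Qed.

Lemma dotz_sum (u v : seq int) m : size u = m -> size v = m -> dotz u v = \sum_(j < m) u`_j * v`_j.
Proof.
elim: m u v => [|m IH] [|x u] [|y v] //=; first by rewrite big_ord0.
by case=> /IH h [/h E]; rewrite big_ord_recl /= E.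
Qed.

Lemma crefl_size i v : (i < k)%N -> size v = k -> size (crefl cmat i v) = k.
Proof. by move=> ik vk; rewrite size_set_nth vk; apply/maxn_idPr. Qed.

Lemma lincomb_crefl i v : (i < k)%N -> size v = k -> exists2 m : int,
  2 * dot (sm i) (lincomb v) = m * dot (sm i) (sm i) & lincomb (crefl cmat i v) = lincomb v - sm i *~ m.
Proof.
move=> ik vk; exists (dotz (nth [::] cmat i) v).
  rewrite nth_mkseq // (@dotz_sum _ _ k) ?size_mkseq // dotC sdot_sum mulr_sumr mulr_suml.
  by apply: eq_bigr => j _; rewrite nth_mkseq // sdotZ dotC mulrCA cartE // mulrCA mulrA.
rewrite /lincomb (bigD1 (Ordinal ik)) //= [in RHS](bigD1 (Ordinal ik)) //= nth_set_nth /= eqxx mulrzBr.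
rewrite addrAC; congr (_ + _ - _); apply: eq_bigr => j ji; rewrite nth_set_nth /= ifN //.
Qed.

Lemma lincomb_inj u v : size u = k -> size v = k -> all (>= 0) u -> all (>= 0) v -> lincomb u = lincomb v -> u = v.
Proof.
move=> uk vk u0 v0; have us : uniq simples by rewrite !filter_uniq.
have E x : size x = k -> all (>= 0) x -> lincomb x = \sum_(s <- simples) s *+ absz (x`_(index s simples))%R.
  move=> xk /allP x0; rewrite (big_nth 0) big_mkord; apply: eq_bigr => i _; rewrite index_uniq // pmulrn.
  by rewrite gez0_abs // x0 // mem_nth // xk.
rewrite (E u) // (E v) // => /simple_inj h; apply: (@eq_from_nth _ 0) => [|i]; first by rewrite uk.
rewrite uk => ik; have := h _ (sm_in ik); rewrite index_uniq // => /(congr1 Posz).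
by rewrite !gez0_abs //; [apply: (allP v0)|apply: (allP u0)]; rewrite mem_nth ?uk ?vk.
Qed.

Lemma lincomb_pos v : size v = k -> all (>= 0) v -> lincomb v \in R -> lincomb v \in posroots.
Proof.
move=> vk /allP v0 vR; rewrite posP vR andbT lt_def laR //= la_sum sumr_ge0 // => i _.
by rewrite laZ; apply: mulr_ge0; [apply/v0/mem_nth; rewrite vk|rewrite ltW // simple_la // sm_in].
Qed.

Lemma lincomb_unit i : (i < k)%N -> lincomb (cunit k i) = sm i.
Proof.
move=> ik; rewrite /lincomb (bigD1 (Ordinal ik)) //= big1 => [|j /negPf ji].
  by rewrite (nth_map 0%N) ?size_iota // nth_iota // add0n eqxx mulr1z addr0.
rewrite (nth_map 0%N) ?size_iota // nth_iota // add0n.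
by rewrite (_ : (nat_of_ord j == i) = false) ?mulr0z //; rewrite -ji.
Qed.

Definition good_list (L : seq (seq int)) := uniq L /\
  forall v, v \in L -> [/\ size v = k, all (>= 0) v & lincomb v \in posroots].

Lemma good_bfs m : good_list (iter m (cstep k cmat) [seq cunit k i | i <- iota 0 k]).
Proof.
elim: m => [|m [uL IH]].
  split=> [|v].
    rewrite map_inj_in_uniq ?iota_uniq // => i j; rewrite !mem_iota !add0n /= => ik jk /(congr1 (nth 0 ^~ i)).
    rewrite !(nth_map 0%N) ?size_iota // nth_iota // add0n eqxx; by case: eqP.
  case/mapP=> i; rewrite mem_iota add0n => /andP[_ ik] ->; split; first by rewrite size_map size_iota.
    by apply/allP => _ /mapP[j _ ->]; case: eqP.
  by rewrite lincomb_unit // simple_pos // sm_in.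
rewrite iterS; move: (iter m _ _) uL IH => L uL IH; rewrite /cstep; case: ifP => // _.
split=> [|v]; first exact: undup_uniq.
rewrite mem_undup mem_cat => /orP[/IH //|]; rewrite mem_filter => /andP[v0 /allpairsP[[u i]] /=].
rewrite mem_iota add0n => -[/IH[uk u0 uP] /andP[_ ik] vE].
have vk : size v = k by rewrite vE crefl_size.
split=> //; apply: lincomb_pos => //; rewrite vE; have [m' E ->] := lincomb_crefl ik uk.
have vuR : lincomb u \in R by move: uP; rewrite posP => /andP[].
have [m2 E2] := Rrefl (simple_R (sm_in ik)) vuR.
by rewrite (_ : m2 = m') //; apply: (mulIf (lt0r_neq0 (dotP (R0 (simple_R (sm_in ik)))))); rewrite -E2 -E.
Qed.

(** Induction on [la]: [pos_descent] reflects a non-simple positive root to a lower one, which is in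
    the list, and closure under the same reflection leads back. *)
Lemma bfs_complete L : good_list L -> cclosed k cmat L -> (forall i, (i < k)%N -> cunit k i \in L) ->
  forall a, a \in posroots -> exists2 v, v \in L & lincomb v = a.
Proof.
move=> [uL gL] cl uni a; move: {2}(`|la a|%N) (leqnn `|la a|%N) => N; elim: N a => [|N IH] a le aP.
  by move: aP le; rewrite posP => /andP[h _]; lia.
have [aS|aS] := boolP (a \in simples).
  have ik : (index a simples < k)%N by rewrite index_mem.
  by exists (cunit k (index a simples)); [exact: uni|rewrite lincomb_unit // /sm nth_index].
have [s [m [hs E m0 bP]]] := pos_descent aP aS.
have la_b : la (a - s *~ m) = la a - m * la s by rewrite laD laN laZ.
have ls := simple_la hs; have lb : 0 < la (a - s *~ m) by move: bP; rewrite posP => /andP[].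
have [|u uL' Eu] := IH _ _ bP.
  have : 0 < m * la s by apply: mulr_gt0.
  by clear -le la_b lb; lia.
have ik : (index s simples < k)%N by rewrite index_mem.
have [uk u0 _] := gL _ uL'; have [m' E' Ev] := lincomb_crefl ik uk.
rewrite /sm nth_index // Eu in E' Ev.
have Em : m' = - m.
  apply: (mulIf (lt0r_neq0 (dotP (R0 (simple_R hs))))); rewrite -E' dotC dotD sdotN sdotZ (dotC a) mulrDr E.
  ring.
have va : lincomb (crefl cmat (index s simples) u) = a by rewrite Ev Em mulrNz opprK subrK.
exists (crefl cmat (index s simples) u) => //.
have /allP/(_ _ uL')/allP/(_ (index s simples)) := cl; rewrite mem_iota add0n ik => /(_ isT) /orP[|//].
case/negP; have [x Ex] := pos_comb aP.
have us : uniq simples by rewrite !filter_uniq.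
pose v := mkseq (fun i => (x (sm i))%:Z) k.
suff -> : crefl cmat (index s simples) u = v by apply/allP => _ /mapP[j _ ->].
pose c := crefl cmat (index s simples) u; have ck : size c = k by rewrite crefl_size.
(* The coordinates of the reflected vector are not yet known to be nonnegative, as [lincomb_inj]
   demands; both sides are shifted by a common large constant. *)
pose big := (\max_(i < k) absz (c`_i)%R)%N.
have ge i : (i < k)%N -> 0 <= c`_i + big%:Z.
  by move=> hi; have := @leq_bigmax _ (fun i : 'I_k => absz (c`_i)%R) (Ordinal hi); rewrite /= -/big; clear; lia.
pose sh (y : seq int) := mkseq (fun i => y`_i + big%:Z) k.
have valsh y : lincomb (sh y) = lincomb y + \sum_(i < k) sm i *~ big.
  by rewrite -big_split; apply: eq_bigr => i _ /=; rewrite nth_mkseq // mulrzDr.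
have : sh c = sh v.
  apply: lincomb_inj; rewrite ?size_mkseq //.
  - by apply/allP => _ /mapP[i + ->]; rewrite mem_iota add0n => /andP[_ /ge].
  - by apply/allP => _ /mapP[i + ->]; rewrite mem_iota add0n => /andP[_ hi]; rewrite nth_mkseq // addr_ge0.
  rewrite !valsh va; congr (_ + _); rewrite [LHS]Ex (big_nth 0) big_mkord; apply: eq_bigr => i _.
  by rewrite nth_mkseq // pmulrn.
move=> Esh; apply: (@eq_from_nth _ 0) => [|i]; first by rewrite ck size_mkseq.
rewrite ck => hi; have := congr1 (nth 0 ^~ i) Esh; rewrite !nth_mkseq // => /addIr //.
Qed.

Lemma bfs_unit m i : (i < k)%N -> cunit k i \in iter m (cstep k cmat) [seq cunit k i | i <- iota 0 k].
Proof.
move=> ik; elim: m => [|m IH]; first by apply: map_f; rewrite mem_iota.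
by rewrite iterS {1}/cstep; case: ifP => // _; rewrite mem_undup mem_cat IH.
Qed.

Lemma pos_le9 : (size posroots <= 9)%N.
Proof.
have [L [g uni chk]] : exists L, [/\ good_list L, forall i, (i < k)%N -> cunit k i \in L &
    (26 < size L)%N || (cclosed k cmat L && (size L <= 9)%N)].
  exists (cbfs k cmat); split; [exact: good_bfs|move=> i; exact: bfs_unit|exact: cmat_check].
have up : uniq posroots by rewrite filter_uniq.
have inj : {in L &, injective lincomb}.
  by move=> u v /(g.2)[uk u0 _] /(g.2)[vk v0 _]; apply: lincomb_inj.
(* An overflowing list would consist of more than 26 distinct positive roots, against [R52]. *)
case/orP: chk => [big|/andP[cl le]].
  have : (size L <= size posroots)%N.
    rewrite -(size_map lincomb); apply: uniq_leq_size; first by rewrite map_inj_in_uniq //; case: g.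
    by move=> _ /mapP[v /(g.2)[_ _ h] ->].
  by move=> /(leq_trans big); move: R52; rewrite size_pos; clear; lia.
apply: leq_trans le; rewrite -(size_map lincomb); apply: uniq_leq_size => // a aP.
by have [v vL <-] := bfs_complete g cl uni aP; exact: map_f.
Qed.

End Base.

Theorem small_rank_roots : (size R <= 18)%N.
Proof. by have [la [laD laR]] := functional_exists; rewrite (size_pos laD laR); have := pos_le9 laD laR; lia. Qed.
End SmallRank.

(* The columns of the Cartan matrices. *)
Definition colsF4 : seq (seq int) := [:: [:: 2; -1; 0; 0]; [:: -1; 2; -1; 0]; [:: 0; -2; 2; -1]; [:: 0; 0; -1; 2]].
Definition colsB4 : seq (seq int) := [:: [:: 2; -1; 0; 0]; [:: -1; 2; -1; 0]; [:: 0; -1; 2; -1]; [:: 0; 0; -2; 2]].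

Definition rstep C (L : seq (seq int)) := undup (L ++ [seq crefl C i v | v <- L, i <- iota 0 4]).
Definition rlist C := iter 14 (rstep C) [seq cunit 4 i | i <- iota 0 4].
Definition rclosed C (L : seq (seq int)) :=
  all (fun i => cunit 4 i \in L) (iota 0 4) && all (fun v => all (fun i => crefl C i v \in L) (iota 0 4)) L.

Definition srow (s : seq int) : 'rV[int]_4 := \row_i s`_i.
Definition rseq (v : 'rV[int]_4) : seq int := [seq v 0 i | i <- enum 'I_4].

Lemma size_rseq v : size (rseq v) = 4%N. Proof. by rewrite size_map size_enum_ord. Qed.

Lemma nth_rseq v (i : 'I_4) : (rseq v)`_i = v 0 i.
Proof. by rewrite (nth_map i) ?size_enum_ord // nth_ord_enum. Qed.

Lemma rseqK v : srow (rseq v) = v. Proof. by apply/rowP => i; rewrite mxE nth_rseq. Qed.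

Lemma srowK s : size s = 4%N -> rseq (srow s) = s.
Proof.
move=> s4; apply: (@eq_from_nth _ 0) => [|i]; first by rewrite size_rseq.
by rewrite size_rseq => hi; rewrite (nth_rseq _ (Ordinal hi)) mxE.
Qed.

(** * Closed subsets of the roots of F4 *)

Section CartanList.
Variables (A : 'M[int]_4) (C : seq (seq int)).
Hypothesis AC : forall i j : 'I_4, A i j = (nth [::] C j)`_i.
Hypothesis sC : all (fun c => size c == 4%N) C && (size C == 4%N).

Lemma srow_crefl (j : 'I_4) s : size s = 4%N -> srow (crefl C j s) = srow s - (srow s *m A) 0 j *: delta_mx 0 j.
Proof.
move=> s4; have [/allP c4 /eqP C4] := andP sC.
have E : dotz (nth [::] C j) s = (srow s *m A) 0 j.
  rewrite (@dotz_sum _ _ 4) //; last by apply/eqP/c4/mem_nth; rewrite C4.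
  by rewrite mxE; apply: eq_bigr => i _; rewrite mxE AC mulrC.
move: ((srow s *m A) 0 j) E => c E; apply/rowP => i; rewrite /crefl E !mxE nth_set_nth /= (inj_eq (@ord_inj 4)).
by case: eqVneq => [->|ij]; rewrite ?mulr1 ?mulr0 ?subr0.
Qed.

Lemma size_crefl i s : (i < 4)%N -> size s = 4%N -> size (crefl C i s) = 4%N.
Proof. by move=> i4 s4; rewrite size_set_nth s4; apply/maxn_idPr. Qed.

Lemma srow_cunit (i : 'I_4) : srow (cunit 4 i) = delta_mx 0 i.
Proof.
by apply/rowP => j; rewrite !mxE (nth_map 0%N) ?size_iota ?ltn_ord // nth_iota ?ltn_ord // add0n eqxx /=.
Qed.

(** Closure of the list contains the inductive orbit; conversely, each round of the construction
    only adds reflections of roots. *)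
Lemma cartan_root_rlist k L : L = iter k (rstep C) [seq cunit 4 i | i <- iota 0 4] -> rclosed C L ->
  forall v, cartan_root A v <-> rseq v \in L.
Proof.
move=> LE /andP[/allP uL /allP cL] v; split=> [|vL].
  elim=> [i|u j _ uu]; first by rewrite -srow_cunit srowK ?size_map ?size_iota // uL // mem_iota ltn_ord.
  have := cL _ uu => /allP/(_ (j : nat)); rewrite mem_iota ltn_ord => /(_ isT).
  rewrite -[crefl C j (rseq u)]srowK ?size_crefl ?size_rseq ?ltn_ord //.
  by rewrite srow_crefl ?size_rseq // rseqK.
rewrite LE in vL; suff G m : forall s, s \in iter m (rstep C) [seq cunit 4 i | i <- iota 0 4] -> size s = 4%N /\ cartan_root A (srow s).
  by rewrite -(rseqK v); case: (G _ _ vL).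
elim: m => [|m IH] s.
  case/mapP=> i; rewrite mem_iota add0n => /andP[_ i4] ->; rewrite size_map size_iota; split=> //.
  by rewrite (srow_cunit (Ordinal i4)); constructor.
rewrite iterS mem_undup mem_cat => /orP[/IH //|/allpairsP[[u i] /= [/IH[u4 cu] hi ->]]].
have i4 : (i < 4)%N by move: hi; rewrite !inE => /or4P[] /eqP->.
split; first exact: size_crefl.
by rewrite (@srow_crefl (Ordinal i4)) //; constructor.
Qed.
End CartanList.

Definition listF4 := Eval vm_compute in rlist colsF4.
Definition listB4 := Eval vm_compute in rlist colsB4.

Lemma listF4P v : cartan_root cartan_F4 v <-> rseq v \in listF4.
Proof.
apply: (@cartan_root_rlist _ colsF4 _ _ 14); try by vm_compute.
by move=> i j; rewrite mxE; case: i => [[|[|[|[|]]]]] //= ?; case: j => [[|[|[|[|]]]]] //= ?.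
Qed.

Lemma listB4P v : cartan_root cartan_B4 v <-> rseq v \in listB4.
Proof.
apply: (@cartan_root_rlist _ colsB4 _ _ 14); try by vm_compute.
by move=> i j; rewrite mxE; case: i => [[|[|[|[|]]]]] //= ?; case: j => [[|[|[|[|]]]]] //= ?.
Qed.

Definition vadd (u v : seq int) := [seq x.1 + x.2 | x <- zip u v].
Definition vneg (u : seq int) := [seq - x | x <- u].
Definition posF4 := Eval vm_compute in [seq v <- listF4 | all (>= 0) v].

(* [(i, j, k)] stands for the relation [posF4_i + posF4_j = posF4_k]. *)
Definition linesF4 := Eval vm_compute in
  [seq x <- [seq (i, j, index (vadd (nth [::] posF4 i) (nth [::] posF4 j)) posF4) | i <- iota 0 24, j <- iota 0 24]
   | (x.1.1 < x.1.2)%N && (x.2 < 24)%N].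

(* A state records which positive roots are known to lie, or not to lie, in the closed subset. *)
Notation state := (seq (option bool)).
(** In a closed symmetric subset, when three roots satisfy an additive relation and one of them
    belongs to the subset, the other two both belong or both do not. [None] signals a
    contradiction. *)
Definition upd a b c (st : state) : option state :=
  if (nth None st a, nth None st b) is (Some true, Some x) then
    match nth None st c with
    | None => Some (set_nth None st c (Some x))
    | Some y => if x == y then Some st else None
    end
  else Some st.

Definition upd_line (l : nat * nat * nat) (st : state) : option state :=
  let: (i, j, k) := l in
  obind (upd i j k) (obind (upd i k j) (obind (upd j i k) (obind (upd j k i) (obind (upd k i j) (upd k j i st))))).

Definition propagate (st : state) : option state :=
  iter 4 (fun o => foldl (fun o l => obind (upd_line l) o) o linesF4) (Some st).

(** At least 22 roots are wanted, that is 11 of the 24 positive ones, so a branch excluding more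
    than 13 is cut. The propagation is a parameter: soundness only needs that it preserves
    consistency. *)
Fixpoint search (prop : state -> option state) (ks : seq nat) (st : state) : seq state :=
  if (13 < count_mem (Some false) st)%N then [::] else
  if ks is i :: ks' then
    if nth None st i is Some _ then search prop ks' st else
    (if prop (set_nth None st i (Some true)) is Some st' then search prop ks' st' else [::]) ++
    (if prop (set_nth None st i (Some false)) is Some st' then search prop ks' st' else [::])
  else if prop st is Some _ then [:: st] else [::].

(** The solutions are the whole system, the three subsystems of type [B4], and the [D4] of the long
    roots. *)
Definition resF4 := Eval vm_compute in search propagate (iota 0 24) (nseq 24 None).

Lemma search_res : search propagate (iota 0 24) (nseq 24 None) = resF4.
Proof. by vm_compute. Qed.

Section SearchSound.
Variable psi : nat -> bool.
Definition two_of_three (l : nat * nat * nat) := let: (i, j, k) := l in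
  [/\ psi i -> psi j = psi k, psi j -> psi i = psi k & psi k -> psi i = psi j].
Hypothesis psi_lines : forall l, l \in linesF4 -> two_of_three l.
Hypothesis psi_count : (11 <= count psi (iota 0 24))%N.

Definition consistent (st : state) := size st = 24%N /\ forall i b, nth None st i = Some b -> psi i = b.
Definition oconsistent (o : option state) := exists2 st, o = Some st & consistent st.

Lemma consistent_set st i : (i < 24)%N -> consistent st -> consistent (set_nth None st i (Some (psi i))).
Proof.
move=> i24 [s24 h]; split=> [|j b]; first by rewrite size_set_nth s24; apply/maxn_idPr.
by rewrite nth_set_nth /=; case: eqP => [-> [<-]|_ /h].
Qed.

Lemma upd_sound a b c o : (a < 24)%N -> (b < 24)%N -> (c < 24)%N -> (psi a -> psi b = psi c) ->
  oconsistent o -> oconsistent (obind (upd a b c) o).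
Proof.
move=> a24 b24 c24 h [st -> cst] /=; have [_ hst] := cst; rewrite /upd.
case Ea : (nth None st a) => [[|]|]; last by exists st.
  case Eb : (nth None st b) => [x|]; last by exists st.
  have xc : psi c = x by rewrite -h ?(hst _ _ Ea) // (hst _ _ Eb).
  case Ec : (nth None st c) => [y|]; last by exists (set_nth None st c (Some x)) => //; rewrite -xc; apply: consistent_set.
  by rewrite -xc (hst _ _ Ec) eqxx; exists st.
by exists st.
Qed.

Lemma lines_bound l : l \in linesF4 -> [/\ (l.1.1 < 24)%N, (l.1.2 < 24)%N & (l.2 < 24)%N].
Proof.
move=> hl; suff /allP/(_ l hl)/and3P : all (fun l => [&& (l.1.1 < 24)%N, (l.1.2 < 24)%N & (l.2 < 24)%N]) linesF4 by [].
by vm_compute.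
Qed.

Lemma upd_line_sound l o : l \in linesF4 -> oconsistent o -> oconsistent (obind (upd_line l) o).
Proof.
move=> hl [st -> cst]; have := psi_lines hl; have := lines_bound hl.
case: l {hl} => [[i j] k] [i24 j24 k24] [h1 h2 h3] /=.
do 5 (apply: upd_sound; [by []|by []|by []|by move=> p; rewrite ?(h1 p) ?(h2 p) ?(h3 p)|]).
apply: (@upd_sound k j i (Some st)) => // [p|]; first by rewrite (h3 p).
by exists st.
Qed.

Lemma pass_sound k ls o : {subset ls <= linesF4} -> oconsistent o ->
  oconsistent (iter k (fun o => foldl (fun o l => obind (upd_line l) o) o ls) o).
Proof.
move=> sub; elim: k => // k IH /IH; rewrite iterS; move: (iter k _ o) => {}o {IH}.
elim: ls o sub => // l ls IH o sub ho; apply: IH; first by move=> x xs; apply: sub; rewrite inE xs orbT.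
by apply: upd_line_sound => //; apply: sub; rewrite mem_head.
Qed.

Lemma propagate_sound st : consistent st -> oconsistent (propagate st).
Proof. by move=> cst; apply: (@pass_sound 4 linesF4) => //; exists st. Qed.

Lemma search_sound prop ks st : (forall st, consistent st -> oconsistent (prop st)) -> consistent st -> {subset ks <= iota 0 24} ->
  exists2 st', st' \in search prop ks st & consistent st'.
Proof.
move=> prop_sound; elim: ks st => [|i ks IH] st cst sub.
(* A consistent state only excludes indices where [psi] fails, and there are at most 24 - 11 of
   these. *)
all: have prune : (13 < count_mem (Some false) st)%N = false.
  1, 3: have [s24 hst] := cst; apply/negbTE; rewrite -leqNgt -[st](mkseq_nth None) s24 /mkseq count_map.
  1, 2: have : (count (predC psi) (iota 0 24) <= 13)%N by
    have := count_predC psi (iota 0 24); rewrite size_iota; move: psi_count; lia.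
  1, 2: by apply: leq_trans; apply: sub_count => j /= /eqP /hst ->.
  by rewrite /= prune; have [st' -> _] := prop_sound _ cst; exists st; rewrite ?mem_head.
rewrite /= prune; have i24 : (i < 24)%N by have := sub i (mem_head _ _); rewrite mem_iota.
have sub' : {subset ks <= iota 0 24} by move=> x xs; apply: sub; rewrite inE xs orbT.
case E : (nth None st i) => [b|]; first exact: IH.
have [st' E' cst'] := prop_sound _ (consistent_set i24 cst).
have [st'' h c''] := IH st' cst' sub'; exists st'' => //; rewrite mem_cat.
by case: (psi i) E' => ->; rewrite h ?orbT.
Qed.
End SearchSound.

Definition stroots (st : state) : seq (seq int) :=
  let p := [seq nth [::] posF4 i | i <- iota 0 24 & nth None st i == Some true] in p ++ map vneg p.

Definition vcomb (u : seq int) (B : seq (seq int)) : seq int := [seq dotz u c | c <- B].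

(* Each matrix is listed by columns; [B.2] is twice the inverse of [B.1]. *)
Definition basesB4 : seq (seq (seq int) * seq (seq int)) :=
  [:: ([:: [:: 0; 1; 0; 0]; [:: 1; 0; 1; 0]; [:: 0; 0; 2; 0]; [:: 0; 0; 0; 1]],
       [:: [:: 0; 2; -1; 0]; [:: 2; 0; 0; 0]; [:: 0; 0; 1; 0]; [:: 0; 0; 0; 2]]);
      ([:: [:: 0; 1; 0; 0]; [:: 1; 0; 1; 0]; [:: 2; 0; 0; 1]; [:: 2; 0; 0; 0]],
       [:: [:: 0; 0; 0; 1]; [:: 2; 0; 0; 0]; [:: 0; 2; 0; -1]; [:: 0; 0; 2; -2]]);
      ([:: [:: 0; 1; 0; 0]; [:: 1; 0; 1; 0]; [:: 2; 0; 0; 1]; [:: 0; 0; 0; 1]],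
       [:: [:: 0; 0; 1; -1]; [:: 2; 0; 0; 0]; [:: 0; 2; -1; 1]; [:: 0; 0; 0; 2]])].

Definition is_baseB4 (B : seq (seq int)) (L : seq (seq int)) :=
  all (fun u => vcomb u B \in L) listB4 && all (fun v => v \in [seq vcomb u B | u <- listB4]) L.

Definition cmxl (B : seq (seq int)) : 'M[int]_4 := \matrix_(i, j) (nth [::] B j)`_i.

Definition half_ok (B : seq (seq int) * seq (seq int)) :=
  all (fun i => vcomb (vcomb (cunit 4 i) B.1) B.2 == [seq 2 * x | x <- cunit 4 i]) (iota 0 4) &&
  all (fun B => (size B == 4%N) && all (fun c => size c == 4%N) B) [:: B.1; B.2].

Definition over_ok (L L' : seq (seq int)) :=
  [&& [&& all (fun v => v \in L') L, all (fun u => all (fun v => (vadd u v \in listF4) ==> (vadd u v \in L')) L') L' &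
          all (fun v => v \in listF4) L'], has (fun v => v \notin L') listF4, has (fun v => v \notin L) L' &
      all (fun v => vneg v \in L') L'].

Definition st_ok L := [|| all (fun v => v \in L) listF4, has (fun B => is_baseB4 B.1 L) basesB4 |
  has (fun st' => over_ok L (stroots st')) resF4].

Lemma resF4_check : all (fun st => st_ok (stroots st)) resF4.
Proof. by vm_compute. Qed.

Lemma st_okP L : st_ok L -> [\/ forall v, v \in listF4 -> v \in L,
  exists2 B, B \in basesB4 & is_baseB4 B.1 L | exists st', over_ok L (stroots st')].
Proof.
rewrite /st_ok; move: listF4 basesB4 resF4 => l1 l2 l3.
by case/or3P=> [/allP h|/hasP[B hB h]|/hasP[st' _ h]]; [apply: Or31|apply: Or32; exists B|apply: Or33; exists st'].
Qed.

Lemma is_baseB4P B L : is_baseB4 B L ->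
  (forall u, u \in listB4 -> vcomb u B \in L) /\ forall v, v \in L -> exists2 u, u \in listB4 & v = vcomb u B.
Proof. by rewrite /is_baseB4; move: listB4 => l /andP[/allP h1 /allP h2]; split=> // v /h2 /mapP. Qed.

Lemma over_okP L L' : over_ok L L' -> [/\ forall v, v \in L -> v \in L',
  forall u v, u \in L' -> v \in L' -> vadd u v \in listF4 -> vadd u v \in L', forall v, v \in L' -> v \in listF4,
  (exists2 v, v \in listF4 & v \notin L') /\ (exists2 v, v \in L' & v \notin L) & forall v, v \in L' -> vneg v \in L'].
Proof.
rewrite /over_ok; move: listF4 => l /and4P[/and3P[/allP h1 /allP h2 /allP h3] /hasP h4 /hasP h5 /allP h6].
by split=> // u v hu hv; have /allP/(_ _ hv)/implyP := h2 _ hu.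
Qed.

Lemma basesB4_check : all half_ok basesB4. Proof. by vm_compute. Qed.
Lemma posF4_check : all (fun v => [&& (v \in posF4) || (vneg v \in posF4), size v == 4%N & vneg v \in listF4]) listF4.
Proof. by vm_compute. Qed.
Lemma posF4_sub : all (fun v => v \in listF4) posF4 && (size posF4 == 24%N). Proof. by vm_compute. Qed.
Lemma posF4_disj : ~~ has (fun v => vneg v \in posF4) posF4. Proof. by vm_compute. Qed.
Lemma linesF4_check : all (fun l => vadd (nth [::] posF4 l.1.1) (nth [::] posF4 l.1.2) == nth [::] posF4 l.2) linesF4.
Proof. by vm_compute. Qed.
Lemma size_listF4 : size listF4 = 48%N. Proof. by vm_compute. Qed.
Lemma resF4_decided : all (fun st => all (fun i => nth None st i != None) (iota 0 24)) resF4.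
Proof. by vm_compute. Qed.

Lemma srow_vcomb u B : size u = 4%N -> size B = 4%N -> all (fun c => size c == 4%N) B ->
  srow (vcomb u B) = srow u *m cmxl B.
Proof.
move=> u4 B4 /allP c4; apply/rowP => j; rewrite !mxE (nth_map [::]) ?B4 //.
rewrite (@dotz_sum _ _ 4) //; last by apply/eqP/c4/mem_nth; rewrite B4.
by apply: eq_bigr => i _; rewrite !mxE.
Qed.

Lemma listB4_size : all (fun u => size u == 4%N) listB4. Proof. by vm_compute. Qed.
#[local] Opaque listF4 listB4 posF4 linesF4 resF4 basesB4.

Lemma size_vcomb u B : size (vcomb u B) = size B. Proof. exact: size_map. Qed.

Lemma srow_vadd u v : size u = 4%N -> size v = 4%N -> srow (vadd u v) = srow u + srow v.
Proof.
move=> u4 v4; apply/rowP => i; rewrite !mxE (nth_map (0, 0)) ?size_zip ?u4 ?v4 // nth_zip ?u4 //.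
Qed.

Lemma size_vneg u : size (vneg u) = size u. Proof. exact: size_map. Qed.

Lemma vnegK : involutive vneg.
Proof. by move=> u; rewrite /vneg -map_comp map_id_in // => x _ /=; rewrite opprK. Qed.

Lemma size_vadd u v : size u = 4%N -> size v = 4%N -> size (vadd u v) = 4%N.
Proof. by move=> u4 v4; rewrite size_map size_zip u4 v4. Qed.

Lemma srow_vneg u : size u = 4%N -> srow (vneg u) = - srow u.
Proof. by move=> u4; apply/rowP => i; rewrite !mxE (nth_map 0) ?u4. Qed.

Lemma rseqN v : rseq (- v) = vneg (rseq v).
Proof. by rewrite -[vneg _]srowK ?size_vneg ?size_rseq // srow_vneg ?size_rseq // rseqK. Qed.

Lemma rseqD u v : rseq (u + v) = vadd (rseq u) (rseq v).
Proof. by rewrite -[vadd _ _]srowK ?size_vadd ?size_rseq // srow_vadd ?size_rseq // !rseqK. Qed.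

Lemma baseB4_det B : B \in basesB4 -> \det (cmxl B.1) != 0.
Proof.
move=> /(allP basesB4_check)/andP[/allP h /= /and3P[/andP[/eqP s1 c1] /andP[/eqP s2 c2] _]].
have : cmxl B.1 *m cmxl B.2 = 2%:M.
  have c4 (i : nat) : size (cunit 4 i) = 4%N by rewrite size_map size_iota.
  apply/row_matrixP => i; rewrite row_mul rowE -srow_cunit -srow_vcomb // -srow_vcomb ?size_vcomb //.
  have := h i; rewrite mem_iota ltn_ord => /(_ isT)/eqP ->.
  rewrite [RHS]rowE mul_mx_scalar -srow_cunit; apply/rowP => j.
  by rewrite mxE (nth_map 0) ?c4 // [RHS]mxE [srow _ _ _]mxE.
by move/(congr1 determinant); rewrite det_mulmx det_scalar => E; apply/eqP => E0; rewrite E0 mul0r in E.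
Qed.

Section ClosedSubsets.
Variable psi : 'rV[int]_4 -> Prop.
Hypothesis psi_root : forall v, psi v -> cartan_root cartan_F4 v.
Hypothesis psiN : forall v, psi v -> psi (- v).
Hypothesis psiD : forall u v, psi u -> psi v -> cartan_root cartan_F4 (u + v) -> psi (u + v).
Variable s : seq 'rV[int]_4.
Hypothesis us : uniq s.
Hypothesis s22 : (22 <= size s)%N.
Hypothesis s_psi : forall v, v \in s -> psi v.

Definition pidx i : bool := `[< psi (srow (nth [::] posF4 i)) >].

Lemma posF4_nth i : (i < 24)%N -> [/\ nth [::] posF4 i \in listF4, size (nth [::] posF4 i) = 4%N &
  cartan_root cartan_F4 (srow (nth [::] posF4 i))].
Proof.
move=> i24; have [/allP h /eqP s24] := andP posF4_sub.
have hi : nth [::] posF4 i \in listF4 by apply: h; rewrite mem_nth // s24.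
have /and3P[_ /eqP h4 _] := allP posF4_check _ hi; split=> //.
by apply/listF4P; rewrite srowK.
Qed.

Lemma psi_lines l : l \in linesF4 -> two_of_three pidx l.
Proof.
move=> hl; have := lines_bound hl; have /eqP := allP linesF4_check l hl.
case: l {hl} => [[i j] k] /= E [/posF4_nth[_ si ri] /posF4_nth[_ sj rj] /posF4_nth[_ sk rk]].
have {}E : srow (nth [::] posF4 k) = srow (nth [::] posF4 i) + srow (nth [::] posF4 j).
  by rewrite -srow_vadd ?E.
rewrite /pidx; set x := srow (nth _ _ i) in E ri *; set y := srow (nth _ _ j) in E rj *.
rewrite E in rk *; split=> /asboolP p; apply/asboolP/asboolP => q.
- exact: psiD.
- by rewrite -[y](addKr x); apply: psiD; rewrite ?addKr //; apply: psiN.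
- by apply: psiD.
- by rewrite -[x](addrK y); apply: psiD; rewrite ?addrK //; apply: psiN.
- by rewrite -[y](addKr x); apply: psiD; rewrite ?addKr //; apply: psiN.
- by rewrite -[x](addrK y); apply: psiD; rewrite ?addrK //; apply: psiN.
Qed.

Lemma psi_count : (11 <= count pidx (iota 0 24))%N.
Proof.
pose P := [seq nth [::] posF4 i | i <- iota 0 24 & pidx i].
have sP : size P = count pidx (iota 0 24) by rewrite size_map size_filter.
have sub : {subset map rseq s <= P ++ map vneg P}.
  move=> _ /mapP[v vs ->]; have pv := s_psi vs; have := (listF4P v).1 (psi_root pv) => hv.
  have inP u : psi u -> rseq u \in posF4 -> rseq u \in P.
    move=> pu hu; apply/mapP; exists (index (rseq u) posF4); last by rewrite nth_index.
    have [_ /eqP p24] := andP posF4_sub.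
    have i24 : (index (rseq u) posF4 < 24)%N by rewrite -p24 index_mem.
    have p : pidx (index (rseq u) posF4) by rewrite /pidx nth_index // rseqK; apply/asboolP.
    by rewrite mem_filter p mem_iota add0n i24.
  rewrite mem_cat; have /and3P[/orP[h|h] _ _] := allP posF4_check _ hv; first by rewrite inP.
  apply/orP; right; apply/mapP; exists (rseq (- v)); last by rewrite -rseqN opprK.
  by apply: inP; [exact: psiN|rewrite rseqN].
have := uniq_leq_size _ sub; rewrite map_inj_uniq ?us; last by apply: can_inj rseqK.
by rewrite size_cat (size_map vneg) sP (size_map rseq) => /(_ isT); move: s22; lia.
Qed.

Lemma psi_state : exists2 st, st \in resF4 & forall v, psi v <-> rseq v \in stroots st.
Proof.
have [|st hst [s24 cst]] := search_sound psi_count (propagate_sound psi_lines) _ (fun x h => h) (st := nseq 24 None).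
  by split=> // i b; rewrite nth_nseq if_same.
rewrite search_res in hst; exists st => // v; have dec := allP resF4_decided st hst.
have inS u : rseq u \in posF4 -> psi u <-> rseq u \in [seq nth [::] posF4 i | i <- iota 0 24 & nth None st i == Some true].
  move=> hu; have [_ /eqP p24] := andP posF4_sub.
  have i24 : (index (rseq u) posF4 < 24)%N by rewrite -p24 index_mem.
  have := allP dec (index (rseq u) posF4); rewrite mem_iota add0n i24 => /(_ isT).
  case E : (nth None st _) => [b|//] _; have := cst _ _ E; rewrite /pidx nth_index // rseqK => Eb; split=> [pu|].
    have bt : b = true by rewrite -Eb; apply/asboolP.
    apply/mapP; exists (index (rseq u) posF4); rewrite ?nth_index // mem_filter mem_iota add0n i24 andbT E bt //.
  case/mapP=> i; rewrite mem_filter mem_iota add0n => /andP[/eqP Ei i24'] Eu.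
  by have := cst _ _ Ei; rewrite /pidx -Eu rseqK => /asboolP.
have root_or : psi v \/ rseq v \in stroots st -> rseq v \in posF4 \/ rseq (- v) \in posF4.
  case=> [/psi_root/listF4P hv|].
    by have /and3P[/orP[h|h] _ _] := allP posF4_check _ hv; [left|right; rewrite rseqN].
  have nthP i : i \in [seq i <- iota 0 24 | nth None st i == Some true] -> nth [::] posF4 i \in posF4.
    rewrite mem_filter mem_iota => /andP[_ i24]; have [_ /eqP p24] := andP posF4_sub.
    by rewrite mem_nth // p24.
  rewrite mem_cat => /orP[/mapP[i hi ->]|/mapP[_ /mapP[i hi ->] E]]; [left; exact: nthP|right].
  have i24 : (i < 24)%N by move: hi; rewrite mem_filter mem_iota => /andP[].
  by rewrite rseqN E vnegK; apply: nthP.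
have disj u : rseq u \in posF4 -> rseq (- u) \in posF4 -> False.
  by move=> h1 h2; have := hasPn posF4_disj _ h1; rewrite -rseqN h2.
have negmem (l : seq (seq int)) u : rseq (- u) \in l -> rseq u \in map vneg l.
  by move=> h; apply/mapP; exists (rseq (- u)); rewrite // -rseqN opprK.
have nthP' w : w \in [seq nth [::] posF4 i | i <- iota 0 24 & nth None st i == Some true] -> w \in posF4.
  case/mapP=> i; rewrite mem_filter mem_iota add0n => /andP[_ i24] ->.
  by have [_ /eqP p24] := andP posF4_sub; rewrite mem_nth // p24.
rewrite /stroots mem_cat; split=> [pv|/orP[] h].
- case: (root_or (or_introl pv)) => h; first by rewrite (inS _ h).1.
  by rewrite (negmem _ _ ((inS _ h).1 (psiN pv))) orbT.
- by apply: ((inS v _).2 h); apply: nthP'.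
case/mapP: h => w hw Ew; have E' : rseq (- v) = w by rewrite rseqN Ew vnegK.
by rewrite -(opprK v); apply: psiN; apply: (inS (- v) _).2; rewrite E' // nthP'.
Qed.

(** The last alternative only provides an intermediate closed symmetric subset; that is all that
    maximality of [H] will need for a contradiction. *)
Theorem F4_closed_subsets :
  [\/ forall v, cartan_root cartan_F4 v -> psi v,
      exists2 B : 'M[int]_4, \det B != 0 & forall v, psi v <-> exists2 u, cartan_root cartan_B4 u & v = u *m B |
      exists phi : 'rV[int]_4 -> Prop,
        [/\ forall v, psi v -> phi v, forall v, phi v -> cartan_root cartan_F4 v, forall v, phi v -> phi (- v),
            forall u v, phi u -> phi v -> cartan_root cartan_F4 (u + v) -> phi (u + v) &
            (exists2 v, cartan_root cartan_F4 v & ~ phi v) /\ exists2 v, phi v & ~ psi v]].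
Proof.
have [st hst E] := psi_state; move: (allP resF4_check st hst) E; move: (stroots st) => L /st_okP + E.
case=> [h|[B hB /is_baseB4P[b1 b2]]|[st' /over_okP[]]].
- by apply: Or31 => v /listF4P/h/E.
- apply: Or32; exists (cmxl B.1); first exact: baseB4_det.
  have /andP[_ /and3P[/andP[/eqP s1 c1] _ _]] := allP basesB4_check _ hB.
  move=> v; split=> [/E/b2[u hu Ev]|[u /listB4P/b1 hu ->]].
    have u4 : size u = 4%N by apply/eqP; apply: (allP listB4_size).
    by exists (srow u); [apply/listB4P; rewrite srowK|rewrite -srow_vcomb // -Ev rseqK].
  by apply/E; rewrite -(rseqK u) -srow_vcomb ?size_rseq // srowK ?size_vcomb.
move: (stroots st') => L' h1 h2 h3 [[v hv nv] [u hu nu]] h6.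
have s4 w : w \in listF4 -> size w = 4%N by move=> /(allP posF4_check)/and3P[_ /eqP].
apply: Or33; exists (fun v => rseq v \in L'); split=> [w /E/h1 //|w /h3/listF4P //|w /h6|x y hx hy|].
- by rewrite rseqN.
- by move=> /listF4P; rewrite rseqD; apply: h2.
split; first by exists (srow v); [apply/listF4P; rewrite srowK // s4|rewrite srowK ?s4 //; apply/negP].
by exists (srow u); [rewrite srowK // s4 // h3|move/E; rewrite srowK ?s4 ?h3 //; apply/negP].
Qed.
End ClosedSubsets.

Lemma mem_mkseq (T : eqType) (f : nat -> T) j k : (j < k)%N -> f j \in mkseq f k.
Proof. by move=> jk; apply/mapP; exists j; rewrite // mem_iota. Qed.

Lemma mkseq_mem (T : eqType) (f : nat -> T) k y :
  y \in mkseq f k -> exists2 j, (j < k)%N & y = f j.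
Proof. by case/mapP => j; rewrite mem_iota => /= jk ->; exists j. Qed.

(** * Lie algebras of closed subgroups *)

Section Noetherian.
Variable R : comNzRingType.
Implicit Types (I J : R -> Prop) (s : seq R).

Definition ideal I :=
  [/\ I 0, forall x y, I x -> I y -> I (x + y) & forall a x, I x -> I (a * x)].

Definition span_ideal s : R -> Prop :=
  fun x => forall I, ideal I -> (forall y, y \in s -> I y) -> I x.

Lemma span_ideal_ideal s : ideal (span_ideal s).
Proof.
split=> [I [] //|x y Ix Iy I iI Is|a x Ix I iI Is]; case: (iI) => _ D M.
  by apply: D; [apply: Ix | apply: Iy].
by apply: M; apply: Ix.
Qed.

Lemma span_ideal_mem s x : x \in s -> span_ideal s x.
Proof. by move=> xs I _; apply. Qed.

Lemma span_ideal_sub s t :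
  (forall y, y \in s -> span_ideal t y) -> forall x, span_ideal s x -> span_ideal t x.
Proof. by move=> st x; apply=> //; apply: span_ideal_ideal. Qed.

(** The ascending chain condition, phrased with elements of sequences so that chains of ideals need
    not be manipulated. *)
Definition noetherian := forall a : nat -> R, exists k, span_ideal (mkseq a k) (a k).

Lemma ideal_sub I x y : ideal I -> I x -> I y -> I (x - y).
Proof. by case=> _ D M Ix Iy; apply: D => //; rewrite -mulN1r; apply: M. Qed.

Lemma ideal_sum I (T : Type) (r : seq T) (P : pred T) (f : T -> R) :
  ideal I -> (forall i, P i -> I (f i)) -> I (\sum_(i <- r | P i) f i).
Proof. by case=> I0 D _ If; elim/big_ind: _. Qed.

Hypothesis noeth : noetherian.

(** The colon ideals of [I] by the powers of [x] form an ascending chain. If it never stopped,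
    elements witnessing the strict inclusions would give a sequence against the chain condition. *)
Lemma noetherian_colon I x : ideal I ->
  exists k, forall r, I (x ^+ k.+1 * r) -> I (x ^+ k * r).
Proof.
move=> iI; apply: contrapT => H.
have {H}/choice[r Hr] k : exists r, I (x ^+ k.+1 * r) /\ ~ I (x ^+ k * r).
  apply: contrapT => H1; apply: H; exists k => r Ir; apply: contrapT => nI.
  by apply: H1; exists r.
have [k ak] := noeth r; have [_ nI] := Hr k; apply: nI.
case: (iI) => I0 D M.
apply: (ak (fun r => I (x ^+ k * r))).
  split=> [|u v|u v]; first by rewrite mulr0.
    by rewrite mulrDr; apply: D.
  by move=> Iv; rewrite mulrCA; apply: M.
move=> y /mkseq_mem[j jk ->].
have -> : x ^+ k = x ^+ (k - j.+1) * x ^+ j.+1 by rewrite -exprD subnK.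
by rewrite -mulrA; apply: M; case: (Hr j).
Qed.

(** Otherwise every ideal avoiding [p] could be enlarged by a new element while still avoiding [p],
    and the chosen elements would violate the chain condition. *)
Lemma noetherian_maximal_avoiding I p : ideal I -> ~ I p ->
  exists J, [/\ ideal J, forall x, I x -> J x, ~ J p &
    forall r, ~ J r -> forall J', ideal J' -> (forall x, J x -> J' x) -> J' r -> J' p].
Proof.
move=> iI nIp; apply: contrapT => H.
pose good J := [/\ ideal J, forall x, I x -> J x & ~ J p].
have next J : good J -> exists rJ : R * (R -> Prop),
    [/\ ~ J rJ.1, good rJ.2, forall x, J x -> rJ.2 x & rJ.2 rJ.1].
  move=> [iJ IJ nJ]; apply: contrapT => H1; apply: H; exists J; split=> // r nr J' iJ' JJ' Jr.
  by apply: contrapT => nJp; apply: H1; exists (r, J'); split=> //; split=> // x /IJ/JJ'.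
have [f fP] : exists f : {J | good J} -> R * {J | good J},
    forall J : {J | good J}, [/\ ~ sval J (f J).1, forall x, sval J x -> sval (f J).2 x & sval (f J).2 (f J).1].
  suff /choice[f fP] : forall J : {J | good J}, exists fJ : R * {J | good J},
    [/\ ~ sval J fJ.1, forall x, sval J x -> sval fJ.2 x & sval fJ.2 fJ.1] by exists f.
  move=> [J gJ]; have [[r J'] [/= nJr gJ' JJ' J'r]] := next J gJ.
  by exists (r, exist _ J' gJ'); split.
have g0 : good I by split.
pose L k := iter k (fun K => (f K).2) (exist good I g0).
pose r k := (f (L k)).1.
have Lmono j k : (j <= k)%N -> forall x, sval (L j) x -> sval (L k) x.
  move=> jk; rewrite -(subnK jk); elim: (k - j)%N => // d IH x /IH.
  by rewrite addSn; case: (fP (L (d + j)%N)) => _ + _; apply.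
have [k rk] := noeth r; have [nr _ _] := fP (L k); apply: nr; apply: rk.
  by case: (svalP (L k)).
move=> y /mkseq_mem[j jk ->].
by apply: (Lmono j.+1) => //; case: (fP (L j)).
Qed.

End Noetherian.

Lemma noetherian_surj (A B : comNzRingType) (f : {rmorphism A -> B}) :
  (forall y, exists x, f x = y) -> noetherian A -> noetherian B.
Proof.
move=> /choice[g gK] nA b; have [k ak] := nA (fun i => g (b i)).
exists k => I [I0 D M] Ib; rewrite -[b k]gK; apply: (ak (fun x => I (f x))).
  by split=> [|x y|a x]; rewrite ?rmorph0 ?rmorphD ?rmorphM //; [exact: D | exact: M].
move=> y /mkseq_mem[j jk ->]; rewrite gK; apply: Ib.
exact: mem_mkseq.
Qed.

Lemma noetherian_field (F : fieldType) : noetherian F.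
Proof.
move=> a; have [a0|a0] := eqVneq (a 0%N) 0; first by exists 0%N => I [I0 _ _] _; rewrite a0.
exists 1%N => I [I0 D M] Ia; have Ia0 := Ia _ (mem_head _ _).
by rewrite -[a 1%N]mulr1 -(mulVf a0) mulrA; apply: M.
Qed.

Section Hilbert.
Variable R : comNzRingType.
Hypothesis noeth : noetherian R.

(** Hilbert's argument: in the ideal [J] generated by the whole sequence, pick successively an
    element [g k] of least size outside the ideal of the earlier ones. If the leading coefficient of
    [g k] is a combination of earlier leading coefficients, subtracting the same combination of
    shifted [g j] contradicts minimality. *)
Lemma noetherian_poly : noetherian {poly R}.
Proof.
move=> f; apply: contrapT => nof.
have {}nof k : ~ span_ideal (mkseq f k) (f k) by move=> fk; apply: nof; exists k.
pose J p := exists m, span_ideal (mkseq f m) p.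
have mkJ m m' p : (m <= m')%N -> span_ideal (mkseq f m) p -> span_ideal (mkseq f m') p.
  move=> mm; apply: span_ideal_sub => y /mkseq_mem[j jm ->].
  by apply: span_ideal_mem; apply: mem_mkseq; lia.
have Jseq (s : seq {poly R}) : (forall y, y \in s -> J y) -> exists m, forall y, y \in s -> span_ideal (mkseq f m) y.
  elim: s => [|y s IH] Js; first by exists 0%N.
  have [m sm] := IH (fun y ys => Js y (mem_behead (s := _ :: _) ys)).
  have [m' ym'] := Js y (mem_head _ _).
  exists (maxn m m') => z; rewrite inE => /orP[/eqP->|zs]; first exact: (mkJ _ _ _ (leq_maxr _ _) ym').
  exact: (mkJ _ _ _ (leq_maxl _ _) (sm _ zs)).
have ex (s : seq {poly R}) : (forall y, y \in s -> J y) ->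
    exists p, [/\ J p, ~ span_ideal s p & forall q, J q -> ~ span_ideal s q -> (size p <= size q)%N].
  move=> Js; have [m sm] := Jseq s Js.
  pose Q d := `[< exists p, [/\ J p, ~ span_ideal s p & size p = d] >].
  have exQ : exists d, Q d.
    exists (size (f m)); apply/asboolP; exists (f m); split=> //.
      by exists m.+1; apply: span_ideal_mem; apply: mem_mkseq.
    by move=> sp; apply: (nof m); apply: span_ideal_sub sp.
  case: (ex_minnP exQ) => d /asboolP[p [Jp np pd]] dmin.
  by exists p; split=> // q Jq nq; rewrite pd; apply: dmin; apply/asboolP; exists q.
have [nx nxP] : {nx : seq {poly R} -> {poly R} & forall s : seq {poly R}, (forall y, y \in s -> J y) ->
    [/\ J (nx s), ~ span_ideal s (nx s) & forall q, J q -> ~ span_ideal s q -> (size (nx s) <= size q)%N]}.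
  suff H (s : seq {poly R}) : {p | (forall y, y \in s -> J y) -> [/\ J p, ~ span_ideal s p &
      forall q, J q -> ~ span_ideal s q -> (size p <= size q)%N]}.
    by exists (fun s => sval (H s)) => s; apply: (svalP (H s)).
  apply: cid; have [/ex[p Pp]|nJ] := pselect (forall y, y \in s -> J y); [by exists p | by exists 0].
pose G k := iter k (fun s => rcons s (nx s)) [::].
pose g k := nx (G k).
have GE k : G k = mkseq g k.
  elim: k => // k IH; rewrite /mkseq -addn1 iotaD map_cat cats1 /= add0n addn1 /=.
  by rewrite -/(G k) IH; congr rcons; rewrite /g IH.
have GJ k y : y \in G k -> J y.
  elim: k y => // k IH y; rewrite /= mem_rcons inE => /orP[/eqP->|/IH//].
  by case: (nxP (G k) IH).
have gP k : [/\ J (g k), ~ span_ideal (G k) (g k) &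
    forall q, J q -> ~ span_ideal (G k) q -> (size (g k) <= size q)%N] := nxP (G k) (GJ k).
have szg j k : (j <= k)%N -> (size (g j) <= size (g k))%N.
  move=> jk; have [_ _ H] := gP j; have [Jk nk _] := gP k; apply: H => // sj; apply: nk.
  apply: span_ideal_sub sj => y; rewrite !GE => /mkseq_mem[i ij ->].
  by apply: span_ideal_mem; apply: mem_mkseq; lia.
have [k ak] := noeth (fun k => lead_coef (g k)).
have [Jgk ngk gmin] := gP k.
have gk0 : g k != 0 by apply/eqP => g0; apply: ngk; rewrite g0; case: (span_ideal_ideal (G k)).
have iJ : ideal J.
  split; first by exists 0%N; case: (span_ideal_ideal (mkseq f 0)).
    move=> x y [m xm] [m' ym']; exists (maxn m m'); case: (span_ideal_ideal (mkseq f (maxn m m'))) => _ D _.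
    by apply: D; [apply: mkJ xm; apply: leq_maxl | apply: mkJ ym'; apply: leq_maxr].
  by move=> a x [m xm]; exists m; case: (span_ideal_ideal (mkseq f m)) => _ _; apply.
have [iG0 iGD iGM] := span_ideal_ideal (G k).
pose d := (size (g k)).-1.
suff [h [hG hs hc]] : exists h, [/\ span_ideal (G k) h, (size h <= size (g k))%N & h`_d = lead_coef (g k)].
  have : (size (g k) <= size (g k - h)%R)%N.
    apply: gmin.
      apply: ideal_sub => //; have [m Gm] := Jseq _ (GJ k).
      by exists m; apply: span_ideal_sub hG.
    by move=> gh; apply: ngk; rewrite -(subrK h (g k)); apply: iGD.
  apply/negP; rewrite -ltnNge; have sg : size (g k) = d.+1 by rewrite prednK // size_poly_gt0.
  rewrite sg ltnS; apply/leq_sizeP => j; rewrite leq_eqVlt => /orP[/eqP<-|dj].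
    by rewrite coefB hc lead_coefE subrr.
  by rewrite coefB !nth_default ?subrr // ?(leq_trans hs) ?sg.
apply: (ak (fun x => exists h, [/\ span_ideal (G k) h, (size h <= size (g k))%N & h`_d = x])).
  split.
  - by exists 0; rewrite size_poly0 coef0.
  - move=> x y [h [h1 h2 h3]] [h' [h1' h2' h3']]; exists (h + h'); split; first exact: iGD.
      by rewrite (leq_trans (size_polyD _ _)) // geq_max h2.
    by rewrite coefD h3 h3'.
  - move=> a x [h [h1 h2 h3]]; exists (a%:P * h); split; first exact: iGM.
      by rewrite mul_polyC (leq_trans (size_scale_leq _ _)).
    by rewrite coefCM h3.
move=> y /mkseq_mem[j jk ->].
exists ('X^(size (g k) - size (g j)) * g j); split.
- by apply: iGM; apply: span_ideal_mem; rewrite GE; apply: mem_mkseq.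
- rewrite (leq_trans (size_polyMleq _ _)) // size_polyXn addSn /=.
  by rewrite subnK ?szg ?(ltnW jk).
- rewrite coefXnM lead_coefE /d.
  have le := szg j k (ltnW jk).
  have [gj0|gj0] := eqVneq (g j) 0; first by rewrite gj0 !coef0 if_same.
  have : (0 < size (g j))%N by rewrite size_poly_gt0.
  move=> gj1; rewrite ifF; last by lia.
  by congr (nth 0 _ _); lia.
Qed.

End Hilbert.

Lemma mpoly_ring_ind n (R : comNzRingType) (P : {mpoly R[n]} -> Prop) :
  (forall c, P c%:MP) -> (forall i, P 'X_i) -> (forall p q, P p -> P q -> P (p + q)) ->
  (forall p q, P p -> P q -> P (p * q)) -> forall p, P p.
Proof.
move=> PC PX PD PM p; rewrite (mpolyE p); elim/big_ind: _ => //; first exact: (PC 0).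
move=> m _; rewrite -mul_mpolyC; apply: (PM) => //; rewrite mpolyXE_id.
apply: big_ind => [|p1 p2|i _]; [exact: (PC 1) | exact: PM |].
by elim: (m i) => [|k IH]; [exact: (PC 1) | rewrite exprS; apply: (PM)].
Qed.

Lemma noetherian_mpoly (F : fieldType) n : noetherian {mpoly F[n]}.
Proof.
elim: n => [|n IH].
  apply: (@noetherian_surj F _ (@mpolyC 0 F)); last exact: noetherian_field.
  by move=> y; exists (y@_0); rewrite -{2}(mpolyKC y).
apply: (@noetherian_surj {poly {mpoly F[n]}} _
  (horner_eval ('X_ord_max : {mpoly F[n.+1]}) \o map_poly (@mwiden n F))).
  apply: mpoly_ring_ind => [c|i|y z [p <-] [q <-]|y z [p <-] [q <-]].
  - by exists (c%:MP)%:P; rewrite /= map_polyC /= /horner_eval hornerC mwidenC.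
  - have [->|ni] := eqVneq i ord_max; first by exists 'X; rewrite /= map_polyX /horner_eval hornerX.
    have ltin : (i < n)%N by have := ltn_ord i; rewrite ltnS leq_eqVlt => /orP[/eqP e|//]; case/eqP: ni; apply: val_inj.
    exists ('X_(Ordinal ltin))%:P; rewrite /= map_polyC /horner_eval hornerC /= mwidenX mnmwiden1.
    by congr 'X__; apply: val_inj.
  - by exists (p + q); rewrite rmorphD.
  - by exists (p * q); rewrite rmorphM.
exact: noetherian_poly.
Qed.

Lemma mnm_subnn n (m : 'X_{1..n}) : (m - m = 0)%MM.
Proof. by apply/mnmP => j; rewrite mnmBE mnm0E subnn. Qed.

Fact bracket_leibniz (R : comNzRingType) (p q xp xq yp yq xyp xyq yxp yxq : R) :
  xyp * q + yp * xq + (xp * yq + p * xyq) - (yxp * q + xp * yq + (yp * xq + p * yxq)) =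
  (xyp - yxp) * q + p * (xyq - yxq).
Proof. by ring. Qed.

Section CharZero.
Variable F : fieldType.

Definition char0 : Prop := forall k, (k%:R == 0 :> F) = (k == 0%N).

Hypothesis F0 : char0.

Lemma char0_natr_inj : injective (fun k : nat => k%:R : F).
Proof.
suff le i j : (i <= j)%N -> i%:R = j%:R :> F -> i = j.
  by move=> i j E; have [/le|/ltnW/le H] := leqP i j; [apply | apply/esym/H].
move=> ij /eqP; rewrite eq_sym -subr_eq0 -natrB // F0 subn_eq0 => ji.
by apply/eqP; rewrite eqn_leq ij.
Qed.

Lemma char0_intr (m : int) : (m%:~R == 0 :> F) = (m == 0).
Proof. by case: m => k; rewrite ?NegzE ?rmorphN ?oppr_eq0 /= -pmulrn F0. Qed.

Lemma char0_intr_inj : injective (fun m : int => m%:~R : F).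
Proof. by move=> m l /eqP; rewrite -subr_eq0 -rmorphB char0_intr subr_eq0 => /eqP. Qed.

Lemma poly_eq0_char0 (p : {poly F}) : (forall x, p.[x] = 0) -> p = 0.
Proof.
move=> p0; apply/eqP; apply: contraT => pn0.
pose s : seq F := [seq i%:R | i <- iota 0 (size p)].
have := max_poly_roots pn0 (rs := s); rewrite size_map size_iota ltnn => -> //.
  by apply/allP => a _; rewrite /root p0.
by rewrite map_inj_uniq ?iota_uniq //; apply: char0_natr_inj.
Qed.
End CharZero.

(** * Polynomial functions on matrices and their invariant derivations *)

Section Evaluation.
Variables (F : closedFieldType) (n : nat).
Local Notation N := (n.+1 * n.+1)%N.
Local Notation poly := {mpoly F[N]}.
Implicit Types (p q : poly) (A X Y g : 'M[F]_n.+1).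

Section Target.
Variables (S : comNzRingType) (f : {rmorphism F -> S}).

Definition mxsubst (M : 'M[S]_n.+1) p : S := mmap f (fun k => mxvec M 0 k) p.

Lemma mxsubstD M p q : mxsubst M (p + q) = mxsubst M p + mxsubst M q.
Proof. exact: mmapD. Qed.

Lemma mxsubst_sum M (I : Type) (r : seq I) (P : pred I) (G : I -> poly) :
  mxsubst M (\sum_(i <- r | P i) G i) = \sum_(i <- r | P i) mxsubst M (G i).
Proof. exact: raddf_sum. Qed.

Lemma mxsubstM M p q : mxsubst M (p * q) = mxsubst M p * mxsubst M q.
Proof. by rewrite /mxsubst rmorphM. Qed.

Lemma mxsubstC M c : mxsubst M c%:MP = f c.
Proof. exact: mmapC. Qed.

Lemma mxsubstZ M c p : mxsubst M (c *: p) = f c * mxsubst M p.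
Proof. by rewrite -mul_mpolyC mxsubstM mxsubstC. Qed.
End Target.

Definition xvar i j : poly := 'X_(mxvec_index i j).

Definition xmat : 'M[poly]_n.+1 := \matrix_(i, j) xvar i j.

Lemma mxsubst_xvar S f M i j : @mxsubst S f M (xvar i j) = M i j.
Proof. by rewrite /mxsubst /xvar mmapX mmap1U mxvecE. Qed.

Lemma mxpoly_ind (P : poly -> Prop) :
  (forall c, P c%:MP) -> (forall i j, P (xvar i j)) -> (forall p q, P p -> P q -> P (p + q)) ->
  (forall p q, P p -> P q -> P (p * q)) -> forall p, P p.
Proof.
by move=> PC PX PD PM; apply: mpoly_ring_ind => // k; case/mxvec_indexP: k => i j; apply: PX.
Qed.

Lemma mxsubst_comp (S S' : comNzRingType) (f : {rmorphism F -> S}) (f' : {rmorphism F -> S'})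
    (h : {rmorphism S -> S'}) M p :
  (forall c, h (f c) = f' c) -> h (mxsubst f M p) = mxsubst f' (map_mx h M) p.
Proof.
move=> hf; elim/mxpoly_ind: p => [c|i j|p q hp hq|p q hp hq].
- by rewrite !mxsubstC.
- by rewrite !mxsubst_xvar mxE.
- by rewrite !mxsubstD rmorphD hp hq.
- by rewrite !mxsubstM rmorphM hp hq.
Qed.

Lemma mxevalE p A : mxeval p A = mxsubst idfun A p.
Proof. by []. Qed.

Lemma mxevalD p q A : mxeval (p + q) A = mxeval p A + mxeval q A.
Proof. exact: mxsubstD. Qed.
Lemma mxevalB p q A : mxeval (p - q) A = mxeval p A - mxeval q A.
Proof. exact: mevalB. Qed.
Lemma mxevalM p q A : mxeval (p * q) A = mxeval p A * mxeval q A.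
Proof. exact: mevalM. Qed.
Lemma mxevalC c A : mxeval c%:MP A = c.
Proof. exact: mevalC. Qed.
Lemma mxevalZ c p A : mxeval (c *: p) A = c * mxeval p A.
Proof. exact: mevalZ. Qed.
Lemma mxeval0 A : mxeval 0 A = 0.
Proof. exact: meval0. Qed.
Lemma mxeval1 A : mxeval 1 A = 1.
Proof. exact: meval1. Qed.
Lemma mxeval_sum (I : Type) (r : seq I) (P : pred I) (G : I -> poly) A :
  mxeval (\sum_(i <- r | P i) G i) A = \sum_(i <- r | P i) mxeval (G i) A.
Proof. exact: raddf_sum. Qed.
Lemma mxeval_xvar i j A : mxeval (xvar i j) A = A i j.
Proof. by rewrite mxevalE mxsubst_xvar. Qed.
Lemma mxevalX p k A : mxeval (p ^+ k) A = mxeval p A ^+ k.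
Proof. exact: rmorphXn. Qed.

Lemma map_mx_xmat A : map_mx (fun p => mxeval p A) xmat = A.
Proof. by apply/matrixP => i j; rewrite !mxE mxeval_xvar. Qed.

Notation "A %:MM" := (map_mx (@mpolyC N F) A) (at level 2, format "A %:MM").

Definition mxpull (M : 'M[poly]_n.+1) p : poly := mxsubst (@mpolyC N F) M p.

Lemma mxeval_mxpull M p A : mxeval (mxpull M p) A = mxeval p (map_mx (fun p => mxeval p A) M).
Proof.
apply: (@mxsubst_comp _ _ (@mpolyC N F) idfun (meval (fun k => mxvec A 0 k)) M p) => c.
exact: mevalC.
Qed.

Lemma mxeval_mulmx (M M' : 'M[poly]_n.+1) A :
  map_mx (fun p => mxeval p A) (M *m M') = map_mx (fun p => mxeval p A) M *m map_mx (fun p => mxeval p A) M'.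
Proof.
by apply/matrixP => i j; rewrite !mxE mxeval_sum; apply: eq_bigr => k _; rewrite mxevalM !mxE.
Qed.

Lemma mxeval_constmx g A : map_mx (fun p => mxeval p A) g%:MM = g.
Proof. by apply/matrixP => i j; rewrite !mxE mxevalC. Qed.

Definition lmove g p := mxpull (g%:MM *m xmat) p.
Definition rmove g p := mxpull (xmat *m g%:MM) p.

Lemma mxeval_lmove g p A : mxeval (lmove g p) A = mxeval p (g *m A).
Proof. by rewrite mxeval_mxpull mxeval_mulmx mxeval_constmx map_mx_xmat. Qed.
Lemma mxeval_rmove g p A : mxeval (rmove g p) A = mxeval p (A *m g).
Proof. by rewrite mxeval_mxpull mxeval_mulmx mxeval_constmx map_mx_xmat. Qed.

Fact ider_key : unit. Proof. by []. Qed.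

(** The left-invariant vector field of [X]: at the point [A] it differentiates in the direction
    [A *m X]. The definition is locked so that the sum is not unfolded by accident. *)
Definition ider : 'M[F]_n.+1 -> poly -> poly :=
  locked_with ider_key (fun X p => \sum_k mxvec (xmat *m X%:MM) 0 k * p^`M(k)).

Lemma iderE X p : ider X p = \sum_k mxvec (xmat *m X%:MM) 0 k * p^`M(k).
Proof. by rewrite /ider unlock. Qed.

Lemma iderD X p q : ider X (p + q) = ider X p + ider X q.
Proof. by rewrite !iderE -big_split; apply: eq_bigr => k _; rewrite mderivD mulrDr. Qed.

Lemma iderM X p q : ider X (p * q) = ider X p * q + p * ider X q.
Proof.
rewrite !iderE mulr_suml mulr_sumr -big_split; apply: eq_bigr => k _ /=.
by rewrite mderivM; ring.
Qed.

Lemma iderC X c : ider X c%:MP = 0.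
Proof. by rewrite iderE big1 // => k _; rewrite mderivC mulr0. Qed.

Lemma iderZ X c p : ider X (c *: p) = c *: ider X p.
Proof. by rewrite -!mul_mpolyC iderM iderC mul0r add0r. Qed.

Lemma ider0 X : ider X 0 = 0.
Proof. exact: iderC. Qed.

Lemma ider_xvar X i j : ider X (xvar i j) = \sum_l X l j *: xvar i l.
Proof.
rewrite iderE (bigD1 (mxvec_index i j)) //= big1 ?addr0 => [|k ki].
  rewrite mxvecE mxE /xvar mderivX mnmE eqxx mulr1n scale1r.
  rewrite mnm_subnn mpolyX0 mulr1; apply: eq_bigr => l _.
  by rewrite !mxE -mul_mpolyC mulrC.
by rewrite /xvar mderivX mnmE eq_sym (negPf ki) scale0r mulr0.
Qed.

Lemma iderN X p : ider X (- p) = - ider X p.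
Proof. by rewrite -scaleN1r iderZ scaleN1r. Qed.

Lemma iderB X p q : ider X (p - q) = ider X p - ider X q.
Proof. by rewrite iderD iderN. Qed.

Lemma ider_sum X (I : Type) (r : seq I) (P : pred I) (G : I -> poly) :
  ider X (\sum_(i <- r | P i) G i) = \sum_(i <- r | P i) ider X (G i).
Proof. by apply: (big_morph _ (iderD X) (ider0 X)). Qed.

(** Derivations are determined by their values on constants and variables. The commutator of two
    derivations is one, which is how the bracket formula below is obtained. *)
Lemma ider_eq (d d' : poly -> poly) :
    (forall c, d c%:MP = d' c%:MP) -> (forall i j, d (xvar i j) = d' (xvar i j)) ->
    (forall p q, d (p + q) = d p + d q) -> (forall p q, d' (p + q) = d' p + d' q) ->
    (forall p q, d (p * q) = d p * q + p * d q) -> (forall p q, d' (p * q) = d' p * q + p * d' q) ->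
  d =1 d'.
Proof.
move=> dC dX dD dD' dM dM'; apply: mxpoly_ind => // p q hp hq; first by rewrite dD dD' hp hq.
by rewrite dM dM' hp hq.
Qed.

Lemma ider_linear a X Y p : ider (a *: X + Y) p = a *: ider X p + ider Y p.
Proof.
move: p; apply: ider_eq => [c|i j|p q|p q|p q|p q].
- by rewrite !iderC scaler0 addr0.
- rewrite !ider_xvar scaler_sumr -big_split; apply: eq_bigr => l _ /=.
  by rewrite !mxE scalerDl scalerA.
- exact: iderD.
- by rewrite !iderD scalerDr addrACA.
- exact: iderM.
- by rewrite !iderM scalerDr scalerAl scalerAr mulrDl mulrDr addrACA.
Qed.

Lemma ider_addl X Y p : ider (X + Y) p = ider X p + ider Y p.
Proof. by rewrite -[X in ider (X + _)]scale1r ider_linear scale1r. Qed.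
Lemma ider_zero p : ider 0 p = 0.
Proof. by have := ider_addl 0 0 p; rewrite addr0 => /eqP; rewrite -subr_eq subrr eq_sym => /eqP. Qed.
Lemma ider_scalel a X p : ider (a *: X) p = a *: ider X p.
Proof. by rewrite -[a *: X]addr0 ider_linear ider_zero addr0. Qed.
Lemma ider_suml (I : Type) (r : seq I) (P : pred I) (G : I -> 'M[F]_n.+1) p :
  ider (\sum_(i <- r | P i) G i) p = \sum_(i <- r | P i) ider (G i) p.
Proof. by apply: (big_morph (fun X => ider X p) (fun X Y => ider_addl X Y p) (ider_zero p)). Qed.

Definition lieb X Y : 'M[F]_n.+1 := X *m Y - Y *m X.

Lemma ider_bracket X Y p : ider (lieb X Y) p = ider X (ider Y p) - ider Y (ider X p).
Proof.
move: p; apply: ider_eq => [c|i j|p q|p q|p q|p q].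
- by rewrite !iderC subrr.
- rewrite !ider_xvar !ider_sum.
  have E (U V : 'M[F]_n.+1) : \sum_l ider U (V l j *: xvar i l) = \sum_l (U *m V) l j *: xvar i l.
    under eq_bigr do rewrite iderZ ider_xvar scaler_sumr.
    rewrite exchange_big; apply: eq_bigr => l _ /=; rewrite mxE scaler_suml.
    by apply: eq_bigr => k _; rewrite scalerA mulrC.
  rewrite !E -sumrB; apply: eq_bigr => l _.
  by rewrite !mxE scalerBl.
- by rewrite iderD.
- by rewrite !iderD opprD addrACA.
- by rewrite iderM.
- by rewrite !iderM !iderD !iderM bracket_leibniz.
Qed.

Lemma ider_lmove X g p : ider X (lmove g p) = lmove g (ider X p).
Proof.
rewrite /lmove /mxpull; elim/mxpoly_ind: p => [c|i j|p q hp hq|p q hp hq].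
- by rewrite mxsubstC !iderC /mxsubst mmap0.
- rewrite ider_xvar mxsubst_xvar mxsubst_sum mxE ider_sum.
  under eq_bigr => k _ do rewrite !mxE mul_mpolyC iderZ ider_xvar scaler_sumr.
  rewrite exchange_big; apply: eq_bigr => l _ /=.
  rewrite mxsubstZ mxsubst_xvar mxE mulr_sumr; apply: eq_bigr => k _.
  by rewrite !mxE -!mul_mpolyC mulrCA.
- by rewrite !(mxsubstD, iderD) hp hq.
- by rewrite !(mxsubstM, iderM, mxsubstD) hp hq.
Qed.

Definition linform (i : 'I_n.+1) (u : 'cV[F]_n.+1) : poly := \sum_l u l 0 *: xvar i l.

Lemma ider_linform X i u : ider X (linform i u) = linform i (X *m u).
Proof.
rewrite /linform ider_sum; under eq_bigr => l _ do rewrite iderZ ider_xvar scaler_sumr.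
rewrite exchange_big; apply: eq_bigr => k _ /=; rewrite mxE scaler_suml.
by apply: eq_bigr => l _; rewrite scalerA mulrC.
Qed.

Lemma linform_delta i j : linform i (delta_mx j 0) = xvar i j.
Proof.
rewrite /linform (bigD1 j) //= big1 ?addr0 => [|l lj]; first by rewrite mxE !eqxx scale1r.
by rewrite mxE (negPf lj) scale0r.
Qed.

Lemma rmove_linform g i u : rmove g (linform i u) = linform i (g *m u).
Proof.
rewrite /rmove /mxpull /linform mxsubst_sum.
have E l : mxsubst (@mpolyC N F) (xmat *m g%:MM) (u l 0 *: xvar i l) = \sum_k (g k l * u l 0) *: xvar i k.
  rewrite mxsubstZ mxsubst_xvar mxE mulr_sumr; apply: eq_bigr => k _.
  by rewrite [xmat i k]mxE [g%:MM k l]mxE -mul_mpolyC mpolyCM [LHS]mulrCA [LHS]mulrC; congr (_ * _); apply: mulrC.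
under eq_bigr do rewrite E.
rewrite exchange_big; apply: eq_bigr => k _ /=; rewrite mxE scaler_suml.
by [].
Qed.

(** Left-invariant fields commute with left translations, whereas a right translation twists them by
    the adjoint action. *)
Lemma ider_rmove X g p : g \in unitmx -> ider X (rmove g p) = rmove g (ider (invmx g *m X *m g) p).
Proof.
move=> ug; elim/mxpoly_ind: p => [c|i j|p q hp hq|p q hp hq].
- by rewrite /rmove /mxpull mxsubstC !iderC /mxsubst mmap0.
- by rewrite -linform_delta rmove_linform !ider_linform rmove_linform -!mulmxA mulKVmx.
- rewrite /rmove /mxpull in hp hq *; by rewrite !(mxsubstD, iderD) hp hq.
- rewrite /rmove /mxpull in hp hq *; by rewrite !(mxsubstM, iderM, mxsubstD) hp hq.
Qed.

Lemma mxeval_ider X p A :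
  mxeval (ider X p) A = \sum_k mxeval p^`M(k) A * mxvec (A *m X) 0 k.
Proof.
rewrite iderE mxeval_sum; apply: eq_bigr => k _; rewrite mxevalM mulrC; congr (_ * _).
case/mxvec_indexP: k => i j; rewrite !mxvecE !mxE mxeval_sum; apply: eq_bigr => l _.
by rewrite mxevalM !mxE mxeval_xvar mxevalC.
Qed.

Lemma lie_algebraE (K : set 'M[F]_n.+1) X :
  lie_algebra K X <-> forall p, (forall A, K A -> mxeval p A = 0) -> mxeval (ider X p) 1%:M = 0.
Proof. by split=> H p /H; rewrite mxeval_ider mul1mx. Qed.

Section Curves.
Implicit Types (c : 'M[{poly F}]_n.+1).

Definition curve c (s : F) : 'M[F]_n.+1 := map_mx (horner_eval s) c.
Definition polyeval p c : {poly F} := mxsubst polyC c p.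

Lemma horner_polyeval p c s : (polyeval p c).[s] = mxeval p (curve c s).
Proof.
rewrite -[LHS]/(horner_eval s (mxsubst polyC c p)) (@mxsubst_comp _ _ polyC idfun) //.
by move=> a; rewrite /= /horner_eval hornerC.
Qed.

Lemma deriv_polyeval p c :
  (polyeval p c)^`() = \sum_k polyeval p^`M(k) c * mxvec (map_mx (@deriv F) c) 0 k.
Proof.
rewrite /polyeval; elim/mpoly_ring_ind: p => [a|k|p q hp hq|p q hp hq].
- by rewrite mxsubstC derivC big1 // => k _; rewrite mderivC /mxsubst mmap0 mul0r.
- rewrite (bigD1 k) //= big1 ?addr0 => [|l lk].
    rewrite mderivX mnmE eqxx mulr1n scale1r mnm_subnn mpolyX0 /mxsubst mmapX mmap1U rmorph1 mul1r.
    by case/mxvec_indexP: k => i j; rewrite !mxvecE mxE.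
  by rewrite mderivX mnmE eq_sym (negPf lk) scale0r /mxsubst mmap0 mul0r.
- rewrite mxsubstD derivD hp hq -big_split; apply: eq_bigr => k _ /=.
  by rewrite mderivD mxsubstD mulrDl.
- rewrite mxsubstM derivM hp hq mulr_suml mulr_sumr -big_split; apply: eq_bigr => k _ /=.
  by rewrite mderivM mxsubstD !mxsubstM mulrDl -!mulrA (mulrC (mxsubst _ _ q)).
Qed.

Lemma deriv_polyeval_at p c s X : curve (map_mx (@deriv F) c) s = curve c s *m X ->
  ((polyeval p c)^`()).[s] = mxeval (ider X p) (curve c s).
Proof.
move=> cX; rewrite deriv_polyeval mxeval_ider horner_sum; apply: eq_bigr => k _.
rewrite hornerM horner_polyeval -cX; congr (_ * _).
by case/mxvec_indexP: k => i j; rewrite !mxvecE !mxE.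
Qed.

Lemma deriv_polyeval_flow p c X : char0 F -> map_mx (@deriv F) c = c *m map_mx polyC X ->
  (polyeval p c)^`() = polyeval (ider X p) c.
Proof.
move=> F0 cX; apply/eqP; rewrite -subr_eq0; apply/eqP/poly_eq0_char0 => // a.
rewrite hornerD hornerN horner_polyeval (@deriv_polyeval_at _ _ _ X) ?subrr //.
rewrite cX /curve; apply/matrixP => i j; rewrite !mxE /horner_eval horner_sum.
by apply: eq_bigr => k _; rewrite hornerM !mxE hornerC.
Qed.
End Curves.

(** Induction on a degree bound: [msize p <= k.+1] means degree at most [k], and monomials are built
    by multiplying by one variable at a time. *)
Lemma mdeg_ind (P : nat -> poly -> Prop) :
    P 0%N 1 -> (forall k, P k 0) -> (forall k p q, P k p -> P k q -> P k (p + q)) ->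
    (forall k c p, P k p -> P k (c *: p)) -> (forall k p, P k p -> P k.+1 p) ->
    (forall k i j p, P k p -> P k.+1 (xvar i j * p)) ->
  forall k p, (msize p <= k.+1)%N -> P k p.
Proof.
move=> P1 P0 PD PZ PS PX k p sp.
have Pm d m : mdeg m = d -> P d 'X_[m].
  elim: d m => [|d IH] m md; first by move/eqP: md; rewrite mdeg_eq0 => /eqP->; rewrite mpolyX0.
  have [i mi] : exists i, (0 < m i)%N.
    apply/existsP; apply: contraT; rewrite negb_exists => /forallP m0.
    suff: mdeg m = 0%N by rewrite md.
    by apply/eqP; rewrite mdegE sum_nat_eq0; apply/forallP => i; have := m0 i; rewrite -eqn0Ngt.
  have mE : m = (U_(i) + (m - U_(i)))%MM.
    apply/mnmP => j; rewrite mnmDE mnmBE mnmE; case: eqP => [<-|_] /=; lia.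
  rewrite mE mpolyXD; case/mxvec_indexP: i mi mE => i j mi mE; apply: PX; apply: IH.
  by have := congr1 mdeg mE; rewrite md mdegD mdeg1 add1n => -[<-].
have Pmono d d' q : (d <= d')%N -> P d q -> P d' q.
  by move=> dd; rewrite -(subnK dd); elim: (d' - d)%N => // e IH /IH; rewrite addSn; apply: PS.
rewrite (mpolyE p) big_seq; elim/big_ind: _ => [||m mp]; [exact: P0 | exact: PD |].
apply: PZ; apply: (Pmono (mdeg m)); last exact: Pm.
by rewrite -ltnS; apply: leq_trans sp; apply: msize_mdeg_lt.
Qed.

End Evaluation.

Global Opaque mxeval mxpull mxsubst.

Section Subspaces.
Variables (F : fieldType) (vT : vectType F).

(** A subspace of largest dimension among those contained in [P] must be all of [P]. This turns
    undecidable linear conditions, such as membership in a Lie algebra, into finite-dimensional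
    spaces. *)
Lemma vspace_of_pred (P : vT -> Prop) : P 0 -> (forall a u v, P u -> P v -> P (a *: u + v)) ->
  {U : {vspace vT} | forall v, v \in U <-> P v}.
Proof.
move=> P0 PL; apply: cid.
pose Q d := `[< exists U : {vspace vT}, (forall v, v \in U -> P v) /\ \dim U = d >].
have Q0 : exists d, Q d.
  exists 0%N; apply/asboolP; exists 0%VS; rewrite dimv0; split=> // v.
  by rewrite memv0 => /eqP->.
have Qb d : Q d -> (d <= \dim {:vT})%N.
  by move=> /asboolP[U [_ <-]]; apply: dimvS; apply: subvf.
case: (ex_maxnP Q0 Qb) => d /asboolP[U [UP dU]] dmax.
exists U => v; split=> [/UP//|Pv]; apply: contraT => vU.
have : (\dim (U + <[v]>)%VS <= d)%N.
  apply: dmax; apply/asboolP; exists (U + <[v]>)%VS; split=> // w /memv_addP[u uU [x /vlineP[k ->] ->]].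
  by rewrite addrC; apply: PL => //; apply: UP.
rewrite -dU => le; have /eqP UE : U == (U + <[v]>)%VS by rewrite eqEdim addvSl le.
by move: vU; rewrite UE (subvP (addvSr U <[v]>)) ?memv_line.
Qed.

End Subspaces.

(** * Functions on a connected group are determined by their derivatives at the identity *)

Section Identity.
Variables (F : closedFieldType) (n : nat).
Local Notation N := (n.+1 * n.+1)%N.
Local Notation poly := {mpoly F[N]}.
Local Notation mat := 'M[F]_n.+1.
Implicit Types (p q f : poly) (A X Y g : mat) (K : set mat).

Definition vanish K p : Prop := forall A, K A -> mxeval p A = 0.

Lemma vanish_ideal K : ideal (vanish K).
Proof.
split=> [A _|p q hp hq A KA|p q hq A KA]; first exact: mxeval0.
  by rewrite mxevalD hp ?hq ?addr0.
by rewrite mxevalM hq ?mulr0.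
Qed.

Lemma lie_exists K : {U : {vspace mat} | forall X, X \in U <-> lie_algebra K X}.
Proof.
apply: vspace_of_pred => [|a X Y]; first by apply/lie_algebraE => p _; rewrite ider_zero mxeval0.
move=> /lie_algebraE hX /lie_algebraE hY; apply/lie_algebraE => p pK.
by rewrite ider_linear mxevalD mxevalZ (hX p pK) (hY p pK) mulr0 addr0.
Qed.

Definition lie K : {vspace mat} := sval (lie_exists K).

Lemma lieE K X : X \in lie K <-> lie_algebra K X.
Proof. exact: (svalP (lie_exists K)). Qed.

Lemma lieP K X : X \in lie K <-> forall p, vanish K p -> mxeval (ider X p) 1%:M = 0.
Proof. by rewrite lieE lie_algebraE. Qed.

Lemma lie_sub K K' : (forall A, K A -> K' A) -> (lie K <= lie K')%VS.
Proof. by move=> KK; apply/subvP => X /lieP H; apply/lieP => p hp; apply: H => A /KK/hp. Qed.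

(** The [k]-th power of the maximal ideal of the point [1], by its generators, the entries of the
    generic matrix minus the identity. *)
Fixpoint mk k p : Prop :=
  if k is k'.+1 then exists q : 'I_n.+1 -> 'I_n.+1 -> poly,
    (forall i j, mk k' (q i j)) /\ p = \sum_i \sum_j (xvar F i j - (1%:M i j)%:MP) * q i j
  else True.

Local Notation yvar i j := (xvar F i j - ((1%:M : mat) i j)%:MP : poly).

Lemma mk_ideal k : ideal (mk k).
Proof.
elim: k => // k [I0 ID IM]; split=> /=.
- by exists (fun _ _ => 0); split=> //; rewrite big1 // => i _; rewrite big1 // => j _; rewrite mulr0.
- move=> p p' [q [hq ->]] [q' [hq' ->]]; exists (fun i j => q i j + q' i j); split=> [i j|]; first exact: ID.
  rewrite -big_split; apply: eq_bigr => i _; rewrite -big_split; apply: eq_bigr => j _ /=.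
  by rewrite mulrDr.
- move=> a p [q [hq ->]]; exists (fun i j => a * q i j); split=> [i j|]; first exact: IM.
  rewrite mulr_sumr; apply: eq_bigr => i _; rewrite mulr_sumr; apply: eq_bigr => j _.
  by rewrite mulrCA.
Qed.

Lemma mk_yvar k i j q : mk k q -> mk k.+1 (yvar i j * q).
Proof.
move=> hq; exists (fun i' j' => if (i', j') == (i, j) then q else 0); split=> [i' j'|].
  by case: ifP => // _; case: (mk_ideal k).
rewrite (bigD1 i) //= (bigD1 j) //= eqxx big1 ?addr0 => [|j' jj]; last by rewrite xpair_eqE (negPf jj) andbF mulr0.
rewrite big1 ?addr0 // => i' ii; rewrite big1 // => j' _.
by rewrite xpair_eqE (negPf ii) mulr0.
Qed.

Lemma mk_ind k (P : poly -> Prop) : ideal P ->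
  (forall i j q, mk k q -> P (yvar i j * q)) -> forall p, mk k.+1 p -> P p.
Proof.
move=> iP Py p [q [hq ->]]; apply: ideal_sum => // i _; apply: ideal_sum => // j _.
apply: Py; exact: hq.
Qed.

Lemma ideal_preim (R : comNzRingType) (I : R -> Prop) (a : R) : ideal I -> ideal (fun x => I (x * a)).
Proof.
case=> I0 ID IM; split=> [|x y|b x]; first by rewrite mul0r.
  by rewrite mulrDl; apply: ID.
by rewrite -mulrA; apply: IM.
Qed.

Lemma mkM k l p q : mk k p -> mk l q -> mk (k + l) (p * q).
Proof.
move=> + hq; elim: k p => [|k IH] p; first by move=> _; case: (mk_ideal l) => _ _; apply.
move: p; apply: (@mk_ind k (fun p => mk (k.+1 + l) (p * q))); first exact: ideal_preim (mk_ideal _).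
by move=> i j r hr; rewrite -mulrA addSn; apply: mk_yvar; apply: IH.
Qed.

Lemma mk_ider k X p : mk k.+1 p -> mk k (ider X p).
Proof.
elim: k p => // k IH p [q [hq ->]]; rewrite ider_sum; apply: ideal_sum => [|i _]; first exact: mk_ideal.
rewrite ider_sum; apply: ideal_sum => [|j _]; first exact: mk_ideal.
case: (mk_ideal k.+1) => _ ID IM; rewrite iderM; apply: ID; first exact: IM.
by apply: mk_yvar; apply: IH.
Qed.

Lemma mk1P p : mxeval p 1%:M = 0 -> mk 1 p.
Proof.
move=> p0; suff: mk 1 (p - (mxeval p 1%:M)%:MP) by rewrite p0 subr0.
have [I0 ID IM] := mk_ideal 1.
elim/mxpoly_ind: p {p0} => [c|i j|p q hp hq|p q hp hq].
- by rewrite mxevalC subrr.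
- by rewrite mxeval_xvar -[_ - _]mulr1; apply: mk_yvar.
- by rewrite mxevalD mpolyCD opprD addrACA; apply: ID.
- rewrite mxevalM mpolyCM.
  have -> : p * q - (mxeval p 1%:M)%:MP * (mxeval q 1%:M)%:MP =
    q * (p - (mxeval p 1%:M)%:MP) + (mxeval p 1%:M)%:MP * (q - (mxeval q 1%:M)%:MP) by ring.
  by apply: ID; apply: IM.
Qed.

(** The Euler field centred at [1], up to terms of higher order: at the identity the invariant field
    of [delta_mx i j] is the partial derivative. Hence it acts on [mk k] as multiplication by [k]
    modulo [mk k.+1]. *)
Definition euler p : poly := \sum_i \sum_j yvar i j * ider (delta_mx i j) p.

Lemma eulerM p q : euler (p * q) = euler p * q + p * euler q.
Proof.
rewrite /euler mulr_suml mulr_sumr -big_split; apply: eq_bigr => i _ /=.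
rewrite mulr_suml mulr_sumr -big_split; apply: eq_bigr => j _ /=.
by rewrite iderM mulrDr mulrA; congr (_ + _); rewrite mulrCA.
Qed.

Lemma eulerD p q : euler (p + q) = euler p + euler q.
Proof.
rewrite /euler -big_split; apply: eq_bigr => i _ /=.
by rewrite -big_split; apply: eq_bigr => j _ /=; rewrite iderD mulrDr.
Qed.

Lemma euler_yvar a b : mk 2 (euler (yvar a b) - yvar a b).
Proof.
have E : euler (yvar a b) = yvar a b + \sum_i yvar i b * yvar a i.
  rewrite /euler.
  transitivity (\sum_i yvar i b * xvar F a i).
    apply: eq_bigr => i _; rewrite (bigD1 b) //= big1 ?addr0 => [|j jb].
      rewrite iderB iderC subr0 ider_xvar (bigD1 i) //= big1 ?addr0; last by move=> l li; rewrite mxE (negPf li) scale0r.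
      by rewrite [delta_mx _ _ _ _]mxE !eqxx scale1r.
    rewrite iderB iderC subr0 ider_xvar big1 ?mulr0 // => l _.
    by rewrite [delta_mx _ _ _ _]mxE [b == j]eq_sym (negPf jb) andbF scale0r.
  rewrite -[X in X + _](_ : \sum_i yvar i b * ((1%:M : mat) a i)%:MP = _).
    rewrite -big_split; apply: eq_bigr => i _ /=; by rewrite -mulrDr [_%:MP + _]addrC subrK.
  rewrite (bigD1 a) //= big1 ?addr0 => [|i ia]; first by rewrite [X in _ * X%:MP]mxE eqxx mulr1.
  by rewrite [X in _ * X%:MP]mxE eq_sym (negPf ia) mulr0.
rewrite E addrAC subrr add0r; apply: ideal_sum => [|i _]; first exact: mk_ideal.
by apply: mk_yvar; rewrite -[_ - _]mulr1; apply: mk_yvar.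
Qed.

Lemma euler_mk k p : mk k p -> mk k.+1 (euler p - k%:R * p).
Proof.
elim: k p => [|k IH] p.
  rewrite mul0r subr0 => _; apply: ideal_sum => [|i _]; first exact: mk_ideal.
  by apply: ideal_sum => [|j _]; [exact: mk_ideal | apply: mk_yvar].
have [I0 ID IM] := mk_ideal k.+2.
have E0 : euler 0 = 0.
  by rewrite /euler big1 // => i _; rewrite big1 // => j _; rewrite ider0 mulr0.
move=> [q [hq ->]].
rewrite (big_morph euler eulerD E0) mulr_sumr -sumrB; apply: ideal_sum => // i _.
rewrite (big_morph euler eulerD E0) mulr_sumr -sumrB; apply: ideal_sum => // j _.
set y := yvar i j; rewrite eulerM.
have -> : euler y * q i j + y * euler (q i j) - k.+1%:R * (y * q i j) =
  (euler y - y) * q i j + y * (euler (q i j) - k%:R * q i j) by rewrite -natr1; ring.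
apply: ID; last by apply: mk_yvar; apply: IH; apply: hq.
by apply: (mkM (k := 2) (l := k)); [apply: euler_yvar | apply: hq].
Qed.

Lemma ider_delta X p : mxeval (ider X p) 1%:M = \sum_i \sum_j X i j * mxeval (ider (delta_mx i j) p) 1%:M.
Proof.
rewrite {1}(matrix_sum_delta X) ider_suml mxeval_sum; apply: eq_bigr => i _.
by rewrite ider_suml mxeval_sum; apply: eq_bigr => j _; rewrite ider_scalel mxevalZ.
Qed.

(** Finite-dimensional duality: [lie K] is the annihilator of the space [W] of differentials at [1]
    of functions vanishing on [K], so a form that kills [lie K] already lies in [W]. *)
Lemma conormal K (l : mat) : (forall X, X \in lie K -> \sum_i \sum_j X i j * l i j = 0) ->
  exists2 f, vanish K f & forall X, mxeval (ider X f) 1%:M = \sum_i \sum_j X i j * l i j.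
Proof.
move=> lK.
pose d f : mat := \matrix_(i, j) mxeval (ider (delta_mx i j) f) 1%:M.
have dE f X : mxeval (ider X f) 1%:M = \sum_i \sum_j X i j * d f i j.
  by rewrite ider_delta; apply: eq_bigr => i _; apply: eq_bigr => j _; rewrite mxE.
have [||W WP] := @vspace_of_pred _ mat (fun w => exists2 f, vanish K f & w = d f).
- exists 0; first by case: (vanish_ideal K).
  by apply/matrixP => i j; rewrite !mxE ider0 mxeval0.
- move=> a u v [f hf ->] [f' hf' ->]; exists (a *: f + f').
    have [_ ID IM] := vanish_ideal K; apply: ID => //; rewrite -mul_mpolyC; exact: IM.
  by apply/matrixP => i j; rewrite !mxE iderD iderZ mxevalD mxevalZ.
have [lW|lW] := boolP (l \in W).
  by have /WP[f hf lf] := lW; exists f => // X; rewrite dE lf.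
pose phi (Z : mat) := Z - projv W Z.
have phiE (Z : mat) : phi Z = \sum_i \sum_j Z i j *: phi (delta_mx i j).
  rewrite /phi {1 2}(matrix_sum_delta Z) linear_sum -sumrB; apply: eq_bigr => i _.
  rewrite linear_sum -sumrB; apply: eq_bigr => j _.
  by rewrite linearZ scalerBr.
have phil : phi l != 0.
  by apply: contra lW; rewrite subr_eq0 => /eqP->; apply: memv_proj.
have [a [b ab]] : exists a b, phi l a b != 0.
  have [/existsP[a /existsP[b ab]]|] := boolP [exists a, exists b, phi l a b != 0]; first by exists a, b.
  rewrite negb_exists => /forallP H; case/eqP: phil; apply/matrixP => a b; rewrite [RHS]mxE.
  by apply/eqP; have := H a; rewrite negb_exists => /forallP/(_ b); rewrite negbK.
(* [Z] represents the functional taking an entry of the component complementary to [W]: it kills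
   [W], hence belongs to [lie K], but does not kill [l]. *)
pose Z : mat := \matrix_(i, j) phi (delta_mx i j) a b.
have ZE (w : mat) : \sum_i \sum_j Z i j * w i j = phi w a b.
  rewrite phiE summxE; apply: eq_bigr => i _; rewrite summxE; apply: eq_bigr => j _.
  by rewrite !mxE mulrC.
have ZK : Z \in lie K.
  apply/lieP => f hf; rewrite dE ZE /phi projv_id ?subrr ?mxE //.
  by apply/WP; exists f.
by case/eqP: ab; rewrite -ZE; apply: lK.
Qed.

Definition wder (s : seq mat) p := foldr (@ider F n) p s.

Lemma vanish_lmove K g p : subgroup K -> K g -> vanish K p -> vanish K (lmove g p).
Proof. by move=> sK Kg hp A KA; rewrite mxeval_lmove; apply: hp; apply: subgroup_mul. Qed.

Lemma lie_vanish K X p : subgroup K -> X \in lie K -> vanish K p -> vanish K (ider X p).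
Proof.
move=> sK /lieP hX hp A KA.
have := hX _ (vanish_lmove sK KA hp).
by rewrite ider_lmove mxeval_lmove mulmx1.
Qed.

Lemma lie_bracket K X Y : subgroup K -> X \in lie K -> Y \in lie K -> lieb X Y \in lie K.
Proof.
move=> sK hX hY; apply/lieP => p hp; rewrite ider_bracket mxevalB.
have I1 := subgroup_one sK.
rewrite (lie_vanish sK hX (lie_vanish sK hY hp) I1).
by rewrite (lie_vanish sK hY (lie_vanish sK hX hp) I1) subrr.
Qed.

Lemma wder_vanish K s p : subgroup K -> (forall X, X \in s -> X \in lie K) ->
  vanish K p -> vanish K (wder s p).
Proof.
move=> sK; elim: s => // X s IH hs hp; apply: lie_vanish => //; first exact: hs (mem_head _ _).
by apply: IH => // Y ys; apply: hs; rewrite inE ys orbT.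
Qed.

(** The sum of the ideal of [K] and the [k]-th power of the maximal ideal: functions whose
    restriction to [K] vanishes to order [k] at [1]. *)
Definition kmk K k p := exists2 f, vanish K f & mk k (p - f).

Lemma kmk_ideal K k : ideal (kmk K k).
Proof.
have [V0 VD VM] := vanish_ideal K; have [I0 ID IM] := mk_ideal k.
split=> [|p q [f hf pf] [f' hf' qf]|a p [f hf pf]]; first by exists 0; rewrite ?subrr.
  by exists (f + f'); [apply: VD | rewrite opprD addrACA; apply: ID].
by exists (a * f); [apply: VM | rewrite -mulrBr; apply: IM].
Qed.

Lemma kmk_mk K k p : mk k p -> kmk K k p.
Proof. by exists 0; rewrite ?subr0 //; case: (vanish_ideal K). Qed.

Lemma kmk_vanish K k p : vanish K p -> kmk K k p.
Proof. by exists p; rewrite ?subrr //; case: (mk_ideal k). Qed.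

Lemma kmk_yvar K k i j q : kmk K k q -> kmk K k.+1 (yvar i j * q).
Proof.
case=> f hf qf; exists (yvar i j * f); last by rewrite -mulrBr; apply: mk_yvar.
by case: (vanish_ideal K) => _ _; apply.
Qed.

(** Euler's formula recovers [q] from its first derivatives, dividing by [k.+1]. Directions inside
    [lie K] are covered by the hypothesis. The transverse ones are collected into linear
    coefficients [l a b] that kill [lie K]; by [conormal] these agree to second order with functions
    vanishing on [K]. *)
Lemma kmk_step K k q : char0 F -> subgroup K -> mk k.+1 q -> (forall X, X \in lie K -> kmk K k.+1 (ider X q)) ->
  kmk K k.+2 q.
Proof.
move=> F0 sK hq hD; have iK := kmk_ideal K k.+2; have [J0 JD JM] := iK.
suff He : kmk K k.+2 (euler q).
  have := ideal_sub iK He (kmk_mk K (euler_mk hq)).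
  rewrite opprB addrCA subrr addr0 => H.
  have -> : q = (k.+1%:R^-1)%:MP * (k.+1%:R * q).
    rewrite mulrA -mpolyC_nat -mpolyCM mulVf ?mpolyC1 ?mul1r //.
    by rewrite F0.
  exact: JM.
pose pr (X : mat) := projv (lie K) X; pose pr' X := X - pr X.
have -> : euler q = \sum_i \sum_j yvar i j * ider (pr (delta_mx i j)) q +
    \sum_i \sum_j yvar i j * ider (pr' (delta_mx i j)) q.
  rewrite -big_split; apply: eq_bigr => i _; rewrite -big_split; apply: eq_bigr => j _ /=.
  by rewrite -mulrDr -ider_addl /pr' [pr _ + _]addrC subrK.
apply: (JD).
  apply: ideal_sum => // i _; apply: ideal_sum => // j _; apply: kmk_yvar; apply: hD.
  exact: memv_proj.
pose l a b : poly := \sum_i \sum_j (pr' (delta_mx i j) a b) *: yvar i j.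
have -> : \sum_i \sum_j yvar i j * ider (pr' (delta_mx i j)) q =
    \sum_a \sum_b l a b * ider (delta_mx a b) q.
  under eq_bigr => i _ do under eq_bigr => j _ do
    (rewrite {1}(matrix_sum_delta (pr' _)) ider_suml mulr_sumr).
  under eq_bigr => i _ do (rewrite exchange_big /=).
  rewrite exchange_big; apply: eq_bigr => a _ /=.
  under eq_bigr => i _ do under eq_bigr => j _ do (rewrite ider_suml mulr_sumr).
  under eq_bigr => i _ do (rewrite exchange_big /=).
  rewrite exchange_big; apply: eq_bigr => b _ /=.
  rewrite /l mulr_suml; apply: eq_bigr => i _; rewrite mulr_suml; apply: eq_bigr => j _.
  by rewrite ider_scalel -scalerAl -scalerAr.
apply: ideal_sum => // a _; apply: ideal_sum => // b _.
pose lm : mat := \matrix_(i, j) pr' (delta_mx i j) a b.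
have [|f hf fE] := @conormal K lm.
  move=> X hX; transitivity (pr' X a b); last by rewrite /pr' /pr projv_id // subrr mxE.
  have -> : pr' X = \sum_i \sum_j X i j *: pr' (delta_mx i j).
    rewrite /pr' /pr {1 2}(matrix_sum_delta X) linear_sum -sumrB; apply: eq_bigr => i _.
    rewrite linear_sum -sumrB; apply: eq_bigr => j _.
    by rewrite linearZ scalerBr.
  rewrite summxE; apply: eq_bigr => i _; rewrite summxE; apply: eq_bigr => j _.
  by rewrite mxE [RHS]mxE.
have lf : mk 2 (l a b - f + (mxeval f 1%:M)%:MP).
  have l1 : mxeval (l a b) 1%:M = 0.
    rewrite mxeval_sum big1 // => i _; rewrite mxeval_sum big1 // => j _.
    by rewrite mxevalZ mxevalB mxeval_xvar mxevalC subrr mulr0.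
  set h := (X in mk 2 X).
  have h1 : mk 1 h by apply: mk1P; rewrite mxevalD mxevalB mxevalC l1 sub0r addNr.
  have dl X : mxeval (ider X (l a b)) 1%:M = \sum_i \sum_j X i j * lm i j.
    rewrite ider_sum mxeval_sum; apply: eq_bigr => i _.
    rewrite ider_sum mxeval_sum; apply: eq_bigr => j _.
    rewrite iderZ iderB iderC subr0 mxevalZ ider_xvar mxeval_sum [lm i j]mxE mulrC; congr (_ * _).
    rewrite (bigD1 i) //= big1 ?addr0 => [|m mi]; first by rewrite mxevalZ mxeval_xvar mxE eqxx mulr1.
    by rewrite mxevalZ mxeval_xvar mxE eq_sym (negPf mi) mulr0.
  have dh X : mxeval (ider X h) 1%:M = 0.
    by rewrite /h iderD iderC addr0 iderB mxevalB dl fE subrr.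
  have [I0 ID IM] := mk_ideal 2.
  have : mk 2 (euler h).
    by apply: ideal_sum => // i _; apply: ideal_sum => // j _; apply: mk_yvar; apply: mk1P.
  by move/ideal_sub => /(_ _ (mk_ideal 2) (euler_mk h1)); rewrite mul1r opprB addrCA subrr addr0.
rewrite (hf _ (subgroup_one sK)) addr0 in lf.
have -> : l a b * ider (delta_mx a b) q = (l a b - f) * ider (delta_mx a b) q + ider (delta_mx a b) q * f by ring.
apply: JD; last by apply: JM; apply: kmk_vanish.
by apply: kmk_mk; rewrite -[k.+2]/(2 + k)%N; apply: mkM => //; apply: mk_ider.
Qed.

(** Smoothness at the identity in characteristic zero: vanishing to order [k] is gained one order at
    a time by [kmk_step], after subtracting a function in the ideal of [K]. *)
Lemma cartier K k p : char0 F -> subgroup K ->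
  (forall s, (size s < k)%N -> (forall X, X \in s -> X \in lie K) -> mxeval (wder s p) 1%:M = 0) ->
  kmk K k p.
Proof.
move=> F0 sK; elim: k p => [|k IH] p hp; first by exists 0; rewrite ?subr0 //; case: (vanish_ideal K).
have [f hf pf] : kmk K k p by apply: IH => s sk; apply: hp; apply: ltnW.
suff H : kmk K k.+1 (p - f).
  rewrite -(subrK f p); have [_ JD _] := kmk_ideal K k.+1; apply: JD => //; exact: kmk_vanish.
case: k IH hp pf  => [|k] IH hp pf.
  apply: kmk_mk; apply: mk1P; rewrite mxevalB (hf _ (subgroup_one sK)) subr0.
  exact: (hp [::]).
apply: kmk_step => // X hX; rewrite iderB; apply: ideal_sub; first exact: kmk_ideal.
  apply: IH => s sk hs; have -> : wder s (ider X p) = wder (rcons s X) p by rewrite /wder foldr_rcons.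
  apply: hp; first by rewrite size_rcons.
  by move=> Y; rewrite mem_rcons inE => /orP[/eqP->//|]; apply: hs.
by apply: kmk_vanish; apply: lie_vanish.
Qed.

Lemma count_bound (T : finType) (w : seq T) k : (#|T| * k < size w)%N -> exists x, (k < count_mem x w)%N.
Proof.
move=> sw; apply/existsP; apply: contraLR sw; rewrite negb_exists => /forallP H.
have -> : size w = (\sum_(x : T) count_mem x w)%N.
  elim: w {H} => [|a w IH] /=; first by rewrite big1.
  rewrite big_split /= -IH (bigD1 a) //= eqxx big1 ?addn0 ?add1n // => x xa.
  by rewrite eq_sym (negPf xa).
rewrite -leqNgt -sum_nat_const; apply: leq_sum => x _.
by have := H x; rewrite -leqNgt.
Qed.

(** Krull's intersection theorem for the local ring of [K] at [1]. If [p] is not in the ideal of [K]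
    plus the maximal ideal times [p], choose an ideal [L] above it maximal among those avoiding [p].
    It contains a power of the maximal ideal, hence [p] after all. *)
Lemma krull K p : subgroup K -> (forall k, kmk K k p) ->
  exists2 u, mxeval u 1%:M = 1 & vanish K (u * p).
Proof.
move=> sK hp; have [V0 VD VM] := vanish_ideal K.
pose Q x := exists f m, [/\ vanish K f, mxeval m 1%:M = 0 & x = f + m * p].
have [[f [m [hf m1 pE]]]|nQp] := pselect (Q p).
  exists (1 - m); first by rewrite mxevalB mxeval1 m1 subr0.
  by rewrite mulrBl mul1r {1}pE addrK.
have iQ : ideal Q.
  split; first by exists 0, 0; rewrite mxeval0 mul0r addr0.
  - move=> x y [f [m [hf hm ->]]] [f' [m' [hf' hm' ->]]]; exists (f + f'), (m + m').
    split; [exact: VD | by rewrite mxevalD hm hm' addr0 | by rewrite mulrDl addrACA].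
  - move=> a x [f [m [hf hm ->]]]; exists (a * f), (a * m).
    split; [exact: VM | by rewrite mxevalM hm mulr0 | by rewrite mulrDr mulrA].
have noeth : noetherian {mpoly F[N]} by apply: noetherian_mpoly.
have [L [iL QL nLp Lmax]] := noetherian_maximal_avoiding noeth iQ nQp.
have [L0 LD LM] := iL.
(* With the exponent [k] at which the colon ideals of [L] stabilize: if the power were outside [L],
   maximality would give [p = l + yvar i j ^+ k * r]. As [yvar i j * p] is in [L], so is
   [yvar i j ^+ k.+1 * r], then [yvar i j ^+ k * r], then [p]. *)
have yL i j : exists k, L (yvar i j ^+ k).
  have [k hk] := noetherian_colon noeth (yvar i j) iL.
  exists k; apply: contrapT => nL.
  have [l [r [hl pE]]] : exists l r, L l /\ p = l + yvar i j ^+ k * r.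
    apply: (Lmax _ nL (fun x => exists l r, L l /\ x = l + yvar i j ^+ k * r)).
    - split; first by exists 0, 0; rewrite mulr0 addr0.
        move=> x y [l [r [hl ->]]] [l' [r' [hl' ->]]]; exists (l + l'), (r + r').
        by split; [apply: LD | rewrite mulrDr addrACA].
      move=> a x [l [r [hl ->]]]; exists (a * l), (a * r).
      by split; [apply: LM | rewrite mulrDr [a * (_ * _)]mulrCA].
    - by move=> x Lx; exists x, 0; rewrite mulr0 addr0.
    - by exists 0, 1; rewrite mulr1 add0r.
  have Lyp : L (yvar i j * p).
    apply: QL; exists 0, (yvar i j); split=> //; last by rewrite add0r.
    by rewrite mxevalB mxeval_xvar mxevalC subrr.
  apply: nLp; rewrite pE; apply: LD => //; apply: hk.
  have -> : yvar i j ^+ k.+1 * r = yvar i j * p - yvar i j * l.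
    by rewrite pE mulrDr addrAC subrr add0r mulrA -exprS.
  by apply: ideal_sub => //; apply: LM.
have {yL}/choice[e he] (x : 'I_n.+1 * 'I_n.+1) : exists k, L (yvar x.1 x.2 ^+ k) by apply: yL.
pose k := \max_x e x.
pose T : finType := ('I_n.+1 * 'I_n.+1)%type.
pose wy (w : seq T) : poly := \prod_(x <- w) yvar x.1 x.2.
(* Pigeonhole: a long product of generators repeats one of them more than [k] times. *)
have wyL (w : seq T) : (#|T| * k < size w)%N -> L (wy w).
  move=> /count_bound[x xk].
  have [r ->] : exists r, wy w = yvar x.1 x.2 ^+ count_mem x w * r.
    elim: (w) => [|a v [r hr]]; first by exists 1; rewrite /wy big_nil mul1r.
    rewrite /wy big_cons -/(wy v) hr /=; case: eqP => [->|_].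
      by exists r; rewrite add1n exprS mulrA.
    by exists (yvar a.1 a.2 * r); rewrite mulrCA.
  have ek : (e x <= count_mem x w)%N by apply: leq_trans (ltnW xk); apply: leq_bigmax.
  rewrite mulrC; apply: (LM); rewrite -(subnK ek) exprD; apply: LM; exact: he.
have mkL d : forall r, (forall w : seq T, size w = d -> L (r * wy w)) -> forall q, mk d q -> L (r * q).
  elim: d => [|d IH] r hr q.
    by move=> _; rewrite mulrC; apply: LM; have := hr [::] erefl; rewrite /wy big_nil mulr1.
  move: q; apply: (@mk_ind d (fun q => L (r * q))).
    split=> [|x y|a x]; rewrite ?mulr0 // ?mulrDr ?[r * (a * x)]mulrCA; [exact: LD | exact: LM].
  move=> i j q hq; rewrite mulrA; apply: IH => // w sw.
  have := hr ((i, j) :: w); rewrite /= sw => /(_ erefl).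
  by rewrite /wy big_cons /= mulrA.
have [f hf] := hp (#|T| * k).+1.
move=> /(mkL _ 1); rewrite mul1r => Lpf; case: nLp.
rewrite -(subrK f p); apply: LD; first by apply: Lpf => w sw; rewrite mul1r; apply: wyL; rewrite sw.
by apply: QL; exists f, 0; rewrite mxeval0 mul0r addr0.
Qed.

Lemma wder_lmove g s p : wder s (lmove g p) = lmove g (wder s p).
Proof. by elim: s => //= X s ->; rewrite ider_lmove. Qed.

(** [Z1] is the set where all derivatives of [p] along [lie K] vanish, [Z2] the common zeros of the
    multipliers [u] with [u * p] zero on [K]. Both are closed. They cover [K] by the Leibniz rule
    and are disjoint on it by [krull] applied to a translate of [p]. Since [1] is in [Z1],
    connectedness leaves only [Z1]. *)
Theorem identity_theorem K p : char0 F -> closed_connected K ->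
  (forall s, (forall X, X \in s -> X \in lie K) -> mxeval (wder s p) 1%:M = 0) -> vanish K p.
Proof.
move=> F0 [[sK _] [_ conn]] hp.
pose Z1 : set mat := fun A => forall q, (exists2 s, (forall X, X \in s -> X \in lie K) & q = wder s p) -> mxeval q A = 0.
pose Z2 : set mat := fun A => forall u, vanish K (u * p) -> mxeval u A = 0.
have one := subgroup_one sK.
have Z11 : Z1 1%:M by move=> q [s hs ->]; apply: hp.
have disj A : K A -> Z1 A -> ~ Z2 A.
  move=> KA hA hA2.
  have [|u u1 hu] := @krull K (lmove A p) sK.
    move=> k; apply: cartier => // s _ hs; rewrite wder_lmove mxeval_lmove mulmx1.
    by apply: hA; exists s.
  have : mxeval (lmove (invmx A) u) A = 0.
    apply: hA2 => B KB; rewrite mxevalM mxeval_lmove.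
    have := hu (invmx A *m B); rewrite mxevalM mxeval_lmove mulKVmx ?(subgroup_unit sK) //.
    by apply; apply: subgroup_mul => //; apply: subgroup_inv.
  by rewrite mxeval_lmove mulVmx ?(subgroup_unit sK) // u1 => /eqP; rewrite oner_eq0.
have cl1 : zclosed Z1 by exists (fun q => exists2 s, (forall X, X \in s -> X \in lie K) & q = wder s p).
have cl2 : zclosed Z2 by exists (fun u => vanish K (u * p)).
case: (conn Z1 Z2 cl1 cl2).
- move=> A KA; have [|nA] := pselect (Z1 A); [by left | right].
  move=> u hu; apply: contrapT => uA; apply: nA => q [s hs ->].
  (* Each further derivation costs one more factor [u]. *)
  suff H : vanish K (u ^+ (size s).+1 * wder s p).
    have /eqP := H A KA; rewrite mxevalM mxevalX mulf_eq0 expf_eq0 /= => /orP[/eqP//|/eqP//].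
  elim: s hs => [|X s IH] hs; first by rewrite expr1.
  have {}IH := IH (fun Y ys => hs Y (mem_behead (s := _ :: _) ys)).
  have [_ VD VM] := vanish_ideal K.
  have := VM u _ (lie_vanish sK (hs X (mem_head _ _)) IH); rewrite iderM mulrDr.
  have [r hr] : exists r, ider X (u ^+ (size s).+1) = u ^+ (size s) * r.
    elim: (size s) => [|k [r hr]]; first by exists (ider X u); rewrite mul1r expr1.
    by exists (ider X u + r); rewrite exprS iderM hr mulrA -exprS mulrDr [ider X u * _]mulrC.
  have -> : u * (ider X (u ^+ (size s).+1) * wder s p) = r * (u ^+ (size s).+1 * wder s p).
    by rewrite hr exprS; ring.
  move=> H2; have := ideal_sub (vanish_ideal K) H2 (VM r _ IH).
  by rewrite addrAC subrr add0r mulrA -exprS.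
- apply/seteqP; split=> // A [[KA h1] h2]; exact: (disj A).
- by move=> KZ A KA; apply: (KZ A KA); exists [::].
- by move=> KZ; case: (disj 1%:M) => //; apply: KZ.
Qed.

(** Irreducibility of a connected group. After translating [x] to [1], where [z] is invertible, the
    Leibniz rule shows that all derivatives of [p] vanish there, and the identity theorem
    applies. *)
Lemma vanish_mul K (z p : poly) x : char0 F -> closed_connected K -> K x -> mxeval z x != 0 ->
  vanish K (z * p) -> vanish K p.
Proof.
move=> F0 cK Kx zx hzp; have [[sK _] _] := cK.
have [V0 VD VM] := vanish_ideal K.
suff H : vanish K (lmove x p).
  move=> A KA; have := H (invmx x *m A); rewrite mxeval_lmove mulKVmx ?(subgroup_unit sK) //.
  by apply; apply: subgroup_mul => //; apply: subgroup_inv.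
have {}hzp : vanish K (lmove x z * lmove x p).
  move=> A KA; rewrite mxevalM !mxeval_lmove -mxevalM; apply: hzp.
  exact: subgroup_mul.
have {}zx : mxeval (lmove x z) 1%:M != 0 by rewrite mxeval_lmove mulmx1.
move: (lmove x z) (lmove x p) hzp zx => {}z {}p hzp zx.
apply: identity_theorem => // s hs.
suff H : vanish K (z ^+ (size s).+1 * wder s p).
  have /eqP := H 1%:M (subgroup_one sK); rewrite mxevalM mxevalX mulf_eq0 expf_eq0 /= (negPf zx).
  by move/eqP.
elim: s hs => [|X s IH] hs; first by rewrite expr1.
have {}IH := IH (fun Y ys => hs Y (mem_behead (s := _ :: _) ys)).
have := VM z _ (lie_vanish sK (hs X (mem_head _ _)) IH); rewrite iderM mulrDr.
have [r hr] : exists r, ider X (z ^+ (size s).+1) = z ^+ (size s) * r.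
  elim: (size s) => [|k [r hr]]; first by exists (ider X z); rewrite mul1r expr1.
  by exists (ider X z + r); rewrite exprS iderM hr mulrA -exprS mulrDr [ider X z * _]mulrC.
have -> : z * (ider X (z ^+ (size s).+1) * wder s p) = r * (z ^+ (size s).+1 * wder s p).
  by rewrite hr exprS; ring.
move=> H2; have := ideal_sub (vanish_ideal K) H2 (VM r _ IH).
by rewrite addrAC subrr add0r mulrA -exprS.
Qed.

(** The equations of [K'] are stable under [lie K'], hence have zero derivatives at [1] along
    [lie K]. Inclusions of groups are deduced from inclusions of Lie algebras by this lemma. *)
Lemma connected_sub K K' : char0 F -> closed_connected K -> closed_subgroup K' ->
  (lie K <= lie K')%VS -> forall A, K A -> K' A.
Proof.
move=> F0 cK [sK' [Z [S ZE] K'E]] /subvP LL A KA; have [[sK _] _] := cK.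
rewrite K'E; split; first exact: (subgroup_unit sK).
rewrite ZE => p Sp; suff: vanish K p by apply.
apply: identity_theorem => // s hs.
have hp : vanish K' p by move=> B; rewrite K'E ZE => -[_]; apply.
apply: (wder_vanish (K := K')) (subgroup_one sK') => // X /hs; exact: LL.
Qed.
End Identity.

(** * Jordan decomposition and replicas *)

Section Interpolation.
Variable F : fieldType.

Lemma coprimep_prod_XsubC (s : seq F) N (d : F) :
  d \notin s -> coprimep (\prod_(e <- s) ('X - e%:P) ^+ N) (('X - d%:P) ^+ N).
Proof.
elim: s => [|e s IH]; first by rewrite big_nil coprime1p.
rewrite inE negb_or => /andP[de ds]; rewrite big_cons coprimepMl IH // andbT.
by rewrite coprimep_expl // coprimep_expr // coprimep_XsubC2 // subr_eq0.
Qed.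

Lemma dvdp_prod_XsubC_exp (s : seq F) N (q : {poly F}) : uniq s ->
  (forall d, d \in s -> ('X - d%:P) ^+ N %| q) -> \prod_(e <- s) ('X - e%:P) ^+ N %| q.
Proof.
elim: s => [|d s IH] /=; first by rewrite big_nil dvd1p.
move=> /andP[ds us] H; rewrite big_cons Gauss_dvdp; last by rewrite coprimep_sym coprimep_prod_XsubC.
by rewrite H ?mem_head // IH // => e es; apply: H; rewrite inE es orbT.
Qed.

Lemma crt_XsubC (s : seq F) N (h : F -> F) : uniq s ->
  exists q : {poly F}, forall d, d \in s -> ('X - d%:P) ^+ N %| (q - (h d)%:P).
Proof.
elim: s => [|d s IH] /=; first by exists 0.
move=> /andP[ds us]; have [q hq] := IH us.
pose A := \prod_(e <- s) ('X - e%:P) ^+ N : {poly F}.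
have /Bezout_eq1_coprimepP[[u v] /= uv] := coprimep_prod_XsubC N ds.
rewrite -/A in uv.
exists (q + A * (u * ((h d)%:P - q))) => e; rewrite inE => /orP[/eqP->|es].
  have -> : q + A * (u * ((h d)%:P - q)) - (h d)%:P = ('X - d%:P) ^+ N * (v * (q - (h d)%:P)).
    have E : u * A = 1 - v * ('X - d%:P) ^+ N by rewrite -uv addrK.
    have -> : A * (u * ((h d)%:P - q)) = (u * A) * ((h d)%:P - q) by ring.
    by rewrite E; ring.
  exact: dvdp_mulr.
rewrite addrAC; apply: dvdp_add; [exact: hq | apply: dvdp_mulr].
by rewrite /A (big_rem e) //= dvdp_mulr.
Qed.

End Interpolation.

Section Jordan.
Variables (F : closedFieldType) (n : nat).
Local Notation mat := 'M[F]_n.+1.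
Implicit Types (A X Y Q S : mat).

Definition diagm Q (w : 'I_n.+1 -> F) : mat := invmx Q *m diag_mx (\row_i w i) *m Q.

Lemma diagm_mul Q w w' : Q \in unitmx -> diagm Q w *m diagm Q w' = diagm Q (fun i => w i * w' i).
Proof.
move=> uQ; rewrite /diagm -!mulmxA (mulmxA Q) mulmxV // mul1mx (mulmxA (diag_mx _)).
by rewrite mulmx_diag; congr (_ *m (diag_mx _ *m _)); apply/rowP => i; rewrite !mxE.
Qed.

Lemma diagm_comb (I : Type) (r : seq I) Q (c : I -> F) (w : I -> 'I_n.+1 -> F) :
  \sum_(j <- r) c j *: diagm Q (w j) = diagm Q (fun i => \sum_(j <- r) c j * w j i).
Proof.
rewrite /diagm; under eq_bigr => j _ do rewrite scalemxAl scalemxAr.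
rewrite -mulmx_suml -mulmx_sumr; congr (_ *m _ *m _).
under eq_bigr do rewrite -linearZ.
rewrite -linear_sum; congr diag_mx; apply/rowP => i; rewrite !mxE summxE.
by apply: eq_bigr => j _; rewrite !mxE.
Qed.

Lemma diagm_const Q a : Q \in unitmx -> diagm Q (fun=> a) = a%:M.
Proof.
move=> uQ; rewrite /diagm; have -> : diag_mx (\row__ a) = a%:M :> mat.
  by apply/matrixP => i j; rewrite !mxE.
by rewrite mul_mx_scalar -scalemxAl mulVmx // scalemx1.
Qed.

Lemma horner_mx_diagm Q w p : Q \in unitmx -> horner_mx (diagm Q w) p = diagm Q (fun i => p.[w i]).
Proof.
move=> uQ; elim/poly_ind: p => [|p c IH].
  rewrite rmorph0; transitivity (0%:M : mat); first by rewrite raddf0.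
  by rewrite -(diagm_const 0 uQ); congr diagm; apply: funext => i; rewrite horner0.
rewrite rmorphD rmorphM /= horner_mx_X horner_mx_C IH -[_ * _]/(_ *m _) diagm_mul //.
rewrite -(diagm_const c uQ) -[X in X + _]scale1r -[X in _ + X]scale1r.
have := diagm_comb [:: true; false] Q (fun=> 1) (fun b i => if b then p.[w i] * w i else c).
rewrite !big_cons big_nil addr0 => ->; congr diagm; apply: funext => i.
by rewrite !big_cons big_nil addr0 !mul1r hornerMXaddC.
Qed.

Lemma diagm_inj Q w w' : Q \in unitmx -> diagm Q w = diagm Q w' -> w = w'.
Proof.
move=> uQ H; have : diag_mx (\row_i w i) = diag_mx (\row_i w' i).
  have E v : diag_mx (\row_i v i) = Q *m diagm Q v *m invmx Q.
    by rewrite /diagm !mulmxA mulmxV // mul1mx mulmxK.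
  by rewrite !E H.
by move=> H2; apply: funext => i; move/matrixP/(_ i i): H2; rewrite !mxE eqxx !mulr1n.
Qed.

Lemma is_diagm Q A : Q \in unitmx -> is_diag_mx (Q *m A *m invmx Q) -> exists w, A = diagm Q w.
Proof.
move=> uQ /is_diag_mxP H; exists (fun i => (Q *m A *m invmx Q) i i).
rewrite /diagm; have -> : diag_mx (\row_i (Q *m A *m invmx Q) i i) = Q *m A *m invmx Q.
  apply/matrixP => i j; rewrite !mxE; have [->|ij] := eqVneq i j; first by rewrite mulr1n.
  by rewrite mulr0n; have := H i j ij; rewrite !mxE.
by rewrite !mulmxA mulVmx // mul1mx mulmxKV.
Qed.

Lemma diagm_is_diag Q w : Q \in unitmx -> is_diag_mx (Q *m diagm Q w *m invmx Q).
Proof. by move=> uQ; rewrite /diagm !mulmxA mulmxV // mul1mx mulmxK // diag_mx_is_diag. Qed.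

Lemma codiag_seq (As : seq mat) :
  (forall A B, A \in As -> B \in As -> A *m B = B *m A) ->
  (forall A, A \in As -> exists2 Q, Q \in unitmx & exists w, A = diagm Q w) ->
  exists2 Q, Q \in unitmx & forall A, A \in As -> exists w, A = diagm Q w.
Proof.
move=> cA dA; have [] := (mxpoly.codiagonalizableP As).1.
  split; first by move=> A B hA hB; apply: cA.
  move=> A /dA[Q uQ [w ->]]; exists Q => //.
  apply/(diagonalizable_forLR uQ); exists (\row_i w i).
  by rewrite mxpoly.conjumx ?unitmx_inv // invmxK.
move=> Q uQ /allP H; exists Q => // A /H.
move=> /(diagonalizable_forLR uQ)[D ->]; exists (fun i => D 0 i).
rewrite mxpoly.conjumx ?unitmx_inv // invmxK /diagm; congr (_ *m diag_mx _ *m _).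
by apply/rowP => i; rewrite mxE.
Qed.

(** By Chinese remainders, [q] is congruent to [d] modulo a high power of ['X - d] for each
    eigenvalue [d]. Then [q] of [X] is killed by a product of distinct linear factors, hence
    diagonalizable, and some power of ['X - q] is divisible by the characteristic polynomial. *)
Theorem jordan_decomposition X : exists S q, [/\ S = horner_mx X q,
  exists2 Q, Q \in unitmx & exists w, S = diagm Q w & exists k, (X - S) ^+ k = 0].
Proof.
have [rs char] := closed_field_poly_normal (char_poly X).
rewrite (monicP (char_poly_monic X)) scale1r in char.
pose s := undup rs; pose N := size rs; have us : uniq s by apply: undup_uniq.
have zero (q : {poly F}) : (forall d, d \in s -> ('X - d%:P) ^+ N %| q) -> horner_mx X q = 0.
  move=> /(dvdp_prod_XsubC_exp us) H.
  have : char_poly X %| q.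
    apply: dvdp_trans H; rewrite char -prodr_undup_exp_count.
    apply: (big_ind2 (fun x y => x %| y)) => // [x x' y y'|d _]; first exact: dvdp_mul.
    by rewrite dvdp_exp2l // count_size.
  by move=> /dvdpP[q' ->]; rewrite rmorphM /= Cayley_Hamilton mulr0.
have [q hq] := crt_XsubC N id us; exists (horner_mx X q), q; split=> //.
  have : exists2 rs0, uniq rs0 & mxminpoly (horner_mx X q) %| \prod_(x <- rs0) ('X - x%:P).
    exists s => //; apply: mxminpoly_min; rewrite rmorph_prod /=.
    rewrite (eq_bigr (fun x => horner_mx X (q - x%:P))); last first.
      by move=> x _; rewrite !rmorphB /= horner_mx_X !horner_mx_C.
    rewrite -rmorph_prod; apply: zero => d ds; rewrite (big_rem d) //=.
    by rewrite dvdp_mulr // hq.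
  move=> /(mxpoly.diagonalizableP _).2[Q uQ]; move=> /(diagonalizable_forLR uQ)[D ->].
  exists Q => //; exists (fun i => D 0 i).
  rewrite mxpoly.conjumx ?unitmx_inv // invmxK /diagm; congr (_ *m diag_mx _ *m _).
  by apply/rowP => i; rewrite mxE.
exists N; have -> : X - horner_mx X q = horner_mx X ('X - q) by rewrite rmorphB /= horner_mx_X.
rewrite -rmorphXn; apply: zero => d ds; rewrite dvdp_exp2r //.
have N0 : (0 < N)%N by move: ds; rewrite mem_undup /N; case: (rs).
have d1 : ('X - d%:P) %| q - d%:P by apply: dvdp_trans (hq d ds); rewrite -(prednK N0) exprS dvdp_mulr.
have -> : 'X - q = ('X - d%:P) - (q - d%:P) by rewrite opprB addrA subrK.
by apply: dvdp_add; rewrite ?dvdpp // dvdpNr.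
Qed.

Lemma interpolation (s : seq F) (h : F -> F) : exists p : {poly F}, forall x, x \in s -> p.[x] = h x.
Proof.
have [q hq] := crt_XsubC 1 h (undup_uniq s); exists q => x xs.
have : 'X - x%:P %| q - (h x)%:P by rewrite -[X in X %| _]expr1 hq // mem_undup.
by rewrite dvdp_XsubCl /root !hornerE subr_eq0 => /eqP.
Qed.

Lemma diagm_poly Q w w' : Q \in unitmx -> (forall i j, w i = w j -> w' i = w' j) ->
  exists p, diagm Q w' = horner_mx (diagm Q w) p.
Proof.
move=> uQ H; pose h x := if [pick i | w i == x] is Some i then w' i else 0.
have [p hp] := interpolation (codom w) h; exists p.
rewrite horner_mx_diagm //; congr diagm; apply: funext => i.
rewrite hp ?codom_f // /h; case: pickP => [j /eqP/H//|/(_ i)].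
by rewrite eqxx.
Qed.

(** A basis of the rational span of [s], rescaled to make all coordinates integral: a new element is
    either independent or forces division of the basis by one common denominator [z0]. *)
Lemma integral_span (s : seq F) : char0 F -> exists m (c : 'I_m -> F),
  (forall z : 'I_m -> int, \sum_j (z j)%:~R * c j = 0 -> forall j, z j = 0) /\
  forall x, x \in s -> exists a : 'I_m -> int, x = \sum_j (a j)%:~R * c j.
Proof.
move=> F0; elim: s => [|x s [m [c [free sp]]]]; first by exists 0%N, (fun=> 0); split=> // z _ [].
have [[z0 [z [z0n zE]]]|H] := pselect (exists z0 (z : 'I_m -> int),
    z0 != 0 /\ z0%:~R * x = \sum_j (z j)%:~R * c j).
  have zF : z0%:~R != 0 :> F by rewrite char0_intr.
  exists m, (fun j => z0%:~R^-1 * c j); split.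
    move=> y; under eq_bigr do rewrite mulrCA; rewrite -mulr_sumr => /eqP.
    by rewrite mulf_eq0 invr_eq0 (negPf zF) => /eqP; apply: free.
  move=> y; rewrite inE => /orP[/eqP->|/sp[a ->]].
    exists z; under eq_bigr do rewrite mulrCA; rewrite -mulr_sumr -zE mulrA mulVf // mul1r //.
  exists (fun j => a j * z0); apply: eq_bigr => j _.
  by rewrite rmorphM /= -mulrA mulVKf.
pose c' (j : 'I_m.+1) := if unlift ord0 j is Some i then c i else x.
have E (z : 'I_m.+1 -> int) : \sum_j (z j)%:~R * c' j =
    (z ord0)%:~R * x + \sum_j (z (lift ord0 j))%:~R * c j.
  rewrite big_ord_recl /c' unlift_none; congr (_ + _); apply: eq_bigr => j _.
  by rewrite liftK.
exists m.+1, c'; split=> [z|y].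
  rewrite E => zE; have z0 : z ord0 = 0.
    apply: contrapT => /eqP z0; apply: H; exists (z ord0), (fun j => - z (lift ord0 j)); split=> //.
    under eq_bigr do rewrite rmorphN mulNr; rewrite sumrN; apply/eqP.
    by rewrite -addr_eq0 zE.
  move: zE; rewrite z0 mul0r add0r => /free zl j.
  by case: (unliftP ord0 j) => [i ->|->].
rewrite inE => /orP[/eqP->|/sp[a ->]].
  exists (fun j => if unlift ord0 j is Some _ then 0 else 1).
  by rewrite E unlift_none mul1r big1 ?addr0 // => j _; rewrite liftK mul0r.
exists (fun j => if unlift ord0 j is Some i then a i else 0).
by rewrite E unlift_none mul0r add0r; apply: eq_bigr => j _; rewrite liftK.
Qed.

End Jordan.

(** * Weight components of polynomials and replicas of matrices *)

Section GradedDecomposition.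
Variables (F : closedFieldType) (n : nat).
Local Notation N := (n.+1 * n.+1)%N.
Local Notation poly := {mpoly F[N]}.
Local Notation mat := 'M[F]_n.+1.

Lemma linform_linear i a (u v : 'cV[F]_n.+1) : linform i (a *: u + v) = a *: linform i u + linform i v.
Proof.
rewrite /linform scaler_sumr -big_split; apply: eq_bigr => l _ /=.
by rewrite !mxE scalerDl scalerA.
Qed.

Lemma linform0 (i : 'I_n.+1) : linform i (0 : 'cV[F]_n.+1) = 0.
Proof. by rewrite /linform big1 // => l _; rewrite mxE scale0r. Qed.

Lemma linformZ i a (u : 'cV[F]_n.+1) : linform i (a *: u) = a *: linform i u.
Proof. by rewrite -[a *: u]addr0 linform_linear linform0 addr0. Qed.

Lemma linformB i (u v : 'cV[F]_n.+1) : linform i (u - v) = linform i u - linform i v.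
Proof. by rewrite addrC -scaleN1r linform_linear scaleN1r addrC. Qed.

Lemma mxeval_linform i (u : 'cV[F]_n.+1) A : mxeval (linform i u) A = (A *m u) i 0.
Proof.
rewrite mxeval_sum mxE; apply: eq_bigr => l _.
by rewrite mxevalZ mxeval_xvar mulrC.
Qed.

Lemma xvar_linform (Q : mat) i l : Q \in unitmx ->
  xvar F i l = \sum_j (Q j l) *: linform i (col j (invmx Q)).
Proof.
move=> uQ; rewrite /linform; under eq_bigr => j _ do rewrite scaler_sumr.
rewrite exchange_big /= (bigD1 l) //= [X in _ = _ + X]big1 ?addr0 => [|k kl].
  under eq_bigr do rewrite scalerA; rewrite -scaler_suml.
  have -> : \sum_j Q j l * col j (invmx Q) l 0 = (invmx Q *m Q) l l.
    by rewrite mxE; apply: eq_bigr => j _; rewrite mxE mulrC.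
  by rewrite mulVmx // mxE eqxx scale1r.
under eq_bigr do rewrite scalerA; rewrite -scaler_suml.
have -> : \sum_j Q j l * col j (invmx Q) k 0 = (invmx Q *m Q) k l.
  by rewrite mxE; apply: eq_bigr => j _; rewrite mxE mulrC.
by rewrite mulVmx // mxE (negPf kl) scale0r.
Qed.

Lemma diagm_col (Q : mat) w j : Q \in unitmx -> diagm Q w *m col j (invmx Q) = w j *: col j (invmx Q).
Proof.
move=> uQ; rewrite !colE mulmxA /diagm mulmxK // -mulmxA scalemxAr; congr (_ *m _).
rewrite mul_diag_mx; apply/colP => i; rewrite !mxE.
by case: eqVneq => [->|]; rewrite ?mulr0.
Qed.

Lemma graded_decomposition (W : zmodType) (GE : W -> poly -> Prop) (Q : mat) (wt : 'I_n.+1 -> W) :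
    Q \in unitmx -> (forall w, GE w 0) -> (forall c, GE 0 c%:MP) ->
    (forall w p q, GE w p -> GE w q -> GE w (p + q)) ->
    (forall w w' p q, GE w p -> GE w' q -> GE (w + w') (p * q)) ->
    (forall i j, GE (wt j) (linform i (col j (invmx Q)))) ->
  forall p, exists (r : seq W) (f : W -> poly),
    [/\ uniq r, forall w, w \in r -> GE w (f w) & p = \sum_(w <- r) f w].
Proof.
move=> uQ G0 GC GD GM GX p.
suff [r [hr ->]] : exists r : seq (W * poly), (forall x, x \in r -> GE x.1 x.2) /\ p = \sum_(x <- r) x.2.
  exists (undup (map fst r)), (fun w => \sum_(x <- r | x.1 == w) x.2); split; first exact: undup_uniq.
    move=> w _; rewrite big_seq_cond; elim/big_ind: _ => //; first exact: GD.
    by move=> x /andP[/hr + /eqP<-].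
  rewrite (exchange_big_dep xpredT) //= big_seq [RHS]big_seq; apply: eq_bigr => x xr.
  have xu : x.1 \in undup (map fst r) by rewrite mem_undup map_f.
  rewrite big_mkcond (bigD1_seq x.1) ?undup_uniq //= eqxx big1 ?addr0 // => w.
  by rewrite eq_sym => /negPf->.
pose dec q := exists r : seq (W * poly), (forall x, x \in r -> GE x.1 x.2) /\ q = \sum_(x <- r) x.2.
rewrite -/(dec p).
have dD q q' : dec q -> dec q' -> dec (q + q').
  move=> [r [hr ->]] [r' [hr' ->]]; exists (r ++ r'); rewrite big_cat; split=> // x.
  by rewrite mem_cat => /orP[/hr|/hr'].
have dG w q : GE w q -> dec q by move=> h; exists [:: (w, q)]; rewrite big_seq1; split=> // x; rewrite inE => /eqP->.
elim/mxpoly_ind: p => [c|i l|q q' hq hq'|q q' [r [hr ->]] [r' [hr' ->]]].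
- exact: dG (GC c).
- rewrite (xvar_linform i l uQ); elim/big_ind: _ => [||j _].
  + exact: dG (G0 0).
  + exact: dD.
  + by apply: dG (0 + wt j) _ _; rewrite -mul_mpolyC; apply: GM.
- exact: dD.
- exists [seq (x.1 + y.1, x.2 * y.2) | x <- r, y <- r']; split.
    by move=> z /allpairsP[[x y] [/hr hx /hr' hy ->]]; apply: GM.
  by rewrite big_allpairs_dep /= mulr_suml; apply: eq_bigr => x _; rewrite mulr_sumr.
Qed.

End GradedDecomposition.

Section Components.
Variables (F : fieldType) (V : lmodType F) (T : V -> V) (I : V -> Prop).
Hypotheses (TD : forall u v, T (u + v) = T u + T v) (TZ : forall a v, T (a *: v) = a *: T v).
Hypotheses (I_0 : I 0) (I_D : forall u v, I u -> I v -> I (u + v)) (I_Z : forall a v, I v -> I (a *: v)).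
Hypothesis I_stable : forall v, I v -> I (T v).

Definition shift (a : F) (v : V) := T v - a *: v.

Lemma shiftD a u v : shift a (u + v) = shift a u + shift a v.
Proof. by rewrite /shift TD scalerDr opprD addrACA. Qed.

Lemma shiftZ a c u : shift a (c *: u) = c *: shift a u.
Proof. by rewrite /shift TZ scalerBr !scalerA mulrC. Qed.

Lemma shift0 a : shift a 0 = 0.
Proof. by rewrite -[0](scale0r 0) shiftZ !scale0r. Qed.

Lemma shiftC a b v : shift a (shift b v) = shift b (shift a v).
Proof.
have TB x y : T (x - y) = T x - T y by rewrite -scaleN1r TD TZ scaleN1r.
rewrite /shift !TB !TZ !scalerBr !scalerA (mulrC a b) !opprB addrACA [RHS]addrACA.
by congr (_ + _); apply: addrC.
Qed.

Lemma iter_shiftC a b k v : iter k (shift a) (shift b v) = shift b (iter k (shift a) v).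
Proof. by elim: k => //= k ->; rewrite shiftC. Qed.

Lemma iter_shift0 a k : iter k (shift a) 0 = 0.
Proof. by elim: k => //= k ->; rewrite shift0. Qed.

Lemma iter_shiftD a k u v : iter k (shift a) (u + v) = iter k (shift a) u + iter k (shift a) v.
Proof. by elim: k => //= k ->; rewrite shiftD. Qed.

Lemma iter_iter_shift a b k l v : iter k (shift a) (iter l (shift b) v) = iter l (shift b) (iter k (shift a) v).
Proof. by elim: l v => //= l IH v; rewrite iter_shiftC IH. Qed.

Lemma shift_stable a v : I v -> I (shift a v).
Proof. by move=> Iv; rewrite /shift -scaleNr; apply: I_D; [apply: I_stable | apply: I_Z]. Qed.

Lemma shift_coprime a b k l v : a != b ->
  I (iter k (shift a) v) -> I (iter l (shift b) v) -> I v.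
Proof.
move=> ab; move Ed : (k + l)%N => d; elim: d k l v Ed => [|d IH] [|k] [|l] v //= Ed Ha Hb.
rewrite -!iterS !iterSr in Ha Hb.
have Ia : I (shift a v).
  apply: (IH k l.+1) => //; first by lia.
  by rewrite iter_shiftC iterSr; apply: shift_stable.
have Ib : I (shift b v).
  apply: (IH k.+1 l) => //; first by lia.
  by rewrite iter_shiftC iterSr; apply: shift_stable.
have -> : v = (b - a)^-1 *: (shift a v + (-1) *: shift b v).
  rewrite /shift scaleN1r opprB [X in _ *: X]addrC addrA subrK -scalerBl scalerA mulVf ?scale1r //.
  by rewrite subr_eq0 eq_sym.
by apply: I_Z; apply: I_D => //; apply: I_Z.
Qed.

(** Powers of [T - a] and [T - b] with distinct [a], [b] together recover a vector, so generalized
    eigencomponents can be separated inside a stable subspace. No finiteness is assumed, as the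
    ambient space is often a polynomial ring. *)
Lemma component_mem (W : eqType) (r : seq W) (mu : W -> F) (f : W -> V) :
    uniq r -> {in r &, injective mu} -> (forall w, w \in r -> exists k, iter k (shift (mu w)) (f w) = 0) ->
  I (\sum_(w <- r) f w) -> forall w, w \in r -> I (f w).
Proof.
elim: r f => // w0 r IH f /= /andP[w0r ur] inj kill; rewrite big_cons => Is.
have [k0 k0E] := kill w0 (mem_head _ _).
have hr w : w \in r -> w \in w0 :: r by move=> wr; rewrite inE wr orbT.
have Ir w : w \in r -> I (f w).
  move=> wr; have [l lE] := kill w (hr w wr).
  apply: (@shift_coprime (mu w0) (mu w) k0 l); rewrite ?lE //.
    apply: contraNneq w0r => /(inj _ _ (mem_head _ _) (hr w wr)) -> //.
  apply: (IH (fun w => iter k0 (shift (mu w0)) (f w))) wr => //.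
  - by move=> x y xr yr; apply: inj; apply: hr.
  - move=> x xr; have [m mE] := kill x (hr x xr); exists m.
    by rewrite iter_iter_shift mE iter_shift0.
  - have -> : \sum_(w <- r) iter k0 (shift (mu w0)) (f w) = iter k0 (shift (mu w0)) (f w0 + \sum_(w <- r) f w).
      rewrite iter_shiftD k0E add0r.
      by apply/esym; apply: (big_morph _ (iter_shiftD (mu w0) k0) (iter_shift0 _ _)).
    by elim: k0 {k0E} => //= k; apply: shift_stable.
move=> w; rewrite inE => /orP[/eqP->|]; last exact: Ir.
rewrite -[f w0](addrK (\sum_(w <- r) f w)) -scaleN1r; apply: I_D => //; apply: I_Z.
by rewrite big_seq; elim/big_ind: _.
Qed.

End Components.

Section Replicas.
Variables (F : closedFieldType) (n : nat).
Hypothesis F0 : char0 F.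
Local Notation N := (n.+1 * n.+1)%N.
Local Notation poly := {mpoly F[N]}.
Local Notation mat := 'M[F]_n.+1.

Lemma vanish_components (K : set mat) (X : mat) (W : eqType) (r : seq W) (mu : W -> F) (f : W -> poly) :
    subgroup K -> X \in lie K -> uniq r -> {in r &, injective mu} ->
    (forall w, w \in r -> exists k, iter k (shift (@ider F n X) (mu w)) (f w) = 0) ->
  vanish K (\sum_(w <- r) f w) -> forall w, w \in r -> vanish K (f w).
Proof.
move=> sK hX; have [V0 VD VM] := vanish_ideal K; apply: component_mem => //.
- exact: iderD.
- exact: iderZ.
- by move=> a v; rewrite -mul_mpolyC; apply: VM.
- by move=> v; apply: lie_vanish.
Qed.

Lemma iter_shift_mul (X : mat) (a b : F) k l (p q : poly) :
  iter k (shift (@ider F n X) a) p = 0 -> iter l (shift (@ider F n X) b) q = 0 ->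
  iter (k + l) (shift (@ider F n X) (a + b)) (p * q) = 0.
Proof.
have S0 c d : iter d (shift (@ider F n X) c) 0 = 0 by apply: iter_shift0; exact: iderZ.
move Ed : (k + l)%N => d; elim: d k l p q Ed => [|d IH] [|k] [|l] p q //=.
- by move=> _ ->; rewrite mul0r.
- by move=> _ -> _; rewrite mul0r -iterS S0.
- by move=> _ _ ->; rewrite mulr0 -iterS S0.
move=> Ed; rewrite -!iterS !iterSr => hp hq.
have -> : shift (@ider F n X) (a + b) (p * q) = shift (@ider F n X) a p * q + p * shift (@ider F n X) b q.
  rewrite /shift iderM mulrBl mulrBr scalerDl opprD addrACA; congr (_ - _ + (_ - _)).
    by rewrite scalerAl.
  by rewrite scalerAr.
rewrite iter_shiftD; last exact: iderD.
have E1 : iter d (shift (@ider F n X) (a + b)) (shift (@ider F n X) a p * q) = 0.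
  by apply: (IH k l.+1) => //; [lia | rewrite iterSr].
have E2 : iter d (shift (@ider F n X) (a + b)) (p * shift (@ider F n X) b q) = 0.
  by apply: (IH k.+1 l) => //; [lia | rewrite iterSr].
by rewrite E1 E2 addr0.
Qed.

(** Chevalley's replicas. Expanding the eigenvalues of the semisimple part in a family [c]
    independent over the integers splits it into integral diagonal matrices. On polynomials of
    weight [v], [ider X] has the generalized eigenvalue [\sum_j v_j c_j], and these differ for
    different [v]. So the components of a function vanishing on [K] vanish on [K], and each replica
    merely scales them. *)
Theorem replicas (X : mat) : exists m (c : 'I_m -> F) (Q : mat) (a : 'I_m -> 'I_n.+1 -> int),
  [/\ Q \in unitmx, forall z : 'I_m -> int, \sum_j (z j)%:~R * c j = 0 -> forall j, z j = 0,
      forall j, exists q, diagm Q (fun i => (a j i)%:~R) = horner_mx X q,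
      exists k, (X - \sum_j c j *: diagm Q (fun i => (a j i)%:~R)) ^+ k = 0 &
      forall K, subgroup K -> X \in lie K -> forall j, diagm Q (fun i => (a j i)%:~R) \in lie K].
Proof.
have [S [q [SE [Q uQ [w Sw]] [k nil]]]] := jordan_decomposition X.
have [m [c [free sp]]] := integral_span (codom w) F0.
have /choice[a aE] i : exists a : 'I_m -> int, w i = \sum_j (a j)%:~R * c j by apply: sp; apply: codom_f.
have SY : \sum_j c j *: diagm Q (fun i => (a i j)%:~R) = S.
  rewrite Sw diagm_comb; congr diagm; apply: funext => i; rewrite aE.
  by apply: eq_bigr => j _; rewrite mulrC.
exists m, c, Q, (fun j i => a i j); split => //.
- move=> j; have [|p ->] := @diagm_poly _ _ Q w (fun i => (a i j)%:~R) uQ.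
    move=> i i' wi; congr (_%:~R); apply/eqP; rewrite -subr_eq0; apply/eqP.
    apply: (free (fun j => a i j - a i' j)).
    under eq_bigr do rewrite rmorphB mulrBl; by rewrite sumrB -!aE wi subrr.
  exists (p \Po q); rewrite -Sw SE.
  elim/poly_ind: (p) => [|p' c' IH]; first by rewrite comp_poly0 !rmorph0.
  by rewrite comp_poly_MXaddC !rmorphD !rmorphM /= IH horner_mx_X !horner_mx_C.
- by exists k; rewrite SY.
move=> K sK hX j0; apply/lieP => p hp.
pose GE (v : 'rV[int]_m) p := (exists k, iter k (shift (@ider F n X) (\sum_j (v 0 j)%:~R * c j)) p = 0) /\
  forall j, ider (diagm Q (fun i => (a i j)%:~R)) p = (v 0 j)%:~R *: p.
have S0 b d : iter d (shift (@ider F n X) b) 0 = 0 by apply: iter_shift0; exact: iderZ.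
have muD (v v' : 'rV[int]_m) : \sum_j ((v + v') 0 j)%:~R * c j = \sum_j (v 0 j)%:~R * c j + \sum_j (v' 0 j)%:~R * c j.
  by rewrite -big_split; apply: eq_bigr => j _; rewrite mxE rmorphD mulrDl.
have [|||||r [f [ur hf pE]]] := @graded_decomposition F n _ GE Q (fun i => \row_j a i j) uQ _ _ _ _ _ p.
- by move=> v; split=> [|j]; [exists 0%N | rewrite ider0 scaler0].
- move=> b; split=> [|j]; last by rewrite iderC mxE scale0r.
  by exists 1%N; rewrite /= /shift iderC sub0r big1 ?scale0r ?oppr0 // => j _; rewrite mxE mul0r.
- move=> v p1 p2 [[k1 h1] e1] [[k2 h2] e2]; split=> [|j]; last by rewrite iderD e1 e2 scalerDr.
  exists (k1 + k2)%N; rewrite iter_shiftD; last exact: iderD.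
  by rewrite {1}addnC !iterD h1 h2 !S0 addr0.
- move=> v v' p1 p2 [[k1 h1] e1] [[k2 h2] e2]; split=> [|j].
    by exists (k1 + k2)%N; rewrite muD; apply: iter_shift_mul.
  by rewrite iderM e1 e2 mxE rmorphD scalerDl scalerAl scalerAr.
- move=> i j; split=> [|l]; last by rewrite ider_linform diagm_col // linformZ mxE.
  exists k; set b := \sum_ _ _; have bE : b = w j.
    by rewrite /b aE; apply: eq_bigr => l _; rewrite mxE.
  have com : S *m (X - S) = (X - S) *m S.
    have : GRing.comm X S by rewrite SE; apply: comm_mx_horner.
    by move=> E; rewrite mulmxBl mulmxBr; congr (_ - _); apply: esym E.
  have E l : iter l (shift (@ider F n X) b) (linform i (col j (invmx Q))) = linform i ((X - S) ^+ l *m col j (invmx Q)).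
    elim: l => [|l IH]; first by rewrite expr0 mul1mx.
    rewrite iterS IH /shift ider_linform -linformZ -linformB; congr linform.
    have Sl : S *m ((X - S) ^+ l *m col j (invmx Q)) = b *: ((X - S) ^+ l *m col j (invmx Q)).
      rewrite mulmxA; have -> : S *m (X - S) ^+ l = (X - S) ^+ l *m S.
        by apply: (commrX l (x := S) (y := X - S)).
      by rewrite -mulmxA {2}Sw diagm_col // bE scalemxAr.
    by rewrite -Sl -mulmxBl mulmxA exprS.
  by rewrite E nil mul0mx linform0.
have inj : {in r &, injective (fun v : 'rV[int]_m => \sum_j (v 0 j)%:~R * c j)}.
  move=> v v' _ _ E; apply/rowP => j; apply/eqP; rewrite -subr_eq0; apply/eqP.
  apply: (free (fun j => v 0 j - v' 0 j)).
  by under eq_bigr do rewrite rmorphB mulrBl; rewrite sumrB E subrr.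
have hv : forall v, v \in r -> vanish K (f v).
  by apply: (vanish_components sK hX ur inj) => [v /hf[]//|]; rewrite -pE.
rewrite pE ider_sum mxeval_sum big_seq big1 // => v vr.
by have [_ ->] := hf v vr; rewrite mxevalZ (hv v vr _ (subgroup_one sK)) mulr0.
Qed.

(** The one-parameter multiplicative subgroup with integer weights [w] in the eigenbasis given by
    [Q]; its tangent vector at [z = 1] is the diagonal matrix of the [w i]. *)
Definition psg (Q : mat) (w : 'I_n.+1 -> int) (z : F) : mat := diagm Q (fun i => z ^ w i).

Lemma psg_mem (K : set mat) Q w z : closed_subgroup K -> Q \in unitmx -> z != 0 ->
  diagm Q (fun i => (w i)%:~R) \in lie K -> K (psg Q w z).
Proof.
move=> [sK [Z [S ZE] KE]] uQ z0 hY; rewrite KE; split.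
  have : psg Q w z *m psg Q w z^-1 = 1%:M.
    rewrite diagm_mul // -(diagm_const 1 uQ); congr diagm; apply: funext => i.
    by rewrite -expfzMl mulfV // exp1rz.
  by move/mulmx1_unit => [].
rewrite ZE => p Sp.
have hp : vanish K p by move=> B; rewrite KE ZE => -[_]; apply.
pose GE (v : int) (p : poly) := ider (diagm Q (fun i => (w i)%:~R)) p = v%:~R *: p /\
  forall A, mxeval p (A *m psg Q w z) = z ^ v * mxeval p A.
have [|||||r [f [ur hf pE]]] := @graded_decomposition F n _ GE Q w uQ _ _ _ _ _ p.
- by move=> v; split=> [|A]; rewrite ?ider0 ?scaler0 // !mxeval0 mulr0.
- by move=> b; split=> [|A]; rewrite ?iderC ?scale0r // !mxevalC expr0z mul1r.
- by move=> v p1 p2 [e1 h1] [e2 h2]; split=> [|A]; rewrite ?iderD ?e1 ?e2 ?scalerDr // !mxevalD h1 h2 mulrDr.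
- move=> v v' p1 p2 [e1 h1] [e2 h2]; split=> [|A].
    by rewrite iderM e1 e2 rmorphD scalerDl scalerAl scalerAr.
  by rewrite !mxevalM h1 h2 expfzDr // mulrACA.
- move=> i j; split=> [|A]; first by rewrite ider_linform diagm_col // linformZ.
  by rewrite !mxeval_linform -mulmxA diagm_col // -scalemxAr mxE.
have hv : forall v, v \in r -> vanish K (f v).
  apply: (vanish_components sK hY ur (mu := fun v => v%:~R)).
  - by move=> v v' _ _; apply: char0_intr_inj.
  - by move=> v vr; exists 1%N; have [e _] := hf v vr; rewrite /= /shift e subrr.
  - by rewrite -pE.
rewrite pE mxeval_sum big_seq big1 // => v vr; have [_ h] := hf v vr.
by rewrite -[psg _ _ _]mul1mx h (hv v vr _ (subgroup_one sK)) mulr0.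
Qed.

End Replicas.

Lemma sum_ord_cut (V : nmodType) a b (f : nat -> V) :
  (forall k, (minn a b <= k)%N -> f k = 0) -> \sum_(k < a) f k = \sum_(k < b) f k.
Proof.
wlog ab : a b / (a <= b)%N => [W H|].
  by have [/W|/ltnW/W E] := leqP a b; [apply | rewrite E // minnC].
rewrite (minn_idPl ab) => H; rewrite -(subnKC ab) big_split_ord /= [X in _ = _ + X]big1 ?addr0 // => i _.
by apply: H; apply: leq_addr.
Qed.

(** * Exponentials and generated subgroups *)

Section Exponential.
Variables (F : closedFieldType) (n : nat).
Hypothesis F0 : char0 F.
Local Notation N := (n.+1 * n.+1)%N.
Local Notation poly := {mpoly F[N]}.
Local Notation mat := 'M[F]_n.+1.
Implicit Types (X Y A : mat) (K S : set mat).

Lemma mulrn_eq0_char0 (x : F) k : (x *+ k == 0) = (k == 0%N) || (x == 0).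
Proof. by rewrite -mulr_natr mulf_eq0 F0 orbC. Qed.

Definition nilmx X := exists k, X ^+ k = 0.

Lemma nilmx_char X : nilmx X -> char_poly X = ('X : {poly F}) ^+ n.+1.
Proof.
move=> [k Xk]; have [rs char] := closed_field_poly_normal (char_poly X).
rewrite (monicP (char_poly_monic X)) scale1r in char.
have szr : size rs = n.+1.
  by have := size_char_poly X; rewrite char size_prod_XsubC => -[].
have rs0 : all (pred1 0) rs.
  apply/allP => x xr; have /eigenvalueP[v vX v0] : eigenvalue X x.
    by rewrite eigenvalue_root_char char root_prod_XsubC.
  have : v *m X ^+ k = x ^+ k *: v.
    elim: (k) => [|j IH]; first by rewrite expr0 mulmx1 scale1r.
    by rewrite exprSr mulmxA IH -scalemxAl vX scalerA -exprSr.
  rewrite Xk mulmx0 => /esym/eqP; rewrite scaler_eq0 (negPf v0) orbF expf_eq0.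
  by case/andP.
rewrite char -szr; elim: (rs) rs0 => [|x s IH] /=; first by rewrite big_nil expr0.
by move=> /andP[/eqP-> /IH]; rewrite big_cons subr0 exprS => ->.
Qed.

Lemma nilmx_pow X : nilmx X -> X ^+ n.+1 = 0.
Proof.
by move=> /nilmx_char nX; have := Cayley_Hamilton X; rewrite nX rmorphXn /= horner_mx_X.
Qed.

(** For nilpotent [X] this is the full exponential series, since its [n.+1]-th power vanishes; it is
    kept as a matrix of polynomials so that it can be differentiated formally. *)
Definition ecurve X : 'M[{poly F}]_n.+1 :=
  \sum_(k < n.+1) ((k`!)%:R^-1 *: 'X^k) *: map_mx polyC (X ^+ k).

Definition expm X (s : F) : mat := curve (ecurve X) s.

Lemma expmE X s : expm X s = \sum_(k < n.+1) ((k`!)%:R^-1 * s ^+ k) *: X ^+ k.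
Proof.
apply/matrixP => i j; rewrite mxE /horner_eval !summxE horner_sum.
by apply: eq_bigr => k _; rewrite !mxE !hornerE.
Qed.

Lemma expm0 X : expm X 0 = 1%:M.
Proof.
rewrite expmE big_ord_recl big1 ?addr0 => [|k _]; last by rewrite exprS mul0r mulr0 scale0r.
by rewrite expr0 fact0 invr1 mulr1 scale1r expr0.
Qed.

Lemma ecurve_flow X : nilmx X -> map_mx (@deriv F) (ecurve X) = ecurve X *m map_mx polyC X.
Proof.
move=> /nilmx_pow Xn; apply/matrixP => i j.
have -> : map_mx (@deriv F) (ecurve X) i j =
    \sum_(k < n.+1) ((k`!)%:R^-1 *: ('X^k)^`()) * ((X ^+ k) i j)%:P.
  rewrite mxE summxE raddf_sum; apply: eq_bigr => k _ /=.
  by rewrite !mxE derivM derivZ derivC mulr0 addr0.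
rewrite big_ord_recl expr0 derivC scaler0 mul0r add0r.
rewrite /ecurve mulmx_suml summxE big_ord_recr /= -scalemxAl -map_mxM -[_ *m X]exprSr Xn.
rewrite [map_mx _ 0](_ : _ = 0) ?scaler0 ?mxE ?addr0; last by apply/matrixP => a b; rewrite !mxE.
apply: eq_bigr => k _; rewrite -scalemxAl -map_mxM -[_ *m X]exprSr !mxE; congr (_ * _).
rewrite derivXn /= -scaler_nat scalerA; congr (_ *: _).
have k0 : k.+1%:R != 0 :> F by rewrite F0.
by rewrite /bump /= add1n factS natrM invfM mulrAC mulVf // mul1r.
Qed.

Lemma polyeval_taylor p X c : map_mx (@deriv F) c = c *m map_mx polyC X ->
  (forall k, mxeval (iter k (@ider F n X) p) (curve c 0) = 0) -> forall s, mxeval p (curve c s) = 0.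
Proof.
move=> cX H s; rewrite -horner_polyeval.
suff -> : polyeval p c = 0 by rewrite horner0.
have D k : (polyeval p c)^`(k) = polyeval (iter k (@ider F n X) p) c.
  by elim: k => [//|k IH]; rewrite derivnS IH (deriv_polyeval_flow _ _ cX).
apply/polyP => k; rewrite coef0; apply/eqP.
have := coef_derivn k (polyeval p c) 0; rewrite addn0 D ffactnn -horner_coef0 horner_polyeval H.
by move/esym/eqP; rewrite mulrn_eq0_char0 => /orP[|//]; rewrite -leqn0 leqNgt fact_gt0.
Qed.

Lemma curve_mulmx (c d : 'M[{poly F}]_n.+1) s : curve (c *m d) s = curve c s *m curve d s.
Proof. exact: map_mxM. Qed.

Lemma curve_const A s : curve (map_mx polyC A) s = A.
Proof. by apply/matrixP => i j; rewrite !mxE /horner_eval hornerC. Qed.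

Lemma curve_deriv_at (c : 'M[{poly F}]_n.+1) X s : map_mx (@deriv F) c = c *m map_mx polyC X ->
  curve (map_mx (@deriv F) c) s = curve c s *m X.
Proof. by move=> ->; rewrite curve_mulmx curve_const. Qed.

Lemma flow_unique (c : 'M[{poly F}]_n.+1) X : map_mx (@deriv F) c = c *m map_mx polyC X ->
  curve c 0 = 0 -> c = 0.
Proof.
move=> cX c0; have D k : map_mx (fun p => p^`(k)) c = c *m map_mx polyC (X ^+ k).
  elim: k => [|k IH]; first by rewrite expr0 map_mx1 mulmx1; apply/matrixP => i j; rewrite mxE.
  have -> : map_mx (fun p => p^`(k.+1)) c = map_mx (@deriv F) (map_mx (fun p => p^`(k)) c).
    by apply/matrixP => i j; rewrite !mxE derivnS.
  rewrite IH; transitivity (map_mx (@deriv F) c *m map_mx polyC (X ^+ k)).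
    apply/matrixP => i j; rewrite !mxE raddf_sum; apply: eq_bigr => l _ /=.
    by rewrite !mxE derivM derivC mulr0 addr0.
  by rewrite cX -mulmxA -map_mxM exprS.
apply/matrixP => i j; apply/polyP => k; rewrite mxE coef0; apply/eqP.
have := coef_derivn k (c i j) 0; rewrite addn0 ffactnn -horner_coef0.
have /matrixP/(_ i j) := D k; rewrite mxE => ->.
have -> : ((c *m map_mx polyC (X ^+ k)) i j).[0] = (curve c 0 *m X ^+ k) i j.
  by rewrite -[in RHS](curve_const (X ^+ k) 0) -curve_mulmx [RHS]mxE.
rewrite c0 mul0mx mxE => /esym/eqP; rewrite mulrn_eq0_char0.
by case/orP => //; rewrite -leqn0 leqNgt fact_gt0.
Qed.

(** As functions of [s], both sides solve the same linear differential equation with the same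
    initial value. *)
Lemma expmD X s t : nilmx X -> expm X t *m expm X s = expm X (t + s).
Proof.
move=> nX; have fl := ecurve_flow nX.
pose c1 := map_mx polyC (expm X t) *m ecurve X.
pose c2 : 'M[{poly F}]_n.+1 := map_mx (fun p => p \Po ('X + t%:P)) (ecurve X).
have c2E u : curve c2 u = expm X (t + u).
  apply/matrixP => i j; rewrite !mxE /horner_eval horner_comp !hornerE addrC.
  by [].
have : c1 - c2 = 0.
  apply: (@flow_unique _ X); last first.
    rewrite /curve map_mxB -!/(curve _ _) c2E addr0 /c1 curve_mulmx curve_const -/(expm X 0) expm0 mulmx1.
    by rewrite subrr.
  have D1 : map_mx (@deriv F) c1 = c1 *m map_mx polyC X.
    rewrite /c1 -mulmxA -fl; apply/matrixP => i j; rewrite !mxE raddf_sum; apply: eq_bigr => l _ /=.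
    by rewrite !mxE derivM derivC mul0r add0r.
  have D2 : map_mx (@deriv F) c2 = c2 *m map_mx polyC X.
    apply/matrixP => i j; rewrite !mxE deriv_comp derivD derivX derivC addr0 mulr1.
    have /matrixP/(_ i j) := fl; rewrite !mxE => ->; rewrite raddf_sum; apply: eq_bigr => l _ /=.
    by rewrite !mxE rmorphM /= comp_polyC.
  by rewrite map_mxB D1 D2 mulmxBl.
move/eqP; rewrite subr_eq0 => /eqP cc.
by rewrite -c2E -cc curve_mulmx curve_const.
Qed.

Lemma expmV X s : nilmx X -> expm X s *m expm X (- s) = 1%:M.
Proof. by move=> nX; rewrite expmD // subrr expm0. Qed.

Lemma expm_unit X s : nilmx X -> expm X s \in unitmx.
Proof. by move=> nX; have [] := mulmx1_unit (expmV s nX). Qed.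

Lemma invmx_expm X s : nilmx X -> invmx (expm X s) = expm X (- s).
Proof.
by move=> nX; rewrite -[RHS](mulKmx (expm_unit s nX)) expmV // mulmx1.
Qed.

Lemma expm_mem K X s : closed_subgroup K -> nilmx X -> X \in lie K -> K (expm X s).
Proof.
move=> [sK [Z [T ZE] KE]] nX hX; rewrite KE; split; first exact: expm_unit.
rewrite ZE => p Tp; apply: (polyeval_taylor (ecurve_flow nX)) => k.
rewrite -[curve _ 0]/(expm X 0) expm0.
have hp : vanish K p by move=> B; rewrite KE ZE => -[_]; apply.
suff : vanish K (iter k (@ider F n X) p) by apply; apply: subgroup_one.
by elim: k => //= k; apply: lie_vanish.
Qed.

(* The polynomial curve s |-> X^s through the powers of a unipotent matrix. *)
Definition ucurve X : 'M[{poly F}]_n.+1 :=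
  \sum_(k < n.+1) ((k`!)%:R^-1 *: \prod_(i < k) ('X - i%:R%:P)) *: map_mx polyC ((X - 1%:M) ^+ k).

Lemma ucurveE X s : curve (ucurve X) s =
  \sum_(k < n.+1) ((k`!)%:R^-1 * \prod_(i < k) (s - i%:R)) *: (X - 1%:M) ^+ k.
Proof.
apply/matrixP => i j; rewrite mxE /horner_eval !summxE horner_sum.
apply: eq_bigr => k _; rewrite !mxE !hornerE horner_prod; congr (_ * _ * _).
by apply: eq_bigr => l _; rewrite !hornerE.
Qed.

Lemma ucurve_nat X m : nilmx (X - 1%:M) -> curve (ucurve X) m%:R = X ^+ m.
Proof.
move=> /nilmx_pow nX; rewrite ucurveE.
have bin k : (k`!)%:R^-1 * \prod_(i < k) (m%:R - i%:R) = 'C(m, k)%:R :> F.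
  have k0 : (k`!)%:R != 0 :> F by rewrite F0 -lt0n fact_gt0.
  apply: (mulfI k0); rewrite mulVKf // -natrM mulnC bin_ffact.
  elim: k {k0} => [|k IH]; first by rewrite big_ord0 ffactn0.
  rewrite big_ord_recr /= IH ffactnSr natrM; have [km|mk] := leqP k m; first by rewrite natrB.
  by rewrite ffact_small // !mul0r.
under eq_bigr do rewrite bin.
have -> : X ^+ m = (1 + (X - 1%:M)) ^+ m by rewrite -[1%:M]/1 addrC subrK.
rewrite exprDn_comm; last by apply: commr_sym; apply: commr1.
under [RHS]eq_bigr do rewrite expr1n mul1r -scaler_nat.
apply: (@sum_ord_cut _ n.+1 m.+1 (fun k => 'C(m, k)%:R *: (X - 1%:M) ^+ k)) => k.
rewrite geq_min => /orP[nk|mk]; last by rewrite bin_small // scale0r.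
by rewrite -(subnK nk) exprD nX mulr0 scaler0.
Qed.

Lemma curve_sub_lie S (c : 'M[{poly F}]_n.+1) X : (forall s, S (curve c s)) ->
  curve c 0 = 1%:M -> curve (map_mx (@deriv F) c) 0 = X -> X \in lie S.
Proof.
move=> cS c0 cX; apply/lieP => p hp; rewrite -c0 -(@deriv_polyeval_at _ _ p c 0 X).
  rewrite (_ : polyeval p c = 0) ?deriv0 ?horner0 //; apply: poly_eq0_char0 => // s.
  by rewrite horner_polyeval; apply: hp.
by rewrite c0 mul1mx.
Qed.

(** The linear equations of [U] along the curve are polynomials vanishing for all nonzero
    parameters; multiplying by the variable covers the parameter 0, so they vanish identically and
    may be differentiated. *)
Lemma curve_deriv_mem (U : {vspace mat}) (c : 'M[{poly F}]_n.+1) s0 :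
  (forall s, s != 0 -> curve c s \in U) -> curve (map_mx (@deriv F) c) s0 \in U.
Proof.
move=> cU; pose pr (Z : mat) := Z - projv U Z.
have prE (Z : mat) : pr Z = \sum_i \sum_j Z i j *: pr (delta_mx i j).
  rewrite /pr {1 2}(matrix_sum_delta Z) linear_sum -sumrB; apply: eq_bigr => i _.
  rewrite linear_sum -sumrB; apply: eq_bigr => j _.
  by rewrite linearZ scalerBr.
suff : pr (curve (map_mx (@deriv F) c) s0) = 0.
  by move/eqP; rewrite subr_eq0 => /eqP->; apply: memv_proj.
apply/matrixP => a b; rewrite prE summxE [RHS]mxE.
pose q := \sum_i \sum_j (pr (delta_mx i j) a b)%:P * c i j.
have q0 : q = 0.
  suff : 'X * q = 0 by move/eqP; rewrite mulf_eq0 polyX_eq0 => /eqP.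
  apply: poly_eq0_char0 => // s; rewrite hornerM hornerX.
  have [->|s0n] := eqVneq s 0; first by rewrite mul0r.
  suff -> : q.[s] = 0 by rewrite mulr0.
  have := cU s s0n => /projv_id => cs.
  have : pr (curve c s) a b = 0 by rewrite /pr cs subrr mxE.
  rewrite prE summxE => E; rewrite -[RHS]E horner_sum; apply: eq_bigr => i _.
  rewrite horner_sum summxE; apply: eq_bigr => j _.
  by rewrite !mxE hornerM hornerC mulrC.
have := congr1 (fun q => (q^`()).[s0]) q0; rewrite /q deriv0 horner0 => E; rewrite -[RHS]E.
rewrite raddf_sum horner_sum; apply: eq_bigr => i _.
rewrite raddf_sum horner_sum summxE; apply: eq_bigr => j _ /=.
by rewrite !mxE derivM derivC mul0r add0r hornerM hornerC mulrC.
Qed.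

Lemma expm_deriv0 X : nilmx X -> curve (map_mx (@deriv F) (ecurve X)) 0 = X.
Proof.
by move=> nX; rewrite (@curve_deriv_at _ X) ?ecurve_flow // -[curve _ 0]/(expm X 0) expm0 mul1mx.
Qed.

Lemma expm_lie S X : nilmx X -> (forall s, S (expm X s)) -> X \in lie S.
Proof.
move=> nX h; apply: (@curve_sub_lie S (ecurve X)) => //; first exact: expm0.
exact: expm_deriv0.
Qed.

Lemma nilmxN X : nilmx X -> nilmx (- X).
Proof. by move=> [k Xk]; exists k; rewrite exprNn Xk mulr0. Qed.

Lemma Ad_expm_curve X A : nilmx X -> exists c : 'M[{poly F}]_n.+1,
  (forall s, curve c s = expm X s *m A *m invmx (expm X s)) /\
  curve (map_mx (@deriv F) c) 0 = lieb X A.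
Proof.
move=> nX; pose d : 'M[{poly F}]_n.+1 := map_mx (fun p => p \Po (- 'X)) (ecurve X).
have dE s : curve d s = expm X (- s).
  by apply/matrixP => i j; rewrite !mxE /horner_eval horner_comp !hornerE.
have dD : map_mx (@deriv F) d = - (d *m map_mx polyC X).
  apply/matrixP => i j; rewrite !mxE deriv_comp derivN derivX mulrN1; congr (- _).
  have /matrixP/(_ i j) := ecurve_flow nX; rewrite !mxE => ->; rewrite raddf_sum; apply: eq_bigr => l _ /=.
  by rewrite !mxE rmorphM /= comp_polyC.
have deriv_mul (c1 c2 : 'M[{poly F}]_n.+1) : map_mx (@deriv F) (c1 *m c2) =
    map_mx (@deriv F) c1 *m c2 + c1 *m map_mx (@deriv F) c2.
  apply/matrixP => i j; rewrite !mxE raddf_sum -big_split; apply: eq_bigr => l _ /=.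
  by rewrite derivM !mxE.
exists (ecurve X *m map_mx polyC A *m d); split=> [s|].
  by rewrite !curve_mulmx curve_const dE invmx_expm.
rewrite !deriv_mul [map_mx _ (map_mx polyC A)](_ : _ = 0); last first.
  by apply/matrixP => i j; rewrite !mxE derivC.
rewrite mulmx0 addr0 dD (ecurve_flow nX).
have curveD (c1 c2 : 'M[{poly F}]_n.+1) s : curve (c1 + c2) s = curve c1 s + curve c2 s by exact: map_mxD.
have curveN (c1 : 'M[{poly F}]_n.+1) s : curve (- c1) s = - curve c1 s by exact: map_mxN.
rewrite curveD mulmxN curveN !curve_mulmx !curve_const dE -[curve (ecurve X) 0]/(expm X 0) oppr0 expm0.
by rewrite !mul1mx !mulmx1.
Qed.
Lemma nilmx_trace X : nilmx X -> \tr X = 0.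
Proof.
move=> nX; have := char_poly_trace X (ltn0Sn n); rewrite nilmx_char // coefXn /= ltn_eqF //.
by move=> /eqP; rewrite eq_sym oppr_eq0 => /eqP.
Qed.

Lemma nilmx_unit X : nilmx X -> 1%:M + X \in unitmx.
Proof.
move=> [k Xk]; have := subrX1 (- X) k; rewrite exprNn Xk mulr0 sub0r => H.
have : (1%:M + X) *m (\sum_(i < k) (- X) ^+ i) = 1%:M.
  by apply: oppr_inj; rewrite -[RHS]/(-1 : mat) H -[_ *m _]/(_ * _) -mulNr opprD addrC.
by move/mulmx1_unit => [].
Qed.

Lemma nilmx_mulC X Y : nilmx X -> X *m Y = Y *m X -> nilmx (X *m Y).
Proof. by move=> [k Xk] c; exists k; rewrite (exprMn_comm k c) Xk mul0r. Qed.

Lemma comm_sum_pow (c : nat -> F) m X : let M := \sum_(k < m) c k *: X ^+ k in X *m M = M *m X.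
Proof.
move=> M; rewrite /M mulmx_sumr mulmx_suml; apply: eq_bigr => k _.
by rewrite -scalemxAl -scalemxAr -[_ *m X]exprSr -[X *m _]exprS.
Qed.

Lemma ucurve_unit X s : nilmx (X - 1%:M) -> curve (ucurve X) s \in unitmx.
Proof.
move=> nX; rewrite ucurveE big_ord_recl fact0 big_ord0 invr1 mulr1 scale1r expr0; apply: nilmx_unit.
pose c k := (k.+1`!)%:R^-1 * \prod_(i < k.+1) (s - i%:R) : F.
have -> : \sum_(i < n) ((bump 0 i)`!%:R^-1 * \prod_(j < bump 0 i) (s - j%:R)) *: (X - 1%:M) ^+ (bump 0 i) =
    (X - 1%:M) *m \sum_(i < n) c i *: (X - 1%:M) ^+ i.
  by rewrite mulmx_sumr; apply: eq_bigr => i _; rewrite -scalemxAr -[_ *m _]exprS.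
by apply: nilmx_mulC => //; apply: comm_sum_pow.
Qed.
End Exponential.

(** * Regular functions, Zariski closures and generated connected groups *)

Section RegularFunctions.
Variables (F : closedFieldType) (n : nat).
Hypothesis F0 : char0 F.
Local Notation N := (n.+1 * n.+1)%N.
Local Notation poly := {mpoly F[N]}.
Local Notation mat := 'M[F]_n.+1.
Implicit Types (X Y A B Q : mat) (K S : set mat).

Definition regfun (f : mat -> F) := exists k (P : poly),
  forall A, A \in unitmx -> mxeval P A = (\det A) ^+ k * f A.

Lemma det_poly : exists P : poly, forall A, mxeval P A = \det A.
Proof.
exists (\det (xmat F n)) => A; rewrite -[in RHS](map_mx_xmat A).
rewrite /determinant mxeval_sum; apply: eq_bigr => s _.
rewrite -[X in mxeval (X * _)](rmorph_sign (@mpolyC N F)) mxevalM mxevalC; congr (_ * _).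
by rewrite [LHS](big_morph (fun p => mxeval p A) (fun p q => mxevalM p q A) (mxeval1 A));
  apply: eq_bigr => i _; rewrite [RHS]mxE.
Qed.

Lemma regfun_poly p : regfun (mxeval p).
Proof. by exists 0%N, p => A _; rewrite mul1r. Qed.

Lemma regfun_cst c : regfun (fun=> c).
Proof. by exists 0%N, c%:MP => A _; rewrite mxevalC mul1r. Qed.

Lemma regfun_ext f g : (forall A, A \in unitmx -> f A = g A) -> regfun f -> regfun g.
Proof. by move=> fg [k [P hP]]; exists k, P => A uA; rewrite hP // fg. Qed.

Lemma regfunM f g : regfun f -> regfun g -> regfun (fun A => f A * g A).
Proof.
move=> [k [P hP]] [l [Q hQ]]; exists (k + l)%N, (P * Q) => A uA.
by rewrite mxevalM hP // hQ // exprD mulrACA.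
Qed.

Lemma regfunD f g : regfun f -> regfun g -> regfun (fun A => f A + g A).
Proof.
have [D hD] := det_poly.
move=> [k [P hP]] [l [Q hQ]]; exists (k + l)%N, (D ^+ l * P + D ^+ k * Q) => A uA.
by rewrite mxevalD !mxevalM !mxevalX hP // hQ // !hD mulrDr exprD !mulrA [X in X * f A]mulrC.
Qed.

Lemma regfun_sum (I : Type) (r : seq I) (f : I -> mat -> F) :
  (forall i, regfun (f i)) -> regfun (fun A => \sum_(i <- r) f i A).
Proof.
move=> rf; elim: r => [|i r IH]; first by apply: regfun_ext (regfun_cst 0) => A _; rewrite big_nil.
by apply: regfun_ext (regfunD (rf i) IH) => A _; rewrite big_cons.
Qed.

Lemma regfun_prod (I : Type) (r : seq I) (f : I -> mat -> F) :
  (forall i, regfun (f i)) -> regfun (fun A => \prod_(i <- r) f i A).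
Proof.
move=> rf; elim: r => [|i r IH]; first by apply: regfun_ext (regfun_cst 1) => A _; rewrite big_nil.
by apply: regfun_ext (regfunM (rf i) IH) => A _; rewrite big_cons.
Qed.

Definition regmx p q (f : mat -> 'M[F]_(p, q)) := forall i j, regfun (fun A => f A i j).

Lemma regmx_cst p q (M : 'M_(p, q)) : regmx (fun=> M).
Proof. by move=> i j; apply: regfun_cst. Qed.

Lemma regmx_id : regmx (fun A => A).
Proof. by move=> i j; apply: regfun_ext (regfun_poly (xvar F i j)) => A _; rewrite mxeval_xvar. Qed.

Lemma regmx_mul p q r (f : mat -> 'M_(p, q)) (g : mat -> 'M_(q, r)) :
  regmx f -> regmx g -> regmx (fun A => f A *m g A).
Proof.
move=> rf rg i j; apply: (@regfun_ext (fun A => \sum_k f A i k * g A k j)).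
  by move=> A _; rewrite mxE.
by apply: regfun_sum => k; apply: regfunM.
Qed.

Lemma regfun_det p (f : mat -> 'M_p) : regmx f -> regfun (fun A => \det (f A)).
Proof.
move=> rf; apply: regfun_sum => s; apply: regfunM; first exact: regfun_cst.
by apply: regfun_prod => i; apply: rf.
Qed.

Lemma regmx_adj : regmx (fun A => \adj A).
Proof.
move=> i j; apply: (@regfun_ext (fun A => cofactor A j i)); first by move=> A _; rewrite mxE.
apply: regfunM; first exact: regfun_cst.
apply: regfun_det => a b; apply: regfun_ext (@regmx_id (lift j a) (lift i b)) => A _.
by rewrite !mxE.
Qed.

Lemma regmx_inv : regmx (fun A => invmx A).
Proof.
move=> i j; have [k [P hP]] := regmx_adj i j; exists k.+1, P => A uA.
have d0 : \det A != 0 by rewrite unitmxE unitfE in uA.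
by rewrite hP // /invmx uA [X in _ = _ * X]mxE exprSr -mulrA; congr (_ * _); rewrite mulrA mulfV ?mul1r.
Qed.

Lemma regmx_mxeval (f : mat -> mat) p : regmx f -> regfun (fun A => mxeval p (f A)).
Proof.
move=> rf; elim/mxpoly_ind: p => [c|i j|p q hp hq|p q hp hq].
- by apply: regfun_ext (regfun_cst c) => A _; rewrite mxevalC.
- by apply: regfun_ext (rf i j) => A _; rewrite mxeval_xvar.
- by apply: regfun_ext (regfunD hp hq) => A _; rewrite mxevalD.
- by apply: regfun_ext (regfunM hp hq) => A _; rewrite mxevalM.
Qed.

Definition zcl S : set mat := fun A => A \in unitmx /\ forall p, vanish S p -> mxeval p A = 0.

Lemma zcl_sub S : (forall A, S A -> A \in unitmx) -> forall A, S A -> zcl S A.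
Proof. by move=> uS A SA; split=> [|p hp]; [apply: uS | apply: hp]. Qed.

Lemma vanish_zcl S p : vanish S p -> vanish (zcl S) p.
Proof. by move=> hp A [_]; apply. Qed.

Lemma lie_zcl S : (forall A, S A -> A \in unitmx) -> lie (zcl S) = lie S.
Proof.
move=> uS; apply/vspaceP => X; apply/idP/idP => /lieP H; apply/lieP => p hp; apply: H.
  exact: vanish_zcl.
by move=> A SA; apply: hp; apply: zcl_sub.
Qed.

Lemma regfun_zcl S f : (forall A, S A -> A \in unitmx) -> regfun f ->
  (forall A, S A -> f A = 0) -> forall A, zcl S A -> f A = 0.
Proof.
move=> uS [k [P hP]] fS A [uA hA].
have : mxeval P A = 0 by apply: hA => B SB; rewrite hP ?uS // fS ?mulr0.
move/eqP; rewrite hP // mulf_eq0 expf_eq0; case/orP => [/andP[_]|/eqP//].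
by move: uA; rewrite unitmxE unitfE => /negPf->.
Qed.

Lemma zcl_image S T (f : mat -> mat) : (forall A, S A -> A \in unitmx) -> regmx f ->
  (forall A, A \in unitmx -> f A \in unitmx) -> (forall A, S A -> zcl T (f A)) ->
  forall A, zcl S A -> zcl T (f A).
Proof.
move=> uS rf uf fS A SA; split=> [|p hp]; first by apply: uf; case: SA.
by apply: (regfun_zcl uS (regmx_mxeval p rf)) SA => B /fS[_]; apply.
Qed.

Lemma zcl_min S K : closed_subgroup K -> (forall A, S A -> K A) -> forall A, zcl S A -> K A.
Proof.
move=> [sK [Z [T ZE] KE]] SK A [uA hA]; rewrite KE; split=> //; rewrite ZE => p Tp; apply: hA => B /SK.
by rewrite KE ZE => -[_]; apply.
Qed.

Lemma zcl_zclosed S Z : zclosed Z -> (forall A, S A -> Z A) -> forall A, zcl S A -> Z A.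
Proof. by move=> [T ZE] SZ A [_ hA]; rewrite ZE => p Tp; apply: hA => B /SZ; rewrite ZE; apply. Qed.

(** Multiplication is handled one variable at a time: first with a factor from [S] fixed, then with
    a factor from the closure fixed. *)
Lemma zcl_subgroup S : subgroup S -> closed_subgroup (zcl S).
Proof.
move=> sS; have uS := subgroup_unit sS.
split; last first.
  exists (fun A => forall p, vanish S p -> mxeval p A = 0) => //.
  by exists (fun p => vanish S p).
split.
- by move=> A [].
- by apply: zcl_sub => //; apply: subgroup_one.
- move=> A B hA hB; have [uA _] := hA.
  apply: (@zcl_image S S (fun B => A *m B)) hB => //.
  + exact: regmx_mul (regmx_cst A) regmx_id.
  + by move=> C uC; rewrite unitmx_mul uA.
  move=> C SC; have uC := uS C SC.
  apply: (@zcl_image S S (fun A => A *m C)) hA => //.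
  + exact: regmx_mul regmx_id (regmx_cst C).
  + by move=> D uD; rewrite unitmx_mul uD.
  by move=> D SD; apply: zcl_sub => //; apply: subgroup_mul.
- move=> A hA; apply: (@zcl_image S S (fun A => invmx A)) hA => //.
  + exact: regmx_inv.
  + by move=> C uC; rewrite unitmx_inv.
  by move=> C SC; apply: zcl_sub => //; apply: subgroup_inv.
Qed.

Lemma generated_subgroup S : (forall A, S A -> A \in unitmx) -> subgroup (generated S).
Proof.
move=> uS; have unit_sub : subgroup (fun A : mat => A \in unitmx).
  split=> //; first exact: unitmx1.
    by move=> A B uA uB; rewrite unitmx_mul uA.
  by move=> A uA; rewrite unitmx_inv.
split.
- by move=> A /(_ _ unit_sub); apply.
- by move=> K sK _; apply: subgroup_one.
- by move=> A B hA hB K sK SK; apply: subgroup_mul => //; [apply: hA | apply: hB].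
- by move=> A hA K sK SK; apply: subgroup_inv => //; apply: hA.
Qed.

Lemma generated_mem S A : S A -> generated S A.
Proof. by move=> SA K _; apply. Qed.

Lemma zclosed_preim Z B : zclosed Z -> zclosed (fun A => Z (B *m A)).
Proof.
move=> [T ->]; exists (fun q => exists2 p, T p & q = lmove B p).
apply/seteqP; split=> A H p.
  by case=> q Tq ->; rewrite mxeval_lmove; apply: H.
by move=> Tp; rewrite -mxeval_lmove; apply: H; exists p.
Qed.

(** Suppose that two closed sets split the closure, with [1] in [Z1]. The elements whose right
    translation preserves [Z1] contain every [C i], because the translate of a connected set stays
    on one side. They form a subgroup, which therefore contains the generated group; so [Z1]
    contains its closure. *)
Theorem generated_connected (I : Type) (C : I -> set mat) :
    (forall i A, C i A -> A \in unitmx) -> (forall i, zconnected (C i)) -> (forall i, C i 1%:M) ->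
  closed_connected (zcl (generated (fun A => exists i, C i A))).
Proof.
move=> uC cC C1; set S : set mat := fun A => exists i, C i A.
have uS A : S A -> A \in unitmx by case=> i; apply: uC.
have sG := generated_subgroup uS; have cK := zcl_subgroup sG; have [sK _] := cK.
set K := zcl _ in cK sK *.
split=> //; split; first by exists 1%:M; apply: subgroup_one.
have SK A : S A -> K A.
  by move=> SA; apply: zcl_sub (generated_mem SA); apply: subgroup_unit.
suff main Z1 Z2 : zclosed Z1 -> zclosed Z2 -> (K `<=` Z1 `|` Z2)%classic -> (K `&` Z1 `&` Z2 = set0)%classic ->
    Z1 1%:M -> (K `<=` Z1)%classic.
  move=> Z1 Z2 c1 c2 cov disj; have [h|h] := cov 1%:M (subgroup_one sK); [left | right].
    exact: (main Z1 Z2).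
  by apply: (main Z2 Z1) => //; [rewrite setUC | rewrite -setIA (setIC Z2) setIA].
move=> c1 c2 cov disj Z11.
have dj A : K A -> Z1 A -> Z2 A -> False.
  by move=> KA h1 h2; have : (K `&` Z1 `&` Z2)%classic A by []; rewrite disj.
(* The equivalence makes this set stable under inversion. *)
pose H : set mat := fun A => K A /\ forall B, K B -> Z1 B <-> Z1 (B *m A).
have sH : subgroup H.
  split.
  - by move=> A [KA _]; apply: (subgroup_unit sK).
  - by split=> [|B _]; [apply: subgroup_one | rewrite mulmx1].
  - move=> A B [KA hA] [KB hB]; split=> [|D KD]; first exact: subgroup_mul.
    rewrite mulmxA -hB; first exact: hA.
    exact: subgroup_mul.
  - move=> A [KA hA]; have KV := subgroup_inv sK KA; split=> // B KB.
    rewrite (hA (B *m invmx A)); last exact: subgroup_mul.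
    by rewrite mulmxKV // (subgroup_unit sK).
have SH A : S A -> H A.
  move=> SA; split; first exact: SK.
  case: SA => i CA B KB.
  have KBC D : C i D -> K (B *m D) by move=> CD; apply: subgroup_mul => //; apply: SK; exists i.
  have [_ con] := cC i.
  have [] := con (fun D => Z1 (B *m D)) (fun D => Z2 (B *m D)) (zclosed_preim _ c1) (zclosed_preim _ c2).
  - by move=> D /KBC/cov.
  - by apply/seteqP; split=> // D [[/KBC h1 h2] h3]; apply: dj h1 h2 h3.
  - move=> h; split=> _; first exact: h.
    by have := h _ (C1 i); rewrite mulmx1.
  - move=> h; split=> h'; last by case: (dj _ (KBC _ CA) h' (h _ CA)).
    by case: (dj B KB h'); have := h _ (C1 i); rewrite mulmx1.
apply: (zcl_zclosed c1) => A hA.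
have [_ hH] : H A by apply: hA.
by have := (hH 1%:M (subgroup_one sK)).1 Z11; rewrite mul1mx.
Qed.

(** Irreducibility of a rational curve: an equation holds along the whole curve or only at roots of
    a nonzero polynomial. If neither closed set contained the curve, a parameter avoiding finitely
    many roots would lie in neither. The same lemma serves exponentials, multiplicative subgroups
    and powers of unipotents. *)
Lemma curve_connected (T : F -> Prop) (g : F -> mat) x0 :
    T x0 -> (forall p, (forall x, T x -> mxeval p (g x) = 0) \/
       exists2 q : {poly F}, q != 0 & forall x, T x -> mxeval p (g x) = 0 -> root q x) ->
    (exists2 q : {poly F}, q != 0 & forall x, ~ T x -> root q x) ->
  zconnected (fun A => exists2 x, T x & A = g x).
Proof.
move=> Tx0 fin [q0 q0n q0T]; split; first by exists (g x0), x0.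
move=> Z1 Z2 [S1 E1] [S2 E2] cov _.
have alt (S : set poly) : (forall x, T x -> forall p, S p -> mxeval p (g x) = 0) \/
    exists2 q : {poly F}, q != 0 & forall x, T x -> (forall p, S p -> mxeval p (g x) = 0) -> root q x.
  have [|H] := pselect (forall x, T x -> forall p, S p -> mxeval p (g x) = 0); [by left | right].
  have [p [Sp np]] : exists p, S p /\ ~ forall x, T x -> mxeval p (g x) = 0.
    apply: contrapT => H2; apply: H => x Tx p Sp; apply: contrapT => H3.
    by apply: H2; exists p; split=> // H4; apply: H3; apply: H4.
  have [//|[q qn hq]] := fin p; exists q => // x Tx Hx; apply: hq => //; exact: Hx.
have [h1|[q1 q1n h1]] := alt S1; first by left=> A [x Tx ->]; rewrite E1 => p; apply: h1.
have [h2|[q2 q2n h2]] := alt S2; first by right=> A [x Tx ->]; rewrite E2 => p; apply: h2.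
have [x] : exists x, (q0 * q1 * q2).[x] != 0.
  apply: contrapT => H; have : q0 * q1 * q2 = 0.
    apply: poly_eq0_char0 => // x; apply/eqP; apply: contrapT => hx; apply: H; exists x; exact/negP.
  by move/eqP; rewrite !mulf_eq0 (negPf q0n) (negPf q1n) (negPf q2n).
rewrite !hornerM !mulf_eq0 !negb_or => /andP[/andP[x0n x1n] x2n].
have Tx : T x by apply: contrapT => /q0T; apply/negP.
have [|hx|hx] := cov (g x); first by exists x.
  by case/negP: x1n; apply: h1 => // p Sp; move: hx; rewrite E1; apply.
by case/negP: x2n; apply: h2 => // p Sp; move: hx; rewrite E2; apply.
Qed.

Lemma expm_connected X : zconnected (fun A => exists2 s : F, True & A = expm X s).
Proof.
apply: (curve_connected (x0 := 0)) => //; last by exists 1; rewrite ?oner_neq0.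
move=> p; have [p0|p0] := eqVneq (polyeval p (ecurve X)) 0; [left | right].
  by move=> x _; rewrite -horner_polyeval p0 horner0.
by exists (polyeval p (ecurve X)) => // x _; rewrite /root horner_polyeval => ->.
Qed.

(** Negative weights make the restriction of [p] a Laurent polynomial, so it is multiplied by a
    power of [z]. The second equation is the Euler derivative of the first and is carried along in
    the induction. *)
Lemma psg_poly Q w p : Q \in unitmx -> exists k (P : {poly F}), forall z, z != 0 ->
  P.[z] = z ^+ k * mxeval p (psg Q w z) /\
  z * (P^`()).[z] = k%:R * P.[z] + z ^+ k * mxeval (ider (diagm Q (fun i => (w i)%:~R)) p) (psg Q w z).
Proof.
move=> uQ; set Y := diagm _ _.
pose good p := exists k (P : {poly F}), forall z, z != 0 ->
  P.[z] = z ^+ k * mxeval p (psg Q w z) /\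
  z * (P^`()).[z] = k%:R * P.[z] + z ^+ k * mxeval (ider Y p) (psg Q w z).
have gC c : good c%:MP.
  by exists 0%N, c%:P => z _; rewrite mxevalC iderC mxeval0 derivC !hornerE; split; ring.
have gM p1 p2 : good p1 -> good p2 -> good (p1 * p2).
  move=> [k [P hP]] [l [R hR]]; exists (k + l)%N, (P * R) => z z0.
  have [h1 h2] := hP z z0; have [h3 h4] := hR z z0.
  rewrite hornerM mxevalM derivM hornerD !hornerM iderM mxevalD !mxevalM natrD exprD.
  split; first by rewrite h1 h3 mulrACA.
  have -> : z * ((P^`()).[z] * R.[z] + P.[z] * (R^`()).[z]) =
    (z * (P^`()).[z]) * R.[z] + P.[z] * (z * (R^`()).[z]) by ring.
  by rewrite h2 h4 h1 h3; ring.
have gX k : exists P : {poly F}, forall z, z != 0 -> P.[z] = z ^+ k /\ z * (P^`()).[z] = k%:R * P.[z].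
  exists 'X^k => z z0; rewrite derivXn hornerMn !hornerXn; split=> //.
  by case: k => [|k]; rewrite ?mulr0n ?mulr0 ?mul0r //= exprS -mulr_natl; ring.
have gD p1 p2 : good p1 -> good p2 -> good (p1 + p2).
  move=> [k [P hP]] [l [R hR]]; have [Xl hXl] := gX l; have [Xk hXk] := gX k.
  exists (k + l)%N, (Xl * P + Xk * R) => z z0.
  have [h1 h2] := hP z z0; have [h3 h4] := hR z z0.
  have [h5 h6] := hXl z z0; have [h7 h8] := hXk z z0.
  rewrite derivD !derivM !hornerD !hornerM mxevalD iderD mxevalD natrD exprD.
  split; first by rewrite h5 h7 h1 h3; ring.
  have -> : z * ((Xl^`()).[z] * P.[z] + Xl.[z] * (P^`()).[z] + ((Xk^`()).[z] * R.[z] + Xk.[z] * (R^`()).[z])) =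
    (z * (Xl^`()).[z]) * P.[z] + Xl.[z] * (z * (P^`()).[z]) + ((z * (Xk^`()).[z]) * R.[z] + Xk.[z] * (z * (R^`()).[z])) by ring.
  by rewrite h6 h8 h2 h4 h5 h7 h1 h3; ring.
have gL i j : good (linform i (col j (invmx Q))).
  have E z : z != 0 -> mxeval (linform i (col j (invmx Q))) (psg Q w z) = z ^ w j * (invmx Q) i j.
    by move=> _; rewrite mxeval_linform diagm_col // !mxE.
  have E' z : z != 0 -> mxeval (ider Y (linform i (col j (invmx Q)))) (psg Q w z) = (w j)%:~R * (z ^ w j * (invmx Q) i j).
    by move=> z0; rewrite ider_linform diagm_col // linformZ mxevalZ E.
  exists `|w j|%N; case wj: (w j) => [m|m].
    exists ((invmx Q) i j *: 'X^(m + m)) => z z0; rewrite E // E' // wj.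
    rewrite derivZ derivXn !hornerZ hornerMn !hornerXn -exprnP -pmulrn absz_nat exprD; split; first by ring.
    have zX k : z * (z ^+ k.-1 *+ k) = k%:R * z ^+ k.
      by case: k => [|k]; rewrite ?mulr0n ?mulr0 ?mul0r //= exprS -mulr_natl; ring.
    by rewrite [X in X = _]mulrCA zX natrD exprD; ring.
  exists ((invmx Q) i j)%:P => z z0; rewrite E // E' // wj derivC !hornerE -[`|Negz m|%N]/m.+1 NegzE.
  rewrite -[z ^ _]/(z ^- m.+1); rewrite rmorphN /= -pmulrn; split.
    by rewrite mulfV ?mul1r // expf_eq0 negb_and z0 orbT.
  rewrite [z ^+ _ * _ / _]mulrAC mulfV ?mul1r; last by rewrite expf_eq0 negb_and z0 orbT.
  by rewrite mulNr subrr.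
suff : good p by [].
elim/mxpoly_ind: p => [c|i l|p1 p2|p1 p2]; [exact: gC | | exact: gD | exact: gM].
rewrite (xvar_linform i l uQ); elim/big_ind: _ => [||j _].
- exact: (gC 0).
- exact: gD.
- by rewrite -mul_mpolyC; apply: gM.
Qed.

Lemma psg_connected Q w : Q \in unitmx -> zconnected (fun A => exists2 z : F, z != 0 & A = psg Q w z).
Proof.
move=> uQ; apply: (curve_connected (x0 := 1)); first exact: oner_neq0.
  move=> p; have [k [P hP]] := psg_poly w p uQ.
  have [P0|P0] := eqVneq P 0; [left | right].
    move=> z z0; have [+ _] := hP z z0; rewrite P0 horner0 => /esym/eqP.
    by rewrite mulf_eq0 expf_eq0 (negPf z0) andbF => /eqP.
  by exists P => // z z0 pz; have [+ _] := hP z z0; rewrite pz mulr0 /root => ->.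
exists 'X; first by rewrite polyX_eq0.
by move=> z /negP; rewrite negbK => /eqP->; rewrite /root hornerX.
Qed.

Lemma psg1 Q w : Q \in unitmx -> psg Q w 1 = 1%:M :> mat.
Proof.
move=> uQ; rewrite -(diagm_const 1 uQ); congr diagm; apply: funext => i; exact: exp1rz.
Qed.

Lemma psgM Q w z : Q \in unitmx -> z != 0 -> psg Q w z *m psg Q w z^-1 = 1%:M :> mat.
Proof.
move=> uQ z0; rewrite diagm_mul // -(diagm_const 1 uQ); congr diagm; apply: funext => i.
by rewrite -expfzMl mulfV // exp1rz.
Qed.

Lemma psg_unit Q w z : Q \in unitmx -> z != 0 -> psg Q w z \in (unitmx : {pred mat}).
Proof. by move=> uQ z0; have [] := mulmx1_unit (psgM w uQ z0). Qed.

Lemma psg_lie S Q w : Q \in unitmx -> (forall z, z != 0 -> S (psg Q w z)) ->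
  diagm Q (fun i => (w i)%:~R) \in lie S.
Proof.
move=> uQ hS; apply/lieP => p hp; have [k [P hP]] := psg_poly w p uQ.
have P0 : 'X * P = 0.
  apply: poly_eq0_char0 => // z; rewrite hornerM hornerX.
  by have [->|z0] := eqVneq z 0; rewrite ?mul0r // (hP z z0).1 hp ?mulr0 //; apply: hS.
have {}P0 : P = 0 by apply/eqP; move/eqP: P0; rewrite mulf_eq0 polyX_eq0.
have [_] := hP 1 (oner_neq0 _); rewrite P0 deriv0 !horner0 !mulr0 add0r expr1n mul1r psg1 //.
Qed.

End RegularFunctions.

(** * Engel's theorem and the trace form *)

Section Engel.
Variables (F : closedFieldType) (n : nat).
Hypothesis F0 : char0 F.
Local Notation mat := 'M[F]_n.+1.
Local Notation vec := 'cV[F]_n.+1.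
Implicit Types (X Y Z A B : mat) (L M : {vspace mat}) (W : {vspace vec}) (v : vec).

Definition bracket_closed L := forall X Y, X \in L -> Y \in L -> lieb X Y \in L.

Lemma flag_exists L W : {U : {vspace vec} | forall v, v \in U <-> forall X, X \in L -> X *m v \in W}.
Proof.
apply: vspace_of_pred => [X _|a u v hu hv X hX]; first by rewrite mulmx0 mem0v.
by rewrite mulmxDr -scalemxAr memvD ?memvZ ?hu ?hv.
Qed.

(** The vectors killed by every product of [i] elements of [L]. *)
Fixpoint flag L i : {vspace vec} := if i is i'.+1 then sval (flag_exists L (flag L i')) else 0%VS.

Lemma flagP L i v : v \in flag L i.+1 <-> forall X, X \in L -> X *m v \in flag L i.
Proof. exact: (svalP (flag_exists L (flag L i))). Qed.

Lemma flag_mono L i : (flag L i <= flag L i.+1)%VS.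
Proof.
elim: i => [|i IH]; first exact: sub0v.
by apply/subvP => v /flagP hv; apply/flagP => X hX; apply: (subvP IH); apply: hv.
Qed.

Lemma flag_le L i j : (i <= j)%N -> (flag L i <= flag L j)%VS.
Proof.
move=> ij; rewrite -(subnK ij); elim: (j - i)%N => [|k IH]; first exact: subvv.
exact: subv_trans IH (flag_mono _ _).
Qed.

Lemma flag_lower L i X v : X \in L -> v \in flag L i -> X *m v \in flag L i.-1.
Proof.
by case: i => [|i] XL; [rewrite memv0 => /eqP->; rewrite mulmx0 mem0v | move/flagP; apply].
Qed.

(** Engel's conclusion for all quotients at once: on the quotient by any proper stable subspace, [L]
    annihilates a nonzero vector. *)
Definition separating L := forall W, (forall X w, X \in L -> w \in W -> X *m w \in W) -> W != fullv ->
  exists v, v \notin W /\ forall X, X \in L -> X *m v \in W.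

Lemma flag_stable L i X v : X \in L -> v \in flag L i -> X *m v \in flag L i.
Proof.
by case: i => [|i]; [rewrite memv0 => _ /eqP->; rewrite mulmx0 mem0v |
  move=> hX /flagP/(_ X hX); apply: (subvP (flag_mono L i))].
Qed.

Lemma flag_full L : separating L -> flag L n.+1 = fullv.
Proof.
move=> sep; suff H i : (minn i n.+1 <= \dim (flag L i))%N.
  by apply/eqP; rewrite eqEdim subvf dimvf /dim /= muln1 -{1}(minnn n.+1) H.
elim: i => // i IH; have [E|ne] := eqVneq (flag L i) fullv.
  by apply: leq_trans (dimvS (flag_mono L i)); rewrite E dimvf /dim /= muln1 geq_minr.
have [v [vn vW]] := sep _ (@flag_stable L i) ne.
suff : (\dim (flag L i) < \dim (flag L i.+1))%N by lia.
rewrite ltnNge; apply: contra vn => le.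
have /eqP -> : flag L i == flag L i.+1 by rewrite eqEdim flag_mono le.
exact/flagP.
Qed.

(** Take a subalgebra [M] of largest dimension with the conclusion. If it is proper, iterated
    brackets with [M] are eventually zero on [L], which yields [z] outside [M] normalizing [M]. Then
    [M + <[z]>] also has the conclusion: the vectors that [M] sends into [W] are stable under the
    nilpotent [z]. *)
Theorem engel L : bracket_closed L -> (forall X, X \in L -> nilmx X) -> separating L.
Proof.
move=> bL nL.
pose good d := `[< exists M, [/\ (M <= L)%VS, bracket_closed M, separating M & \dim M = d] >].
have g0 : exists d, good d.
  exists 0%N; apply/asboolP; exists 0%VS; split; rewrite ?dimv0 ?sub0v //.
    by move=> X Y; rewrite !memv0 => /eqP-> /eqP->; rewrite /lieb mul0mx subrr.
  move=> W _ Wn; have [v vW] : exists v, v \notin W.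
    by move: Wn; rewrite eqEsubv subvf /= => /subvPn[v _ vW]; exists v.
  by exists v; split=> // X; rewrite memv0 => /eqP->; rewrite mul0mx mem0v.
have gb d : good d -> (d <= \dim L)%N by move=> /asboolP[M [ML _ _ <-]]; apply: dimvS.
case: (ex_maxnP g0 gb) => d /asboolP[M [ML bM sM dM]] dmax.
have [-> //|neq] := eqVneq L M.
have [y yL yM] : exists2 y, y \in L & y \notin M.
  by apply/subvPn; apply: contra neq => h; rewrite eqEsubv h ML.
have full := flag_full sM.
pose adw (s : seq mat) Z := foldr (@lieb F n) Z s.
pose K := n.+1.
have fullK i : (K <= i)%N -> flag M i = fullv.
  move=> /subnK<-; elim: (i - K)%N => [|j IH]; first exact: full.
  by apply/eqP; rewrite addSn eqEsubv subvf -{1}IH flag_mono.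
(* An arbitrary matrix raises the flag degree by at most [K], and each bracket with [M] lowers this
   bound by one; hence [2 * K] brackets give zero. *)
have adwP s Z : (forall X, X \in s -> X \in M) ->
    forall i v, v \in flag M i -> adw s Z *m v \in flag M (i + K - size s).
  elim: s => [|X s IH] sMs i v hv; first by rewrite subn0 fullK ?memvf // leq_addl.
  have XM := sMs X (mem_head _ _).
  have {}IH := IH (fun Y ys => sMs Y (mem_behead (s := _ :: _) ys)).
  have -> : (i + K - size (X :: s) = (i + K - size s).-1)%N by rewrite /= subnS.
  rewrite /= /lieb mulmxBl -!mulmxA; apply: memvB; first by apply: flag_lower => //; apply: IH.
  case: i hv => [|i] hv.
    by move: hv; rewrite memv0 => /eqP->; rewrite !mulmx0 mem0v.
  have := IH i (X *m v) (flag_lower XM hv).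
  have le : (i + K - size s <= (i.+1 + K - size s).-1)%N by rewrite addSn; lia.
  exact: (subvP (flag_le M le)).
have adw0 s Z : (forall X, X \in s -> X \in M) -> (2 * K <= size s)%N -> adw s Z = 0.
  move=> sMs szs; apply/matrixP => i j; rewrite [RHS]mxE.
  have : adw s Z *m delta_mx j 0 \in flag M (K + K - size s) by apply: adwP; rewrite // full memvf.
  rewrite (_ : (K + K - size s)%N = 0%N); last by lia.
  rewrite memv0 -colE => /eqP/matrixP/(_ i 0); by rewrite !mxE.
pose Q r := `[< forall s, (forall X, X \in s -> X \in M) -> size s = r -> adw s y \in M >].
have exQ : exists r, Q r.
  by exists (2 * K)%N; apply/asboolP => s sMs sz; rewrite adw0 ?mem0v // sz.
case: (ex_minnP exQ) => -[|r] /asboolP hr rmin; first by case/negP: yM; apply: (hr [::]).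
have [s [sMs szs sn]] : exists s, [/\ forall X, X \in s -> X \in M, size s = r & adw s y \notin M].
  apply: contrapT => H; suff : Q r by move/rmin; rewrite ltnn.
  apply/asboolP => s sMs szs; apply: contraT => hs; exfalso; apply: H; exists s; split=> //.
set z := adw s y in sn.
have Mz X : X \in M -> lieb X z \in M.
  move=> XM; apply: (hr (X :: s)); last by rewrite /= szs.
  by move=> Y; rewrite inE => /orP[/eqP->|/sMs].
have zL : z \in L.
  rewrite /z; elim: (s) sMs => //= X s' IH sMs'; apply: bL; first by apply: (subvP ML); apply: sMs'; apply: mem_head.
  by apply: IH => Y Ys; apply: sMs'; rewrite inE Ys orbT.
have liebN X Y : lieb X Y = - lieb Y X by rewrite /lieb opprB.
have liebDl X Y Z : lieb (X + Y) Z = lieb X Z + lieb Y Z.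
  by rewrite /lieb mulmxDl mulmxDr opprD addrACA.
have liebZl a X Y : lieb (a *: X) Y = a *: lieb X Y.
  by rewrite /lieb -scalemxAl -scalemxAr scalerBr.
have liebDr X Y Z : lieb Z (X + Y) = lieb Z X + lieb Z Y by rewrite liebN liebDl opprD -!liebN.
have liebZr a X Y : lieb Y (a *: X) = a *: lieb Y X by rewrite liebN liebZl -scalerN -liebN.
have liebb X : lieb X X = 0 by rewrite /lieb subrr.
pose M' := (M + <[z]>)%VS.
have MM' : (M <= M')%VS by apply: addvSl.
have M'P X : X \in M' -> exists A a, A \in M /\ X = A + a *: z.
  by move=> /memv_addP[A AM [B /vlineP[a ->] ->]]; exists A, a.
suff /dmax : good (\dim M').
  rewrite -dM => le; have /eqP E : M == M' by rewrite eqEdim MM' le.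
  by case/negP: sn; rewrite E (subvP (addvSr M <[z]>)) ?memv_line.
apply/asboolP; exists M'; split=> //.
- by apply/subvP => X /M'P[A [a [AM ->]]]; rewrite memvD ?memvZ // (subvP ML).
- move=> X Y /M'P[A [a [AM ->]]] /M'P[B [b [BM ->]]]; apply: (subvP MM').
  rewrite liebDl !liebDr !liebZl !liebZr liebb !scaler0 addr0 [lieb z B]liebN.
  apply: memvD; first by apply: memvD; [apply: bM | apply: memvZ; apply: Mz].
  by apply: memvZ; rewrite memvN; apply: Mz.
move=> W sW Wn.
have sWM X w : X \in M -> w \in W -> X *m w \in W by move=> XM; apply: sW; apply: (subvP MM').
have zM' : z \in M' by apply: (subvP (addvSr M <[z]>)); apply: memv_line.
have [v [vW Mv]] := sM W sWM Wn.
have [k zk] := nL z zL.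
have ex : exists j, z ^+ j *m v \in W by exists k; rewrite zk mul0mx mem0v.
case: (ex_minnP ex) => -[|j] hj jmin; first by case/negP: vW; rewrite -[v]mul1mx.
have Mzv i X : X \in M -> X *m (z ^+ i *m v) \in W.
  elim: i X => [|i IH] X XM; first by rewrite expr0 mul1mx Mv.
  have -> : X *m (z ^+ i.+1 *m v) = lieb X z *m (z ^+ i *m v) + z *m (X *m (z ^+ i *m v)).
    by rewrite /lieb mulmxBl -!mulmxA subrK exprS !mulmxA.
  by rewrite memvD ?IH ?Mz // sW // IH.
exists (z ^+ j *m v); split; first by apply/negP => /jmin; rewrite ltnn.
move=> X /M'P[A [a [AM ->]]]; rewrite mulmxDl -scalemxAl memvD ?Mzv // memvZ //.
by rewrite mulmxA -[z *m _]exprS.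
Qed.

Lemma flag_normal L (Y : mat) : (forall X, X \in L -> lieb Y X \in L) ->
  forall i v, v \in flag L i -> Y *m v \in flag L i.
Proof.
move=> hY; elim=> [|i IH] v; first by rewrite !memv0 => /eqP->; rewrite mulmx0.
move=> /flagP hv; apply/flagP => X XL.
have -> : X *m (Y *m v) = Y *m (X *m v) - lieb Y X *m v.
  by rewrite /lieb mulmxBl -!mulmxA opprB addrC subrK.
by apply: memvB; [apply: IH; apply: hv | apply: hv; apply: hY].
Qed.

Lemma flag_pow_nil L (Z : mat) : flag L n.+1 = fullv ->
  (forall i v, v \in flag L i.+1 -> Z *m v \in flag L i) -> Z ^+ n.+1 = 0.
Proof.
move=> full hZ.
have H k i v : v \in flag L (i + k) -> Z ^+ k *m v \in flag L i.
  elim: k i v => [|k IH] i v; first by rewrite addn0 expr0 mul1mx.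
  by rewrite addnS -addSn exprS -mulmxA => /IH; apply: hZ.
apply/matrixP => i j; rewrite [RHS]mxE.
have : Z ^+ n.+1 *m delta_mx j 0 \in flag L 0 by apply: H; rewrite add0n full memvf.
by rewrite memv0 -colE => /eqP/matrixP/(_ i 0); rewrite !mxE.
Qed.

(** [L] strictly lowers its flag, which is the whole space at the top, while [Y] preserves it
    because it normalizes [L]. So [X *m Y] is nilpotent. *)
Lemma nil_ideal_trace L (Y : mat) : bracket_closed L -> (forall X, X \in L -> nilmx X) ->
  (forall X, X \in L -> lieb Y X \in L) -> forall X, X \in L -> \tr (X *m Y) = 0.
Proof.
move=> bL nL hY X XL; apply: nilmx_trace; exists n.+1.
apply: (@flag_pow_nil L); first by apply: flag_full; apply: engel.
by move=> i v hv; rewrite -mulmxA; apply: (flagP L i _).1 => //; apply: flag_normal.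
Qed.
End Engel.

(** * Nondegeneracy of the trace form of a reductive group *)

Section Reductive.
Variables (F : closedFieldType) (n : nat).
Hypothesis F0 : char0 F.
Local Notation N := (n.+1 * n.+1)%N.
Local Notation mat := 'M[F]_n.+1.
Local Notation vec := 'cV[F]_n.+1.
Implicit Types (X Y Z A B : mat) (K : set mat).

Lemma lie_Ad_sub (K S : set mat) g X : g \in unitmx -> (forall A, S A -> K (invmx g *m A *m g)) ->
  X \in lie S -> invmx g *m X *m g \in lie K.
Proof.
move=> ug conj /lieP hX; apply/lieP => p hp.
have := hX (lmove (invmx g) (rmove g p)).
rewrite ider_lmove ider_rmove // mxeval_lmove mxeval_rmove mulmx1 mulVmx //; apply.
by move=> A SA; rewrite mxeval_lmove mxeval_rmove; apply: hp; apply: conj.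
Qed.

Lemma lie_Ad K g X : subgroup K -> K g -> X \in lie K -> g *m X *m invmx g \in lie K.
Proof.
move=> sK Kg hX; have ug := subgroup_unit sK Kg.
rewrite -{1}[g]invmxK; apply: (lie_Ad_sub (S := K)) => //; first by rewrite unitmx_inv.
by move=> A KA; rewrite invmxK; apply: subgroup_mul => //; [apply: subgroup_mul | apply: subgroup_inv].
Qed.

Lemma lie_trivial X : X \in lie [set (1%:M : mat)]%classic -> X = 0.
Proof.
move=> /lieP H; apply/matrixP => i j; rewrite mxE.
have := H (xvar F i j - (1%:M i j : F)%:MP); rewrite iderB iderC subr0 ider_xvar mxeval_sum.
rewrite (bigD1 i) //= big1 ?addr0 => [|l li].
  rewrite mxevalZ mxeval_xvar [(1%:M : mat) i i]mxE eqxx mulr1; apply=> A ->.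
  by rewrite mxevalB mxeval_xvar mxevalC subrr.
by rewrite mxevalZ mxeval_xvar [(1%:M : mat) i l]mxE eq_sym (negPf li) mulr0.
Qed.

Lemma int_sqr_sum0 (I : finType) (a : I -> int) : \sum_i a i * a i = 0 -> forall i, a i = 0.
Proof.
move=> /eqP; rewrite psumr_eq0 => [/allP H i|i _]; last by rewrite -expr2 sqr_ge0.
by have := H i (mem_index_enum i); rewrite mulf_eq0 orbb => /eqP.
Qed.

Lemma diagm_trace Q (w : 'I_n.+1 -> F) : Q \in unitmx -> \tr (diagm Q w) = \sum_i w i.
Proof.
move=> uQ; rewrite /diagm mxtrace_mulC mulmxA mulmxV // mul1mx /mxtrace.
by apply: eq_bigr => i _; rewrite !mxE eqxx mulr1n.
Qed.

(** The trace of [X] against a replica of itself is a combination of the independent numbers [c l]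
    with integral coefficients, one of which is a sum of squares. So all replicas vanish and [X] is
    nilpotent. *)
Lemma trace_radical_nil K X : subgroup K -> X \in lie K ->
  (forall Y, Y \in lie K -> \tr (X *m Y) = 0) -> nilmx X.
Proof.
move=> sK hX rad; have [m [c [Q [a [uQ free hq nil hK]]]]] := replicas F0 X.
have a0 j i : a j i = 0.
  pose Y l := diagm Q (fun i => (a l i)%:~R).
  have trY l k : \tr (Y l *m Y k) = (\sum_i a l i * a k i)%:~R.
    rewrite diagm_mul // diagm_trace // rmorph_sum; apply: eq_bigr => b _.
    by rewrite rmorphM.
  move: i; apply: int_sqr_sum0; apply: (free (fun l => \sum_i a l i * a j i)).
  have [k nk] := nil; have [q Yq] := hq j.
  have : \tr ((X - \sum_l c l *: Y l) *m Y j) = 0.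
    apply: nilmx_trace; apply: nilmx_mulC; first by exists k.
    rewrite /Y Yq; apply: comm_mx_horner; apply/comm_mx_sym; rewrite /comm_mx mulmxBl mulmxBr; congr (_ - _).
    rewrite mulmx_sumr mulmx_suml; apply: eq_bigr => l _; rewrite -scalemxAl -scalemxAr; congr (_ *: _).
    by have [ql Yl] := hq l; rewrite /Y Yl; apply: comm_mx_horner.
  rewrite mulmxBl linearB /= rad ?hK // sub0r mulmx_suml linear_sum /= => /eqP.
  rewrite oppr_eq0 => /eqP E; rewrite -[RHS]E; apply: eq_bigr => l _.
  by rewrite -scalemxAl linearZ /= trY mulrC.
suff S0 : \sum_j c j *: diagm Q (fun i => (a j i)%:~R) = 0.
  by have [k nk] := nil; exists k; rewrite -nk S0 subr0.
rewrite big1 // => j _; rewrite (_ : diagm Q _ = 0) ?scaler0 //.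
by apply/matrixP => b d; rewrite /diagm (_ : diag_mx _ = 0) ?mulmx0 ?mul0mx ?mxE //;
  apply/matrixP => e f; rewrite !mxE a0 mul0rn.
Qed.

Lemma vspace_equations (U : {vspace vec}) : exists P : mat, forall v : vec, v \in U <-> P *m v = 0.
Proof.
pose pr (v : vec) := v - projv U v.
exists (\matrix_(i, j) pr (delta_mx j 0) i 0) => v.
have -> : (\matrix_(i, j) pr (delta_mx j 0) i 0) *m v = pr v.
  have prE : pr v = \sum_j v j 0 *: pr (delta_mx j 0).
    rewrite /pr {1 2}(matrix_sum_delta v).
    under eq_bigr do rewrite big_ord1; rewrite linear_sum -sumrB; apply: eq_bigr => j _.
    by rewrite linearZ scalerBr.
  apply/colP => i; rewrite mxE prE summxE; apply: eq_bigr => j _.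
  by rewrite !mxE mulrC.
split=> [/projv_id vU|/eqP]; first by rewrite /pr vU subrr.
by rewrite subr_eq0 => /eqP->; apply: memv_proj.
Qed.

Lemma closed_connected_curves K : closed_subgroup K ->
  (forall A, K A -> exists C : set mat, [/\ zconnected C, C 1%:M, C A & forall B, C B -> K B]) ->
  closed_connected K.
Proof.
move=> cK hC; have [sK _] := cK.
pose I := {C : set mat | [/\ zconnected C, C 1%:M & forall B, C B -> K B]}.
have -> : K = zcl (generated (fun A => exists i : I, (sval i) A)).
  have uS A : (exists i : I, (sval i) A) -> A \in unitmx.
    by move=> [[C [c1 c2 c3]] /= CA]; apply: (subgroup_unit sK); apply: c3.
  apply/seteqP; split=> A.
    move=> KA; apply: zcl_sub; first exact: subgroup_unit (generated_subgroup uS).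
    apply: generated_mem; have [C [c1 c2 c3 c4]] := hC A KA.
    have hCI : [/\ zconnected C, C 1%:M & forall B, C B -> K B] by [].
    by exists (exist _ C hCI).
  apply: zcl_min => // B /(_ _ sK); apply.
  by move=> D [[C [c1 c2 c3]] /=]; apply: c3.
apply: generated_connected => //.
- by move=> [C [c1 c2 c3]] A /= /c3; apply: subgroup_unit.
- by move=> [C []].
- by move=> [C []].
Qed.

(** The radical of the trace form is an ideal of nilpotent matrices stable under [K], so [K]
    preserves its flag. The elements of [K] acting trivially on the graded pieces form a closed
    connected normal unipotent subgroup, trivial by reductivity. The exponentials of the radical lie
    in it. *)
Theorem reductive_nondegenerate K X : reductive K -> X \in lie K ->
  (forall Y, Y \in lie K -> \tr (X *m Y) = 0) -> X = 0.
Proof.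
move=> [cK red] hX hrad; have [csK _] := cK; have [sK _] := csK.
have [||rad radP] := @vspace_of_pred _ mat (fun X => X \in lie K /\ forall Y, Y \in lie K -> \tr (X *m Y) = 0).
- by split=> [|Y _]; rewrite ?mem0v // mul0mx raddf0.
- move=> a U V [hU tU] [hV tV]; split=> [|Y hY]; first by rewrite memvD ?memvZ.
  by rewrite mulmxDl -scalemxAl linearD linearZ /= tU // tV // mulr0 addr0.
have nrad Y : Y \in rad -> nilmx Y by move=> /radP[hY tY]; apply: trace_radical_nil hY tY.
have brad : forall Y Z, Y \in lie K -> Z \in rad -> lieb Y Z \in rad.
  move=> Y Z hY /radP[hZ tZ]; apply/radP; split=> [|V hV]; first exact: lie_bracket.
  have -> : \tr (lieb Y Z *m V) = - \tr (Z *m lieb Y V).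
    rewrite /lieb mulmxBl mulmxBr !linearB /= opprB -!mulmxA; congr (_ - _).
    by rewrite mxtrace_mulC -mulmxA.
  by rewrite tZ ?oppr0 //; apply: lie_bracket.
have crad : bracket_closed rad by move=> Y Z /radP[hY _]; apply: brad.
have full := flag_full (engel crad nrad).
have Adrad g Y : K g -> Y \in rad -> g *m Y *m invmx g \in rad.
  move=> Kg /radP[hY tY]; have ug := subgroup_unit sK Kg; apply/radP; split=> [|Z hZ]; first exact: lie_Ad.
  have := lie_Ad sK (subgroup_inv sK Kg) hZ; rewrite invmxK => /tY; rewrite !mulmxA mxtrace_mulC !mulmxA => E.
  by rewrite -[RHS]E.
have flagK g i v : K g -> v \in flag rad i -> g *m v \in flag rad i.
  move=> Kg; have ug := subgroup_unit sK Kg; elim: i v => [|i IH] v; first by rewrite !memv0 => /eqP->; rewrite mulmx0.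
  move=> /flagP hv; apply/flagP => Y hY.
  have -> : Y *m (g *m v) = g *m ((invmx g *m Y *m g) *m v) by rewrite !mulmxA mulmxV // mul1mx.
  by apply: IH; apply: hv; have := Adrad _ _ (subgroup_inv sK Kg) hY; rewrite invmxK.
have /choice[P hP] i := vspace_equations (flag rad i).
have [k0 [Z0 [S0 ZE0] KE]] := csK.
(* the largest subgroup of K acting trivially on the quotients of the flag *)
pose Nn : set mat := fun g => K g /\ forall i v, v \in flag rad i.+1 -> g *m v - v \in flag rad i.
have sN : subgroup Nn.
  split.
  - by move=> A [/(subgroup_unit sK)].
  - by split=> [|i v _]; [apply: subgroup_one | rewrite mul1mx subrr mem0v].
  - move=> A B [KA hA] [KB hB]; split=> [|i v hv]; first exact: subgroup_mul.
    rewrite -mulmxA -(subrK (B *m v) (A *m _)) -addrA memvD ?hB // hA //; exact: flagK.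
  - move=> A [KA hA]; have KV := subgroup_inv sK KA; split=> // i v hv.
    have -> : invmx A *m v - v = - (invmx A *m (A *m v - v)).
      by rewrite mulmxBr mulKmx ?(subgroup_unit sK) // opprB.
    by rewrite memvN; apply: flagK => //; apply: hA.
have cN : closed_subgroup Nn.
  split=> //; exists (fun A => Z0 A /\ forall i v, v \in flag rad i.+1 -> P i *m (A *m v - v) = 0).
    pose lin (i : nat) (v : vec) (a : 'I_n.+1) : {mpoly F[N]} :=
      \sum_b (P i a b)%:MP * (linform b v - (v b 0)%:MP).
    exists (fun p => S0 p \/ exists i v a, v \in flag rad i.+1 /\ p = lin i v a).
    have linE i v a A : mxeval (lin i v a) A = (P i *m (A *m v - v)) a 0.
      rewrite mxeval_sum mxE; apply: eq_bigr => b _.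
      by rewrite mxevalM mxevalB !mxevalC mxeval_linform !mxE.
    apply/seteqP; split=> A.
      rewrite ZE0 => -[h1 h2] p [/h1//|[i [v [a [hv ->]]]]].
      by rewrite linE h2 ?mxE.
    move=> h; split; first by rewrite ZE0 => p hp; apply: h; left.
    by move=> i v hv; apply/colP => a; rewrite -linE mxE; apply: h; right; exists i, v, a.
  apply/seteqP; split=> A.
    move=> [KA hA]; have := KA; rewrite KE => -[uA ZA]; split=> //; split=> // i v hv.
    by apply/hP; apply: hA.
  move=> [uA [ZA hA]]; split; first by rewrite KE.
  by move=> i v hv; apply/hP; apply: hA.
have uniN g : Nn g -> nilmx (g - 1%:M).
  move=> [_ hg]; exists n.+1; apply: (flag_pow_nil full) => i v hv.
  by rewrite mulmxBl mul1mx; apply: hg.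
(* Every element of [Nn] is joined to [1] inside [Nn] by the polynomial curve through its powers. *)
have ccN : closed_connected Nn.
  apply: closed_connected_curves => // A NA; have nA := uniN A NA.
  exists (fun B => exists2 s : F, True & B = curve (ucurve A) s); split.
  - apply: (curve_connected F0 (x0 := 0)) => //; last by exists 1; rewrite ?oner_neq0.
    move=> p; have [p0|p0] := eqVneq (polyeval p (ucurve A)) 0; [left | right].
      by move=> s _; rewrite -horner_polyeval p0 horner0.
    by exists (polyeval p (ucurve A)) => // s _; rewrite /root horner_polyeval => ->.
  - by exists 0 => //; have := ucurve_nat F0 0 nA; rewrite expr0.
  - by exists 1 => //; have := ucurve_nat F0 1 nA; rewrite expr1.
  move=> B [s _ ->]; have [_ [Z1 [S1 ZE1] NE]] := cN.
  rewrite NE; split; first exact: ucurve_unit.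
  rewrite ZE1 => p Sp; rewrite -horner_polyeval.
  (* The equations hold at all natural parameters, where the curve takes the powers of [A] as
     values; a nonzero polynomial has finitely many roots. *)
  suff -> : polyeval p (ucurve A) = 0 by rewrite horner0.
  apply/eqP; apply: contraT => pn0.
  pose rs : seq F := [seq i%:R | i <- iota 0 (size (polyeval p (ucurve A)))].
  have := max_poly_roots pn0 (rs := rs); rewrite size_map size_iota ltnn => -> //.
    apply/allP => a /mapP[m _ ->]; rewrite /root horner_polyeval ucurve_nat //.
    have : Nn (A ^+ m).
      elim: m => [|m IH]; first by rewrite expr0; apply: subgroup_one.
      by rewrite exprS; apply: subgroup_mul.
    by rewrite NE ZE1 => -[_ /(_ _ Sp)->].
  by rewrite map_inj_uniq ?iota_uniq //; apply: char0_natr_inj.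
have nN : normal_in Nn K.
  split=> [g []//|g x Kg [Kx hx]]; split.
    by apply: subgroup_mul; [exact: sK | apply: subgroup_mul | apply: subgroup_inv].
  move=> i v hv; have ug := subgroup_unit sK Kg.
  have -> : g *m x *m invmx g *m v - v = g *m (x *m (invmx g *m v) - invmx g *m v).
    by rewrite mulmxBr mulKVmx // !mulmxA.
  by apply: (flagK) => //; apply: hx; apply: (flagK) => //; apply: subgroup_inv.
have triv : trivial Nn by apply: red.
have /nrad nX : X \in rad by apply/radP.
apply: lie_trivial; rewrite -triv; apply: expm_lie => // s; split; first exact: expm_mem.
have Xr : X \in rad by apply/radP.
move=> i v hv; rewrite expmE big_ord_recl fact0 invr1 !expr0 mulr1 scale1r mulmxDl mul1mx addrC addKr.
rewrite mulmx_suml; apply: memv_suml => j _; rewrite -scalemxAl memvZ //.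
have H k : X ^+ k.+1 *m v \in flag rad i.
  elim: k => [|k IH]; first by rewrite expr1; apply: (flagP _ _ _).1.
  by rewrite exprS -mulmxA; apply: flag_stable.
exact: H.
Qed.

End Reductive.

(** * Roots with respect to a toral subalgebra *)

Section Toral.
Variables (F : closedFieldType) (n : nat).
Hypothesis F0 : char0 F.
Local Notation mat := 'M[F]_n.+1.
Implicit Types (X Y Z A B H Q : mat) (K : set mat) (t k : {vspace mat}).

Definition toral t := exists2 Q, Q \in unitmx & forall X, X \in t -> exists w, X = diagm Q w.

Definition maxtoral k t :=
  [/\ (t <= k)%VS, toral t & forall t', (t <= t')%VS -> (t' <= k)%VS -> toral t' -> (t' <= t)%VS].

Lemma maxtoral_extend k t0 : (t0 <= k)%VS -> toral t0 -> exists2 t, maxtoral k t & (t0 <= t)%VS.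
Proof.
move=> tk0 tt0; pose good d := `[< exists t, [/\ (t <= k)%VS, toral t, (t0 <= t)%VS & \dim t = d] >].
have g0 : exists d, good d by exists (\dim t0); apply/asboolP; exists t0.
have gb d : good d -> (d <= \dim k)%N by move=> /asboolP[t [tk _ _ <-]]; apply: dimvS.
case: (ex_maxnP g0 gb) => d /asboolP[t [tk tt t0t dt]] dmax.
exists t => //; split=> // t' tt1 tk' tt'; suff /eqP-> : t == t' by [].
rewrite eqEdim tt1 dt; apply: dmax; apply/asboolP; exists t'; split=> //; exact: subv_trans t0t tt1.
Qed.

Lemma toral0 : toral 0%VS.
Proof.
exists 1%:M; rewrite ?unitmx1 // => X; rewrite memv0 => /eqP->; exists (fun=> 0).
by rewrite diagm_const ?unitmx1 // raddf0.
Qed.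

Lemma maxtoral_exists k : exists t, maxtoral k t.
Proof. by have [t mt _] := maxtoral_extend (sub0v k) toral0; exists t. Qed.

Lemma diagm_commute Q w w' : Q \in unitmx -> diagm Q w *m diagm Q w' = diagm Q w' *m diagm Q w.
Proof. by move=> uQ; rewrite !diagm_mul //; congr diagm; apply: funext => i; rewrite mulrC. Qed.

Lemma diagm_linear Q a w w' : a *: diagm Q w + diagm Q w' = diagm Q (fun i => a * w i + w' i).
Proof.
have := diagm_comb [:: true; false] Q (fun b : bool => if b then a else 1) (fun b : bool => if b then w else w').
rewrite !big_cons big_nil addr0 scale1r => ->; congr diagm; apply: funext => i.
by rewrite !big_cons big_nil addr0 mul1r.
Qed.

Lemma toral_of_commuting t : (forall X Y, X \in t -> Y \in t -> X *m Y = Y *m X) ->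
  (forall X, X \in t -> exists2 Q, Q \in unitmx & exists w, X = diagm Q w) -> toral t.
Proof.
move=> ct dt; have [A B hA hB|A hA|Q uQ hQ] := @codiag_seq F n (vbasis t).
- by apply: ct; apply: vbasis_mem.
- by apply: dt; apply: vbasis_mem.
exists Q => // X /coord_vbasis->; elim/big_ind: _ => [|Y Z [w ->] [w' ->]|i _].
- by exists (fun=> 0); rewrite diagm_const // raddf0.
- by exists (fun i => 1 * w i + w' i); rewrite -diagm_linear scale1r.
have [w ->] : exists w, (vbasis t)`_i = diagm Q w by apply: hQ; apply: mem_nth; rewrite size_tuple.
exists (fun j => coord (vbasis t) i X * w j + 0); rewrite -diagm_linear diagm_const //.
by rewrite raddf0 addr0.
Qed.

Lemma toral_commute t X Y : toral t -> X \in t -> Y \in t -> X *m Y = Y *m X.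
Proof. by move=> [Q uQ hQ] /hQ[w ->] /hQ[w' ->]; apply: diagm_commute. Qed.

Lemma maxtoral_mem k t Y : maxtoral k t -> Y \in k -> (exists2 Q, Q \in unitmx & exists w, Y = diagm Q w) ->
  (forall X, X \in t -> X *m Y = Y *m X) -> Y \in t.
Proof.
move=> [tk tt tmax] Yk dY cY; pose t' := (t + <[Y]>)%VS.
have t'P X : X \in t' -> exists A a, A \in t /\ X = A + a *: Y.
  by move=> /memv_addP[A At [B /vlineP[a ->] ->]]; exists A, a.
suff tt' : toral t'.
  have tk' : (t' <= k)%VS by rewrite subv_add tk -memvE.
  by apply: (subvP (tmax t' (addvSl _ _) tk' tt')); rewrite (subvP (addvSr t <[Y]>)) ?memv_line.
apply: toral_of_commuting => [X Z /t'P[A [a [At ->]]] /t'P[B [b [Bt ->]]]|X /t'P[A [a [At ->]]]].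
  rewrite !mulmxDl !mulmxDr -!scalemxAl -!scalemxAr (toral_commute tt At Bt) (cY A At) (cY B Bt).
  by rewrite -!addrA; congr (_ + _); rewrite addrCA !scalerA mulrC.
have [|A' /=|Q uQ hQ] := @codiag_seq F n [:: A; Y].
- by move=> A' B'; rewrite !inE => /orP[] /eqP-> /orP[] /eqP->; rewrite ?cY.
- rewrite !inE => /orP[] /eqP-> //; have [Q uQ hQ] := tt; exists Q => //; exact: hQ.
have [w Aw] := hQ A (mem_head _ _); have [w' Yw] : exists w', Y = diagm Q w' by apply: hQ; rewrite !inE eqxx orbT.
by exists Q => //; exists (fun i => a * w' i + w i); rewrite -diagm_linear addrC -Aw -Yw.
Qed.

Lemma diagm_nil Q w : Q \in unitmx -> nilmx (diagm Q w) -> diagm Q w = 0.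
Proof.
move=> uQ [m]; have -> : diagm Q w ^+ m = diagm Q (fun i => w i ^+ m).
  elim: m => [|m IH]; first by rewrite expr0 (diagm_const 1 uQ).
  by rewrite exprS IH -[_ * _]/(_ *m _) diagm_mul //; congr diagm; apply: funext => i; rewrite exprS.
move=> H; have := @diagm_inj F n Q (fun i => w i ^+ m) (fun=> 0) uQ.
rewrite diagm_const // raddf0 H => /(_ erefl) E.
transitivity (diagm Q (fun=> 0)); last by rewrite diagm_const // raddf0.
congr diagm; apply: funext => i; have /eqP := congr1 (fun f => f i) E.
by rewrite expf_eq0 => /andP[_ /eqP].
Qed.

Definition integral_elt Y := exists2 Q, Q \in unitmx & exists a : 'I_n.+1 -> int, Y = diagm Q (fun i => (a i)%:~R).

(** The replicas of [X] lie in [lie K] and are polynomials in [X], so they commute with [t];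
    maximality puts them into [t]. *)
Lemma maxtoral_split K t X : subgroup K -> maxtoral (lie K) t -> X \in lie K ->
    (forall H, H \in t -> H *m X = X *m H) -> exists m (c : 'I_m -> F) (Y : 'I_m -> mat),
  [/\ forall j, Y j \in t, forall j, integral_elt (Y j), nilmx (X - \sum_j c j *: Y j) &
      forall j, exists q, Y j = horner_mx X q].
Proof.
move=> sK mt hX cX; have [m [c [Q [a [uQ _ hq nil hK]]]]] := replicas F0 X.
exists m, c, (fun j => diagm Q (fun i => (a j i)%:~R)); split=> //; last by move=> j; exists Q => //; exists (a j).
move=> j; apply: (maxtoral_mem mt); [exact: hK | by exists Q => //; eexists |].
by move=> H Ht; have [q ->] := hq j; apply: comm_mx_horner; apply: cX.
Qed.

Lemma integral_common Q u Q' (a : 'I_n.+1 -> int) : Q \in unitmx -> Q' \in unitmx ->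
  diagm Q u = diagm Q' (fun i => (a i)%:~R) -> exists b : 'I_n.+1 -> int, u = fun i => (b i)%:~R.
Proof.
move=> uQ uQ' E; pose p : {poly F} := \prod_i ('X - ((a i)%:~R)%:P).
have pa i : p.[(a i)%:~R] = 0 by rewrite /p (bigD1 i) //= hornerM !hornerE subrr mul0r.
have : horner_mx (diagm Q u) p = 0.
  rewrite E horner_mx_diagm // (_ : (fun i => _) = fun=> 0); first by rewrite diagm_const // raddf0.
  by apply: funext => i; rewrite pa.
rewrite horner_mx_diagm // => H.
have := @diagm_inj F n Q (fun i => p.[u i]) (fun=> 0) uQ; rewrite diagm_const // raddf0 H => /(_ erefl) pu.
have /choice[b hb] i : exists b : int, u i = b%:~R.
  have := congr1 (fun f => f i) pu; rewrite /p horner_prod => /eqP/prodf_eq0[j _].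
  by rewrite !hornerE subr_eq0 => /eqP->; exists (a j).
by exists b; apply: funext.
Qed.

(** A basis of [t] made of matrices with integer eigenvalues in one common eigenbasis. Weights
    thereby become integer row vectors of length [r], without reference to a group of characters. *)
Record tdata t (r : nat) Q (w : 'I_r -> 'I_n.+1 -> int) : Prop := TData {
  td_unit : Q \in unitmx;
  td_span : forall X, X \in t <-> exists c : 'I_r -> F, X = \sum_i c i *: diagm Q (fun j => (w i j)%:~R);
  td_free : forall c : 'I_r -> F, \sum_i c i *: diagm Q (fun j => (w i j)%:~R) = 0 -> forall i, c i = 0 }.

Theorem tdata_exists K t : subgroup K -> maxtoral (lie K) t -> exists Q w, @tdata t (\dim t) Q w.
Proof.
move=> sK mt; have [tk tt _] := mt; have [Q uQ hQ] := tt.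
have ex : exists s : seq mat, [/\ free s, forall Y, Y \in s -> integral_elt Y /\ Y \in t & size s = \dim t].
  suff H d : (d <= \dim t)%N -> exists s : seq mat, [/\ free s, forall Y, Y \in s -> integral_elt Y /\ Y \in t & size s = d] by exact: H.
  elim: d => [|d IH] dt; first by exists [::]; rewrite nil_free.
  have [s [fs hs szs]] := IH (ltnW dt).
  have : ~~ (t <= <<s>>)%VS.
    apply/negP => /dimvS; move/eqP: (fs) => ->; rewrite szs; by rewrite leqNgt dt.
  move/subvPn => [X Xt Xs].
  have [m [c [Y [Yt Yi nil Yq]]]] := maxtoral_split sK mt (subvP tk _ Xt) (fun H Ht => toral_commute tt Ht Xt).
  have XE : X = \sum_j c j *: Y j.
    apply/eqP; rewrite -subr_eq0; apply/eqP.
    have [u E] : exists u, X - \sum_j c j *: Y j = diagm Q u.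
      by apply: hQ; rewrite memvB // memv_suml // => j _; rewrite memvZ.
    by rewrite E diagm_nil // -E.
  have [j Yj] : exists j, Y j \notin <<s>>%VS.
    apply: contrapT => H; case/negP: Xs; rewrite XE memv_suml // => j _; rewrite memvZ //.
    by apply: contraT => h; case: H; exists j.
  exists (Y j :: s); split; rewrite ?free_cons ?Yj //= ?szs // => Z.
  by rewrite inE => /orP[/eqP->|/hs].
have [s [fs hs szs]] := ex.
pose om i := s`_(nat_of_ord (i : 'I_(\dim t))).
have omS i : om i \in s by rewrite mem_nth // szs.
have /choice[w wE] i : exists w : 'I_n.+1 -> int, om i = diagm Q (fun j => (w j)%:~R).
  have [[Q' uQ' [a aE]] ht] := hs _ (omS i); have [u uE] := hQ _ ht.
  have [b bE] := integral_common uQ uQ' (etrans (esym uE) aE).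
  by exists b; rewrite uE bE.
have bs : basis_of t s by rewrite basisEfree fs szs leqnn andbT; apply/span_subvP => Y /hs[].
have sumE (c : 'I_(\dim t) -> F) : \sum_i c i *: diagm Q (fun j => (w i j)%:~R) = \sum_i c i *: s`_i.
  by apply: eq_bigr => i _; rewrite -wE.
pose T : (\dim t).-tuple mat := Tuple (introT eqP szs).
exists Q, w; split=> // [X|c].
  split=> [Xt|[c ->]]; last by rewrite sumE memv_suml // => i _; rewrite memvZ //; case: (hs _ (omS i)).
  exists (fun i => coord T i X); rewrite sumE; have bT : basis_of t T := bs; exact: (coord_basis bT Xt).
rewrite sumE => H; have fT : free T by [].
have /freeP h := fT; exact: h H.
Qed.

(** On the curve with coordinates [c ^+ i], each nonzero functional becomes a nonzero polynomial in
    [c], so some [c] avoids all their roots. *)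
Lemma generic_point r (s : seq 'rV[int]_r) : (forall a, a \in s -> a != 0) ->
  exists x : 'I_r -> F, forall a, a \in s -> \sum_i (a 0 i)%:~R * x i != 0.
Proof.
move=> s0; pose p (a : 'rV[int]_r) : {poly F} := \poly_(i < r) (if insub i is Some j then (a 0 j)%:~R else 0).
have pn a : a != 0 -> p a != 0.
  apply: contraNneq => pa; apply/eqP/rowP => j; rewrite mxE; apply/eqP; rewrite -(char0_intr F0).
  have := congr1 (fun q : {poly F} => q`_j) pa; rewrite coef0 coef_poly ltn_ord.
  rewrite insubT //= => lt H; apply/eqP; rewrite -[RHS]H; congr (_%:~R); congr (a 0 _).
  exact: val_inj.
have [c hc] : exists c, (\prod_(a <- s) p a).[c] != 0.
  apply: contrapT => H; have : \prod_(a <- s) p a = 0.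
    apply: poly_eq0_char0 => // x; apply/eqP; apply: contrapT => hx; apply: H; exists x; exact/negP.
  by move/eqP; rewrite prodf_seq_eq0 => /hasP[a /s0/pn /negPf]; rewrite andTb => ->.
exists (fun i => c ^+ i) => a ha.
have -> : \sum_i (a 0 i)%:~R * c ^+ i = (p a).[c].
  rewrite horner_poly; apply: eq_bigr => i _; rewrite insubT //= => lt.
  by congr (_%:~R * _); congr (a 0 _); apply: val_inj.
apply: contraNneq hc => pc; rewrite horner_prod (big_rem a) //= pc mul0r //.
Qed.

End Toral.

(** * Weight spaces of a toral subalgebra *)

Section Weights.
Variables (F : closedFieldType) (n : nat).
Hypothesis F0 : char0 F.
Local Notation mat := 'M[F]_n.+1.
Implicit Types (X Y Z A B H : mat) (t U : {vspace mat}).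

Lemma liebN X Y : lieb X Y = - lieb Y X. Proof. by rewrite /lieb opprB. Qed.
Lemma liebDl X Y Z : lieb (X + Y) Z = lieb X Z + lieb Y Z.
Proof. by rewrite /lieb mulmxDl mulmxDr opprD addrACA. Qed.
Lemma liebZl a X Y : lieb (a *: X) Y = a *: lieb X Y.
Proof. by rewrite /lieb -scalemxAl -scalemxAr scalerBr. Qed.
Lemma liebDr X Y Z : lieb Z (X + Y) = lieb Z X + lieb Z Y.
Proof. by rewrite liebN liebDl opprD -!liebN. Qed.
Lemma liebZr a X Y : lieb Y (a *: X) = a *: lieb Y X.
Proof. by rewrite liebN liebZl -scalerN -liebN. Qed.
Lemma liebb X : lieb X X = 0. Proof. by rewrite /lieb subrr. Qed.
Lemma lieb0 X : lieb X 0 = 0. Proof. by rewrite /lieb mulmx0 mul0mx subrr. Qed.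
Lemma lie0b X : lieb 0 X = 0. Proof. by rewrite /lieb mulmx0 mul0mx subrr. Qed.
Lemma lieb_suml (I : Type) (s : seq I) (P : pred I) (G : I -> mat) X :
  lieb (\sum_(i <- s | P i) G i) X = \sum_(i <- s | P i) lieb (G i) X.
Proof. by apply: (big_morph (fun Y => lieb Y X) (fun Y Z => liebDl Y Z X) (lie0b X)). Qed.

Lemma jacobi X Y Z : lieb X (lieb Y Z) = lieb (lieb X Y) Z + lieb Y (lieb X Z).
Proof.
rewrite /lieb !mulmxBl !mulmxBr !mulmxA.
rewrite !opprB !addrA; do !rewrite -[_ - _ + _]addrA; apply/matrixP => i j; rewrite !mxE; ring.
Qed.

Lemma trace_lieb X Y Z : \tr (lieb X Y *m Z) = - \tr (Y *m lieb X Z).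
Proof.
rewrite /lieb mulmxBl mulmxBr !linearB /= opprB -!mulmxA; congr (_ - _).
by rewrite mxtrace_mulC -mulmxA.
Qed.

Variables (r : nat) (t : {vspace mat}) (Q : mat) (w : 'I_r -> 'I_n.+1 -> int).
Hypothesis td : tdata t Q w.
Let uQ : Q \in unitmx := td_unit td.

Definition om i : mat := diagm Q (fun j => (w i j)%:~R).
Definition isw (a : 'rV[int]_r) X := forall i, lieb (om i) X = (a 0 i)%:~R *: X.
Definition wd (j k : 'I_n.+1) : 'rV[int]_r := \row_i (w i j - w i k).
Definition wts : seq 'rV[int]_r := undup [seq wd p.1 p.2 | p <- enum {: 'I_n.+1 * 'I_n.+1}].
Definition cmx X : mat := Q *m X *m invmx Q.
(** The projection to weight [a]: in the eigenbasis, the matrix entry [j], [k] has weight [wd j k],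
    and the other entries are erased. *)
Definition wcomp (a : 'rV[int]_r) X : mat :=
  invmx Q *m (\matrix_(j, k) (if wd j k == a then cmx X j k else 0)) *m Q.
Definition pairing (a : 'rV[int]_r) (c : 'I_r -> F) : F := \sum_i (a 0 i)%:~R * c i.

Lemma cmxK X : invmx Q *m cmx X *m Q = X.
Proof. by rewrite /cmx !mulmxA mulVmx // mul1mx mulmxKV. Qed.

Lemma cmx_inv A : cmx (invmx Q *m A *m Q) = A.
Proof. by rewrite /cmx !mulmxA mulmxV // mul1mx mulmxK. Qed.

Lemma cmx_inj X Y : cmx X = cmx Y -> X = Y.
Proof. by move=> E; rewrite -(cmxK X) E cmxK. Qed.

Lemma cmxM X Y : cmx (X *m Y) = cmx X *m cmx Y.
Proof. by rewrite /cmx !mulmxA mulmxKV. Qed.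

Lemma cmx_om i : cmx (om i) = diag_mx (\row_j (w i j)%:~R).
Proof. exact: cmx_inv. Qed.

Lemma cmx_lieb_om i X j k : cmx (lieb (om i) X) j k = (wd j k 0 i)%:~R * cmx X j k.
Proof.
have -> : cmx (lieb (om i) X) = cmx (om i) *m cmx X - cmx X *m cmx (om i).
  by rewrite -!cmxM /cmx mulmxBr mulmxBl.
by rewrite cmx_om mul_diag_mx mul_mx_diag !mxE rmorphB mulrBl [X in _ - X]mulrC.
Qed.

Lemma iswP a X : isw a X <-> forall j k, cmx X j k != 0 -> wd j k = a.
Proof.
split=> [h j k X0|h i].
  apply/rowP => i; apply: (char0_intr_inj F0); apply: (mulIf X0).
  rewrite -cmx_lieb_om h /cmx -scalemxAr -scalemxAl mxE //.
apply: cmx_inj; apply/matrixP => j k; rewrite cmx_lieb_om /cmx -scalemxAr -scalemxAl [RHS]mxE.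
rewrite -/(cmx X); have [->|X0] := eqVneq (cmx X j k) 0; first by rewrite !mulr0.
by rewrite (h j k X0).
Qed.

Lemma cmx_wcomp a X j k : cmx (wcomp a X) j k = if wd j k == a then cmx X j k else 0.
Proof. by rewrite cmx_inv mxE. Qed.

Lemma wcomp_isw a X : isw a (wcomp a X).
Proof. by apply/iswP => j k; rewrite cmx_wcomp; case: (eqVneq (wd j k) a) => // _; rewrite eqxx. Qed.

Lemma wcomp_id a X : isw a X -> wcomp a X = X.
Proof.
move/iswP=> h; apply: cmx_inj; apply/matrixP => j k; rewrite cmx_wcomp; case: eqP => // ne.
by apply/esym/eqP; apply: contraT => /h.
Qed.

Lemma wcomp_other a b X : isw a X -> b != a -> wcomp b X = 0.
Proof.
move/iswP=> h ba; apply: cmx_inj; apply/matrixP => j k; rewrite cmx_wcomp /cmx mulmx0 mul0mx [RHS]mxE -/(cmx X).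
case: eqP => // wb; apply/eqP; apply: contraT => ne.
by move: ba; rewrite -(h j k ne) wb eqxx.
Qed.

Lemma cmxD X Y : cmx (X + Y) = cmx X + cmx Y. Proof. by rewrite /cmx mulmxDr mulmxDl. Qed.
Lemma cmxZ c X : cmx (c *: X) = c *: cmx X. Proof. by rewrite /cmx -scalemxAr -scalemxAl. Qed.
Lemma cmx0 : cmx 0 = 0. Proof. by rewrite /cmx mulmx0 mul0mx. Qed.
Lemma cmx_sum (I : Type) (s : seq I) (G : I -> mat) : cmx (\sum_(i <- s) G i) = \sum_(i <- s) cmx (G i).
Proof. exact: (big_morph cmx cmxD cmx0). Qed.

Lemma wcompD a X Y : wcomp a (X + Y) = wcomp a X + wcomp a Y.
Proof.
apply: cmx_inj; apply/matrixP => j k; rewrite cmxD [RHS]mxE !cmx_wcomp cmxD mxE.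
by case: eqP; rewrite ?addr0.
Qed.

Lemma wcompZ a c X : wcomp a (c *: X) = c *: wcomp a X.
Proof.
apply: cmx_inj; apply/matrixP => j k; rewrite cmxZ [RHS]mxE !cmx_wcomp cmxZ mxE.
by case: eqP; rewrite ?mulr0.
Qed.

Lemma wcomp0 a : wcomp a 0 = 0.
Proof. by rewrite -(scale0r (0 : mat)) wcompZ !scale0r. Qed.

Lemma wcomp_sumE a (I : Type) (s : seq I) (P : pred I) (G : I -> mat) :
  wcomp a (\sum_(i <- s | P i) G i) = \sum_(i <- s | P i) wcomp a (G i).
Proof. exact: (big_morph (wcomp a) (wcompD a) (wcomp0 a)). Qed.

Lemma wd_wts j k : wd j k \in wts.
Proof. by rewrite mem_undup; apply/mapP; exists (j, k); rewrite ?mem_enum. Qed.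

Lemma wcomp_decomp X : X = \sum_(a <- wts) wcomp a X.
Proof.
apply: cmx_inj; rewrite cmx_sum; apply/matrixP => j k; rewrite summxE.
rewrite (bigD1_seq (wd j k)) ?wd_wts ?undup_uniq //= cmx_wcomp eqxx big1 ?addr0 // => a.
by rewrite eq_sym cmx_wcomp => /negPf->.
Qed.

Lemma isw_wts a X : isw a X -> X != 0 -> a \in wts.
Proof.
move=> /iswP h X0; have [j [k jk]] : exists j k, cmx X j k != 0.
  apply: contrapT => H; case/eqP: X0; apply: cmx_inj; apply/matrixP => j k; rewrite cmx0 [RHS]mxE.
  by apply/eqP; apply: contraT => jk; case: H; exists j, k.
by rewrite -(h j k jk) wd_wts.
Qed.

Lemma isw_lin a c X Y : isw a X -> isw a Y -> isw a (c *: X + Y).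
Proof. by move=> hX hY i; rewrite liebDr liebZr hX hY scalerDr !scalerA mulrC. Qed.

Lemma isw0 a : isw a 0. Proof. by move=> i; rewrite lieb0 scaler0. Qed.
Lemma iswZ a c X : isw a X -> isw a (c *: X).
Proof. by move=> h; rewrite -[_ *: _]addr0; apply: isw_lin => //; apply: isw0. Qed.

Lemma isw_bracket a b X Y : isw a X -> isw b Y -> isw (a + b) (lieb X Y).
Proof. by move=> ha hb i; rewrite jacobi ha hb liebZl liebZr mxE rmorphD scalerDl. Qed.

Lemma isw_trace a b X Y : isw a X -> isw b Y -> a + b != 0 -> \tr (X *m Y) = 0.
Proof.
move=> ha hb ab; have [i abi] : exists i, (a + b) 0 i != 0.
  apply: contrapT => H; case/eqP: ab; apply/rowP => i; rewrite [RHS]mxE.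
  by apply/eqP; apply: contraT => hi; case: H; exists i.
have := trace_lieb (om i) X Y; rewrite ha hb -scalemxAl -scalemxAr !linearZ /= => /eqP.
rewrite -subr_eq0 opprK -mulrDl -rmorphD mulf_eq0 char0_intr //.
have E : (a + b) 0 i = a 0 i + b 0 i; first by rewrite mxE.
by rewrite -E (negPf abi) => /eqP.
Qed.

Lemma wts_multiples (a b : 'rV[int]_r) : a != 0 -> exists k, forall j, (k <= j)%N -> b + a *+ j \notin wts.
Proof.
move=> a0; have [i ai] : exists i, a 0 i != 0.
  apply: contrapT => H; case/eqP: a0; apply/rowP => i; rewrite mxE.
  by apply/eqP; apply: contraT => hi; case: H; exists i.
pose M := (\max_(c <- wts) `|c 0%R i|)%N.
exists (M + `|b 0%R i|).+1%N => j hj; apply/negP => h.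
have : (`|((b + a *+ j) 0 i)%R| <= M)%N by rewrite /M (big_rem _ h) /= leq_maxl.
have -> : (b + a *+ j) 0 i = b 0 i + a 0 i *+ j by rewrite mxE mulmxnE.
rewrite -mulr_natr natz => le.
have : (j <= `|(a 0 i * j%:Z)%R|)%N by rewrite abszM absz_nat leq_pmull // absz_gt0.
by lia.
Qed.

Lemma iter_lieb_isw a b X Y j : isw a X -> isw b Y -> isw (b + a *+ j) (iter j (lieb X) Y).
Proof.
move=> ha hb; elim: j => [|j IH] /=; first by rewrite mulr0n addr0.
by rewrite mulrS addrCA; apply: isw_bracket.
Qed.

Lemma iter_lieb_nil a b X Y : a != 0 -> isw a X -> isw b Y -> exists j, iter j (lieb X) Y = 0.
Proof.
move=> a0 ha hb; have [k hk] := wts_multiples b a0; exists k; apply/eqP; apply: contraT => h.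
by have := isw_wts (iter_lieb_isw k ha hb) h; rewrite (negPf (hk k (leqnn k))).
Qed.

Lemma isw_nil a X : a != 0 -> isw a X -> nilmx X.
Proof.
move=> a0 ha; have [k hk] := wts_multiples 0 a0; exists k; apply/eqP; apply: contraT => h.
have hX j : isw (a *+ j) (X ^+ j).
  elim: j => [|j IH]; first by move=> i; rewrite mulr0n mxE scale0r /lieb expr0 mulmx1 mul1mx subrr.
  move=> i; have -> : lieb (om i) (X ^+ j.+1) = lieb (om i) X *m X ^+ j + X *m lieb (om i) (X ^+ j).
    by rewrite exprS -[X * _]/(X *m _) /lieb mulmxBl mulmxBr !mulmxA addrA subrK.
  by rewrite ha IH -scalemxAl -scalemxAr -scalerDl exprS mulrS mxE rmorphD.
by have := isw_wts (hX k) h; rewrite -[a *+ k]add0r (negPf (hk k (leqnn k))).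
Qed.

Lemma om_mem i : om i \in t.
Proof.
apply/(td_span td); exists (fun j => (j == i)%:R).
rewrite (bigD1 i) //= eqxx scale1r big1 ?addr0 // => j /negPf->; exact: scale0r.
Qed.

Lemma isw0P X : isw 0 X <-> forall H, H \in t -> H *m X = X *m H.
Proof.
split=> [h H /(td_span td)[c ->]|h i]; last first.
  by rewrite mxE scale0r /lieb h ?subrr // om_mem.
rewrite mulmx_suml mulmx_sumr; apply: eq_bigr => i _; rewrite -scalemxAl -scalemxAr; congr (_ *: _).
by have := h i; rewrite mxE scale0r => /eqP; rewrite subr_eq0 => /eqP.
Qed.

Lemma lieb_toral a c X : isw a X -> lieb (\sum_i c i *: om i) X = pairing a c *: X.
Proof.
move=> h; rewrite lieb_suml /pairing scaler_suml; apply: eq_bigr => i _.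
by rewrite liebZl h scalerA mulrC.
Qed.

(** A generic element of [t] takes distinct values on the finitely many weights, so its bracket
    alone separates the components. *)
Lemma wcomp_mem U a X : (forall i Y, Y \in U -> lieb (om i) Y \in U) -> X \in U -> wcomp a X \in U.
Proof.
move=> sU XU; have [awts|an] := boolP (a \in wts); last first.
  rewrite (_ : wcomp a X = 0) ?mem0v //; apply/eqP; apply: contraT => h.
  by rewrite (isw_wts (wcomp_isw a X) h) in an.
have [|x hx] := @generic_point F F0 r [seq b - c | b <- wts, c <- [seq c <- wts | b != c]].
  by move=> d /allpairsPdep[b [c [_ hc ->]]]; move: hc; rewrite mem_filter subr_eq0 => /andP[bc _].
pose T Y := lieb (\sum_i x i *: om i) Y.
have xb (b c : 'rV[int]_r) : pairing (b - c) x = pairing b x - pairing c x.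
  by rewrite /pairing -sumrB; apply: eq_bigr => i _; rewrite !mxE rmorphB mulrBl.
apply: (@component_mem _ _ T (fun Y => Y \in U) _ _ _ _ _ _ _ wts (fun b => pairing b x) (fun b => wcomp b X)).
- by move=> u v; apply: liebDr.
- by move=> b v; apply: liebZr.
- exact: mem0v.
- by move=> u v; apply: memvD.
- by move=> b v; apply: memvZ.
- move=> v hv; rewrite /T lieb_suml; apply: memv_suml => i _; rewrite liebZl memvZ // sU //.
- exact: undup_uniq.
- move=> b c hb hc E; apply/eqP; apply: contraT => bc.
  have : b - c \in [seq b - c | b <- wts, c <- [seq c <- wts | b != c]].
    by apply/allpairsPdep; exists b, c; rewrite mem_filter bc hc.
  by move/hx; rewrite -/(pairing _ x) xb E subrr eqxx.
- move=> b _; exists 1%N; rewrite /= /shift /T (lieb_toral _ (wcomp_isw b X)) subrr //.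
- by rewrite -wcomp_decomp.
- by [].
Qed.

End Weights.

(** * Root strings and reflections for a nondegenerate trace form *)

Section Roots.
Variables (F : closedFieldType) (n : nat).
Hypothesis F0 : char0 F.
Local Notation mat := 'M[F]_n.+1.
Variables (k t : {vspace mat}) (r : nat) (Q : mat) (w : 'I_r -> 'I_n.+1 -> int).
Implicit Types (X Y Z e f y z : mat) (a b c : 'rV[int]_r).
Hypothesis td : tdata t Q w.
Hypothesis tk : (t <= k)%VS.
Hypothesis bk : bracket_closed k.
Hypothesis nd : forall X, X \in k -> (forall Y, Y \in k -> \tr (X *m Y) = 0) -> X = 0.
Hypothesis ct : forall X, X \in k -> isw Q w 0 X -> X \in t.
Let uQ : Q \in unitmx := td_unit td.
Local Notation om := (om Q w).
Local Notation isw := (isw Q w).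
Local Notation wcomp := (wcomp Q w).

Definition root a := a != 0 /\ exists X, [/\ X \in k, X != 0 & isw a X].

Lemma k_om i : om i \in k. Proof. exact: subvP tk _ (om_mem td i). Qed.

Lemma k_wcomp a X : X \in k -> wcomp a X \in k.
Proof. by move=> Xk; apply: (wcomp_mem F0 td) => // i Y Yk; apply: bk => //; apply: k_om. Qed.

Lemma trace_wcomp a X Y : isw a X -> \tr (X *m Y) = \tr (X *m wcomp (- a) Y).
Proof.
move=> hX; have E b : b != - a -> \tr (X *m wcomp b Y) = 0.
  move=> ba; apply: (isw_trace F0 hX (wcomp_isw F0 td b Y)).
  by apply: contraNneq ba => h; apply/eqP; rewrite -[b]add0r -(addNr a) -addrA h addr0.
rewrite {1}(wcomp_decomp td Y) mulmx_sumr linear_sum /=.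
have [aw|aw] := boolP (- a \in wts w).
  by rewrite (bigD1_seq (- a)) ?undup_uniq //= big1 ?addr0 // => b /E.
rewrite big_seq big1 => [|b hb]; last by apply: E; apply: contraNneq aw => <-.
rewrite (_ : wcomp (- a) Y = 0) ?mulmx0 ?mxtrace0 //.
by apply/eqP; apply: contraT => h; rewrite (isw_wts F0 td (wcomp_isw F0 td (- a) Y) h) in aw.
Qed.

Definition pr a e f := [/\ e \in k, f \in k, isw a e, isw (- a) f & \tr (e *m f) = 1].

Lemma dual_vector a X : X \in k -> X != 0 -> isw a X -> exists f, pr a X f.
Proof.
move=> Xk X0 hX; have [Y Yk XY] : exists2 Y, Y \in k & \tr (X *m Y) != 0.
  apply: contrapT => H; case/eqP: X0; apply: nd => // Y Yk.
  by apply/eqP; apply: contraT => h; case: H; exists Y.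
exists ((\tr (X *m Y))^-1 *: wcomp (- a) Y); split=> //.
- by rewrite memvZ // k_wcomp.
- exact: iswZ (wcomp_isw F0 td _ _).
- by rewrite -scalemxAr linearZ /= -trace_wcomp // mulVf.
Qed.

Lemma prN a e f : pr a e f -> pr (- a) f e.
Proof. by case=> ek fk he hf tef; split=> //; rewrite ?opprK // mxtrace_mulC. Qed.

Lemma pr_neq0 a e f : pr a e f -> e != 0.
Proof. by case=> _ _ _ _; apply: contra_eqN => /eqP->; rewrite mul0mx mxtrace0 eq_sym oner_eq0. Qed.

Lemma root_pr a : root a -> a != 0 /\ exists e f, pr a e f.
Proof. by case=> a0 [X [Xk X0 hX]]; split=> //; exists X; apply: dual_vector. Qed.

Lemma pr_root a e f : a != 0 -> pr a e f -> root a.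
Proof. by move=> a0 h; split=> //; exists e; split; [case: h|exact: pr_neq0 h|case: h]. Qed.

Lemma rootN a : root a -> root (- a).
Proof. by case/root_pr=> a0 [e [f h]]; apply: (pr_root _ (prN h)); rewrite oppr_eq0. Qed.

Definition wmx : 'M[int]_(r, n.+1) := \matrix_(i, l) w i l.
(** The Gram matrix of the trace form on the integral basis of [t]. Its adjugate is used in place of
    its inverse, so that all the forms on weights stay integral. *)
Definition gram : 'M[int]_r := wmx *m wmx^T.
Definition bil a b : int := (a *m \adj gram *m b^T) 0 0.
Definition uvec a : 'rV[int]_n.+1 := a *m \adj gram *m wmx.
(** A multiple, by [\det gram], of the form dual to the scaled trace form; written as a scalar
    product of integer vectors, its positivity is visible. *)
Definition dot a b : int := (uvec a *m (uvec b)^T) 0 0.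
(** The element of [t] that represents the weight [a] under the trace form, multiplied by
    [\det gram]. *)
Definition tau a : mat := \sum_i ((a *m \adj gram) 0 i)%:~R *: om i.

Lemma trace_om i j : \tr (om i *m om j) = (gram i j)%:~R.
Proof.
rewrite /om diagm_mul // diagm_trace // mxE rmorph_sum /=; apply: eq_bigr => l _.
by rewrite !mxE rmorphM.
Qed.

Lemma trace_comb_om (c : 'I_r -> F) j :
  \tr ((\sum_i c i *: om i) *m om j) = \sum_i c i * (gram i j)%:~R.
Proof.
by rewrite mulmx_suml linear_sum /=; apply: eq_bigr => i _; rewrite -scalemxAl linearZ /= trace_om.
Qed.

Lemma toral_nondegenerate X : X \in t -> (forall j, \tr (X *m om j) = 0) -> X = 0.
Proof.
move=> Xt h; apply: nd => [|Y Yk]; first exact: subvP tk _ Xt.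
have X0 : isw 0 X.
  apply/(isw0P td) => H Ht; have [c ->] := (td_span td X).1 Xt; have [d ->] := (td_span td H).1 Ht.
  rewrite !mulmx_suml; under eq_bigr => i _ do rewrite mulmx_sumr.
  rewrite [RHS](eq_bigr (fun i => \sum_j (c i *: om i) *m (d j *: om j))) => [|i _]; last exact: mulmx_sumr.
  rewrite exchange_big; apply: eq_bigr => i _; apply: eq_bigr => j _.
  by rewrite -!scalemxAl -!scalemxAr !scalerA mulrC /om diagm_commute.
have : wcomp 0 Y \in t by apply: ct; [exact: k_wcomp|exact: (wcomp_isw F0 td)].
rewrite (trace_wcomp _ X0) oppr0 => /(td_span td)[c ->].
rewrite mulmx_sumr linear_sum big1 // => j _ /=; rewrite -scalemxAr linearZ /=.
by rewrite [X in _ * X](h j) mulr0.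
Qed.

Lemma det_gram_neq0 : \det gram != 0.
Proof.
apply/eqP => D0; have : \det (map_mx (intmul (1 : F)) gram) == 0.
  by rewrite det_map_mx D0.
case/det0P=> v v0 vG; have : \sum_i v 0 i *: om i = 0.
  apply: toral_nondegenerate => [|j]; first by apply/(td_span td); exists (fun i => v 0 i).
  rewrite trace_comb_om -[RHS](_ : (v *m map_mx (intmul 1) gram) 0 j = 0); last by rewrite vG mxE.
  by rewrite [RHS]mxE; apply: eq_bigr => i _; rewrite [map_mx _ _ _ _]mxE.
move/(td_free td)=> h; case/eqP: v0; apply/rowP => i; rewrite h mxE //.
Qed.

Lemma adj_gram : \adj gram *m gram = (\det gram)%:M. Proof. exact: mul_adj_mx. Qed.

Lemma gram_tr : gram^T = gram. Proof. by rewrite /gram trmx_mul trmxK. Qed.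

Lemma adj_gram_tr : (\adj gram)^T = \adj gram. Proof. by rewrite trmx_adj gram_tr. Qed.

Lemma trace_tau a j : \tr (tau a *m om j) = (\det gram * a 0 j)%:~R.
Proof.
rewrite trace_comb_om; have -> : \det gram * a 0 j = (a *m \adj gram *m gram) 0 j.
  by rewrite -mulmxA adj_gram mul_mx_scalar mxE.
by rewrite [in RHS]mxE rmorph_sum /=; apply: eq_bigr => i _; rewrite rmorphM.
Qed.

Lemma dotE a b : dot a b = \det gram * bil a b.
Proof.
rewrite /dot /uvec !trmx_mul -!mulmxA [wmx *m _]mulmxA -/gram adj_gram_tr.
by rewrite [\adj gram *m (gram *m _)]mulmxA adj_gram mul_scalar_mx -scalemxAr mxE mulmxA.
Qed.

Lemma dotC a b : dot a b = dot b a.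
Proof. by rewrite /dot -[in LHS](trmxK (uvec a)) -trmx_mul mxE. Qed.

Lemma dotDl a b c : dot (a + b) c = dot a c + dot b c.
Proof. by rewrite /dot /uvec !mulmxDl mxE. Qed.
Lemma dotDr a b c : dot c (a + b) = dot c a + dot c b.
Proof. by rewrite dotC dotDl !(dotC c). Qed.
Lemma dotNl a b : dot (- a) b = - dot a b.
Proof. by rewrite /dot /uvec !mulNmx mxE. Qed.
Lemma dotNr a b : dot b (- a) = - dot b a.
Proof. by rewrite dotC dotNl dotC. Qed.
Lemma dotZr a b m : dot b (a *+ m) = dot b a *+ m.
Proof. by elim: m => [|m IH]; rewrite ?mulr0n ?mulrS ?dotDr ?IH // /dot /uvec !mul0mx trmx0 mulmx0 mxE. Qed.
Lemma dotZzr a b (m : int) : dot b (a *~ m) = dot b a * m.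
Proof.
case: m => m; first by rewrite -pmulrn dotZr -mulr_natr natz.
by rewrite NegzE !mulrNz mulrN dotNr -pmulrn dotZr -mulr_natr natz.
Qed.

Lemma dot_gt0 a : a != 0 -> 0 < dot a a.
Proof.
have E : dot a a = \sum_l uvec a 0 l * uvec a 0 l.
  by rewrite /dot [LHS]mxE; apply: eq_bigr => l _; rewrite [in X in _ * X]mxE.
move=> a0; rewrite lt_def E sumr_ge0 ?andbT => [|l _]; last by rewrite -expr2 sqr_ge0.
apply/eqP => /int_sqr_sum0 h; case/eqP: a0.
have u0 : uvec a = 0 by apply/rowP => l; rewrite h mxE.
have : a *m (\adj gram *m gram) = 0 by rewrite /gram !mulmxA -/(uvec a) u0 mul0mx.
by rewrite adj_gram mul_mx_scalar => /eqP; rewrite scalemx_eq0 (negPf det_gram_neq0) /= => /eqP.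
Qed.

Lemma bilDr a b c : bil c (a + b) = bil c a + bil c b.
Proof. by rewrite /bil linearD /= mulmxDr mxE. Qed.

Lemma lieb_tau a b X : isw b X -> lieb (tau a) X = (bil a b)%:~R *: X.
Proof.
move=> h; rewrite (lieb_toral _ h); congr (_ *: _); rewrite /bil /pairing [in RHS]mxE rmorph_sum /=.
by apply: eq_bigr => i _; rewrite rmorphM mulrC [b^T _ _]mxE.
Qed.

Lemma comb_om_mem (c : 'I_r -> F) : \sum_i c i *: om i \in t.
Proof. by apply/(td_span td); exists c. Qed.

Lemma lieb_pr a e f : e \in k -> f \in k -> isw a e -> isw (- a) f ->
  lieb e f = (\tr (e *m f) / (\det gram)%:~R) *: tau a.
Proof.
move=> ek fk he hf; apply/eqP; rewrite -subr_eq0; apply/eqP; apply: toral_nondegenerate => [|j].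
  rewrite rpredB ?memvZ ?comb_om_mem //; apply: ct; first exact: bk.
  by rewrite -(subrr a); apply: isw_bracket.
rewrite mulmxBl linearB /= -scalemxAl linearZ /= trace_tau trace_lieb liebN mulmxN linearN /= opprK he.
rewrite -scalemxAr linearZ /= (mxtrace_mulC f e) rmorphM /= mulrA divfK ?char0_intr //; last exact: det_gram_neq0.
by rewrite mulrC subrr.
Qed.

Definition hval a b : F := (bil a b)%:~R / (\det gram)%:~R.

Lemma lieb_h a e f b X : pr a e f -> isw b X -> lieb (lieb e f) X = hval a b *: X.
Proof.
case=> ek fk he hf tef hX; rewrite (lieb_pr ek fk he hf) tef liebZl (lieb_tau a hX) scalerA mul1r.
by rewrite mulrC.
Qed.

Lemma hvalB a b (j : nat) : hval a (b + (- a) *+ j) = hval a b - j%:R * hval a a.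
Proof.
rewrite /hval mulrA -mulrBl; congr (_ / _).
have N : bil a (- a) = - bil a a.
  by apply: (addrI (bil a a)); rewrite -bilDr !subrr /bil trmx0 mulmx0 mxE.
elim: j => [|j IH]; first by rewrite mulr0n addr0 mul0r subr0.
rewrite mulrSr addrA bilDr rmorphD /= IH N rmorphN /= -natr1; ring.
Qed.

Lemma hval_dot a b (x y : int) : x%:~R * hval a b = y%:~R * hval a a -> x * dot a b = y * dot a a.
Proof.
have D0 : (\det gram)%:~R != 0 :> F by rewrite char0_intr //; exact: det_gram_neq0.
rewrite /hval !mulrA => /(mulIf (invr_neq0 D0)); rewrite -!rmorphM /= => /(char0_intr_inj F0) E.
by rewrite !dotE [x * _]mulrCA E mulrCA.
Qed.

Lemma hval_neq0 a : a != 0 -> hval a a != 0.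
Proof.
move=> a0; have D0 : (\det gram)%:~R != 0 :> F by rewrite char0_intr //; exact: det_gram_neq0.
rewrite mulf_neq0 ?invr_neq0 // char0_intr //.
by have := dot_gt0 a0; rewrite dotE; apply: contraTneq => ->; rewrite mulr0 ltxx.
Qed.

(** The coefficient is the sum of an arithmetic progression of eigenvalues of [lieb e f]; the factor
    2 avoids the fraction. *)
Lemma sl2_formula a e f b y j : pr a e f -> isw b y -> lieb e y = 0 ->
  2 *: lieb e (iter j.+1 (lieb f) y) = (j.+1%:R * (2 * hval a b - j%:R * hval a a)) *: iter j (lieb f) y.
Proof.
move=> h hy ey; have hf : isw (- a) f by case: h.
elim: j => [|j IH] /=.
  by rewrite jacobi (lieb_h h hy) ey lieb0 addr0 scalerA mul0r subr0 mul1r.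
rewrite jacobi (lieb_h h (iter_lieb_isw j.+1 hf hy)) hvalB scalerDr scalerA -liebZr IH liebZr -scalerDl.
congr (_ *: _); rewrite -!natr1; ring.
Qed.

(** The descending string must end, as only finitely many weights occur. At its end the coefficient
    in [sl2_formula] vanishes, which determines the Cartan integer [m]; for smaller indices the
    coefficient is nonzero. *)
Lemma primitive a e f b y : a != 0 -> pr a e f -> isw b y -> y != 0 -> lieb e y = 0 ->
  exists m : nat, [/\ 2 * dot a b = m%:Z * dot a a,
    forall i, (i <= m)%N -> iter i (lieb f) y != 0 &
    forall i, (i < m)%N -> lieb e (iter i.+1 (lieb f) y) != 0].
Proof.
move=> a0 h hy y0 ey; have hf : isw (- a) f by case: h.
have Na0 : - a != 0 by rewrite oppr_eq0.
have two : (2 : F) != 0 by rewrite (F0 2).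
have ex : exists j, iter j (lieb f) y == 0 by have [j /eqP] := iter_lieb_nil F0 td Na0 hf hy; exists j.
case: (ex_minnP ex) => -[|m] /eqP hm mmin; first by case/eqP: y0.
have nz i : (i <= m)%N -> iter i (lieb f) y != 0.
  by move=> im; apply: contraL im => /mmin; rewrite -ltnNge.
have E : 2 * hval a b = m%:R * hval a a.
  have := sl2_formula m h hy ey; rewrite hm lieb0 scaler0 => /esym/eqP.
  rewrite scaler_eq0 (negPf (nz m (leqnn m))) orbF mulf_eq0 F0 /= subr_eq0 => /eqP //.
exists m; split=> //.
- apply: hval_dot; rewrite -[m%:Z%:~R]/(m%:R) -[2%:~R]/(2 : F) E //.
- move=> i im; apply/eqP => E2; have := sl2_formula i h hy ey; rewrite E2 scaler0 E -mulrBl => /esym/eqP.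
  rewrite scaler_eq0 (negPf (nz i (ltnW im))) orbF mulf_eq0 F0 mulf_eq0 (negPf (hval_neq0 a0)) orbF /=.
  by rewrite -natrB 1?ltnW // F0 subn_eq0 leqNgt im.
Qed.

Lemma string_top a e b y : a != 0 -> e \in k -> isw a e -> y \in k -> isw b y -> y != 0 ->
  exists p z, [/\ z \in k, isw (b + a *+ p) z, z != 0 & lieb e z = 0].
Proof.
move=> a0 ek he yk hy y0.
have ex : exists j, iter j (lieb e) y == 0 by have [j /eqP] := iter_lieb_nil F0 td a0 he hy; exists j.
case: (ex_minnP ex) => -[|m] /eqP hm mmin; first by case/eqP: y0.
exists m, (iter m (lieb e) y); split=> //.
- by elim: (m) => //= i; apply: bk.
- exact: iter_lieb_isw.
- by apply/eqP => /eqP/mmin; rewrite ltnn.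
Qed.

Lemma dot_cancel a (x y : int) : a != 0 -> x * dot a a = y * dot a a -> x = y.
Proof. by move=> a0; apply: mulIf; apply: lt0r_neq0; apply: dot_gt0. Qed.

Lemma iter_lieb_mem f y j : f \in k -> y \in k -> iter j (lieb f) y \in k.
Proof. by move=> fk yk; elim: j => //= i; apply: bk. Qed.

(** Subtract the multiple of [e] with the same trace against [f]. The rest commutes with [f], hence
    is primitive for the opposite pair, and a nonzero one would have string length -2. *)
Lemma root_line a e f y : a != 0 -> pr a e f -> y \in k -> isw a y -> exists s, y = s *: e.
Proof.
move=> a0 h yk hy; exists (\tr (y *m f)); apply/eqP; rewrite -subr_eq0; apply: contraT => z0.
set z := y - _ in z0; case: (h) => ek fk he hf tef.
have zk : z \in k by rewrite rpredB ?memvZ.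
have hz : isw a z by rewrite /z addrC -scaleNr; apply: isw_lin.
have tz : \tr (z *m f) = 0 by rewrite mulmxBl linearB /= -scalemxAl linearZ /= tef mulr1 subrr.
have fz : lieb f z = 0 by rewrite liebN (lieb_pr zk fk hz hf) tz mul0r scale0r oppr0.
have Na0 : - a != 0 by rewrite oppr_eq0.
have [m [E _ _]] := primitive Na0 (prN h) hz z0 fz.
move: E; rewrite dotNl dotNr dotNl opprK mulrN -mulNr => /(dot_cancel a0) E; clear -E; lia.
Qed.

(** A string starting at a higher multiple of [a] passes through weight [a] itself. There it is a
    multiple of [e] by [root_line], so [e] kills it, against [primitive]. *)
Lemma root_multiple a j : root a -> root (a *+ j) -> (j <= 1)%N.
Proof.
case/root_pr=> a0 [e [f h]] [_ [y [yk y0 hy]]]; case: (h) => ek fk he hf tef.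
rewrite leqNgt; apply/negP => j2.
have [p [z [zk hz z0 ez]]] := string_top a0 ek he yk hy y0.
move: hz; rewrite -mulrnDr => hz; have [m [E nz nz2]] := primitive a0 h hz z0 ez.
have mE : m = (2 * (j + p))%N.
  by move: E; rewrite [a *+ _]pmulrn dotZzr mulrCA mulrC => /(dot_cancel a0) E; clear -E; lia.
have [[|K] KE] : {K : nat | (j + p = K.+2)%N} by exists (j + p).-2; clear -j2; lia.
  all: rewrite KE in hz mE.
- have [|c E1] := root_line a0 h (iter_lieb_mem 1 fk zk) _.
    by have := iter_lieb_isw 1 hf hz; rewrite mulNrn -mulrnBr.
  by have := nz2 0%N; rewrite E1 liebZr liebb scaler0 eqxx mE => /(_ isT).
- have [|c E1] := root_line a0 h (iter_lieb_mem K.+2 fk zk) _.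
    have := iter_lieb_isw K.+2 hf hz; rewrite mulNrn -mulrnBr //.
    by rewrite subSnn.
  have := nz2 K.+1; rewrite E1 liebZr liebb scaler0 eqxx mE => H.
  by suff: ~~ true by []; apply: H; clear; lia.
Qed.

Lemma root_string a b : root a -> root b -> exists m p : nat,
  2 * dot a b + 2 * p%:Z * dot a a = m%:Z * dot a a /\
  forall i, (i <= m)%N -> exists X, [/\ X \in k, X != 0 & isw (b + a *+ p - a *+ i) X].
Proof.
case/root_pr=> a0 [e [f h]] [_ [y [yk y0 hy]]]; case: (h) => ek fk he hf tef.
have [p [z [zk hz z0 ez]]] := string_top a0 ek he yk hy y0.
have [m [E nz _]] := primitive a0 h hz z0 ez; exists m, p; split=> [|i im].
  by move: E; rewrite dotDr dotZr -mulr_natr natz => <-; ring.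
exists (iter i (lieb f) z); split; [exact: iter_lieb_mem|exact: nz|].
by have := iter_lieb_isw i hf hz; rewrite mulNrn.
Qed.

Lemma root_reflection_pos a b (m : int) : root a -> root b -> 2 * dot a b = m * dot a a -> 0 <= m ->
  root (b - a *~ m).
Proof.
move=> ra rb; have [m' [p [E nz]]] := root_string ra rb; have [a0 _] := ra; have [b0 _] := rb.
move=> E2 m0; have D := dot_gt0 a0; have mE : m = m'%:Z - 2 * p%:Z.
  by apply: (mulIf (lt0r_neq0 D)); rewrite -E2 mulrBl -E; ring.
split; last first.
  have [|X [Xk X0 hX]] := nz (m' - p)%N; first by clear; lia.
  exists X; split=> //; move: hX; congr (isw _ X).
  rewrite -addrA (_ : m = (m' - p)%N%:Z - p%:Z); last by clear -mE m0; lia.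
  by rewrite mulrzBr -!pmulrn opprB.
apply/eqP => /eqP; rewrite subr_eq0 => /eqP bE.
have m00 : m = 0.
  by move: E2; rewrite bE dotZzr mulrCA mulrC => /(dot_cancel a0) E2; clear -E2; lia.
by move: b0; rewrite bE m00 mulr0z eqxx.
Qed.

Lemma root_integral a b : root a -> root b -> exists m : int, 2 * dot a b = m * dot a a.
Proof.
move=> ra rb; have [m [p [E _]]] := root_string ra rb; exists (m%:Z - 2 * p%:Z).
by rewrite mulrBl -E; ring.
Qed.

Theorem root_reflection a b : root a -> root b ->
  exists2 m : int, 2 * dot a b = m * dot a a & root (b - a *~ m).
Proof.
move=> ra rb; have [m E] := root_integral ra rb; exists m => //.
have [m0|m0] := leP 0 m; first exact: root_reflection_pos.
have := @root_reflection_pos (- a) b (- m) (rootN ra) rb.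
by rewrite !dotNl dotNr opprK mulrN E -mulNr oppr_ge0 mulNrz mulrNz opprK => H; apply: H => //; apply: ltW.
Qed.

(** If the bracket were zero, the string descending from the top above weight [a + b] would reach
    weight [b] at a vector not killed by [x]; by [root_line] this vector is a multiple of [y]. *)
Theorem root_bracket a b x y : root a -> root b -> root (a + b) -> x \in k -> y \in k ->
  isw a x -> isw b y -> x != 0 -> y != 0 -> lieb x y != 0.
Proof.
move=> ra rb [_ [z [zk z0 hz]]] xk yk hx hy x0 y0; have [a0 _] := ra; have [b0 _] := rb.
apply/eqP => xy; have [f h] := dual_vector xk x0 hx; case: (h) => _ fk _ hf _.
have [mb [Eb _ _]] := primitive a0 h hy y0 xy.
have [p [z' [zk' hz' z0' ez']]] := string_top a0 xk hx zk hz z0.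
have [m [E nz nz2]] := primitive a0 h hz' z0' ez'.
have mE : m = (mb + 2 * p.+1)%N.
  suff E2 : m%:Z = mb%:Z + 2 * (p%:Z + 1) by clear -E2; lia.
  by apply: (dot_cancel a0); rewrite -E !dotDr [a *+ _]pmulrn dotZzr [(mb%:Z + _) * _]mulrDl -Eb; ring.
have [g hg] := dual_vector yk y0 hy.
have [|c Ec] := root_line b0 hg (iter_lieb_mem p.+1 fk zk') _.
  by have := iter_lieb_isw p.+1 hf hz'; rewrite mulNrn mulrS [a + b]addrC -[b + a + _]addrA addrK.
have := nz2 p; rewrite Ec liebZr xy scaler0 eqxx mE => H.
by suff: ~~ true by []; apply: H; clear; lia.
Qed.

Definition roots : seq 'rV[int]_r := [seq a <- wts w | `[< root a >]].

Lemma rootsP a : reflect (root a) (a \in roots).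
Proof.
rewrite mem_filter; apply: (iffP andP) => [[/asboolP //]|ra]; split; first exact/asboolP.
by case: ra => _ [X [_ X0 hX]]; apply: (isw_wts F0 td hX X0).
Qed.

Lemma roots_uniq : uniq roots. Proof. by rewrite filter_uniq ?undup_uniq. Qed.

Lemma root_decomposition X : X \in k -> wcomp 0 X \in t /\ X = wcomp 0 X + \sum_(a <- roots) wcomp a X.
Proof.
move=> Xk; split; first by apply: ct; [exact: k_wcomp|exact: (wcomp_isw F0 td)].
rewrite {1}(wcomp_decomp td X) (bigID (fun a => a == 0)) /=; congr (_ + _).
  have [z0|z0] := boolP (0 \in wts w).
    by rewrite -big_filter (@filter_pred1_uniq _ _ 0) ?undup_uniq // big_seq1.
  rewrite big_seq_cond big1 => [|a /andP[ha /eqP a0]]; last by rewrite -a0 ha in z0.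
  by apply/esym/eqP; apply: contraT => h; rewrite (isw_wts F0 td (wcomp_isw F0 td 0 X) h) in z0.
rewrite big_filter [RHS]big_mkcond [LHS]big_mkcond; apply: eq_bigr => a _.
case: ifPn => [a0|/negPn/eqP->]; last by case: asboolP => // -[/eqP].
case: asboolP => // ra; apply/eqP; apply: contraT => h; case: ra; split=> //.
by exists (wcomp a X); split; [exact: k_wcomp|exact: h|exact: (wcomp_isw F0 td)].
Qed.
End Roots.

(** * Maximal tori and their characters *)

Section Centralizers.
Variables (F : closedFieldType) (n : nat).
Hypothesis F0 : char0 F.
Local Notation mat := 'M[F]_n.+1.
Implicit Types (X Y Z N A B H g u : mat) (K : set mat) (t U : {vspace mat}).

(** Interpolating the inverse on the eigenvalues gives a polynomial for which the trace counts the
    nonzero eigenvalues. *)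
Lemma diagm_trace_zero Q (w : 'I_n.+1 -> F) : Q \in unitmx ->
  (forall p, \tr (diagm Q w *m horner_mx (diagm Q w) p) = 0) -> diagm Q w = 0.
Proof.
move=> uQ h; have [p hp] := @interpolation F [seq w i | i <- enum 'I_n.+1] (fun x => x^-1).
have {}hp i : p.[w i] = (w i)^-1 by apply: hp; apply: map_f; rewrite mem_enum.
move: (h p); rewrite horner_mx_diagm // diagm_mul // diagm_trace //.
rewrite (eq_bigr (fun i => ((w i != 0) : nat)%:R)) => [|i _]; last first.
  by rewrite hp; have [->|w0] := eqVneq (w i) 0; rewrite ?mul0r // mulfV.
rewrite -natr_sum => /eqP; rewrite F0 sum_nat_eq0 => /forallP w0.
rewrite (_ : w = fun=> 0); first by rewrite diagm_const // raddf0.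
by apply: funext => i; have := w0 i; rewrite eqb0 negbK => /eqP.
Qed.

Lemma lieb_commute H X Y : H *m X = X *m H -> H *m Y = Y *m H -> H *m lieb X Y = lieb X Y *m H.
Proof.
move=> cX cY; rewrite /lieb mulmxBr mulmxBl !mulmxA cX cY.
by rewrite -(mulmxA X H) cY -(mulmxA Y H) cX !mulmxA.
Qed.

(** In the centralizer of [t], the elements trace-orthogonal to all polynomials in elements of [t]
    form an ideal [L]. It consists of nilpotent matrices, since their semisimple parts lie in [t]
    and are orthogonal to their own polynomials. [N] lies in [L] and [Y] normalizes it. *)
Lemma commuting_nil_trace K t N Y : subgroup K -> maxtoral (lie K) t -> N \in lie K -> nilmx N ->
    (forall H, H \in t -> H *m N = N *m H) -> Y \in lie K -> (forall H, H \in t -> H *m Y = Y *m H) ->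
  \tr (N *m Y) = 0.
Proof.
move=> sK mt Nk nN cN Yk cY; have [_ tt _] := mt.
pose P X := [/\ X \in lie K, forall H, H \in t -> H *m X = X *m H &
  forall H q, H \in t -> \tr (X *m horner_mx H q) = 0].
have [|a u v [uk cu tu] [vk cv tv]|L hL] := @vspace_of_pred F _ P.
- split=> [|H _|H q _]; rewrite ?mem0v ?mulmx0 ?mul0mx ?mxtrace0 //.
- split=> [|H Ht|H q Ht]; first by rewrite memvD ?memvZ.
    by rewrite mulmxDr mulmxDl -scalemxAl -scalemxAr cu ?cv.
  by rewrite mulmxDl -scalemxAl linearD linearZ /= tu // tv // mulr0 addr0.
have nilL X : X \in L -> nilmx X.
  move/hL=> [Xk cX tX]; have [m [c [Z [Zt _ nil _]]]] := maxtoral_split F0 sK mt Xk cX.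
  set S := \sum_j _ in nil; have St : S \in t by rewrite memv_suml // => j _; rewrite memvZ.
  suff S0 : S = 0 by move: nil; rewrite S0 subr0.
  have [Q uQ hQ] := tt; have [w Sw] := hQ S St; rewrite Sw; apply: diagm_trace_zero => // q; rewrite -Sw.
  rewrite -[X in \tr (X *m _)](subKr X) mulmxBl linearB /= tX // sub0r nilmx_trace ?oppr0 //.
  apply: nilmx_mulC => //; apply: comm_mx_horner.
  by rewrite /comm_mx mulmxBl mulmxBr cX.
have NL : N \in L.
  apply/hL; split=> // H q Ht; apply: nilmx_trace; apply: nilmx_mulC => //.
  by apply: comm_mx_horner; apply/esym/cN.
apply: (@nil_ideal_trace _ _ L Y) NL => //.
  move=> X Z /hL[Xk cX tX] /hL[Zk cZ tZ]; apply/hL; split=> [|H Ht|H q Ht].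
  - exact: lie_bracket.
  - by apply: lieb_commute; [apply: cX|apply: cZ].
  have cq : Z *m horner_mx H q = horner_mx H q *m Z by apply: comm_mx_horner; apply/esym/cZ.
  by rewrite /lieb mulmxBl linearB /= -mulmxA cq mulmxA mxtrace_mulC mulmxA subrr.
move=> X /hL[Xk cX tX]; apply/hL; split=> [|H Ht|H q Ht].
- exact: lie_bracket.
- by apply: lieb_commute; [apply: cY|apply: cX].
have cq : Y *m horner_mx H q = horner_mx H q *m Y by apply: comm_mx_horner; apply/esym/cY.
by rewrite /lieb mulmxBl linearB /= -[X *m Y *m _]mulmxA cq mulmxA [\tr (X *m _ *m _)]mxtrace_mulC mulmxA subrr.
Qed.

Lemma trace_commuting t (r : nat) Q (w : 'I_r -> 'I_n.+1 -> int) X Y : tdata t Q w ->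
  isw Q w 0 X -> \tr (X *m Y) = \tr (X *m wcomp Q w 0 Y).
Proof.
move=> td hX; have E b : b != 0 -> \tr (X *m wcomp Q w b Y) = 0.
  by move=> b0; apply: (isw_trace F0 hX (wcomp_isw F0 td b Y)); rewrite add0r.
rewrite {1}(wcomp_decomp td Y) mulmx_sumr linear_sum /=.
have [aw|aw] := boolP (0 \in wts w).
  by rewrite (bigD1_seq 0) ?undup_uniq //= big1 ?addr0 // => b /E.
rewrite big_seq big1 => [|b hb]; last by apply: E; apply: contraNneq aw => <-.
rewrite (_ : wcomp Q w 0 Y = 0) ?mulmx0 ?mxtrace0 //.
by apply/eqP; apply: contraT => h; rewrite (isw_wts F0 td (wcomp_isw F0 td 0 Y) h) in aw.
Qed.

Lemma nil_centralizer_radical K t N Y : subgroup K -> maxtoral (lie K) t -> N \in lie K -> nilmx N ->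
  (forall H, H \in t -> H *m N = N *m H) -> Y \in lie K -> \tr (N *m Y) = 0.
Proof.
move=> sK mt Nk nN cN Yk; have [Q [w td]] := tdata_exists F0 sK mt; have [tk _ _] := mt.
rewrite (trace_commuting Y td); last exact/(isw0P td).
apply: (commuting_nil_trace sK mt) => //; last by apply/(isw0P td); exact: (wcomp_isw F0 td).
by apply: (wcomp_mem F0 td) => // i Z Zk; apply: lie_bracket => //; apply: (subvP tk); apply: om_mem td _.
Qed.

(** [X] differs from an element of [t] by a nilpotent matrix of the centralizer, which is
    trace-orthogonal to all of [lie K]. *)
Theorem maxtoral_centralizer K t X : subgroup K -> maxtoral (lie K) t ->
    (forall X, X \in lie K -> (forall Y, Y \in lie K -> \tr (X *m Y) = 0) -> X = 0) ->
  X \in lie K -> (forall H, H \in t -> H *m X = X *m H) -> X \in t.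
Proof.
move=> sK mt nd Xk cX; have [tk tt _] := mt.
have [m [c [Z [Zt _ nil _]]]] := maxtoral_split F0 sK mt Xk cX.
set S := \sum_j _ in nil; have St : S \in t by rewrite memv_suml // => j _; rewrite memvZ.
suff -> : X = S by [].
have Nk : X - S \in lie K by rewrite memvB // (subvP tk).
apply/eqP; rewrite -subr_eq0; apply/eqP; apply: nd => // Y Yk.
apply: (nil_centralizer_radical sK mt) => // H Ht.
by rewrite mulmxBl mulmxBr cX // (toral_commute tt Ht St).
Qed.

Lemma cmx_diagm Q (w : 'I_n.+1 -> F) : Q \in unitmx -> cmx Q (diagm Q w) = diag_mx (\row_i w i).
Proof. by move=> uQ; rewrite /cmx /diagm !mulmxA mulmxV // mul1mx mulmxK. Qed.

Lemma psg_isw Q (r : nat) (w : 'I_r -> 'I_n.+1 -> int) t (td : tdata t Q w) b X i z :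
  z != 0 -> isw Q w b X -> psg Q (w i) z *m X *m psg Q (w i) z^-1 = z ^ b 0 i *: X.
Proof.
move=> z0 hX; have uQ := td_unit td.
apply: (cmx_inj td); rewrite (cmxM td) (cmxM td) /psg !cmx_diagm // cmxZ.
move: ((iswP F0 td b X).1 hX); move: (cmx Q X) => M hM.
apply/matrixP => j l; rewrite mul_mx_diag mul_diag_mx !mxE.
have [->|X0] := eqVneq (M j l) 0; first by rewrite mulr0 mul0r mulr0.
have /rowP/(_ i) := hM j l X0; rewrite mxE => <-.
by rewrite mulrAC exprz_inv -expfzDr.
Qed.

(** The number 2 has infinite multiplicative order in characteristic zero, so one point of a
    multiplicative subgroup tells its weights apart. *)
Lemma exprz2_inj (x y : int) : (2 : F) ^ x = 2 ^ y -> x = y.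
Proof.
have two : (2 : F) != 0 by rewrite F0.
have pw (p q : nat) : (2 : F) ^+ p = 2 ^+ q -> p = q.
  rewrite -!natrX => /eqP; rewrite -subr_eq0; have [pq|qp] := leqP p q.
    by rewrite -opprB oppr_eq0 -natrB ?leq_pexp2l // F0 subn_eq0 leq_exp2l // => qp; apply/eqP; rewrite eqn_leq pq.
  by rewrite -natrB ?leq_pexp2l // 1?ltnW // F0 subn_eq0 leq_exp2l // leqNgt qp.
move=> E; have : (2 : F) ^ (x + `|x| + `|y|) = 2 ^ (y + `|x| + `|y|) by rewrite !expfzDr // E.
have [p Ep] : exists p : nat, x + `|x| + `|y| = p by exists (absz (x + `|x| + `|y|)); clear; lia.
have [q Eq] : exists q : nat, y + `|x| + `|y| = q by exists (absz (y + `|x| + `|y|)); clear; lia.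
by rewrite Ep Eq => /pw h; clear -h Ep Eq; lia.
Qed.

(** Split [X] into a nilpotent part and integral replicas. For the former, differentiate conjugation
    by exponentials. For the latter, conjugation by the one-parameter subgroup at 2 already
    separates the weight components of [u], which therefore lie in [U]. *)
Lemma Ad_stable_lie K U X u : closed_subgroup K ->
    (forall g v, K g -> v \in U -> g *m v *m invmx g \in U) -> X \in lie K -> u \in U -> lieb X u \in U.
Proof.
move=> cK sU Xk uU; have [sK _] := cK.
have [m [c [Q [a [uQ _ hq nil hK]]]]] := replicas F0 X; set S := \sum_j _ in nil.
have Yk j : diagm Q (fun i => (a j i)%:~R) \in lie K by apply: hK.
rewrite -(subrK S X) liebDl memvD //.
  have [e [E D]] := Ad_expm_curve F0 u nil; rewrite -D; apply: (curve_deriv_mem F0) => s _; rewrite E.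
  by apply: sU => //; apply: expm_mem => //; rewrite memvB // memv_suml // => j _; rewrite memvZ.
rewrite lieb_suml memv_suml // => j _; rewrite liebZl memvZ //; set Y := diagm Q _.
have [->|Y0] := eqVneq Y 0; first by rewrite lie0b mem0v.
have td : tdata <[Y]> Q (fun _ : 'I_1 => a j).
  split=> // [Z|d]; last by rewrite big_ord1 => /eqP; rewrite scaler_eq0 (negPf Y0) orbF => /eqP d0 i; rewrite ord1.
  split=> [/vlineP[d ->]|[d ->]]; last by rewrite big_ord1 memvZ ?memv_line.
  by exists (fun=> d); rewrite big_ord1.
have psgK : K (psg Q (a j) 2) by apply: psg_mem => //; rewrite F0.
have two : (2 : F) != 0 by rewrite F0.
pose T v := psg Q (a j) 2 *m v *m invmx (psg Q (a j) 2).
have Ti : invmx (psg Q (a j) 2) = psg Q (a j) 2^-1.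
  by rewrite -[LHS]mulmx1 -(psgM (a j) uQ two) mulKmx // psg_unit.
have TE b v : isw Q (fun _ : 'I_1 => a j) b v -> T v = 2 ^ b 0 0 *: v.
  by rewrite /T Ti => h; apply: (psg_isw td 0).
have comp b : wcomp Q (fun _ : 'I_1 => a j) b u \in U.
  have [bw|bw] := boolP (b \in wts (fun _ : 'I_1 => a j)); last first.
    rewrite (_ : wcomp _ _ _ _ = 0) ?mem0v //; apply/eqP; apply: contraT => h.
    by rewrite (isw_wts F0 td (wcomp_isw F0 td b u) h) in bw.
  apply: (@component_mem _ _ T (fun Y => Y \in U) _ _ _ _ _ _ _ (wts (fun _ : 'I_1 => a j))
    (fun b => 2 ^ b 0 0) (fun b => wcomp Q (fun _ : 'I_1 => a j) b u)).
  - by move=> v v'; rewrite /T mulmxDr mulmxDl.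
  - by move=> d v; rewrite /T -scalemxAr -scalemxAl.
  - exact: mem0v.
  - by move=> v v'; apply: memvD.
  - by move=> d v; apply: memvZ.
  - by move=> v vU; apply: sU.
  - exact: undup_uniq.
  - move=> b1 b2 _ _ E; apply/rowP => i; rewrite ord1; exact: exprz2_inj E.
  - by move=> b' _; exists 1%N; rewrite /= /shift (TE _ _ (wcomp_isw F0 td b' u)) subrr.
  - by rewrite -(wcomp_decomp td).
  - by [].
rewrite (wcomp_decomp td u) liebN (lieb_suml) -sumrN memv_suml // => b _; rewrite -liebN.
by have := wcomp_isw F0 td b u ord0; rewrite /om => ->; rewrite memvZ.
Qed.

Lemma spanned_basis (P : mat -> Prop) U : (forall X, X \in U -> exists (I : finType) (c : I -> F) (Y : I -> mat),
    X = \sum_i c i *: Y i /\ forall i, P (Y i) /\ Y i \in U) ->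
  exists s : seq mat, basis_of U s /\ forall Y, Y \in s -> P Y.
Proof.
move=> hU; suff H d : (d <= \dim U)%N -> exists s : seq mat, [/\ free s, forall Y, Y \in s -> P Y /\ Y \in U & size s = d].
  have [s [fs hs ss]] := H _ (leqnn _); exists s; split; last by move=> Y /hs[].
  by rewrite basisEfree fs ss leqnn andbT; apply/span_subvP => Y /hs[].
elim: d => [|d IH] dU; first by exists [::]; rewrite nil_free.
have [s [fs hs ss]] := IH (ltnW dU).
have : ~~ (U <= <<s>>)%VS by apply/negP => /dimvS; move/eqP: (fs) => ->; rewrite ss leqNgt dU.
case/subvPn => X XU Xs; have [I [c [Y [XE hY]]]] := hU X XU.
have [i Yi] : exists i, Y i \notin <<s>>%VS.
  apply: contrapT => H; case/negP: Xs; rewrite XE memv_suml // => i _; rewrite memvZ //.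
  by apply: contraT => h; case: H; exists i.
exists (Y i :: s); split; rewrite ?free_cons ?Yi //= ?ss // => Z.
by rewrite inE => /orP[/eqP->|/hs].
Qed.

(** The replicas and the nilpotent remainder of any element span it. Such a basis has a controlled
    action on polynomials of bounded degree. *)
Lemma lie_basis K : subgroup K -> exists s : seq mat, basis_of (lie K) s /\
  forall Y, Y \in s -> nilmx Y \/ integral_elt Y.
Proof.
move=> sK; apply: spanned_basis => X Xk; have [m [c [Q [a [uQ _ hq nil hK]]]]] := replicas F0 X.
have Yk j : diagm Q (fun i => (a j i)%:~R) \in lie K by apply: hK.
set S := \sum_j _ in nil; exists ('I_m + unit)%type, (fun o => if o is inl j then c j else 1),
  (fun o => if o is inl j then diagm Q (fun i => (a j i)%:~R) else X - S); split.
  by rewrite big_sumType /= big_const card_unit /= addr0 scale1r addrC subrK.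
move=> [j|u]; split=> //; first by right; exists Q => //; exists (a j).
  by left.
by rewrite memvB // memv_suml // => j _; rewrite memvZ.
Qed.
End Centralizers.

(** * Characters, maximal tori and root data *)

Section Characters.
Variables (F : closedFieldType) (n : nat).
Hypothesis F0 : char0 F.
Local Notation mat := 'M[F]_n.+1.
Implicit Types (X Y A B E : mat) (K T S : set mat) (f g : mat -> F).

Lemma regular_onP T f : (forall A, T A -> A \in unitmx) ->
  regular_on T f <-> exists2 g, regfun g & forall A, T A -> f A = g A.
Proof.
move=> uT; split=> [[p [k h]]|[g [k [P hP]] fg]].
  exists (fun A => mxeval p A / \det A ^+ k) => //; exists k, p => A uA.
  by rewrite mulrCA divff ?mulr1 // expf_neq0 // -unitfE.
exists P, k => A TA; have uA := uT A TA; rewrite fg // hP // mulrC mulKf // expf_neq0 // -unitfE //.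
Qed.

Lemma regfun_inv f k p : (forall A, A \in unitmx -> f A = mxeval p (invmx A) * \det A ^+ k) -> regfun f.
Proof.
move=> h; apply: regfun_ext (fun A uA => esym (h A uA)) _.
apply: regfunM; first exact: regmx_mxeval (@regmx_inv F n).
elim: k {h} => [|k IH]; first exact: regfun_cst.
apply: (regfun_ext (f := fun A => \det A * \det A ^+ k)) => [A _|]; first by rewrite exprS.
by apply: regfunM => //; apply: (regfun_det (f := fun A => A)); apply: regmx_id.
Qed.

Section Group.
Variable T : set mat.
Hypothesis sT : subgroup T.
Let uT := subgroup_unit sT.

Lemma char_one f : character T f -> f 1%:M = 1.
Proof.
move=> cf; have := character_mul cf (subgroup_one sT) (subgroup_one sT); rewrite mulmx1 => /eqP.
by rewrite -[X in X == _]mulr1 (inj_eq (mulfI (character_neq0 cf (subgroup_one sT)))) => /eqP.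
Qed.

Lemma char_invmx f A : character T f -> T A -> f (invmx A) = (f A)^-1.
Proof.
move=> cf TA; apply: (mulfI (character_neq0 cf TA)); rewrite divff ?(character_neq0 cf TA) //.
by rewrite -(character_mul cf TA (subgroup_inv sT TA)) mulmxV ?uT // char_one.
Qed.

Lemma character1 : character T (fun=> 1).
Proof.
split=> [|A _|A B _ _]; rewrite ?oner_eq0 ?mulr1 //; apply/(regular_onP _ uT).
by exists (fun=> 1) => //; apply: regfun_cst.
Qed.

Lemma characterM f g : character T f -> character T g -> character T (fun A => f A * g A).
Proof.
move=> cf cg; split=> [|A TA|A B TA TB]; last by rewrite (character_mul cf) // (character_mul cg) // mulrACA.
  have [f' rf Ef] := (regular_onP _ uT).1 (character_regular cf).
  have [g' rg Eg] := (regular_onP _ uT).1 (character_regular cg).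
  by apply/(regular_onP _ uT); exists (fun A => f' A * g' A) => [|A TA]; [apply: regfunM|rewrite Ef // Eg].
by rewrite mulf_neq0 ?(character_neq0 cf) ?(character_neq0 cg).
Qed.

Lemma characterV f : character T f -> character T (fun A => (f A)^-1).
Proof.
move=> cf; split=> [|A TA|A B TA TB]; last by rewrite (character_mul cf) // invfM.
  have [p [k h]] := character_regular cf; apply/(regular_onP _ uT).
  exists (fun A => mxeval p (invmx A) * \det A ^+ k); first exact: (@regfun_inv _ k p).
  by move=> A TA; rewrite -char_invmx // (h _ (subgroup_inv sT TA)) det_inv exprVn invrK.
by rewrite invr_eq0 (character_neq0 cf).
Qed.

Lemma characterX f (z : int) : character T f -> character T (fun A => f A ^ z).
Proof.
move=> cf; have E (m : nat) : character T (fun A => f A ^+ m).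
  elim: m => [|m IH]; first exact: character1.
  by have := characterM cf IH; congr (character T _); apply: funext => A; rewrite exprS.
by case: z => m; [exact: E|exact: characterV (E m.+1)].
Qed.

Lemma char_comb_character r (alpha : 'I_r -> mat -> F) v : (forall i, character T (alpha i)) ->
  character T (char_comb alpha v).
Proof.
move=> ca; have E (s : seq 'I_r) : character T (fun A => \prod_(i <- s) alpha i A ^ v 0 i).
  elim: s => [|i s IH].
    by have := character1; congr (character T _); apply: funext => A; rewrite big_nil.
  have := characterM (characterX (v 0 i) (ca i)) IH; congr (character T _).
  by apply: funext => A; rewrite big_cons.
exact: E.
Qed.
End Group.

Lemma lie_commute K E X : (forall A, K A -> A *m E = E *m A) -> X \in lie K -> X *m E = E *m X.
Proof.
move=> hK /lieP hX; apply/matrixP => i j.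
have colEE (A : mat) : (A *m E) i j = (A *m col j E) i 0.
  by rewrite !mxE; apply: eq_bigr => l _; rewrite [in RHS]mxE.
have rowE (A : mat) : (E *m A) i j = \sum_l E i l * (A *m (delta_mx j 0 : 'cV[F]_n.+1)) l 0.
  by rewrite mxE; apply: eq_bigr => l _; rewrite -colE [in RHS]mxE.
pose p := linform i (col j E) - \sum_l E i l *: linform l (delta_mx j 0).
have pE A : mxeval p A = (A *m E) i j - (E *m A) i j.
  rewrite /p mxevalB mxeval_linform mxeval_sum colEE rowE; congr (_ - _).
  by apply: eq_bigr => l _; rewrite mxevalZ mxeval_linform.
have vp : vanish K p by move=> A KA; rewrite pE (hK A KA) subrr.
have := hX p vp; rewrite /p iderB ider_linform ider_sum mxevalB mxeval_linform mxeval_sum.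
rewrite mul1mx colEE rowE => /eqP; rewrite subr_eq0 => /eqP->.
by apply: eq_bigr => l _; rewrite iderZ mxevalZ ider_linform mxeval_linform mul1mx.
Qed.

(** A diagonal matrix with distinct eigenvalues: being diagonal in the basis of [Q] amounts to
    commuting with it, a closed linear condition. *)
Definition spread Q : mat := diagm Q (fun i => (i : nat)%:R).

Lemma commute_spread Q X : Q \in unitmx -> X *m spread Q = spread Q *m X -> exists w, X = diagm Q w.
Proof.
move=> uQ cX; apply: is_diagm => //; apply/is_diag_mxP => i j ij.
have : Q *m (X *m spread Q) *m invmx Q = Q *m (spread Q *m X) *m invmx Q by rewrite cX.
have -> : Q *m (X *m spread Q) *m invmx Q = (Q *m X *m invmx Q) *m diag_mx (\row_i (i : nat)%:R).
  by rewrite /spread /diagm !mulmxA mulmxK.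
have -> : Q *m (spread Q *m X) *m invmx Q = diag_mx (\row_i (i : nat)%:R) *m (Q *m X *m invmx Q).
  by rewrite /spread /diagm !mulmxA mulmxV // mul1mx.
move: (Q *m X *m invmx Q) => M /matrixP/(_ i j); rewrite mul_mx_diag mul_diag_mx !mxE => /eqP.
rewrite -subr_eq0 mulrC -mulrBl mulf_eq0 => /orP[|/eqP //]; rewrite subr_eq0 => /eqP E.
by case/eqP: ij; apply/esym; apply: (char0_natr_inj F0).
Qed.

Lemma torus_toral K : torus K -> toral (lie K).
Proof.
move=> [_ [Q uQ hQ]]; exists Q => // X Xk; apply: commute_spread => //; apply: lie_commute Xk => A KA.
by have [w ->] := is_diagm uQ (hQ A KA); apply: diagm_commute.
Qed.
End Characters.

Section Tori.
Variables (F : closedFieldType) (n : nat).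
Hypothesis F0 : char0 F.
Local Notation mat := 'M[F]_n.+1.
Implicit Types (X Y A B E : mat) (K S : set mat) (f g : mat -> F).
Variables (r : nat) (t : {vspace mat}) (Q : mat) (w : 'I_r -> 'I_n.+1 -> int).
Hypothesis td : tdata t Q w.
Let uQ : Q \in unitmx := td_unit td.

Definition tgen : set mat := fun A => exists i, exists2 z : F, z != 0 & A = psg Q (w i) z.
(** The torus attached to a toral subalgebra: the closure of the group generated by the
    multiplicative subgroups of its integral basis. *)
Definition tgroup : set mat := zcl (generated tgen).

Lemma tgen_unit A : tgen A -> A \in unitmx.
Proof. by case=> i [z z0 ->]; apply: psg_unit. Qed.

Lemma tgenerated_unit A : generated tgen A -> A \in unitmx.
Proof. exact: (subgroup_unit (generated_subgroup tgen_unit)). Qed.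

Lemma tgroup_connected : closed_connected tgroup.
Proof.
have := @generated_connected F n 'I_r (fun i A => exists2 z : F, z != 0 & A = psg Q (w i) z).
rewrite -/tgen -/tgroup; apply.
- by move=> i A [z z0 ->]; apply: psg_unit.
- by move=> i; apply: psg_connected.
- by move=> i; exists 1; rewrite ?oner_eq0 ?psg1.
Qed.

Lemma tgroup_subgroup : subgroup tgroup. Proof. by case: tgroup_connected => -[]. Qed.

Lemma tgroup_psg i z : z != 0 -> tgroup (psg Q (w i) z).
Proof. by move=> z0; apply: zcl_sub; [exact: tgenerated_unit|apply: generated_mem; exists i, z]. Qed.

Lemma tgroup_min K : closed_subgroup K -> (forall i, om Q w i \in lie K) -> forall A, tgroup A -> K A.
Proof.
move=> cK hK; apply: zcl_min => // A; apply; first by case: cK.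
by move=> _ [i [z z0 ->]]; apply: psg_mem => //; apply: hK.
Qed.

Lemma sub_lie_tgroup : (t <= lie tgroup)%VS.
Proof.
apply/subvP => X /(td_span td)[c ->]; apply: memv_suml => i _; rewrite memvZ //.
by apply: psg_lie => // z; apply: tgroup_psg.
Qed.

Lemma tgroup_regfun f : regfun f -> (forall A, generated tgen A -> f A = 0) -> forall A, tgroup A -> f A = 0.
Proof. by move=> rf hf; apply: regfun_zcl => //; apply: tgenerated_unit. Qed.

Lemma tgroup_diagm A : tgroup A -> exists d, A = diagm Q d.
Proof.
move=> TA; apply: (commute_spread F0) => //; apply/matrixP => i j; apply/eqP; rewrite -subr_eq0; apply/eqP.
pose f B := (B *m spread Q) i j - (spread Q *m B) i j.
apply: (@tgroup_regfun f) TA => [|B].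
  have R1 := regmx_mul (@regmx_id F n) (@regmx_cst F n _ _ (spread Q)).
  have R2 := regmx_mul (@regmx_cst F n _ _ (spread Q)) (@regmx_id F n).
  apply: (regfun_ext (f := fun B => (B *m spread Q) i j + (-1) * (spread Q *m B) i j)).
    by move=> B _; rewrite mulN1r.
  by apply: regfunD; [exact: R1|apply: regfunM; [exact: regfun_cst|exact: R2]].
move/(_ (fun B => B \in unitmx /\ B *m spread Q = spread Q *m B)%classic).
case=> [|_ [i' [z z0 ->]]|_ cB]; last by rewrite /f cB subrr.
- split=> [C []//||B1 C [uB cB] [uC cC]|B1 [uB cB]].
  + by split; rewrite ?unitmx1 ?mulmx1 ?mul1mx.
  + by rewrite unitmx_mul uB uC; split=> //; rewrite -mulmxA cC mulmxA cB mulmxA.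
  + rewrite unitmx_inv; split=> //; apply: (can_inj (mulKmx uB)); apply: (can_inj (mulmxK uB)).
    by rewrite mulmxA mulmxV // mul1mx mulmxA cB -!mulmxA mulVmx // mulmx1.
- by rewrite psg_unit //; split=> //; apply: diagm_commute.
Qed.

Definition cd j A : F := cmx Q A j j.

Lemma tgroup_cd A : tgroup A -> A = diagm Q (fun j => cd j A).
Proof.
move/tgroup_diagm => [d Ad]; rewrite {1}Ad; congr diagm; apply: funext => j.
by rewrite /cd Ad cmx_diagm // !mxE eqxx.
Qed.

Lemma cd_psg i j z : cd j (psg Q (w i) z) = z ^ w i j.
Proof. by rewrite /cd /psg cmx_diagm // !mxE eqxx. Qed.

Lemma cd_character j : character tgroup (cd j).
Proof.
have sT := tgroup_subgroup; have uT := subgroup_unit sT.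
have M A B : tgroup A -> tgroup B -> cd j (A *m B) = cd j A * cd j B.
  move=> /tgroup_diagm[d ->] /tgroup_diagm[d' ->].
  by rewrite /cd diagm_mul // !cmx_diagm // !mxE eqxx.
split=> // [|A TA].
  apply/(regular_onP _ uT); exists (cd j) => //.
  exact: (regmx_mul (regmx_mul (@regmx_cst F n _ _ Q) (@regmx_id F n)) (@regmx_cst F n _ _ (invmx Q))).
apply/eqP => E; have := M A (invmx A) TA (subgroup_inv sT TA); rewrite mulmxV ?uT // E mul0r.
by rewrite /cd /cmx mulmx1 mulmxV // mxE eqxx => /eqP; rewrite oner_eq0.
Qed.

(** Agreement spreads multiplicatively from the generators to the generated group, and then to its
    closure by regularity. *)
Lemma character_eq f g : character tgroup f -> character tgroup g ->
  (forall i z, z != 0 -> f (psg Q (w i) z) = g (psg Q (w i) z)) -> forall A, tgroup A -> f A = g A.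
Proof.
move=> cf cg fg A TA; have sT := tgroup_subgroup; have uT := subgroup_unit sT.
have [f' rf Ef] := (regular_onP _ uT).1 (character_regular cf).
have [g' rg Eg] := (regular_onP _ uT).1 (character_regular cg).
rewrite Ef // Eg //; apply/eqP; rewrite -subr_eq0; apply/eqP; pose h B := f' B - g' B.
apply: (@tgroup_regfun h) TA => [|B].
  apply: (regfun_ext (f := fun B => f' B + (-1) * g' B)) => [B _|]; first by rewrite mulN1r.
  by apply: regfunD => //; apply: regfunM => //; apply: regfun_cst.
move/(_ (fun B => tgroup B /\ f B = g B)%classic).
case=> [|_ [i [z z0 ->]]|TB fB]; last by rewrite /h -Ef // -Eg // fB subrr.
- split=> [C []/uT//||C D [TB fB] [TC fC]|C [TB fB]].
  + by split; [exact: (subgroup_one sT)|rewrite (char_one sT cf) (char_one sT cg)].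
  + by split; [exact: (subgroup_mul sT)|rewrite (character_mul cf) // (character_mul cg) // fB fC].
  + by split; [exact: (subgroup_inv sT)|rewrite (char_invmx sT cf) // (char_invmx sT cg) // fB].
- by split; [exact: tgroup_psg|exact: fg].
Qed.

(** The character by which conjugation acts on the matrix entry [j], [k] in the eigenbasis; its
    weight is [wd w j k]. *)
Definition rchar j k A : F := cd j A * (cd k A)^-1.

Lemma rchar_character j k : character tgroup (rchar j k).
Proof. exact: (characterM tgroup_subgroup (cd_character j) (characterV tgroup_subgroup (cd_character k))). Qed.

Lemma rchar_psg i j k z : z != 0 -> rchar j k (psg Q (w i) z) = z ^ wd w j k 0 i.
Proof. by move=> z0; rewrite /rchar !cd_psg mxE invr_expz -expfzDr. Qed.

Lemma tgroup_conj A X j k : tgroup A -> cmx Q (A *m X *m invmx A) j k = rchar j k A * cmx Q X j k.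
Proof.
move=> TA; have sT := tgroup_subgroup; have TV := subgroup_inv sT TA.
rewrite (tgroup_cd TV) {1}(tgroup_cd TA) (cmxM td) (cmxM td) !cmx_diagm //.
rewrite /rchar -(char_invmx sT (cd_character k) TA); move: (cmx Q X) => M.
by rewrite mul_mx_diag mul_diag_mx !mxE mulrAC.
Qed.

Lemma rchar_action A X b j k : tgroup A -> isw Q w b X -> wd w j k = b ->
  A *m X *m invmx A = rchar j k A *: X.
Proof.
move=> TA hX jk; apply: (cmx_inj td); apply/matrixP => j' k'; rewrite tgroup_conj // cmxZ [RHS]mxE.
have [->|X0] := eqVneq (cmx Q X j' k') 0; first by rewrite !mulr0.
congr (_ * _); apply: character_eq TA; try exact: rchar_character.
by move=> i z z0; rewrite !rchar_psg // ((iswP F0 td b X).1 hX j' k' X0) jk.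
Qed.

Lemma weight_of_character f X : X != 0 -> (forall A, tgroup A -> A *m X *m invmx A = f A *: X) ->
  exists j k, [/\ isw Q w (wd w j k) X, cmx Q X j k != 0 & forall A, tgroup A -> f A = rchar j k A].
Proof.
move=> X0 hX; have [j [k jk]] : exists j k, cmx Q X j k != 0.
  apply: contrapT => H; case/eqP: X0; apply: (cmx_inj td); apply/matrixP => j k.
  rewrite cmx0 [RHS]mxE; by apply/eqP; apply: contraT => jk; case: H; exists j, k.
have fE j' k' A : tgroup A -> cmx Q X j' k' != 0 -> f A = rchar j' k' A.
  move=> TA nz; apply: (mulIf nz); rewrite -tgroup_conj // hX // cmxZ [RHS]mxE //.
exists j, k; split=> // [|A TA]; last exact: fE.
apply/(iswP F0 td) => j' k' jk'; apply/rowP => i; apply: (exprz2_inj F0).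
have two : (2 : F) != 0 by rewrite F0.
by rewrite -!rchar_psg // -!fE //; apply: tgroup_psg.
Qed.

Lemma tgroup_torus : torus tgroup.
Proof.
split; first exact: tgroup_connected.
by exists Q => // A /tgroup_diagm[d ->]; apply: diagm_is_diag.
Qed.

Lemma tgroup_maximal K : closed_subgroup K -> maxtoral (lie K) t -> maximal_torus K tgroup.
Proof.
move=> cK [tk tt tmax]; split; [|exact: tgroup_torus|].
  by move=> A; apply: tgroup_min => // i; apply: (subvP tk); apply: om_mem td i.
move=> T' tT' TT' T'K; apply/seteqP; split=> // A T'A.
have [cT' _] := tT'; apply: (connected_sub F0 cT' _ _ T'A); first by case: tgroup_connected.
apply: subv_trans sub_lie_tgroup; apply: tmax; [|exact: lie_sub|exact: torus_toral].
by apply: subv_trans sub_lie_tgroup _; apply: lie_sub.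
Qed.
End Tori.

(** [lie T] extends to a maximal toral subalgebra; its torus contains [T] by comparison of Lie
    algebras, so it equals [T] by maximality. *)
Lemma maximal_torus_data (F : closedFieldType) (n : nat) (K T : set 'M[F]_n.+1) : char0 F ->
    closed_subgroup K -> maximal_torus K T ->
  exists t r Q (w : 'I_r -> 'I_n.+1 -> int), [/\ maxtoral (lie K) t, tdata t Q w & T = tgroup Q w].
Proof.
move=> F0 cK [TK tT Tmax]; have [sK _] := cK.
have [t mt Tt] := maxtoral_extend (lie_sub TK) (torus_toral F0 tT).
have [Q [w td]] := tdata_exists F0 sK mt; exists t, (\dim t), Q, w; split=> //; apply/esym.
have [TtK Tt' _] := tgroup_maximal F0 td cK mt.
apply: Tmax => // A TA; have [cT _] := tT.
apply: (connected_sub F0 cT _ _ TA); first by case: (tgroup_connected F0 td).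
exact: subv_trans Tt (sub_lie_tgroup F0 td).
Qed.

Lemma int_row_kernel m p (A : 'M[int]_(m, p)) : (\rank (map_mx (intmul (1 : rat)) A) < m)%N ->
  exists2 v : 'rV[int]_m, v != 0 & v *m A = 0.
Proof.
move=> lt; have : ~~ row_free (map_mx (intmul (1 : rat)) A) by rewrite -row_leq_rank -ltnNge.
rewrite -kermx_eq0 => /rowV0Pn[v /sub_kermxP vA v0].
have [q [d d0 Eq]] := rat_poly_scale (rVpoly v).
have vq i : v 0 i = d%:~R^-1 * (q`_i)%:~R.
  by rewrite -[in LHS](rVpolyK v) mxE Eq coefZ coef_map.
exists (\row_i q`_i).
  apply: contra_neq v0 => h; apply/rowP => i; rewrite vq [RHS]mxE.
  by have /rowP/(_ i) := h; rewrite !mxE => ->; rewrite mulr0.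
apply/rowP => j; rewrite [RHS]mxE.
have : \sum_i v 0 i * (A i j)%:~R = 0.
  have /matrixP/(_ 0 j) := vA; rewrite [RHS]mxE mxE => E; rewrite -[RHS]E.
  by apply: eq_bigr => i _; rewrite [map_mx _ _ _ _]mxE.
move/(congr1 ( *%R d%:~R)); rewrite mulr0 mulr_sumr => E; apply: (@intr_inj rat).
rewrite mxE rmorph_sum -[RHS]E; apply: eq_bigr => i _.
by rewrite vq [(\row_i _) _ _]mxE !mulrA mulfV ?mul1r ?intr_eq0 // rmorphM.
Qed.

(** The Cartan matrix of F4 is unimodular: the fundamental weights, given by the rows here, are
    integral combinations of the simple roots. *)
Definition inv_F4 : 'M[int]_4 :=
  \matrix_(i, j) nth 0 (nth [::]
    [:: [:: 2; 3; 4; 2]; [:: 3; 6; 8; 4]; [:: 2; 4; 6; 3]; [:: 1; 2; 3; 2]] i) j.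

Lemma inv_F4_mul : inv_F4 *m cartan_F4 = 1%:M.
Proof.
apply/matrixP => i j; rewrite !mxE !big_ord_recl big_ord0 !mxE /=.
by case: i => [[|[|[|[|]]]]] //= ?; case: j => [[|[|[|[|]]]]] //= ?.
Qed.

Section FourData.
Variables (F : closedFieldType) (n : nat).
Hypothesis F0 : char0 F.
Local Notation mat := 'M[F]_n.+1.
Implicit Types (X Y A B E : mat) (K G T N : set mat) (f g : mat -> F).

Definition nondegenerate K := forall X, X \in lie K -> (forall Y, Y \in lie K -> \tr (X *m Y) = 0) -> X = 0.

Section CharWeights.
Variables (r : nat) (t : {vspace mat}) (Q : mat) (w : 'I_r -> 'I_n.+1 -> int).
Hypothesis td : tdata t Q w.

Definition weight_of f (a : 'rV[int]_r) := forall i z, z != 0 -> f (psg Q (w i) z) = z ^ a 0 i.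

Lemma rchar_weight j k : weight_of (rchar Q j k) (wd w j k).
Proof. by move=> i z z0; apply: (rchar_psg td). Qed.

Lemma weight_inj f a b : weight_of f a -> weight_of f b -> a = b.
Proof.
move=> ha hb; apply/rowP => i; apply: (exprz2_inj F0); have two : (2 : F) != 0 by rewrite F0.
by rewrite -ha // hb.
Qed.

Lemma char_comb_weight m (alpha : 'I_m -> mat -> F) (W : 'M[int]_(m, r)) v :
  (forall i, weight_of (alpha i) (row i W)) -> weight_of (char_comb alpha v) (v *m W).
Proof.
move=> hW l z z0; rewrite /char_comb mxE.
have E (s : seq 'I_m) : \prod_(i <- s) alpha i (psg Q (w l) z) ^ v 0 i = z ^ (\sum_(i <- s) v 0 i * W i l).
  elim: s => [|i s IH]; first by rewrite !big_nil.
  by rewrite !big_cons IH hW // mxE exprz_exp (mulrC (W i l)) -expfzDr.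
exact: E.
Qed.

Lemma weight_eq f g a : character (tgroup Q w) f -> character (tgroup Q w) g -> weight_of f a -> weight_of g a ->
  forall A, tgroup Q w A -> f A = g A.
Proof. by move=> cf cg ha hb; apply: (character_eq F0 td) => // i z z0; rewrite ha // hb. Qed.

Lemma weight0_one f : character (tgroup Q w) f -> weight_of f 0 -> forall A, tgroup Q w A -> f A = 1.
Proof.
move=> cf h; apply: (weight_eq cf (character1 (tgroup_subgroup F0 td)) h) => i z z0.
by rewrite mxE.
Qed.

Lemma is_root_weight K f : is_root K (tgroup Q w) f -> exists2 a, root (lie K) Q w a & weight_of f a.
Proof.
case=> cf [A TA fA] [X [Xk X0 hX]]; have [j [k [hw _ fE]]] := weight_of_character F0 td X0 hX.
have fw : weight_of f (wd w j k).
  by move=> i z z0; rewrite fE ?(rchar_weight j k) //; apply: (tgroup_psg td).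
exists (wd w j k) => //; split; last by exists X; split=> //; apply/lieE.
by apply: contra fA => /eqP w0; rewrite w0 in fw; rewrite (weight0_one cf fw TA).
Qed.

Lemma root_is_root K a f : root (lie K) Q w a -> character (tgroup Q w) f -> weight_of f a ->
  is_root K (tgroup Q w) f.
Proof.
move=> [a0 [X [Xk X0 hX]]] cf fa; split=> //.
  have [i ai] : exists i, a 0 i != 0.
    apply: contrapT => H; case/eqP: a0; apply/rowP => i; rewrite mxE.
    by apply/eqP; apply: contraT => hi; case: H; exists i.
  have two : (2 : F) != 0 by rewrite F0.
  exists (psg Q (w i) 2); first exact: (tgroup_psg td).
  by rewrite fa //; apply: contra_neq ai => E; apply: (exprz2_inj F0); rewrite E expr0z.
exists X; split=> // [|A TA]; first exact/lieE.
have [j [k jk]] : exists j k, cmx Q X j k != 0.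
  apply: contrapT => H; case/eqP: X0; apply: (cmx_inj td); apply/matrixP => j k; rewrite cmx0 [RHS]mxE.
  by apply/eqP; apply: contraT => jk; case: H; exists j, k.
have wE := (iswP F0 td a X).1 hX j k jk; rewrite (rchar_action F0 td TA hX wE); congr (_ *: _).
by apply: (weight_eq (rchar_character F0 td j k) cf _ fa TA); rewrite -wE; apply: rchar_weight.
Qed.
End CharWeights.

Lemma unipotent_diagm Q (d : 'I_n.+1 -> F) : Q \in unitmx -> nilmx (diagm Q d - 1%:M) -> diagm Q d = 1%:M.
Proof.
move=> uQ; have -> : diagm Q d - 1%:M = diagm Q (fun i => (-1) * 1 + d i).
  by rewrite -diagm_linear diagm_const // scaleN1r addrC.
move/(diagm_nil uQ) => E; have := @diagm_inj F n Q (fun i => (-1) * 1 + d i) (fun=> 0) uQ.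
rewrite E diagm_const // raddf0 => /(_ erefl) d1; rewrite -(diagm_const 1 uQ); congr diagm.
apply: funext => i; have := congr1 (fun h : 'I_n.+1 -> F => h i) d1 => /eqP; by rewrite mulN1r addrC subr_eq0 => /eqP.
Qed.

(** A normal unipotent subgroup equal to [G] would contain the torus; a diagonalizable unipotent
    element is [1], where a root cannot take a value other than 1. *)
Lemma simple_nondegenerate G T f : simple_group G -> maximal_torus G T -> is_root G T f -> nondegenerate G.
Proof.
move=> [cG ncG sG] [TG [[[sT _] _] [Q uQ hQ]] _] [cf [A TA fA] _] X Xk hX.
apply: (reductive_nondegenerate F0) Xk hX; split=> // N cN nN uN.
case: (sG N cN nN) => // NG; case/eqP: fA.
have [d Ad] := is_diagm uQ (hQ A TA); have [|k Ek] := uN A; first by rewrite NG; apply: TG.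
by have -> : A = 1%:M; [rewrite Ad unipotent_diagm // -Ad; exists k|exact: (char_one sT cf)].
Qed.

Record cartan_data K t (r : nat) Q (w : 'I_r -> 'I_n.+1 -> int) : Prop := CartanData {
  cda_connected : closed_connected K;
  cda_maxtoral : maxtoral (lie K) t;
  cda_tdata : tdata t Q w;
  cda_nondeg : nondegenerate K }.

Lemma cda_sub K t r Q (w : 'I_r -> _) : cartan_data K t Q w -> (t <= lie K)%VS.
Proof. by case=> _ [tk _ _]. Qed.

Lemma cda_centralizer K t r Q (w : 'I_r -> _) : cartan_data K t Q w ->
  forall X, X \in lie K -> isw Q w 0 X -> X \in t.
Proof.
case=> [[[sK _] _] mt td nd] X Xk hX; apply: (maxtoral_centralizer F0 sK mt nd Xk).
exact: (isw0P td X).1 hX.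
Qed.

Lemma cda_bracket K t r Q (w : 'I_r -> _) : cartan_data K t Q w -> bracket_closed (lie K).
Proof. by case=> [[[sK _] _] mt td nd] X Y; apply: lie_bracket. Qed.

Lemma fundamental_weight_comb T alpha omega i A : fundamental_weights cartan_F4 T alpha omega -> T A ->
  omega i A = char_comb alpha (row i inv_F4) A :> F.
Proof.
move=> fw TA; rewrite /char_comb.
transitivity (\prod_k \prod_j (omega j A ^ cartan_F4 k j) ^ inv_F4 i k); last first.
  apply: eq_bigr => k _; rewrite (fw.2 k A TA) /char_comb [row _ _ _ _]mxE.
  have E (s : seq 'I_4) z : (\prod_(j <- s) omega j A ^ row k cartan_F4 0 j) ^ z =
      \prod_(j <- s) (omega j A ^ cartan_F4 k j) ^ z.
    by elim: s => [|j s IH]; rewrite ?big_nil ?exp1rz // !big_cons expfzMl IH [row _ _ _ _]mxE.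
  exact/esym/E.
rewrite exchange_big /=.
have E j : \prod_k (omega j A ^ cartan_F4 k j) ^ inv_F4 i k = omega j A ^ (inv_F4 *m cartan_F4) i j.
  rewrite [in RHS]mxE; have oj : omega j A != 0 by apply: (character_neq0 (fw.1 j)).
  elim: (index_enum _) => [|k s IH]; first by rewrite !big_nil expr0z.
  by rewrite !big_cons IH exprz_exp (mulrC (cartan_F4 _ _)) -expfzDr.
rewrite (eq_bigr _ (fun j _ => E j)) inv_F4_mul (bigD1 i) //= mxE eqxx expr1z big1 ?mulr1 // => j ji.
by rewrite mxE eq_sym (negPf ji) expr0z.
Qed.

Theorem root_base_data G T alpha : simple_group G -> maximal_torus G T -> root_base cartan_F4 G T alpha ->
  exists t r Q (w : 'I_r -> 'I_n.+1 -> int) (W : 'M[int]_(4, r)),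
  [/\ T = tgroup Q w, cartan_data G t Q w, forall i, weight_of Q w (alpha i) (row i W),
      forall v : 'rV_4, v *m W = 0 -> v = 0 &
      forall a, root (lie G) Q w a <-> exists2 v, cartan_root cartan_F4 v & a = v *m W].
Proof.
move=> sG mT rb; have [cG _ _] := sG; have [kG _] := cG.
have [t [r [Q [w [mt td TE]]]]] := maximal_torus_data F0 kG mT.
have sT := tgroup_subgroup F0 td; rewrite TE in mT rb.
have root1 i : is_root G (tgroup Q w) (char_comb alpha (delta_mx 0 i)).
  by apply: (base_root rb); constructor.
have nd : nondegenerate G by apply: (simple_nondegenerate sG mT (root1 ord0)).
have alphaE i A : char_comb alpha (delta_mx 0 i) A = alpha i A.
  rewrite /char_comb (bigD1 i) //= !mxE !eqxx expr1z big1 ?mulr1 // => j ji.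
  by rewrite !mxE (negPf ji) andbF expr0z.
have /choice[W' hW'] i : exists a, weight_of Q w (alpha i) a.
  have [a _ ha] := is_root_weight td (root1 i); exists a => l z z0; by rewrite -alphaE ha.
pose W : 'M[int]_(4, r) := \matrix_(i, l) W' i 0 l.
have hW i : weight_of Q w (alpha i) (row i W).
  by move=> l z z0; rewrite hW' // !mxE.
have cw v := char_comb_weight v hW.
have cc v := char_comb_character sT v (base_char rb).
exists t, r, Q, w, W; split=> // [v vW|a].
  apply: (base_free rb) => A TA; apply: (weight0_one td (cc v) _ TA).
  by rewrite -vW; apply: cw.
split=> [ra|[v cv ->]].
  have [a0 [X [Xk X0 hX]]] := ra.
  have [j [k jk]] : exists j k, cmx Q X j k != 0.
    apply: contrapT => H; case/eqP: X0; apply: (cmx_inj td); apply/matrixP => j k; rewrite cmx0 [RHS]mxE.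
    by apply/eqP; apply: contraT => jk; case: H; exists j, k.
  have wE := (iswP F0 td a X).1 hX j k jk.
  have wr : weight_of Q w (rchar Q j k) a by rewrite -wE; apply: (rchar_weight td).
  have ir := root_is_root td ra (rchar_character F0 td j k) wr.
  have [v cv hv] := base_full rb ir; exists v => //; apply: (weight_inj wr) => l z z0.
  by rewrite hv ?cw //; apply: (tgroup_psg td).
have [b rb' hb] := is_root_weight td (base_root rb cv).
by rewrite (weight_inj (cw v) hb).
Qed.

(** The point is that the torus has rank exactly 4. Independence of the simple roots gives [4 <= r].
    Simple connectedness makes each diagonal coordinate an integral combination of the four simple
    roots, so for larger [r] a nontrivial combination of the basis of [t] would be the zero
    matrix. *)
Theorem F4_data G : simple_group G -> simply_connected_of_type cartan_F4 G ->
  exists t Q (w : 'I_4 -> 'I_n.+1 -> int) (W : 'M[int]_4),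
  [/\ cartan_data G t Q w, \det W != 0 &
      forall a, root (lie G) Q w a <-> exists2 v, cartan_root cartan_F4 v & a = v *m W].
Proof.
move=> sG [_ [T [alpha [omega [mT rb fw allc]]]]].
have [t [r [Q [w [W [TE cd hW Winj hroot]]]]]] := root_base_data sG mT rb.
have td := cda_tdata cd; rewrite {}TE in mT rb fw allc.
have omE i A := @fundamental_weight_comb _ _ _ i A fw; have cw v := char_comb_weight v hW.
have /choice[V hV] j : exists u : 'rV[int]_4, forall l, w l j = (u *m W) 0 l.
  have [u hu] := allc _ (cd_character F0 td j); exists (u *m inv_F4) => l; apply: (exprz2_inj F0).
  have two : (2 : F) != 0 by rewrite F0.
  rewrite -(cd_psg td l j 2) hu; last exact: (tgroup_psg td).
  have ow i : weight_of Q w (omega i) (row i (inv_F4 *m W)).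
    by move=> l' z z0; rewrite omE ?(cw (row i inv_F4)) ?row_mul //; apply: (tgroup_psg td).
  by rewrite (char_comb_weight u ow) // mulmxA.
have rk4 : \rank (map_mx (intmul (1 : rat)) W) = 4%N.
  apply/eqP; rewrite eqn_leq rank_leq_row leqNgt; apply/negP => /int_row_kernel[v v0 /Winj vE].
  by rewrite vE eqxx in v0.
have r4 : (4 <= r)%N by rewrite -rk4 rank_leq_col.
have r4' : (r <= 4)%N.
  rewrite leqNgt; apply/negP => lt; pose WF : 'M[F]_(r, 4) := (map_mx (intmul 1) W)^T.
  have : ~~ row_free WF by rewrite -row_leq_rank -ltnNge; apply: leq_ltn_trans (rank_leq_col WF) lt.
  rewrite -kermx_eq0 => /rowV0Pn[c /sub_kermxP cW c0].
  have : \sum_l c 0 l *: om Q w l = 0.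
    rewrite /om diagm_comb; transitivity (diagm Q (fun=> 0)); last by rewrite diagm_const ?(td_unit td) // raddf0.
    congr diagm.
    apply: funext => j; transitivity ((c *m WF *m (map_mx (intmul 1) (V j))^T) 0 0); last first.
      by rewrite cW mul0mx mxE.
    rewrite -mulmxA -trmx_mul -map_mxM mxE; apply: eq_bigr => l _; rewrite [(_ ^T) _ _]mxE [map_mx _ _ _ _]mxE.
    by rewrite hV.
  by move/(td_free td) => h; case/eqP: c0; apply/rowP => l; rewrite h mxE.
have rE : r = 4%N by apply/eqP; rewrite eqn_leq r4' r4.
subst r; exists t, Q, w, W; split=> //.
apply/negP => /eqP W0; have : \det (map_mx (intmul (1 : rat)) W) = 0 by rewrite det_map_mx W0.
have : map_mx (intmul (1 : rat)) W \in unitmx by rewrite -row_full_unit -col_leq_rank rk4.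
by rewrite unitmxE unitfE => /eqP.
Qed.
End FourData.

(** * Conjugacy of weights *)

Section Density.
Variables (F : closedFieldType) (n : nat).
Hypothesis F0 : char0 F.
Local Notation N := (n.+1 * n.+1)%N.
Local Notation poly := {mpoly F[N]}.
Local Notation mat := 'M[F]_n.+1.
Implicit Types (X Y Z A B H g : mat) (p q : poly).

(** Differentiation in the constant direction [Y], in contrast with the left-invariant [ider]: here
    the matrices are points of the vector space [lie K]. *)
Definition cder Y p : poly := \sum_k mxvec Y 0 k *: p^`M(k).

Lemma deriv_polyeval_cder p (c : 'M[{poly F}]_n.+1) s :
  ((polyeval p c)^`()).[s] = mxeval (cder (curve (map_mx (@deriv F) c) s) p) (curve c s).
Proof.
rewrite deriv_polyeval horner_sum /cder mxeval_sum; apply: eq_bigr => k _.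
rewrite hornerM horner_polyeval mxevalZ mulrC; congr (_ * _).
by case/mxvec_indexP: k => i j; rewrite !mxvecE !mxE.
Qed.

Lemma cderD X Y p : cder (X + Y) p = cder X p + cder Y p.
Proof. by rewrite /cder -big_split; apply: eq_bigr => k _; rewrite linearD mxE scalerDl. Qed.

Lemma cderZ a Y p : cder (a *: Y) p = a *: cder Y p.
Proof. by rewrite /cder scaler_sumr; apply: eq_bigr => k _; rewrite linearZ mxE scalerA. Qed.

Lemma cder0 p : cder 0 p = 0. Proof. by rewrite -(scale0r (0 : mat)) cderZ scale0r. Qed.

Lemma cder_sum (I : Type) (s : seq I) (G : I -> mat) p :
  cder (\sum_(i <- s) G i) p = \sum_(i <- s) cder (G i) p.
Proof. exact: (big_morph (fun X => cder X p) (fun X Y => cderD X Y p) (cder0 p)). Qed.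

Definition lcurve A B : 'M[{poly F}]_n.+1 := map_mx polyC A + 'X *: map_mx polyC B.

Lemma curve_lcurve A B s : curve (lcurve A B) s = A + s *: B.
Proof. by apply/matrixP => i j; rewrite /curve !mxE /horner_eval hornerD hornerM hornerX !hornerC. Qed.

Lemma deriv_lcurve A B s : curve (map_mx (@deriv F) (lcurve A B)) s = B.
Proof.
apply/matrixP => i j; rewrite /curve !mxE /horner_eval derivD derivM derivX !derivC.
by rewrite !hornerE.
Qed.

Definition cconj g g' (c : 'M[{poly F}]_n.+1) := map_mx polyC g *m c *m map_mx polyC g'.

Lemma curve_cconj g g' c s : curve (cconj g g' c) s = g *m curve c s *m g'.
Proof. by rewrite /cconj !curve_mulmx !curve_const. Qed.

Lemma deriv_cconj g g' c s : curve (map_mx (@deriv F) (cconj g g' c)) s = g *m curve (map_mx (@deriv F) c) s *m g'.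
Proof.
have dM (d d' : 'M[{poly F}]_n.+1) :
    map_mx (@deriv F) (d *m d') = map_mx (@deriv F) d *m d' + d *m map_mx (@deriv F) d'.
  by apply/matrixP => i j; rewrite !mxE raddf_sum -big_split; apply: eq_bigr => k _; rewrite /= derivM !mxE.
have d0 A : map_mx (@deriv F) (map_mx polyC A) = 0 by apply/matrixP => i j; rewrite !mxE derivC.
by rewrite -curve_cconj /cconj !dM !d0 mul0mx mulmx0 add0r addr0.
Qed.

Lemma invmx_mul A B : A \in unitmx -> B \in unitmx -> invmx (A *m B) = invmx B *m invmx A.
Proof. by move=> uA uB; have := @invrM _ A B uA uB. Qed.

Variables (K : set mat) (t : {vspace mat}) (r : nat) (Q : mat) (w : 'I_r -> 'I_n.+1 -> int).
Hypothesis cd : cartan_data K t Q w.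
Let sK : subgroup K. Proof. by have [[[]]] := cd. Qed.
Let cK : closed_subgroup K. Proof. by have [[]] := cd. Qed.
Let td := cda_tdata cd.

Definition vanish_Ad p := forall g H, K g -> H \in t -> mxeval p (g *m H *m invmx g) = 0.

Lemma vanish_Ad_curve p c s : (forall x, mxeval p (curve c x) = 0) ->
  mxeval (cder (curve (map_mx (@deriv F) c) s) p) (curve c s) = 0.
Proof.
move=> h; rewrite -deriv_polyeval_cder (_ : polyeval p c = 0) ?linear0 ?horner0 //.
by apply: (poly_eq0_char0 F0) => x; rewrite horner_polyeval.
Qed.

(** At a generic conjugate of a point of [t], the directions coming from [t] and from conjugation
    fill [lie K]. In the direction of a root vector, conjugation only gives the derivative
    multiplied by the value of the root; this factor is cancelled along a line in [t]. *)
Lemma vanish_Ad_cder p Y : Y \in lie K -> vanish_Ad p -> vanish_Ad (cder Y p).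
Proof.
move=> Yk hp g H Kg Ht; have ug : g \in unitmx := subgroup_unit sK Kg.
pose Z := invmx g *m Y *m g; have YE : Y = g *m Z *m invmx g.
  by rewrite /Z !mulmxA mulmxV // mul1mx mulmxK.
have Zk : Z \in lie K by rewrite /Z -{2}(invmxK g); apply: lie_Ad => //; apply: (subgroup_inv sK).
have toral_dir V : V \in t -> mxeval (cder (g *m V *m invmx g) p) (g *m H *m invmx g) = 0.
  move=> Vt; have := @vanish_Ad_curve p (cconj g (invmx g) (lcurve H V)) 0.
  rewrite curve_cconj deriv_cconj curve_lcurve deriv_lcurve scale0r addr0; apply => x.
  by rewrite curve_cconj curve_lcurve; apply: hp => //; rewrite memvD // memvZ.
have root_dir a X : X \in lie K -> isw Q w a X -> a != 0 ->
    mxeval (cder (g *m X *m invmx g) p) (g *m H *m invmx g) = 0.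
  move=> Xk hX a0; have nX := isw_nil F0 td a0 hX.
  have E V : V \in t -> mxeval (cder (g *m lieb X V *m invmx g) p) (g *m V *m invmx g) = 0.
    move=> Vt; have [c [cE c'E]] := Ad_expm_curve F0 V nX.
    have := @vanish_Ad_curve p (cconj g (invmx g) c) 0.
    rewrite curve_cconj deriv_cconj c'E cE expm0 invmx1 mulmx1 mul1mx; apply => x.
    have Kx : K (expm X x) by apply: expm_mem.
    rewrite curve_cconj cE; have := hp (g *m expm X x) V (subgroup_mul sK Kg Kx) Vt.
    by rewrite invmx_mul ?(subgroup_unit sK) // !mulmxA.
  have [i ai] : exists i, a 0 i != 0.
    apply: contrapT => nz; case/eqP: a0; apply/rowP => i; rewrite mxE.
    by apply/eqP; apply: contraT => hi; case: nz; exists i.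
  have [x Hx] := (td_span td H).1 Ht.
  (* The direction [om Q w i] is chosen with [a 0 i != 0], so the root is a nonzero polynomial along
     the line; [P] then vanishes also where the root does. *)
  pose P := polyeval (cder (g *m X *m invmx g) p) (cconj g (invmx g) (lcurve H (om Q w i))).
  have PE s : P.[s] = mxeval (cder (g *m X *m invmx g) p) (g *m (H + s *: om Q w i) *m invmx g).
    by rewrite /P horner_polyeval curve_cconj curve_lcurve.
  have : ((pairing a x)%:P + (a 0 i)%:~R *: 'X) * P = 0.
    apply: (poly_eq0_char0 F0) => s; rewrite hornerM !hornerE PE.
    have Ht' : H + s *: om Q w i \in t by rewrite memvD // memvZ // (om_mem td).
    have := E _ Ht'; have -> : lieb X (H + s *: om Q w i) = - (pairing a x + (a 0 i)%:~R * s) *: X.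
      have HX : lieb H X = pairing a x *: X by rewrite Hx; exact: lieb_toral.
      by rewrite liebN liebDl liebZl HX hX scalerA (mulrC s) -scalerDl -scaleNr.
    rewrite -scalemxAr -scalemxAl cderZ mxevalZ mulNr => /eqP; rewrite oppr_eq0 => /eqP //.
  move/eqP; rewrite mulf_eq0 => /orP[/eqP/(congr1 (fun q : {poly F} => q`_1))|/eqP P0].
    rewrite coefD coefC coefZ coefX /= mulr1 add0r coef0 => /eqP.
    by rewrite char0_intr // (negPf ai).
  by have := PE 0; rewrite P0 horner0 scale0r addr0.
have [Z0 ZE] := root_decomposition F0 td (cda_sub cd) (cda_bracket cd) (cda_centralizer F0 cd) Zk.
rewrite YE ZE mulmxDr mulmxDl cderD mxevalD toral_dir // add0r mulmx_sumr mulmx_suml cder_sum mxeval_sum.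
rewrite big_seq big1 // => a; rewrite mem_filter => /andP[/asboolP[a0 _] _].
apply: root_dir a0; last exact: (wcomp_isw F0 td).
by apply: (k_wcomp F0 td (cda_sub cd) (cda_bracket cd)).
Qed.

(** All derivatives of [p] along [X] vanish at the matrix 0, which lies in [t], so [p] vanishes on
    the line through 0 and [X]. *)
Theorem Ad_dense p X : vanish_Ad p -> X \in lie K -> mxeval p X = 0.
Proof.
move=> hp Xk; have hk k : vanish_Ad (iter k (cder X) p).
  by elim: k => //= k IH; apply: vanish_Ad_cder.
have V0 q : vanish_Ad q -> mxeval q 0 = 0.
  by move=> /(_ 1%:M 0 (subgroup_one sK) (mem0v t)); rewrite mulmx0 mul0mx.
have D k : (polyeval p (lcurve 0 X))^`(k) = polyeval (iter k (cder X) p) (lcurve 0 X).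
  elim: k => [//|k IH]; rewrite derivnS IH; apply/eqP; rewrite -subr_eq0; apply/eqP/(poly_eq0_char0 F0) => s.
  by rewrite hornerD hornerN deriv_polyeval_cder deriv_lcurve horner_polyeval subrr.
suff P0 : polyeval p (lcurve 0 X) = 0.
  by have := horner_polyeval p (lcurve 0 X) 1; rewrite P0 horner0 curve_lcurve scale1r add0r.
apply/polyP => k; rewrite coef0; have := congr1 (fun q : {poly F} => q.[0]) (D k).
rewrite horner_polyeval curve_lcurve scale0r addr0 V0 // horner_coef0 coef_derivn addn0 ffactnn => /eqP.
by rewrite (mulrn_eq0_char0 F0) eqn0Ngt fact_gt0 => /eqP.
Qed.

Let m := \dim (lie K).
Let b : m.-tuple mat := vbasis (lie K).

Definition admx X : 'M[F]_m := \matrix_(i, j) coord b j (lieb X b`_i).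
Definition admxp : 'M[poly]_m :=
  \matrix_(i, j) \sum_l \sum_l' coord b j (lieb (delta_mx l l') b`_i) *: xvar F l l'.

Lemma admxpE X : map_mx (fun p => mxeval p X) admxp = admx X.
Proof.
apply/matrixP => i j; rewrite !mxE mxeval_sum {2}[X]matrix_sum_delta lieb_suml linear_sum.
apply: eq_bigr => l _; rewrite mxeval_sum lieb_suml linear_sum; apply: eq_bigr => l' _.
by rewrite mxevalZ mxeval_xvar liebZl linearZ mulrC.
Qed.

Lemma coord_lie X : X \in lie K -> X = \sum_j coord b j X *: b`_j.
Proof. exact: coord_vbasis. Qed.

Lemma char_poly_admx X (e : m.-tuple mat) (mu : 'I_m -> F) : X \in lie K -> basis_of (lie K) e ->
  (forall i : 'I_m, lieb X e`_i = mu i *: e`_i) -> char_poly (admx X) = \prod_i ('X - (mu i)%:P).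
Proof.
move=> Xk be he; have ek (i : 'I_m) : e`_i \in lie K by apply: (basis_mem be); apply: mem_nth; rewrite size_tuple.
pose P : 'M[F]_m := \matrix_(i, j) coord b j e`_i.
pose P' : 'M[F]_m := \matrix_(i, j) coord e j b`_i.
have bk (i : 'I_m) : b`_i \in lie K by apply: vbasis_mem; apply: mem_nth; rewrite size_tuple.
have fe : free e by case/andP: be.
have PP : P *m P' = 1%:M.
  apply/matrixP => i j; rewrite !mxE -(coord_free i j fe) [X in _ = coord e j X](coord_lie (ek i)) linear_sum.
  by apply: eq_bigr => k _; rewrite !mxE linearZ.
have uP : P \in unitmx by case/mulmx1_unit: PP.
have E : P *m admx X = diag_mx (\row_i mu i) *m P.
  apply/matrixP => i j; rewrite mul_diag_mx !mxE -linearZ /= -he [X in coord b j (lieb _ X)](coord_lie (ek i)) liebN.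
  rewrite lieb_suml -sumrN linear_sum; apply: eq_bigr => k _; rewrite !mxE -liebN liebZr linearZ //.
have dX : char_poly (diag_mx (\row_i mu i)) = \prod_i ('X - (mu i)%:P).
  rewrite char_poly_trig ?diag_mx_is_trig //; apply: eq_bigr => i _; by rewrite !mxE eqxx.
rewrite -dX /char_poly; pose Pp := map_mx (@polyC F) P.
have dP : \det Pp != 0 by rewrite det_map_mx polyC_eq0 -unitfE -unitmxE.
apply: (mulfI dP); rewrite -det_mulmx [RHS]mulrC -det_mulmx; congr (\det _).
rewrite /char_poly_mx mulmxBr mulmxBl mul_mx_scalar mul_scalar_mx; congr (_ - _).
by rewrite -!map_mxM E.
Qed.
End Density.

#[local] Transparent mxeval.
Lemma mxeval_meval (F : closedFieldType) n (p : {mpoly F[n * n]}) (A : 'M[F]_n) :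
  mxeval p A = p.@[fun k => mxvec A 0 k].
Proof. by []. Qed.
#[local] Opaque mxeval.

(** This makes symmetric functions of the eigenvalues of [ad X] polynomial in the entries of [X]. *)
Lemma symmetric_char_poly (F : closedFieldType) m (f : {mpoly F[m]}) : f \is symmetric ->
  exists T : {mpoly F[m]}, forall cs : m.-tuple F,
    f.@[tnth cs] = T.@[fun i : 'I_m => (-1) ^+ i.+1 * (\prod_(c <- cs) ('X - c%:P))`_(m - i.+1)].
Proof.
case/sym_fundamental=> T [<- _]; exists T => cs; rewrite comp_mpoly_meval; apply: meval_eq => i.
have i1 : (i.+1 < m.+1)%N by rewrite ltnS; exact: ltn_ord.
rewrite tnth_mktuple (mroots_coeff cs (Ordinal i1)) mulrA -exprD addnn -mul2n exprM sqrrN !expr1n mul1r //.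
Qed.

Section Transport.
Variables (F : closedFieldType) (n : nat).
Hypothesis F0 : char0 F.
Local Notation N := (n.+1 * n.+1)%N.
Local Notation mat := 'M[F]_n.+1.
Implicit Types (X Y Z A B H g : mat).

Lemma weight_basis (U t : {vspace mat}) r Q (w : 'I_r -> 'I_n.+1 -> int) : tdata t Q w ->
    (forall i Y, Y \in U -> lieb (om Q w i) Y \in U) ->
  exists (e : (\dim U).-tuple mat) (a : 'I_(\dim U) -> 'rV[int]_r), basis_of U e /\ forall i : 'I_(\dim U), isw Q w (a i) e`_i.
Proof.
move=> td sU; have [X XU|s [bs hs]] := @spanned_basis F n (fun Y => exists a, isw Q w a Y) U.
  exists 'I_(size (wts w)), (fun=> 1), (fun i => wcomp Q w (tnth (in_tuple (wts w)) i) X); split.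
    rewrite {1}(wcomp_decomp td X) (big_nth 0) big_mkord; apply: eq_bigr => i _.
    by rewrite scale1r (tnth_nth 0).
  by move=> i; split; [eexists; exact: (wcomp_isw F0 td)|exact: (wcomp_mem F0 td)].
have ss : size s == \dim U by case/andP: bs => /eqP sb; rewrite /free sb eq_sym.
have /choice[a ha] (i : 'I_(\dim U)) : exists a, isw Q w a s`_i.
  by apply: hs; apply: mem_nth; rewrite (eqP ss).
by exists (Tuple ss), a.
Qed.

Lemma pairing_mul r q (v : 'rV[int]_q) (M : 'M[int]_(q, r)) (x : 'I_r -> F) :
  pairing (v *m M) x = \sum_i (v 0 i)%:~R * pairing (row i M) x.
Proof.
rewrite /pairing; under [RHS]eq_bigr => i _ do rewrite mulr_sumr.
rewrite exchange_big; apply: eq_bigr => j _; rewrite mxE rmorph_sum mulr_suml; apply: eq_bigr => i _.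
by rewrite rmorphM mulrA mxE.
Qed.

(** A substitute for conjugacy of tori. On [t], every eigenvalue of [ad] is an integral combination,
    with coefficients [al], of those at the indices [si]. The product over all permutations of the
    corresponding relations is a symmetric function of the eigenvalues, hence a polynomial on
    [lie K]. It vanishes on the conjugates of [t] and so everywhere; at a generic point of [t1] this
    singles out a permutation for which the relations hold between weights. *)
Lemma weights_permutation K t r Q (w : 'I_r -> 'I_n.+1 -> int) q (W : 'M[int]_(q, r))
    (e : (\dim (lie K)).-tuple mat) (al : 'I_(\dim (lie K)) -> 'rV[int]_q) (si : 'I_q -> 'I_(\dim (lie K)))
    t1 r1 Q1 (w1 : 'I_r1 -> 'I_n.+1 -> int) (f : (\dim (lie K)).-tuple mat)
    (be : 'I_(\dim (lie K)) -> 'rV[int]_r1) :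
    cartan_data K t Q w -> basis_of (lie K) e -> (forall k, isw Q w (al k *m W) e`_k) ->
    (forall i, al (si i) = delta_mx 0 i) -> tdata t1 Q1 w1 -> (t1 <= lie K)%VS ->
    basis_of (lie K) f -> (forall k, isw Q1 w1 (be k) f`_k) ->
  exists s : {perm (ordinal (\dim (lie K)))}, forall k, be (s k) = al k *m (\matrix_i be (s (si i))).
Proof.
set m := \dim (lie K) => cd eb he hsi td1 t1k fb hf; apply: contrapT => H.
pose M (s : 'S_m) : 'M[int]_(q, r1) := \matrix_i be (s (si i)).
pose d (s : {perm 'I_m}) k := be (s k) - al k *m M s.
have /choice[ks hks] (s : {perm 'I_m}) : exists k, d s k != 0.
  apply: contrapT => h; apply: H; exists s => k; apply/eqP; rewrite -subr_eq0.
  by apply: contraT => hk; case: h; exists k.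
(* If every permutation [s] fails at some index [ks s], one generic point sees all these failures at
   once. *)
have [|x hx] := @generic_point F F0 r1 [seq d s (ks s) | s <- enum {: {perm 'I_m}}].
  by move=> _ /mapP[s _ ->].
pose p s := \poly_(k < m) (if insub k is Some k' then pairing (d s k') x else 0).
have pE s (k : 'I_m) : (p s)`_k = pairing (d s k) x by rewrite coef_poly ltn_ord valK.
have p0 s : p s != 0.
  apply/eqP => ps; have /eqP := hx (d s (ks s)) (map_f _ (mem_enum _ s)).
  by rewrite -/(pairing _ x) -pE ps coef0.
have [u hu] : exists u, forall s, (p s).[u] != 0.
  apply: contrapT => h; have : \prod_s p s != 0 by apply/prodf_neq0.
  case/eqP; apply: (poly_eq0_char0 F0) => u; apply: contrapT => pu; apply: h; exists u => s.
  by apply: contraPneq pu => ps; rewrite horner_prod (bigD1 s) //= ps mul0r.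
(* The powers of [u] pack the relations for all [k] into one form; [u] was chosen so that no failing
   relation is hidden by cancellation. *)
pose l (s : {perm 'I_m}) : {mpoly F[m]} := \sum_(k < m) (u ^+ k)%:MP * ('X_(s k) - \sum_i ((al k 0 i)%:~R)%:MP * 'X_(s (si i))).
have lE s y : (l s).@[y] = \sum_(k < m) u ^+ k * (y (s k) - \sum_i (al k 0 i)%:~R * y (s (si i))).
  rewrite raddf_sum; apply: eq_bigr => k _; rewrite /= mevalM mevalC mevalB mevalXU; congr (_ * (_ - _)); rewrite raddf_sum.
  by apply: eq_bigr => i _; rewrite /= mevalM mevalC mevalXU.
have symf : \prod_s l s \is symmetric.
  apply/issymP => s; rewrite rmorph_prod [RHS](reindex_inj (mulIg s)) /=; apply: eq_bigr => s' _.
  have mX i : msym s ('X_i : {mpoly F[m]}) = 'X_(s i) by rewrite /msym mmapX mmap1U.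
  have mC c : msym s (c%:MP : {mpoly F[m]}) = c%:MP by rewrite /msym mmapC.
  rewrite /l raddf_sum; apply: eq_bigr => k _; rewrite /= msymM mC msymB mX permM; congr (_ * (_ - _)).
  by rewrite raddf_sum; apply: eq_bigr => i _; rewrite /= msymM mC mX permM.
have [T hT] := symmetric_char_poly symf.
pose co : m.-tuple {mpoly F[N]} := [tuple (-1) ^+ i.+1 * (char_poly (admxp K))`_(m - i.+1) | i < m].
pose Phi : {mpoly F[N]} := T \mPo co.
have PhiE X : mxeval Phi X = T.@[fun i : 'I_m => (-1) ^+ i.+1 * (char_poly (admx K X))`_(m - i.+1)].
  rewrite mxeval_meval comp_mpoly_meval; apply: meval_eq => i; rewrite tnth_mktuple mevalM rmorphXn rmorphN1.
  congr (_ * _); rewrite -admxpE -(coef_map (meval _)) map_char_poly //.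
have PhiP X (e' : m.-tuple mat) (mu : 'I_m -> F) : X \in lie K -> basis_of (lie K) e' ->
    (forall i : 'I_m, lieb X e'`_i = mu i *: e'`_i) -> mxeval Phi X = \prod_s (l s).@[mu].
  move=> Xk be' hX; rewrite PhiE (char_poly_admx Xk be' hX).
  have E : \prod_(c <- [tuple mu i | i < m]) ('X - c%:P) = \prod_i ('X - (mu i)%:P).
    by rewrite big_tuple; apply: eq_bigr => i _; rewrite tnth_mktuple.
  rewrite -E -(hT [tuple mu i | i < m]); rewrite rmorph_prod; apply: eq_bigr => s _ /=; apply: meval_eq => i; by rewrite tnth_mktuple.
have cK : closed_subgroup K by have [[]] := cd.
have [sK _] := cK.
have van : vanish_Ad K t Phi.
  move=> g H' Kg Ht; have ug := subgroup_unit sK Kg; have [y Hy] := (td_span (cda_tdata cd) H').1 Ht.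
  pose e' : m.-tuple mat := [tuple of map (fun X => g *m X *m invmx g) e].
  have e'E (i : 'I_m) : e'`_i = g *m e`_i *m invmx g by rewrite (nth_map 0) // size_tuple.
  have be' : basis_of (lie K) e'.
    rewrite basisEfree size_tuple leqnn andbT; apply/andP; split; last first.
      apply/span_subvP => _ /mapP[X Xe ->]; apply: lie_Ad => //; exact: basis_mem eb Xe.
    have /freeP fe : free e by case/andP: eb.
    apply/freeP => c hc; apply: fe; set Z := \sum_i _; rewrite -[Z](mulKmx ug) -[g *m Z](mulmxKV ug).
    suff -> : g *m Z *m invmx g = 0 by rewrite mul0mx mulmx0.
    rewrite mulmx_sumr mulmx_suml -[RHS]hc; apply: eq_bigr => j _.
    by rewrite e'E -scalemxAr -scalemxAl.
  rewrite (PhiP _ e' (fun k => pairing (al k *m W) y)) //; first last.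
  - move=> i; rewrite e'E.
    have -> : lieb (g *m H' *m invmx g) (g *m e`_i *m invmx g) = g *m lieb H' e`_i *m invmx g.
      by rewrite /lieb !mulmxBr !mulmxBl !mulmxA !mulmxKV.
    by rewrite Hy (lieb_toral _ (he i)) -scalemxAr -scalemxAl.
  - by apply: lie_Ad => //; exact: (subvP (cda_sub cd)).
  (* On a conjugate of [t], in the conjugated eigenbasis, the factor of the identity permutation is
     zero. *)
  rewrite (bigD1 (1%g : {perm 'I_m})) //= lE big1 ?mul0r // => k _; rewrite perm1 pairing_mul.
  rewrite [X in _ - X](eq_bigr (fun i => (al k 0 i)%:~R * pairing (row i W) y)) ?subrr ?mulr0 // => i _.
  by rewrite perm1 hsi -rowE.
have Xk : \sum_i x i *: om Q1 w1 i \in lie K.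
  by apply: (subvP t1k); apply/(td_span td1); exists x.
have := Ad_dense F0 cd van Xk; rewrite (PhiP _ f (fun k => pairing (be k) x)) //; last first.
  by move=> i; apply: lieb_toral.
move=> /eqP/prodf_eq0[s _]; rewrite lE => /eqP E; have /eqP := hu s; apply; rewrite horner_poly -[RHS]E.
apply: eq_bigr => k _.
rewrite valK mulrC; congr (_ * _).
have pB (a a' : 'rV[int]_r1) : pairing (a - a') x = pairing a x - pairing a' x.
  by rewrite /pairing -sumrB; apply: eq_bigr => i _; rewrite !mxE rmorphB mulrBl.
rewrite /d pB pairing_mul; congr (_ - _); apply: eq_bigr => i _; by rewrite /M rowK.
Qed.
End Transport.

Section TransportedRoots.
Variables (F : closedFieldType) (n : nat).
Hypothesis F0 : char0 F.
Local Notation mat := 'M[F]_n.+1.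
Implicit Types (X Y Z A B H g Q : mat) (t U : {vspace mat}) (K G : set mat).

Lemma tdata_dim t r Q (w : 'I_r -> 'I_n.+1 -> int) : tdata t Q w -> \dim t = r.
Proof.
move=> td; pose T : r.-tuple mat := [tuple om Q w i | i < r].
have TE (i : 'I_r) : T`_i = om Q w i by rewrite -tnth_nth tnth_mktuple.
have fT : free T.
  apply/freeP => c hc; apply: (td_free td); rewrite -[RHS]hc; apply: eq_bigr => i _; by rewrite TE.
suff -> : t = <<T>>%VS by move: fT; rewrite /free size_tuple => /eqP.
apply/vspaceP => X; apply/idP/idP => [/(td_span td)[c ->]|/coord_span->].
  by apply: memv_suml => i _; rewrite memvZ // memv_span //; apply/mapP; exists i; rewrite ?mem_enum.
apply/(td_span td); exists (fun i => coord T i X); apply: eq_bigr => i _; by rewrite TE.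
Qed.

Lemma basis_weight (U t : {vspace mat}) r Q (w : 'I_r -> 'I_n.+1 -> int) (e : (\dim U).-tuple mat) a b X :
    tdata t Q w -> basis_of U e -> (forall i : 'I_(\dim U), isw Q w (a i) e`_i) ->
  X \in U -> X != 0 -> isw Q w b X -> exists k, a k = b.
Proof.
move=> td be he XU X0 hX; apply: contrapT => H; case/eqP: X0.
rewrite -(wcomp_id F0 td hX) (coord_basis be XU) (wcomp_sumE td) big1 // => k _.
rewrite (wcompZ td) (wcomp_other F0 td (he k)) ?scaler0 //; apply: contra_notN H => /eqP->; by exists k.
Qed.

Lemma det_inj q (M : 'M[int]_q) (v v' : 'rV[int]_q) : \det M != 0 -> v *m M = v' *m M -> v = v'.
Proof.
move=> dM /(congr1 (mulmx^~ (\adj M))); rewrite -!mulmxA mul_mx_adj !mul_mx_scalar => /eqP.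
by rewrite -subr_eq0 -scalerBr scalemx_eq0 (negPf dM) subr_eq0 => /eqP.
Qed.

Definition kernel_free q r (M : 'M[int]_(q, r)) :=
  forall c : 'I_r -> F, (forall i, \sum_j (M i j)%:~R * c j = 0) -> forall j, c j = 0.

Lemma det_kernel_free q (M : 'M[int]_q) : \det M != 0 -> kernel_free M.
Proof.
move=> dM c hc j; pose MF := map_mx (intmul (1 : F)) M; pose v : 'cV[F]_q := \col_j c j.
have Mv : MF *m v = 0.
  by apply/colP => i; rewrite mxE [RHS]mxE -[RHS](hc i); apply: eq_bigr => k _; rewrite !mxE.
have uM : MF \in unitmx by rewrite unitmxE det_map_mx unitfE char0_intr.
by have := mulKmx uM v; rewrite Mv mulmx0 => /colP/(_ j); rewrite !mxE.
Qed.

Lemma kernel_free_leq q r (M : 'M[int]_(q, r)) : kernel_free M -> (r <= q)%N.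
Proof.
move=> kM; rewrite leqNgt; apply/negP => lt; pose MF : 'M[F]_(r, q) := (map_mx (intmul 1) M)^T.
have : ~~ row_free MF by rewrite -row_leq_rank -ltnNge; apply: leq_ltn_trans (rank_leq_col MF) lt.
rewrite -kermx_eq0 => /rowV0Pn[c /sub_kermxP cM c0]; case/eqP: c0; apply/rowP => j; rewrite [RHS]mxE.
apply: kM => i; have /rowP/(_ i) := cM; rewrite [RHS]mxE mxE => E; rewrite -[RHS]E.
by apply: eq_bigr => l _; rewrite mulrC [(_^T) _ _]mxE [map_mx _ _ _ _]mxE.
Qed.

Lemma kernel_free_det q (M : 'M[int]_q) : kernel_free M -> \det M != 0.
Proof.
move=> kM; apply/negP => /eqP dM; have : \det (map_mx (intmul (1 : F)) M)^T == 0 by rewrite det_tr det_map_mx dM.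
case/det0P=> c c0 cM; case/eqP: c0; apply/rowP => j; rewrite [RHS]mxE.
apply: kM => i; have /rowP/(_ i) := cM; rewrite [RHS]mxE mxE => E; rewrite -[RHS]E.
by apply: eq_bigr => l _; rewrite mulrC [(_^T) _ _]mxE [map_mx _ _ _ _]mxE.
Qed.

(** The rows of [M] are the weights of [t1] that correspond to the simple roots. An element of [t1]
    on which they vanish commutes with [lie G]; it thus lies in [t], where all roots vanish on it,
    so it is 0. This bounds [r1] by 4. In rank 4 the permutation preserves the multiplicity of the
    weight 0, so [t1] is its own centralizer. *)
Theorem transported_roots G t Q (w : 'I_4 -> 'I_n.+1 -> int) (W : 'M[int]_4) t1 r1 Q1
    (w1 : 'I_r1 -> 'I_n.+1 -> int) :
    cartan_data G t Q w -> \det W != 0 ->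
    (forall a, root (lie G) Q w a <-> exists2 v, cartan_root cartan_F4 v & a = v *m W) ->
    tdata t1 Q1 w1 -> (t1 <= lie G)%VS ->
  exists M : 'M[int]_(4, r1), [/\ kernel_free M,
    forall a, root (lie G) Q1 w1 a <-> a != 0 /\ exists2 v, cartan_root cartan_F4 v & a = v *m M &
    (4 <= r1)%N -> forall X, X \in lie G -> isw Q1 w1 0 X -> X \in t1].
Proof.
move=> cd dW hW td1 t1k; have td := cda_tdata cd; have bk := cda_bracket cd; have tk := cda_sub cd.
have st r' t' Q' (w' : 'I_r' -> 'I_n.+1 -> int) : tdata t' Q' w' -> (t' <= lie G)%VS ->
    forall i Y, Y \in lie G -> lieb (om Q' w' i) Y \in lie G.
  by move=> td' t'k i Y; apply: bk; apply: (subvP t'k); apply: om_mem td' i.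
have [e [a [be he]]] := weight_basis F0 td (st _ _ _ _ td tk).
have [f [b [bf hf]]] := weight_basis F0 td1 (st _ _ _ _ td1 t1k).
have nz (g : (\dim (lie G)).-tuple mat) (k : 'I_(\dim (lie G))) : basis_of (lie G) g -> g`_k != 0 /\ g`_k \in lie G.
  move=> bg; have gk : g`_k \in (g : seq mat) by apply: mem_nth; rewrite size_tuple.
  by split; [case/andP: bg => _ /free_not0; apply|apply: basis_mem bg gk].
have /choice[al hal] k : exists v : 'rV[int]_4, a k = v *m W /\ (v = 0 \/ cartan_root cartan_F4 v).
  have [a0|a0] := eqVneq (a k) 0; first by exists 0; rewrite mul0mx a0; split=> //; left.
  have : root (lie G) Q w (a k) by split=> //; exists e`_k; have [] := nz e k be.
  by case/hW => v hv E; exists v; split=> //; right.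
have he' k : isw Q w (al k *m W) e`_k by have [<- _] := hal k.
have simple_index v : cartan_root cartan_F4 v -> exists k, al k = v.
  move=> hv; have [_ [X [Xk X0 hX]]] : root (lie G) Q w (v *m W) by apply/hW; exists v.
  have [k hk] := basis_weight td be he Xk X0 hX.
  by exists k; apply: (det_inj dW); have [<- _] := hal k.
have /choice[si hsi] (i : 'I_4) : exists k, al k = delta_mx 0 i by apply: simple_index; constructor.
have [s hs] := weights_permutation F0 cd be he' hsi td1 t1k bf hf.
set M := \matrix_i b (s (si i)) in hs; exists M.
have kM : kernel_free M.
  move=> c hc; have Yt : \sum_j c j *: om Q1 w1 j \in t1 by apply/(td_span td1); exists c.
  set Y := \sum_j _ in Yt; have Yk := subvP t1k _ Yt.
  have Yf (k : 'I_(\dim (lie G))) : lieb Y f`_k = 0.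
    rewrite -(permKV s k) (lieb_toral c (hf _)) hs pairing_mul big1 ?scale0r // => i _.
    by rewrite /pairing (eq_bigr (fun j => (M i j)%:~R * c j)) ?hc ?mulr0 // => j _; rewrite [row _ _ _ _]mxE.
  have cY X : X \in lie G -> lieb Y X = 0.
    move=> Xk; rewrite (coord_basis bf Xk) liebN lieb_suml big1 ?oppr0 // => k _.
    by rewrite liebZl liebN Yf oppr0 scaler0.
  have : Y \in t.
    apply: (cda_centralizer F0 cd) => // i; rewrite mxE scale0r liebN cY ?oppr0 //.
    by apply: (subvP tk); apply: om_mem td i.
  move/(td_span td)=> [d Yd].
  have d0 : forall i, d i = 0.
    apply: (det_kernel_free dW) => i; have [e0 ek] := nz e (si i) be.
    have := cY _ ek; rewrite Yd (lieb_toral d (he' (si i))) hsi -rowE => /eqP.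
    rewrite scaler_eq0 (negPf e0) orbF /pairing => /eqP E; rewrite -[RHS]E.
    by apply: eq_bigr => j _; rewrite [row _ _ _ _]mxE.
  by apply: (td_free td1); rewrite -/Y Yd big1 // => i _; rewrite d0 scale0r.
split=> // [c|r4 X Xk hX].
  split=> [[c0 [X [Xk X0 hX]]]|[c0 [v hv vE]]].
    split=> //; have [k hk] := basis_weight td1 bf hf Xk X0 hX.
    move: hk; rewrite -(permKV s k) hs; have [_ [->|hv] E] := hal (s^-1%g k); last by eexists; eauto.
    by rewrite -E mul0mx eqxx in c0.
  split=> //; have [k kE] := simple_index v hv; have [f0 fk] := nz f (s k) bf.
  by exists f`_(s k); split=> //; rewrite vE -kE -hs.
have r1E : r1 = 4%N by apply/eqP; rewrite eqn_leq r4 (kernel_free_leq kM).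
subst r1; have dM := kernel_free_det kM.
(* [U0] is the zero weight space of [t1]. Its dimension is bounded by counting the zero weights of
   [t], whose vectors are independent and lie in [t]. *)
pose U0 := <<[seq f`_k | k : 'I_(\dim (lie G)) <- enum (ordinal (\dim (lie G))) & (b k == 0)%R]>>%VS.
have in0 Z : Z \in lie G -> isw Q1 w1 0 Z -> Z \in U0.
  move=> Zk hZ; rewrite -(wcomp_id F0 td1 hZ) (coord_basis bf Zk) (wcomp_sumE td1) memv_suml // => k _.
  rewrite (wcompZ td1) memvZ //; have [bk0|bk0] := eqVneq (b k) 0.
    rewrite (wcomp_id F0 td1) -?{1}bk0 //; apply: memv_span; apply/mapP; exists k => //.
    by rewrite mem_filter bk0 eqxx mem_enum.
  by rewrite (wcomp_other F0 td1 (hf k)) ?mem0v // eq_sym.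
have t1U : (t1 <= U0)%VS.
  apply/subvP => Z Zt; apply: in0; first exact: (subvP t1k).
  apply/(isw0P td1) => H Ht; have [tQ uQ hQ] : toral t1.
    exists Q1; first exact: td_unit td1.
    by move=> Y /(td_span td1)[c ->]; rewrite diagm_comb; eexists.
  have [y ->] := hQ H Ht; have [y' ->] := hQ Z Zt; exact: diagm_commute.
suff /eqP E : t1 == U0 by rewrite E; apply: in0.
rewrite eqEdim t1U (tdata_dim td1).
apply: (@leq_trans (\dim t)); last by rewrite (tdata_dim td).
apply: leq_trans (dim_span _) _; rewrite size_map.
pose Z := [seq e`_k | k : 'I_(\dim (lie G)) <- enum 'I_(\dim (lie G)) & al k == 0].
have -> : size [seq k <- enum 'I_(\dim (lie G)) | b k == 0] = size Z.
  rewrite size_map !size_filter -!sum1_count !big_enum_cond /= (reindex_inj (@perm_inj _ s)) /=.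
  apply: eq_bigl => k; rewrite hs; apply/eqP/eqP => [h|->]; last by rewrite mul0mx.
  by apply: (det_inj dM); rewrite mul0mx.
have fZ : free Z.
  have fe : free e by case/andP: be.
  pose PP i := if insub i is Some k then al k == 0 else false.
  suff -> : Z = [seq y <- e | PP (index y e)] by apply: filter_free.
  have eE : tval e = [seq e`_k | k : 'I_(\dim (lie G)) <- enum 'I_(\dim (lie G))].
    apply: (@eq_from_nth _ 0) => [|i]; first by rewrite size_map size_enum_ord size_tuple.
    rewrite size_tuple => hi; rewrite (nth_map (Ordinal hi)) ?size_enum_ord //.
    by rewrite nth_enum_ord.
  pose E0 := tval e; rewrite -/E0 {2}/E0 eE filter_map; congr map; apply: eq_filter => k /=.
  by rewrite index_uniq ?size_tuple ?free_uniq // /PP valK.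
move: (fZ); rewrite /free => /eqP <-; apply: dimvS; apply/span_subvP => _ /mapP[k + ->].
rewrite mem_filter => /andP[/eqP ak _]; have [_ ek] := nz e k be; apply: (cda_centralizer F0 cd ek).
by have := he' k; rewrite ak mul0mx.
Qed.

Lemma dim_roots K t r Q (w : 'I_r -> 'I_n.+1 -> int) : cartan_data K t Q w ->
  (\dim (lie K) <= r + size (roots (lie K) Q w))%N.
Proof.
move=> cd; have td := cda_tdata cd; have bk := cda_bracket cd; have tk := cda_sub cd.
have ct := cda_centralizer F0 cd; have nd := cda_nondeg cd.
have /choice[e he] a : exists e : mat, root (lie K) Q w a -> forall y, y \in lie K -> isw Q w a y -> y \in <[e]>%VS.
  have [ra|nra] := pselect (root (lie K) Q w a); last by exists 0.
  have [a0 [e [f h]]] := root_pr F0 td tk bk nd ra; exists e => _ y yk hy.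
  by have [s ->] := root_line F0 td tk bk nd ct a0 h yk hy; rewrite memvZ ?memv_line.
have sub : (lie K <= t + <<[seq e a | a <- roots (lie K) Q w]>>)%VS.
  apply/subvP => X Xk; have [X0 ->] := root_decomposition F0 td tk bk ct Xk.
  apply: memv_add => //; rewrite big_seq; apply: memv_suml => a ra.
  have /vlineP[c ->] : wcomp Q w a X \in <[e a]>%VS.
    by apply: he; [exact: (elimT (rootsP F0 (lie K) td a) ra)|exact: (k_wcomp F0 td tk bk)|exact: (wcomp_isw F0 td)].
  by rewrite memvZ // memv_span // map_f.
apply: leq_trans (dimvS sub) _; apply: leq_trans (dimv_add_leqif _ _).1 _.
by rewrite (tdata_dim td) leq_add2l; apply: leq_trans (dim_span _) _; rewrite size_map.
Qed.
End TransportedRoots.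

(** * Solvable subgroups *)

Section Solvable.
Variables (F : closedFieldType) (n : nat).
Hypothesis F0 : char0 F.
Local Notation mat := 'M[F]_n.+1.
Implicit Types (X Y Z A B H e f g x y N : mat) (K S : set mat) (t U : {vspace mat}).

Lemma commutator_subgroup_unit S A : subgroup S ->
  (exists x y, [/\ S x, S y & A = x *m y *m invmx x *m invmx y]) -> A \in unitmx.
Proof.
move=> sS [x [y [Sx Sy ->]]]; have uS := subgroup_unit sS.
by rewrite !unitmx_mul !unitmx_inv !uS.
Qed.

Lemma derived_subgroup S : subgroup S -> subgroup (derived S).
Proof. by move=> sS; apply: generated_subgroup => A; apply: commutator_subgroup_unit. Qed.

Lemma zcl_commutator S x y : subgroup S -> zcl S x -> zcl S y ->
  zcl (derived S) (x *m y *m invmx x *m invmx y).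
Proof.
move=> sS Sx Sy; have uS := subgroup_unit sS; have sD := derived_subgroup sS; have uD := subgroup_unit sD.
have step1 y' : S y' -> zcl (derived S) (x *m y' *m invmx x *m invmx y').
  move=> Sy'; apply: (@zcl_image F n S (derived S) (fun x => x *m y' *m invmx x *m invmx y')) Sx => //.
  - apply: regmx_mul (@regmx_cst F n _ _ _); apply: regmx_mul (@regmx_inv F n); apply: regmx_mul (@regmx_cst F n _ _ _).
    exact: regmx_id.
  - by move=> A uA; rewrite !unitmx_mul !unitmx_inv uA uS.
  - by move=> A SA; apply: zcl_sub => //; apply: generated_mem; exists A, y'.
have ux : x \in unitmx by case: Sx.
apply: (@zcl_image F n S (derived S) (fun y => x *m y *m invmx x *m invmx y)) Sy => //.
- apply: regmx_mul (@regmx_inv F n); apply: regmx_mul (@regmx_cst F n _ _ _); apply: regmx_mul (@regmx_id F n).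
  exact: (@regmx_cst F n _ _ x).
- by move=> A uA; rewrite !unitmx_mul !unitmx_inv uA ux.
Qed.

(** Differentiate the commutator of [expm e s] and [y] at 0. Derived groups need not be closed here;
    it suffices that commutators of the closure lie in the closure of the derived group, which has
    the same Lie algebra. *)
Lemma derived_lie S e y : subgroup S -> nilmx e -> e \in lie S -> zcl S y ->
  e - y *m e *m invmx y \in lie (derived S).
Proof.
move=> sS ne eS Sy; have uS := subgroup_unit sS; have cS := zcl_subgroup sS.
have sD := derived_subgroup sS; have uD := subgroup_unit sD; have uy : y \in unitmx by case: Sy.
rewrite -(lie_zcl uD).
have Ee s : expm (- e) s = invmx (expm e s).
  rewrite (invmx_expm F0) // !expmE; apply: eq_bigr => k _.
  by rewrite -scaleN1r exprZn scalerA -mulrA [_ * (-1) ^+ k]mulrC -exprNn.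
pose c := ecurve e *m (map_mx polyC y *m ecurve (- e) *m map_mx polyC (invmx y)).
have cE s : curve c s = expm e s *m (y *m expm (- e) s *m invmx y) by rewrite /c !curve_mulmx !curve_const.
have dM (d d' : 'M[{poly F}]_n.+1) :
    map_mx (@deriv F) (d *m d') = map_mx (@deriv F) d *m d' + d *m map_mx (@deriv F) d'.
  by apply/matrixP => i j; rewrite !mxE raddf_sum -big_split; apply: eq_bigr => k _; rewrite /= derivM !mxE.
have d0 A : map_mx (@deriv F) (map_mx polyC A) = 0 by apply/matrixP => i j; rewrite !mxE derivC.
have cD (d d' : 'M[{poly F}]_n.+1) s : curve (d + d') s = curve d s + curve d' s.
  by apply/matrixP => i j; rewrite /curve !mxE /horner_eval hornerD.
have D0 : curve (map_mx (@deriv F) c) 0 = e - y *m e *m invmx y.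
  rewrite /c !dM !d0 mul0mx add0r mulmx0 addr0 cD !curve_mulmx !curve_const !expm_deriv0 //; last exact: nilmxN.
  by rewrite -/(expm e 0) -/(expm (- e) 0) !expm0 mulmx1 mulmxV // mulmx1 mul1mx mulmxN mulNmx.
apply: (curve_sub_lie F0 _ _ D0) => [s|].
  have Ke : zcl S (expm e s) by apply: (expm_mem F0) => //; rewrite (lie_zcl uS).
  by have := zcl_commutator sS Ke Sy; rewrite cE Ee !mulmxA.
by rewrite cE !expm0 mulmx1 mulmxV // mulmx1.
Qed.

Lemma adjoint_scale S (Y e : mat) (al : F) Q (a : 'I_n.+1 -> int) : closed_subgroup S ->
    Q \in unitmx -> Y = diagm Q (fun i => (a i)%:~R) -> Y \in lie S -> e != 0 -> lieb Y e = al *: e -> al != 0 ->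
  exists y (m : F), [/\ S y, m != 1 & y *m e *m invmx y = m *: e] /\
    forall f, lieb Y f = - al *: f -> y *m f *m invmx y = m^-1 *: f.
Proof.
move=> cS uQ YE YS e0 he al0; have two : (2 : F) != 0 by rewrite F0.
have Y0 : Y != 0 by apply: contraNneq al0 => Y0; move/eqP: he; rewrite Y0 lie0b eq_sym scaler_eq0 (negPf e0) orbF.
have td : tdata <[Y]> Q (fun _ : 'I_1 => a).
  split=> // [Z|d]; last by rewrite big_ord1 -YE => /eqP; rewrite scaler_eq0 (negPf Y0) orbF => /eqP d0 i; rewrite ord1.
  split=> [/vlineP[d ->]|[d ->]]; last by rewrite big_ord1 -YE memvZ ?memv_line.
  by exists (fun=> d); rewrite big_ord1 -YE.
have [j [l jl]] : exists j l, cmx Q e j l != 0.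
  apply: contrapT => nz; case/eqP: e0; apply: (cmx_inj td); apply/matrixP => j l; rewrite cmx0 [RHS]mxE.
  by apply/eqP; apply: contraT => h; case: nz; exists j, l.
pose b := wd (fun _ : 'I_1 => a) j l.
have alE : al = (b 0 0)%:~R.
  apply: (mulIf jl); have := cmx_lieb_om td 0 e j l; rewrite -/b => <-.
  by rewrite /om -YE he cmxZ [RHS]mxE.
have hw f c : lieb Y f = (c%:~R) *: f -> isw Q (fun _ : 'I_1 => a) (const_mx c) f.
  by move=> hf i; rewrite mxE /om -YE.
have Sy : S (psg Q a 2) by apply: psg_mem => //; rewrite -YE.
have Vy : invmx (psg Q a 2) = psg Q a 2^-1.
  by rewrite -[LHS]mulmx1 -(psgM a uQ two) mulKmx // psg_unit.
exists (psg Q a 2), (2 ^ b 0 0); split; [split=> //|].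
- apply: contra_neq al0 => E; rewrite alE (_ : b 0 0 = 0) //; apply: (exprz2_inj F0); by rewrite E expr0z.
- by rewrite Vy (psg_isw F0 td 0 two (hw e (b 0 0) _)) -?alE // [const_mx _ _ _]mxE.
move=> f hf; have hN : lieb Y f = ((- b 0 0)%:~R) *: f by rewrite hf alE rmorphN.
by rewrite Vy (psg_isw F0 td 0 two (hw f _ hN)) [const_mx _ _ _]mxE invr_expz.
Qed.

(** By induction, [e] and [f] stay in the Lie algebra of every derived subgroup. That algebra also
    contains the integral matrix attached to [lieb e f], whose one-parameter subgroup scales [e] and
    [f] by factors other than 1; [derived_lie] then returns nonzero multiples of both. The series
    ends with the trivial group. *)
Lemma solvable_triple S e f Q (a : 'I_n.+1 -> int) (al : F) : subgroup S -> solvable S -> Q \in unitmx ->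
    nilmx e -> nilmx f -> e \in lie S -> f \in lie S ->
    (forall K, subgroup K -> lieb e f \in lie K -> diagm Q (fun l => (a l)%:~R) \in lie K) ->
    lieb (diagm Q (fun l => (a l)%:~R)) e = al *: e -> lieb (diagm Q (fun l => (a l)%:~R)) f = - al *: f ->
  al != 0 -> e = 0.
Proof.
move=> sS [d dS] uQ ne nf eS fS hK he hf al0; apply/eqP; apply: contraT => e0.
have key k : [/\ subgroup (iter k (@derived F n.+1) S), e \in lie (iter k (@derived F n.+1) S) &
    f \in lie (iter k (@derived F n.+1) S)].
  elim: k => [//|k [sk ek fk]]; rewrite iterS; set Sk := iter k _ _ in sk ek fk *.
  have uk := subgroup_unit sk; have ck := zcl_subgroup sk.
  have Yk : diagm Q (fun l => (a l)%:~R) \in lie (zcl Sk) by rewrite (lie_zcl uk); apply: hK => //; apply: lie_bracket.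
  have [y [m' [[Sy m1 ye] yf]]] := adjoint_scale ck uQ erefl Yk e0 he al0.
  have yf' := yf f hf; split; first exact: derived_subgroup.
    have := derived_lie sk ne ek Sy; rewrite ye -{1}[e]scale1r -scalerBl => h1.
    by rewrite -[e]scale1r -(mulVf (_ : 1 - m' != 0)) ?subr_eq0 1?eq_sym // -scalerA memvZ.
  have m1' : 1 - m'^-1 != 0 by rewrite subr_eq0 eq_sym invr_eq1.
  have := derived_lie sk nf fk Sy; rewrite yf' -{1}[f]scale1r -scalerBl => h1.
  by rewrite -[f]scale1r -(mulVf m1') -scalerA memvZ.
have [_ ed _] := key d; rewrite dS in ed; have := lie_trivial ed => /eqP; by rewrite (negPf e0).
Qed.

(** Consider the replicas of [h], the bracket of [e] and [f]; they lie in [t]. If one of them acts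
    on [e] by a nonzero scalar, [solvable_triple] gives [e = 0]. Otherwise [h] is trace-orthogonal
    to all of them, so they vanish and [h] is nilpotent. But its trace against some [om Q w i] is
    [\tr (e *m f)] times a nonzero integer. *)
Lemma solvable_opposite S t r Q (w : 'I_r -> 'I_n.+1 -> int) a e f : subgroup S -> solvable S ->
    maxtoral (lie S) t -> tdata t Q w -> a != 0 -> e \in lie S -> f \in lie S -> isw Q w a e -> isw Q w (- a) f ->
  \tr (e *m f) = 0.
Proof.
move=> sS sol mt td a0 eS fS he hf; apply/eqP; apply: contraT => tef.
have e0 : e != 0 by apply: contraNneq tef => ->; rewrite mul0mx mxtrace0.
have f0 : f != 0 by apply: contraNneq tef => ->; rewrite mulmx0 mxtrace0.
have [tk tt tmax] := mt; pose h := lieb e f.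
have Na0 : - a != 0 by rewrite oppr_eq0.
have ne := isw_nil F0 td a0 he; have nf := isw_nil F0 td Na0 hf.
have ch H : H \in t -> H *m h = h *m H.
  by apply: (isw0P td h).1; rewrite -(subrr a); apply: isw_bracket.
have [i ai] : exists i, a 0 i != 0.
  apply: contrapT => nz; case/eqP: a0; apply/rowP => i; rewrite mxE.
  by apply/eqP; apply: contraT => hi; case: nz; exists i.
have hS : h \in lie S by apply: lie_bracket.
have [m [c [Q' [b [uQ' cfree hq nil hK]]]]] := replicas F0 h.
pose Y j := diagm Q' (fun l => (b j l)%:~R : F).
have Yt j : Y j \in t.
  apply: (maxtoral_mem mt); [exact: hK|by exists Q' => //; eexists|].
  by move=> H Ht; rewrite /Y; have [q ->] := hq j; apply: comm_mx_horner; apply: ch.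
have ev j : exists al, forall (b : 'rV[int]_r) X, isw Q w b X -> b = a -> lieb (Y j) X = al *: X.
  by have [x ->] := (td_span td (Y j)).1 (Yt j); exists (pairing a x) => b' X hX <-; exact: (lieb_toral x hX).
have [j [al [al0 hal]]] : exists j al, al != 0 /\ (lieb (Y j) e = al *: e /\ lieb (Y j) f = - al *: f).
  apply: contrapT => H.
  have Ye j : lieb (Y j) e = 0.
    have [x Ex] := (td_span td (Y j)).1 (Yt j); have := lieb_toral x he; rewrite -Ex => E.
    have [p0|p0] := eqVneq (pairing a x) 0; first by rewrite E p0 scale0r.
    case: H; exists j, (pairing a x); split=> //; split=> //; rewrite Ex (lieb_toral x hf); congr (_ *: _).
    by rewrite /pairing -sumrN; apply: eq_bigr => l _; rewrite mxE rmorphN mulNr.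
  pose N := h - \sum_j c j *: Y j.
  have hY j : \tr (h *m Y j) = 0.
    by rewrite trace_lieb liebN Ye oppr0 mulmx0 mxtrace0 oppr0.
  have NY j : \tr (N *m Y j) = 0.
    apply: nilmx_trace; apply: nilmx_mulC => //; rewrite /N mulmxBl mulmxBr.
    have -> : h *m Y j = Y j *m h by rewrite ch.
    congr (_ - _); rewrite mulmx_suml mulmx_sumr; apply: eq_bigr => l _.
    by rewrite -scalemxAl -scalemxAr (toral_commute tt (Yt l) (Yt j)).
  have YY j : \sum_l (\sum_q b l q * b j q)%:~R * c l = 0.
    have := hY j; rewrite -[h](subrK (\sum_j c j *: Y j)) -/N mulmxDl linearD /= NY add0r => E; rewrite -[RHS]E.
    rewrite mulmx_suml linear_sum; apply: eq_bigr => l _ /=; rewrite -scalemxAl linearZ /= mulrC; congr (_ * _).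
    by rewrite /Y diagm_mul // diagm_trace // rmorph_sum; apply: eq_bigr => q _; rewrite rmorphM.
  have Y0 j : Y j = 0.
    have b0 : forall q, b j q = 0.
      by apply: int_sqr_sum0; apply: (cfree (fun l => \sum_q b l q * b j q)); apply: YY.
    rewrite /Y (_ : (fun l => _) = fun=> 0); first by rewrite diagm_const // raddf0.
    by apply: funext => q; rewrite b0.
  have nh : nilmx h by move: nil; rewrite big1 ?subr0 // => l _; rewrite -/(Y l) Y0 scaler0.
  have : \tr (h *m om Q w i) = 0.
    by apply: nilmx_trace; apply: nilmx_mulC => //; rewrite ch //; apply: om_mem td i.
  rewrite trace_lieb liebN mulmxN linearN opprK he -scalemxAr linearZ /= mxtrace_mulC => /eqP.
  by rewrite mulf_eq0 (negPf tef) orbF char0_intr // (negPf ai).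
case/eqP: e0; apply: (solvable_triple sS sol uQ' ne nf eS fS _ hal.1 hal.2 al0) => K sK hk; exact: hK.
Qed.

Lemma nondegenerate_radical_dim K (b : {vspace mat}) : nondegenerate K -> (b <= lie K)%VS ->
  forall R : {vspace mat}, (R <= lie K)%VS -> (forall X Y, X \in R -> Y \in b -> \tr (X *m Y) = 0) ->
  (\dim R + \dim b <= \dim (lie K))%N.
Proof.
move=> nd bK R RK RB; pose v := vbasis (lie K); pose u := vbasis R; pose s := vbasis b.
pose U : 'M[F]_(\dim R, \dim (lie K)) := \matrix_(i, j) coord v j u`_i.
pose P : 'M[F]_(\dim (lie K), \dim b) := \matrix_(i, j) \tr (v`_i *m s`_j).
have uR (i : 'I_(\dim R)) : u`_i \in R by apply: vbasis_mem; rewrite mem_nth ?size_tuple.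
have sB (i : 'I_(\dim b)) : s`_i \in b by apply: vbasis_mem; rewrite mem_nth ?size_tuple.
have vK (i : 'I_(\dim (lie K))) : v`_i \in lie K by apply: vbasis_mem; rewrite mem_nth ?size_tuple.
have UP : U *m P = 0.
  apply/matrixP => i j; rewrite !mxE -[RHS](RB _ _ (uR i) (sB j)) [X in \tr (X *m _)](coord_vbasis (subvP RK _ (uR i))).
  by rewrite mulmx_suml linear_sum; apply: eq_bigr => l _; rewrite !mxE -scalemxAl linearZ.
have rU : \rank U = \dim R.
  apply/eqP; rewrite -[_ == _]/(row_free U) -kermx_eq0; apply/eqP/row_matrixP => i; rewrite row0.
  have : row i (kermx U) *m U = 0 by apply/sub_kermxP; apply: row_sub.
  move: (row i (kermx U)) => x xU; have /freeP fu : free u by apply: basis_free; apply: vbasisP.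
  apply/rowP => l; rewrite [RHS]mxE; apply: (fu (fun l => x 0 l)).
  have yR : \sum_l x 0 l *: u`_l \in lie K by apply: memv_suml => q _; rewrite memvZ // (subvP RK).
  rewrite (coord_vbasis yR) big1 // => q _; have /rowP/(_ q) := xU; rewrite [RHS]mxE mxE => E.
  rewrite (_ : coord _ q _ = 0) ?scale0r // -[RHS]E linear_sum; apply: eq_bigr => o _ /=.
  by rewrite linearZ /= [U _ _]mxE.
have rP : \rank P = \dim b.
  rewrite -mxrank_tr; apply/eqP; rewrite -[_ == _]/(row_free P^T) -kermx_eq0; apply/eqP/row_matrixP => i; rewrite row0.
  have : row i (kermx P^T) *m P^T = 0 by apply/sub_kermxP; apply: row_sub.
  move: (row i (kermx P^T)) => x xP; have /freeP fs : free s by apply: basis_free; apply: vbasisP.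
  apply/rowP => l; rewrite [RHS]mxE; apply: (fs (fun l => x 0 l)); apply: nd.
    by apply: memv_suml => q _; rewrite memvZ // (subvP bK).
  move=> Z Zk; rewrite (coord_vbasis Zk) mulmx_sumr linear_sum big1 // => q _ /=.
  rewrite -scalemxAr linearZ /=; have /rowP/(_ q) := xP; rewrite [RHS]mxE mxE => E.
  rewrite (_ : \tr _ = 0) ?mulr0 // -[RHS]E mulmx_suml linear_sum; apply: eq_bigr => o _ /=.
  by rewrite -scalemxAl linearZ /= mxtrace_mulC [P^T _ _]mxE [P _ _]mxE.
by rewrite -rU -rP; apply: mulmx0_rank_max.
Qed.

(** Let [R] be the radical of the trace form restricted to [lie S]. Nonzero weight vectors lie in
    [R] by [solvable_opposite], and the centralizer of [t] lies in [t + R]. As [R] is orthogonal to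
    [lie S] inside the nondegenerate [lie K], the dimensions of [R] and [lie S] add up to at most
    that of [lie K]. *)
Theorem solvable_dim K S : nondegenerate K -> (lie S <= lie K)%VS -> closed_subgroup S -> solvable S ->
  exists t, maxtoral (lie S) t /\ (2 * \dim (lie S) <= \dim (lie K) + \dim t)%N.
Proof.
move=> nd SK [sS _] solS; have [t mt] := maxtoral_exists (lie S); exists t; split=> //.
have [Q [w td]] := tdata_exists F0 sS mt; have [tS tt _] := mt.
have bS : bracket_closed (lie S) by move=> X Y; apply: lie_bracket.
have kw a X : X \in lie S -> wcomp Q w a X \in lie S.
  by move=> XS; apply: (wcomp_mem F0 td) => // i Y YS; apply: bS => //; apply: (subvP tS); apply: om_mem td i.
have [|c X Y hX hY|R hR] := @vspace_of_pred F _ (fun X => X \in lie S /\ forall Y, Y \in lie S -> \tr (X *m Y) = 0).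
- by split=> [|Y _]; rewrite ?mem0v ?mul0mx ?mxtrace0.
- case: hX hY => Xk hX [Yk hY]; split=> [|Z Zk]; first by rewrite memvD ?memvZ.
  by rewrite mulmxDl -scalemxAl linearD linearZ /= hX // hY // mulr0 addr0.
have sub : (lie S <= t + R)%VS.
  apply/subvP => X XS; rewrite (wcomp_decomp td X); apply: memv_suml => a _.
  have [->|a0] := eqVneq a 0; last first.
    apply: (subvP (addvSr _ _)); apply/hR; split=> [|Y YS]; first exact: kw.
    have := trace_wcomp F0 td Y (wcomp_isw F0 td a X) => ->.
    by apply: (solvable_opposite sS solS mt td a0); [exact: kw|exact: kw|exact: (wcomp_isw F0 td)|exact: (wcomp_isw F0 td)].
  have c0 := (isw0P td _).1 (wcomp_isw F0 td 0 X).
  have [m [c [Y [Yt _ nil _]]]] := maxtoral_split F0 sS mt (kw 0 X XS) c0.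
  set s := \sum_j _ in nil; have st : s \in t by apply: memv_suml => j _; rewrite memvZ.
  rewrite -[wcomp _ _ _ _](subrK s) addrC; apply: memv_add => //; apply/hR.
  have Nk : wcomp Q w 0 X - s \in lie S by rewrite memvB ?kw // (subvP tS).
  split=> // Z ZS; apply: (nil_centralizer_radical F0 sS mt) => // H Ht.
  by rewrite mulmxBl mulmxBr c0 // (toral_commute tt Ht st).
have RS : (R <= lie S)%VS by apply/subvP => X /hR[].
have := nondegenerate_radical_dim nd SK (subv_trans RS SK) (fun X Y hX hY => ((hR X).1 hX).2 Y hY).
have := leq_trans (dimvS sub) (dimv_add_leqif t R).1; lia.
Qed.
End Solvable.

(** * Growth of functions and open orbits *)

Section Growth.
Variables (F : closedFieldType) (n : nat).
Hypothesis F0 : char0 F.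
Local Notation N := (n.+1 * n.+1)%N.
Local Notation poly := {mpoly F[N]}.
Local Notation mat := 'M[F]_n.+1.
Implicit Types (X Y Z A B g : mat) (K : set mat) (p q : poly).

(** The product of the operators [ider X - m] for [m] in [s]. Such products replace powers of
    [ider X], since a bounded number of factors annihilates all polynomials of bounded degree. *)
Definition eop X (s : seq F) p : poly := foldr (shift (@ider F n X)) p s.

Lemma eop_linear X s c p q : eop X s (c *: p + q) = c *: eop X s p + eop X s q.
Proof.
elim: s => //= m s ->; rewrite /shift iderD iderZ scalerBr scalerDr opprD addrACA !scalerA.
by rewrite (mulrC m).
Qed.

Lemma eop0 X s : eop X s 0 = 0.
Proof. by elim: s => //= m s ->; rewrite /shift ider0 scaler0 subr0. Qed.

Lemma eop_sum X s (I : Type) (r : seq I) (G : I -> poly) :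
  eop X s (\sum_(i <- r) G i) = \sum_(i <- r) eop X s (G i).
Proof.
by elim: r => [|i r IH]; rewrite ?big_nil ?eop0 // !big_cons -[G i]scale1r eop_linear !scale1r IH.
Qed.

Lemma eopZ X s c p : eop X s (c *: p) = c *: eop X s p.
Proof. by have := eop_linear X s c p 0; rewrite eop0 !addr0. Qed.

Lemma msize_xvarM k i j p : (msize p <= k.+1)%N -> (msize (xvar F i j * p) <= k.+2)%N.
Proof.
have [->|p0] := eqVneq p 0; first by rewrite mulr0 msize0.
have x2 : msize (xvar F i j) = 2 by rewrite /xvar msizeX mdeg1.
by rewrite msizeM // ?x2 // -msize_poly_eq0 x2.
Qed.

Lemma msize_ider k X p : (msize p <= k.+1)%N -> (msize (ider X p) <= k.+1)%N.
Proof.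
move=> sp; suff: (msize p <= k.+1)%N && (msize (ider X p) <= k.+1)%N by case/andP.
move: k p sp; apply: mdeg_ind => [|k|k p q /andP[hp1 hp] /andP[hq1 hq]|k c p /andP[hp1 hp]|k p /andP[hp1 hp]|k i j p /andP[hp1 hp]].
- by rewrite (iderC X 1) msize0 msize1.
- by rewrite ider0 msize0.
- by rewrite iderD !(leq_trans (msizeD_le _ _)) // geq_max ?hp1 ?hp.
- by rewrite iderZ !(leq_trans (msizeZ_le _ _)).
- by apply/andP; split; apply: leqW.
rewrite msize_xvarM //=.
rewrite iderM (leq_trans (msizeD_le _ _)) // geq_max msize_xvarM // andbT ider_xvar mulr_suml.
rewrite (leq_trans (msize_sum _ _ _)) //; apply/bigmax_leqP => l _.
by rewrite -scalerAl (leq_trans (msizeZ_le _ _)) // msize_xvarM.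
Qed.

Lemma msize_eop k X s p : (msize p <= k.+1)%N -> (msize (eop X s p) <= k.+1)%N.
Proof.
move=> hp; elim: s => //= m s IH; rewrite /shift (leq_trans (msizeD_le _ _)) // geq_max msize_ider //.
by rewrite msizeN (leq_trans (msizeZ_le _ _)).
Qed.

Lemma eop_nil X k p : nilmx X -> (msize p <= k.+1)%N -> eop X (nseq (n.+1 * k + 1) 0) p = 0.
Proof.
move=> nX; have E j q : eop X (nseq j 0) q = iter j (shift (@ider F n X) 0) q by elim: j => //= j ->.
move: k p; apply: mdeg_ind => [|k|k p q hp hq|k c p hp|k p hp|k i j p hp].
- by rewrite muln0 /= /shift (iderC X 1) scale0r subr0.
- exact: eop0.
- by rewrite -[p]scale1r eop_linear hp hq addr0 scaler0.
- by rewrite eopZ hp scaler0.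
- have -> : (n.+1 * k.+1 + 1 = n.+1 + (n.+1 * k + 1))%N by rewrite mulnS addnA.
  by rewrite E iterD -[iter (_ + 1) _ _]E hp -E eop0.
have -> : (n.+1 * k.+1 + 1 = n.+1 + (n.+1 * k + 1))%N by rewrite mulnS addnA.
rewrite E -[0 : F]addr0.
apply: iter_shift_mul; last by rewrite -E.
have L m u : iter m (shift (@ider F n X) 0) (linform i u) = linform i (X ^+ m *m u).
  elim: m => [|m IH]; first by rewrite expr0 mul1mx.
  by rewrite iterS IH /shift scale0r subr0 ider_linform exprS mulmxA.
by rewrite -linform_delta L (nilmx_pow nX) mul0mx linform0.
Qed.

Lemma eop_integral Q (a : 'I_n.+1 -> int) (b : nat) k p (s : seq F) : Q \in unitmx -> (forall i, (absz (a i) <= b)%N) ->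
    (msize p <= k.+1)%N -> (forall z : int, (absz z <= k * b)%N -> z%:~R \in s) ->
  eop (diagm Q (fun i => (a i)%:~R)) s p = 0.
Proof.
move=> uQ ab sp; set X := diagm _ _; move: k p sp s.
apply: mdeg_ind => [|k|k p q hp hq|k c p hp|k p hp|k i j p hp] s hs.
- have : 0%:~R \in s by apply: hs.
  have E1 s' : exists c : F, eop X s' 1 = c%:MP.
    elim: s' => [|m s' [c Ec]]; first by exists 1.
    by exists (- (m * c)); rewrite /= Ec /shift iderC sub0r -mul_mpolyC -mpolyCM mpolyCN.
  case/splitPr => s1 s2; have [c Ec] := E1 s2.
  by rewrite /eop foldr_cat /= -/(eop X s2 1) Ec /shift iderC scale0r subr0 -/(eop X s1 0) eop0.
- exact: eop0.
- by rewrite -[p]scale1r eop_linear hp // hq // addr0 scaler0.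
- by rewrite eopZ hp // scaler0.
- by apply: hp => z hz; apply: hs; apply: leq_trans hz _; rewrite leq_mul2r leqnSn orbT.
rewrite (xvar_linform i j uQ) mulr_suml eop_sum big1 // => l _; rewrite -scalerAl eopZ.
rewrite (_ : eop X s _ = linform i (col l (invmx Q)) * eop X [seq m - (a l)%:~R | m <- s] p).
  rewrite hp ?mulr0 ?scaler0 // => z hz; apply/mapP; exists ((z + a l)%:~R); last by rewrite rmorphD addrK.
  by apply: hs; have := ab l; rewrite mulSn; lia.
elim: s {hs} => //= m s ->; rewrite {1}/shift iderM ider_linform diagm_col // linformZ /shift mulrBr scalerBl.
rewrite mulrBr -[in RHS]scalerAr -[in RHS]scalerAr -scalerAl opprB [X in X - _]addrC -addrA; congr (_ + _).
Qed.

(** On degree at most [k], a nilpotent [X] gives an operator whose power of exponent [n.+1 * k + 1]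
    is zero. An integral [X] gives integer eigenvalues between [- k b] and [k b], and one factor for
    each of these [2 k b + 1] values suffices. *)
Lemma growth_kill X : nilmx X \/ integral_elt X -> exists C, forall k, exists mu : nat -> F,
  forall j p, (msize p <= k.+1)%N -> (C * k + 1 <= j)%N -> eop X (mkseq mu j) p = 0.
Proof.
case=> [nX|[Q uQ [a ->]]].
  exists n.+1 => k; exists (fun=> 0) => j p sp kj.
  have -> : mkseq (fun=> 0 : F) j = nseq (j - (n.+1 * k + 1)) 0 ++ nseq (n.+1 * k + 1) 0.
    by rewrite -nseqD subnK // /mkseq; elim: (j) 0%N => //= m IH i; rewrite IH.
  by rewrite /eop foldr_cat -/(eop _ _ p) (eop_nil nX sp) -/(eop _ _ 0) eop0.
pose b := \max_i absz (a i).
exists (2 * b)%N => k; exists (fun l => (l%:Z - (k * b)%N%:Z)%:~R) => j p sp kj.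
apply: (@eop_integral Q a b k) => // [i|z hz]; first exact: leq_bigmax.
apply/mapP; exists (absz (z + (k * b)%N%:Z)%R); first by rewrite mem_iota; lia.
congr (_%:~R); lia.
Qed.

Lemma eop_power (f : poly -> F) X (mu : nat -> F) M p : (forall c q q', f (c *: q + q') = c * f q + f q') ->
    (forall j a, (M <= j)%N -> eop X (mkseq mu j) (iter a (@ider F n X) p) = 0) ->
    (forall j, (j < M)%N -> f (eop X (mkseq mu j) p) = 0) -> forall a, f (iter a (@ider F n X) p) = 0.
Proof.
move=> fl kill h a; have f0 : f 0 = 0 by have := fl (-1) 0 0; rewrite scaler0 addr0 mulN1r addNr.
suff: forall j, f (eop X (mkseq mu j) (iter a (@ider F n X) p)) = 0 by move/(_ 0%N).
elim: a => [|a IH] j; first by have [/h//|hj] := ltnP j M; rewrite (kill j 0%N).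
rewrite iterS; set q := iter _ _ _ in IH *.
have -> : ider X q = mu j *: q + shift (@ider F n X) (mu j) q by rewrite /shift addrC subrK.
rewrite eop_linear fl IH mulr0 add0r.
by have := IH j.+1; rewrite mkseqS /eop foldr_rcons.
Qed.

Section Words.
Variables (d : nat) (X : 'I_d -> mat).
Definition word (s : seq 'I_d) p : poly := wder [seq X i | i <- s] p.

Lemma word_cat s s' p : word (s ++ s') p = word s (word s' p).
Proof. by rewrite /word map_cat /wder foldr_cat. Qed.

Lemma word_linear s c p q : word s (c *: p + q) = c *: word s p + word s q.
Proof. by elim: s => //= i s IH; rewrite /word /= -!/(word s _) IH iderD iderZ. Qed.

Lemma word0 s : word s 0 = 0.
Proof. by elim: s => //= i s IH; rewrite /word /= -/(word s _) IH ider0. Qed.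

Lemma word_sum s (I : Type) (r : seq I) (G : I -> poly) : word s (\sum_(i <- r) G i) = \sum_(i <- r) word s (G i).
Proof.
by elim: r => [|i r IH]; rewrite ?big_nil ?word0 // !big_cons -[G i]scale1r word_linear !scale1r IH.
Qed.

Lemma wordZ s c p : word s (c *: p) = c *: word s p.
Proof. by have := word_linear s c p 0; rewrite word0 !addr0. Qed.

Definition ordered (a : 'I_d -> nat) : seq 'I_d := flatten [seq nseq (a i) i | i <- enum 'I_d].

Lemma perm_ordered s : perm_eq s (ordered (fun i => count_mem i s)).
Proof.
suff H (L : seq 'I_d) s' : uniq L -> {subset s' <= L} ->
    perm_eq s' (flatten [seq nseq (count_mem i s') i | i <- L]).
  by apply: H; [exact: enum_uniq | move=> i _; rewrite mem_enum].
move=> uL sL; have cf c x : count_mem x (flatten [seq nseq (c i) i | i <- L]) = if x \in L then c x else 0%N.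
  elim: (L) uL => //= i L' IH /andP[iL uL']; rewrite count_cat count_nseq IH // in_cons /= [i == x]eq_sym.
  by case: eqP => [->|_]; rewrite ?mem_head ?(negPf iL) ?mul1n ?addn0 ?mul0n.
apply/allP => x _; rewrite /= cf; case: ifP => // xL; apply/eqP/count_memPn.
by apply: contraFN xL => /sL.
Qed.

(* Straightening: modulo shorter words, neighbouring letters commute. *)
Lemma straighten p (st : 'I_d -> 'I_d -> 'I_d -> F) :
    (forall i j, lieb (X i) (X j) = \sum_l st i j l *: X l) ->
    (forall a, mxeval (word (ordered a) p) 1%:M = 0) ->
  forall s, mxeval (word s p) 1%:M = 0.
Proof.
move=> hst hord s; have [m] := ubnP (size s); elim: m s => // m IH s; rewrite ltnS leq_eqVlt => /orP[/eqP sm|]; last exact: IH.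
pose ev s := mxeval (word s p) 1%:M.
have swap u v i j : (size u + size v).+2 = m -> ev (u ++ i :: j :: v) = ev (u ++ j :: i :: v).
  move=> suv; apply/eqP; rewrite -subr_eq0 /ev !word_cat /word /= -!/(word _ _) -mxevalB.
  have -> : word u (ider (X i) (ider (X j) (word v p))) - word u (ider (X j) (ider (X i) (word v p))) =
      \sum_l st i j l *: word (u ++ l :: v) p.
    rewrite -[in LHS]scaleN1r addrC -word_linear scaleN1r addrC -ider_bracket hst ider_suml word_sum.
    by apply: eq_bigr => l _; rewrite ider_scalel wordZ word_cat.
  rewrite mxeval_sum big1 // => l _; rewrite mxevalZ IH ?mulr0 // size_cat /=; lia.
have move1 u v i r : (size u + size v + size r).+1 = m -> ev (u ++ i :: r ++ v) = ev (u ++ r ++ i :: v).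
  elim: r u => //= j r IHr u hs; rewrite swap ?size_cat; last by lia.
  by rewrite -cat_rcons IHr ?size_rcons ?cat_rcons //; lia.
have perm u r r' : (size u + size r)%N = m -> perm_eq r r' -> ev (u ++ r) = ev (u ++ r').
  elim: r u r' => [|i r IHr] u r' hs; first by move=> hr; have := perm_size hr; case: r' {hr}.
  move=> hr; have ir : i \in r' by rewrite -(perm_mem hr) mem_head.
  case/splitPr: ir hr => r1 r2 hr.
  have hr' : perm_eq r (r1 ++ r2) by move: hr; rewrite perm_sym perm_catC /= perm_cons perm_catC perm_sym.
  have := perm_size hr'; rewrite size_cat => sz.
  rewrite -(move1 u r2 i r1); last by rewrite -hs /= sz addnS -addnA [(size r2 + _)%N]addnC.
  by rewrite -!cat_rcons; apply: IHr; rewrite ?size_rcons //; move: hs => /=; lia.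
by rewrite -[LHS]/(ev ([::] ++ s)) (perm [::] s _ sm (perm_ordered s)); apply: hord.
Qed.

(** For each letter, powers of the derivation are combinations of the products [eop] of length less
    than [M], because longer products vanish in this degree. So finitely many conditions control all
    ordered words. *)
Lemma bounded_words (f : poly -> F) (mu : 'I_d -> nat -> F) k M p : (0 < M)%N -> (msize p <= k.+1)%N ->
    (forall i j q, (msize q <= k.+1)%N -> (M <= j)%N -> eop (X i) (mkseq (mu i) j) q = 0) ->
    (forall c q q', f (c *: q + q') = c * f q + f q') ->
    (forall j : 'I_d -> nat, (forall i, (j i < M)%N) ->
       f (foldr (fun i => eop (X i) (mkseq (mu i) (j i))) p (enum 'I_d)) = 0) ->
  forall a, f (word (ordered a) p) = 0.
Proof.
move=> M0 sp kill fl; rewrite /ordered; have := enum_uniq 'I_d; move: (enum _) => L uL h a.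
elim: L uL f fl h => [|i L IH] /=; first by move=> _ f fl h; apply: (h (fun=> 0%N)).
case/andP => iL uL f fl h; rewrite word_cat.
have itE m q : word (nseq m i) q = iter m (@ider F n (X i)) q.
  by elim: m => //= m <-.
pose f' q := f (word (nseq (a i) i) q).
apply: (IH uL f') => [c q q'|j hj]; first by rewrite /f' word_linear fl.
rewrite /f' itE; set q := foldr _ _ _.
have sq : (msize q <= k.+1)%N by rewrite /q; elim: (L) => //= l L' IHL; apply: msize_eop.
apply: (eop_power (mu := mu i) (M := M)) => // [m b hm|m hm].
  by apply: kill => //; elim: b => //= b IHb; apply: msize_ider.
have := h (fun l => if l == i then m else j l); rewrite eqxx.
rewrite (_ : foldr _ _ _ = q) => [->//|]; last first.
  rewrite /q; elim: (L) iL => //= l L' IHL; rewrite inE negb_or => /andP[il iL'].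
  by rewrite IHL // eq_sym (negPf il).
by move=> l; case: eqP.
Qed.
End Words.

Lemma words_vanish K p (d : nat) (X : 'I_d -> mat) : closed_connected K ->
    (forall Y, Y \in lie K -> exists c : 'I_d -> F, Y = \sum_l c l *: X l) ->
    (forall s, mxeval (word X s p) 1%:M = 0) -> vanish K p.
Proof.
move=> cK span h; have [[sK _] _] := cK; have K1 := subgroup_one sK.
have all_words s : (forall Y, Y \in s -> Y \in lie K) -> forall s', mxeval (word X s' (wder s p)) 1%:M = 0.
  elim: s => [|Y s IH] hs s'; first exact: h.
  have [c ->] := span Y (hs Y (mem_head _ _)); rewrite /= ider_suml word_sum mxeval_sum big1 // => l _.
  rewrite ider_scalel wordZ mxevalZ (_ : word _ _ _ = word X (rcons s' l) (wder s p)).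
    by rewrite IH ?mulr0 // => Z Zs; apply: hs; rewrite inE Zs orbT.
  by rewrite -cats1 word_cat.
have [k|u u1 up] := krull sK (p := p); last by apply: (vanish_mul F0 cK K1 _ up); rewrite u1 oner_neq0.
by apply: (cartier F0 sK) => s _ hs; apply: (all_words s hs [::]).
Qed.

(** A polynomial is determined on [K] by its derivatives at [1] along words in a basis of [lie K].
    Ordered words suffice, and in degree [k] only [(C * k + 1) ^ \dim (lie K)] functionals matter;
    more functions than that are dependent. *)
Theorem growth K : closed_connected K -> exists C, forall k (I : finType) (f : I -> poly),
    (forall i, (msize (f i) <= k.+1)%N) -> ((C * k + 1) ^ \dim (lie K) < #|I|)%N ->
  exists2 c : I -> F, exists i, c i != 0 & vanish K (\sum_i c i *: f i).
Proof.
move=> cK; have [[sK _] _] := cK; have [e [be he]] := lie_basis F0 sK.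
set d := \dim (lie K); have se : size e = d by have := basis_free be; rewrite /free (span_basis be) => /eqP.
pose X (i : 'I_d) := e`_i.
have Xe i : X i \in e by rewrite mem_nth ?se.
have XK i : X i \in lie K by rewrite -(span_basis be) memv_span.
have span Y : Y \in lie K -> exists c : 'I_d -> F, Y = \sum_l c l *: X l.
  move=> YK; have se' : size e == d by rewrite se.
  have := YK; rewrite -(span_basis be) => /(coord_span (X := Tuple se')) ->; eexists; reflexivity.
have /choice[C hC] i := growth_kill (he _ (Xe i)).
exists (\max_i C i)%N => k I f sf ltI; set M := (_ * k + 1)%N in ltI; have M0 : (0 < M)%N by rewrite /M addn1.
have /choice[mu hmu] i := hC i k.
have kill i j q : (msize q <= k.+1)%N -> (M <= j)%N -> eop (X i) (mkseq (mu i) j) q = 0.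
  move=> sq Mj; apply: hmu => //; apply: leq_trans Mj; rewrite /M leq_add2r leq_mul2r; apply/orP; right.
  exact: leq_bigmax.
pose lam (j : {ffun 'I_d -> 'I_M}) p := mxeval (foldr (fun i => eop (X i) (mkseq (mu i) (j i))) p (enum 'I_d)) 1%:M.
have laml j c p q : lam j (c *: p + q) = c * lam j p + lam j q.
  rewrite /lam -mxevalZ -mxevalD; congr (mxeval _ _); elim: (enum _) => //= i L ->; exact: eop_linear.
have lam0 j : lam j 0 = 0 by have := laml j (-1) 0 0; rewrite scaler0 addr0 mulN1r addNr.
pose V : 'M[F]_(#|I|, #|{ffun 'I_d -> 'I_M}|) := \matrix_(i, j) lam (enum_val j) (f (enum_val i)).
have : ~~ row_free V.
  rewrite -row_leq_rank -ltnNge; apply: leq_ltn_trans (rank_leq_col V) _.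
  by rewrite card_ffun !card_ord.
rewrite -kermx_eq0 => /rowV0Pn[c /sub_kermxP cV c0].
exists (fun i => c 0 (enum_rank i)).
  have [l cl] : exists l, c 0 l != 0.
    apply: contrapT => H; case/eqP: c0; apply/rowP => l; rewrite mxE.
    by apply/eqP; apply: contraT => hl; case: H; exists l.
  by exists (enum_val l); rewrite enum_valK.
set p := \sum_i _; have lp j : lam j p = 0.
  have -> : lam j p = \sum_i c 0 (enum_rank i) * lam j (f i).
    by rewrite /p; elim: (index_enum _) => [|i s IH]; rewrite ?big_nil ?lam0 // !big_cons laml IH.
  have /rowP/(_ (enum_rank j)) := cV; rewrite [RHS]mxE mxE => E; rewrite -[RHS]E.
  rewrite (reindex_onto enum_val enum_rank) => [|i _]; last exact: enum_rankK.
  rewrite (eq_bigl predT) => [|l]; last by rewrite enum_valK eqxx.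
  by apply: eq_bigr => l _; rewrite enum_valK mxE enum_rankK.
have sp : (msize p <= k.+1)%N.
  rewrite /p; elim/big_ind: _ => [|u v hu hv|i _]; first by rewrite msize0.
    by rewrite (leq_trans (msizeD_le _ _)) // geq_max hu.
  by rewrite (leq_trans (msizeZ_le _ _)).
have [/choice[st hst]] : (forall i, exists st : 'I_d -> 'I_d -> F, forall j, lieb (X i) (X j) = \sum_l st j l *: X l) /\ True.
  split=> // i; have /choice[c' hc'] j := span _ (lie_bracket sK (XK i) (XK j)).
  by exists c'.
move=> _; apply: (words_vanish cK span); apply: (straighten hst).
apply: (bounded_words (mu := mu) (f := fun q => mxeval q 1%:M) M0 sp kill) => [c' q q'|j hj].
  by rewrite mxevalD mxevalZ.
have := lp [ffun i => Ordinal (hj i)]; rewrite /lam.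
by congr (mxeval _ _ = 0); elim: (enum _) => //= i L ->; rewrite ffunE.
Qed.
End Growth.

(** * Differentials of representations *)

Section PolynomialRepresentations.
Variables (F : closedFieldType) (n : nat).
Hypothesis F0 : char0 F.
Local Notation N := (n.+1 * n.+1)%N.
Local Notation poly := {mpoly F[N]}.
Local Notation mat := 'M[F]_n.+1.
Implicit Types (X Y Z A B g : mat) (K S G : set mat) (p q : poly).

(** A common power of the determinant clears all denominators. The twist leaves lines and their
    stabilizers unchanged, but shifts the weights. *)
Lemma rational_rep_polynomial G m (rho : mat -> 'M[F]_m) : (forall g, G g -> g \in unitmx) -> rational_rep G rho ->
  exists k (R : 'M[poly]_m), forall g, G g -> map_mx (fun p => mxeval p g) R = \det g ^+ k *: rho g.
Proof.
move=> uG [reg _ _]; have [D hD] := det_poly F n.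
have /choice[pk hpk] (ij : 'I_m * 'I_m) : exists pk : poly * nat, forall A, G A -> rho A ij.1 ij.2 = mxeval pk.1 A / \det A ^+ pk.2.
  by have [p [k h]] := reg ij.1 ij.2; exists (p, k).
pose k := \max_ij (pk ij).2; exists k, (\matrix_(i, j) ((pk (i, j)).1 * D ^+ (k - (pk (i, j)).2))) => g Gg.
apply/matrixP => i j; rewrite !mxE mxevalM mxevalX hD (hpk (i, j)) //=.
have le : ((pk (i, j)).2 <= k)%N by apply: (leq_bigmax (i, j)).
have ug : \det g \is a GRing.unit by rewrite -unitmxE uG.
by rewrite -{2}(subnK le) exprD [RHS]mulrACA mulfV ?mulr1 1?mulrC // -unitfE unitrX.
Qed.

Lemma psg_weight_deriv Q (a : 'I_n.+1 -> int) (e : int) c q : Q \in unitmx ->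
    (forall z, z != 0 -> mxeval q (psg Q a z) = z ^ e * c) ->
  mxeval (ider (diagm Q (fun i => (a i)%:~R)) q) 1%:M = e%:~R * c.
Proof.
move=> uQ hq; have [k [P hP]] := psg_poly a q uQ.
have [P1 dP1] := hP 1 (oner_neq0 F); rewrite (psg1 a uQ) in P1 dP1.
have q1 : mxeval q 1%:M = c by rewrite -(psg1 a uQ) hq ?oner_neq0 // exp1rz mul1r.
pose s := absz e; pose t := absz (e + s%:Z); have te : t%:Z = e + s%:Z by rewrite /t /s; lia.
have E : 'X^s * P = c *: 'X^(k + t).
  apply/eqP; rewrite -subr_eq0; apply/eqP; apply: (@mulfI _ 'X); first by rewrite polyX_eq0.
  rewrite mulr0; apply: (poly_eq0_char0 F0) => z; rewrite hornerM hornerX.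
  have [->|z0] := eqVneq z 0; first by rewrite mul0r.
  rewrite hornerD hornerN hornerM hornerZ !hornerXn (hP z z0).1 hq //.
  rewrite (_ : z ^+ s * _ = c * z ^+ (k + t)) ?subrr ?mulr0 //.
  have zt : z ^+ t = z ^ e * z ^+ s by rewrite (exprnP z t) te expfzDr // -(exprnP z s).
  by rewrite exprD zt; move: (z ^+ s) (z ^+ k) (z ^ e) => u v y; ring.
have := congr1 (fun p : {poly F} => (p^`()).[1]) E.
rewrite derivM derivZ !derivXn hornerD !hornerM hornerZ !hornerMn !hornerXn !expr1n mul1r.
rewrite P1 expr1n !mul1r q1 in dP1 *; rewrite dP1 natrD => E'.
have tF : t%:R = e%:~R + s%:R :> F.
  by have := congr1 (fun z : int => z%:~R : F) te; rewrite rmorphD /= -!pmulrn.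
apply: (addrI (s%:R * c + k%:R * c)); rewrite -addrA E' tF; move: (s%:R) (k%:R) (e%:~R) => u v y; ring.
Qed.

Section Differential.
Variables (G : set mat) (m : nat) (R : 'M[poly]_m).
Hypothesis sG : subgroup G.
Definition repmx g : 'M[F]_m := map_mx (fun p => mxeval p g) R.
Definition drep X : 'M[F]_m := map_mx (fun p => mxeval (ider X p) 1%:M) R.
Hypothesis RM : forall g h, G g -> G h -> repmx (g *m h) = repmx g *m repmx h.

Lemma drepD X Y : drep (X + Y) = drep X + drep Y.
Proof. by apply/matrixP => i j; rewrite !mxE ider_addl mxevalD. Qed.

Lemma drepZ c X : drep (c *: X) = c *: drep X.
Proof. by apply/matrixP => i j; rewrite !mxE ider_scalel mxevalZ. Qed.

Lemma drep_sum (I : Type) (s : seq I) (c : I -> F) (Y : I -> mat) :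
  drep (\sum_(i <- s) c i *: Y i) = \sum_(i <- s) c i *: drep (Y i).
Proof.
elim: s => [|i s IH]; last by rewrite !big_cons drepD drepZ IH.
by rewrite !big_nil -(scale0r (0 : mat)) drepZ scale0r.
Qed.

Lemma drep_at X g i j : X \in lie G -> G g -> mxeval (ider X (R i j)) g = (repmx g *m drep X) i j.
Proof.
move=> /lieP hX Gg; pose q := lmove g (R i j) - \sum_k repmx g i k *: R k j.
have /hX : vanish G q.
  move=> A GA; rewrite mxevalB mxeval_lmove mxeval_sum.
  have /matrixP/(_ i j) := RM Gg GA; rewrite [LHS]mxE => ->; rewrite mxE -sumrB big1 // => k _.
  by rewrite mxevalZ [repmx A _ _]mxE subrr.
rewrite iderB mxevalB ider_lmove mxeval_lmove mulmx1 ider_sum mxeval_sum => /eqP.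
rewrite subr_eq0 => /eqP->; rewrite mxE; apply: eq_bigr => k _.
by rewrite iderZ mxevalZ [drep X _ _]mxE.
Qed.

Lemma drep_bracket X Y : X \in lie G -> Y \in lie G -> drep (lieb X Y) = drep X *m drep Y - drep Y *m drep X.
Proof.
have E U V i j : U \in lie G -> V \in lie G -> mxeval (ider U (ider V (R i j))) 1%:M = (drep U *m drep V) i j.
  move=> /lieP hU hV; pose q := ider V (R i j) - \sum_k drep V k j *: R i k.
  have /hU : vanish G q.
    move=> A GA; rewrite mxevalB (drep_at _ _ hV GA) mxeval_sum mxE -sumrB big1 // => k _.
    by rewrite mxevalZ [repmx A _ _]mxE mulrC subrr.
  rewrite iderB mxevalB ider_sum mxeval_sum => /eqP; rewrite subr_eq0 => /eqP->.
  by rewrite mxE; apply: eq_bigr => k _; rewrite iderZ mxevalZ [drep U _ _]mxE mulrC.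
move=> hX hY; apply/matrixP => i j; rewrite [LHS]mxE ider_bracket mxevalB !E //.
by rewrite [RHS]mxE; congr (_ + _); rewrite [RHS]mxE.
Qed.

(** Preserving a line is expressed by two-by-two minors against a nonzero coordinate of [v]; these
    vanish on [S] and may be differentiated along [X]. *)
Lemma drep_line S (v : 'cV[F]_m) X : v != 0 -> (forall g, S g -> repmx g *m v \in <[v]>%VS) -> X \in lie S ->
  exists c, drep X *m v = c *: v.
Proof.
move=> v0 hS /lieP hX.
have [l vl] : exists l, v l 0 != 0.
  apply: contrapT => H; case/eqP: v0; apply/colP => l; rewrite mxE.
  by apply/eqP; apply: contraT => hl; case: H; exists l.
exists ((drep X *m v) l 0 / v l 0); apply/colP => i; rewrite [RHS]mxE mulrAC.
apply: (canRL (mulfK vl)).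
pose row i' : poly := \sum_j v j 0 *: R i' j.
have rowE i' g : mxeval (row i') g = (repmx g *m v) i' 0.
  by rewrite mxeval_sum mxE; apply: eq_bigr => j _; rewrite mxevalZ [repmx g _ _]mxE mulrC.
have drow i' : mxeval (ider X (row i')) 1%:M = (drep X *m v) i' 0.
  by rewrite ider_sum mxeval_sum mxE; apply: eq_bigr => j _; rewrite iderZ mxevalZ [drep X _ _]mxE mulrC.
have /hX : vanish S (v l 0 *: row i - v i 0 *: row l).
  move=> g Sg; have /vlineP[c hc] := hS g Sg; rewrite mxevalB !mxevalZ !rowE hc ![(c *: v) _ _]mxE.
  by rewrite mulrCA (mulrCA (v i 0)) (mulrC (v i 0)) subrr.
rewrite iderB !iderZ mxevalB !mxevalZ !drow => /eqP; rewrite subr_eq0 => /eqP E.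
by rewrite mulrC E mulrC.
Qed.

Lemma drep_weight Q (a : 'I_n.+1 -> int) (e : int) (v : 'cV[F]_m) : Q \in unitmx ->
    (forall z, z != 0 -> repmx (psg Q a z) *m v = z ^ e *: v) ->
  drep (diagm Q (fun i => (a i)%:~R)) *m v = e%:~R *: v.
Proof.
move=> uQ h; apply/colP => i; rewrite [RHS]mxE.
rewrite -(@psg_weight_deriv Q a e (v i 0) (\sum_j v j 0 *: R i j) uQ) => [|z z0].
  by rewrite ider_sum mxeval_sum mxE; apply: eq_bigr => j _; rewrite iderZ mxevalZ [drep _ _ _]mxE mulrC.
have /colP/(_ i) := h z z0; rewrite [RHS]mxE => <-; rewrite mxE mxeval_sum.
by apply: eq_bigr => j _; rewrite mxevalZ [repmx _ _ _]mxE mulrC.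
Qed.
End Differential.
End PolynomialRepresentations.

(** * Homogeneous functions and the dimension of open orbits *)

Section OrbitDimension.
Variables (F : closedFieldType) (n : nat).
Hypothesis F0 : char0 F.
Local Notation N := (n.+1 * n.+1)%N.
Local Notation poly := {mpoly F[N]}.
Local Notation mat := 'M[F]_n.+1.
Implicit Types (A B g x : mat) (K S G : set mat) (p q : poly).

Lemma euler_homog r d (H : {mpoly F[r]}) : H \is d.-homog for mdeg -> \sum_j 'X_j * H^`M(j) = d%:R *: H.
Proof.
move/dhomogP => hH; rewrite [in RHS](mpolyE H) scaler_sumr.
transitivity (\sum_j \sum_(m <- msupp H) 'X_j * (H@_m *: 'X_[m])^`M(j)).
  by apply: eq_bigr => j _; rewrite [in LHS](mpolyE H) raddf_sum mulr_sumr.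
rewrite exchange_big big_seq [RHS]big_seq; apply: eq_bigr => m /hH <- /=.
under eq_bigr => j _ do rewrite mderivZ mderivX scalerA -scalerAr.
have E j : (m j)%:R != 0 :> F -> 'X_j * 'X_[m - U_(j)] = 'X_[m] :> {mpoly F[r]}.
  rewrite F0 -mpolyXD => mj; congr 'X_[_]; apply/mnmP => l; rewrite mnmDE mnmBE mnmE.
  by case: eqP => [<-|_]; [rewrite subnKC // lt0n | rewrite add0n subn0].
rewrite mdegE natr_sum scalerA mulr_suml scaler_suml; apply: eq_bigr => j _.
by have [->|/E->] := eqVneq (m j)%:R (0 : F); rewrite ?mulr0 ?mul0r ?scale0r // mulrC.
Qed.

Lemma mderiv_homog r d (H : {mpoly F[r]}) j : H \is d.+1.-homog for mdeg -> H^`M(j) \is d.-homog for mdeg.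
Proof.
move/dhomogP => hH; rewrite (mpolyE H) raddf_sum big_seq; apply: rpred_sum => m /hH hm /=.
rewrite mderivZ mderivX scalerA; have [m0|m0] := eqVneq (m j) 0%N; first by rewrite m0 mulr0 scale0r rpred0.
have mE : (U_(j) + (m - U_(j)))%MM = m.
  apply/mnmP => l; rewrite mnmDE mnmBE mnmE.
  by case: eqP => [<-|_]; [rewrite subnKC // lt0n | rewrite add0n subn0].
apply: rpredZ; rewrite dhomogX; have := congr1 mdeg mE; rewrite mdegD mdeg1 add1n => E.
by rewrite -eqSS E hm.
Qed.

Definition subst r (Z : 'I_r -> poly) (H : {mpoly F[r]}) : poly := mmap (@mpolyC N F) Z H.

Lemma mxeval_subst r (Z : 'I_r -> poly) H g : mxeval (subst Z H) g = H.@[fun j => mxeval (Z j) g].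
Proof.
rewrite /subst; elim/mpoly_ring_ind: H => [c|j|p q hp hq|p q hp hq].
- by rewrite mmapC mevalC mxevalC.
- by rewrite mmapX mmap1U mevalXU.
- by rewrite mmapD mevalD mxevalD hp hq.
- by rewrite rmorphM mevalM mxevalM hp hq.
Qed.

Lemma ider_subst r (Z : 'I_r -> poly) H (Y : mat) :
  ider Y (subst Z H) = \sum_j subst Z H^`M(j) * ider Y (Z j).
Proof.
rewrite /subst; elim/mpoly_ring_ind: H => [c|j|p q hp hq|p q hp hq].
- by rewrite mmapC iderC big1 // => j _; rewrite mderivC mmap0 mul0r.
- rewrite mmapX mmap1U (bigD1 j) //= big1 ?addr0 => [|l lj].
    by rewrite mderivX mnmE eqxx mulr1n scale1r mnm_subnn mpolyX0 rmorph1 mul1r.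
  by rewrite mderivX mnmE eq_sym (negPf lj) scale0r mmap0 mul0r.
- rewrite mmapD iderD hp hq -big_split; apply: eq_bigr => j _ /=.
  by rewrite mderivD mmapD mulrDl.
- rewrite rmorphM iderM hp hq mulr_suml mulr_sumr -big_split; apply: eq_bigr => j _ /=.
  by rewrite mderivM mmapD !rmorphM /= mulrDl mulrAC -!mulrA.
Qed.

Lemma det_mxeval r (M : 'M[poly]_r) g : mxeval (\det M) g = \det (map_mx (fun p => mxeval p g) M).
Proof.
rewrite mxeval_meval -det_map_mx; congr (\det _); apply/matrixP => i j; rewrite !mxE.
Qed.

(** A Jacobian criterion. The matrix [MM], with the functions [Z] as first row and their derivatives
    along the [X l] as other rows, is the identity at [1]. It kills the gradient of a homogeneous
    relation, by Euler's formula and by differentiation; hence the partial derivatives are relations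
    of lower degree, zero by induction. *)
Lemma homog_independent G r (Z : 'I_r.+1 -> poly) (X : 'I_r -> mat) : closed_connected G ->
    (forall l, X l \in lie G) -> (forall j, mxeval (Z j) 1%:M = (j == ord0)%:R) ->
    (forall l j, mxeval (ider (X l) (Z j)) 1%:M = (j == lift ord0 l)%:R) ->
  forall d (H : {mpoly F[r.+1]}), H \is d.-homog for mdeg -> vanish G (subst Z H) -> H = 0.
Proof.
move=> cG XG Z1 ZX; have [[sG _] _] := cG; have G1 := subgroup_one sG; elim=> [|d IH] H hH vH.
  have HE : H = (H@_0%MM)%:MP.
    apply/mpolyP => m; rewrite mcoeffC; have [->|m0] := eqVneq m 0%MM; first by rewrite mulr1.
    rewrite mulr0 memN_msupp_eq0 //; apply: contra m0 => /(dhomogP _ _ _ hH) /eqP.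
    by rewrite mdeg_eq0.
  by have := vH _ G1; rewrite HE /subst mmapC mxevalC => ->; rewrite mpolyC0.
pose MM : 'M[poly]_r.+1 := \matrix_(i, j) (if unlift ord0 i is Some l then ider (X l) (Z j) else Z j).
have key j : H^`M(j) = 0.
  apply: IH; first exact: mderiv_homog.
  apply: (vanish_mul F0 cG G1 (z := \det MM)).
    rewrite det_mxeval (_ : map_mx _ _ = 1%:M) ?det1 ?oner_neq0 //.
    apply/matrixP => i k; rewrite !mxE; case: unliftP => [l ->|->]; first by rewrite ZX eq_sym.
    by rewrite Z1 eq_sym.
  move=> g Gg; rewrite mxevalM det_mxeval; set Mg := map_mx _ MM.
  pose a : 'cV[F]_r.+1 := \col_k mxeval (subst Z H^`M(k)) g.
  have Ma : Mg *m a = 0.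
    apply/colP => i; rewrite [RHS]mxE mxE.
    transitivity (\sum_k mxeval (MM i k) g * mxeval (subst Z H^`M(k)) g).
      by apply: eq_bigr => k _; rewrite [a _ _]mxE [Mg _ _]mxE.
    case Ei: (unlift ord0 i) => [l|].
      transitivity (mxeval (ider (X l) (subst Z H)) g).
        by rewrite ider_subst mxeval_sum; apply: eq_bigr => k _; rewrite mxE Ei mxevalM mulrC.
      by apply: (wder_vanish (s := [:: X l]) sG _ vH) => // Y; rewrite inE => /eqP->.
    transitivity (mxeval (subst Z (\sum_k 'X_k * H^`M(k))) g).
      rewrite mxeval_subst raddf_sum; apply: eq_bigr => k _ /=.
      by rewrite mxE Ei mevalM mevalXU -mxeval_subst.
    by rewrite (euler_homog hH) mxeval_subst mevalZ -mxeval_subst vH // mulr0.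
  have : \det Mg *: a = 0 by rewrite -mul_scalar_mx -mul_adj_mx -mulmxA Ma mulmx0.
  by move/colP/(_ j); rewrite !mxE.
have := euler_homog hH; rewrite big1 => [|j _]; last by rewrite key mulr0.
by move/esym/eqP; rewrite scaler_eq0 F0 => /eqP.
Qed.

Lemma msizeM_deg a b p q : (msize p <= a.+1)%N -> (msize q <= b.+1)%N -> (msize (p * q) <= (a + b).+1)%N.
Proof.
have [->|p0] := eqVneq p 0; first by rewrite mul0r msize0.
have [->|q0] := eqVneq q 0; first by rewrite mulr0 msize0.
by rewrite msizeM // => hp hq; rewrite -subn1 leq_subLR (leq_trans (leq_add hp hq)) // addSn addnS.
Qed.

Lemma msize_subst_mnm r e (Z : 'I_r -> poly) (m : 'X_{1..r}) : (forall j, (msize (Z j) <= e.+1)%N) ->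
  (msize (subst Z 'X_[m]) <= (mdeg m * e).+1)%N.
Proof.
move=> hZ; rewrite /subst mmapX /mmap1 mdegE; elim: (index_enum _) => [|j s IH].
  by rewrite !big_nil msize1.
rewrite !big_cons mulnDl; apply: msizeM_deg => //.
elim: (m j) => [|k IHk]; first by rewrite expr0 msize1.
by rewrite exprS (mulSn k e); apply: msizeM_deg.
Qed.

Lemma homog_scale r d (H : {mpoly F[r]}) (c : F) y : H \is d.-homog for mdeg ->
  H.@[fun j => c * y j] = c ^+ d * H.@[y].
Proof.
move/dhomogP => hH; rewrite (mpolyE H) !raddf_sum /= mulr_sumr big_seq [RHS]big_seq.
apply: eq_bigr => m /hH /= md; rewrite !mevalZ mulrCA; congr (_ * _).
rewrite !mevalX -md mdegE -prodrXr.
by rewrite -big_split; apply: eq_bigr => j _; rewrite exprMn.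
Qed.

(* If \dim (lie S) < r, the monomials of degree r k in the r + 1 functions Z, of which there are at
   least (k + 1)^r, outnumber the O(k^(dim S)) independent functions of that degree on S; so a
   homogeneous relation holds on S x, then on the open set, then on G. *)
Theorem open_orbit_dim G S x r (Z : 'I_r.+1 -> poly) (X : 'I_r -> mat) q :
    closed_connected G -> closed_connected S -> G x ->
    (forall l, X l \in lie G) -> (forall j, mxeval (Z j) 1%:M = (j == ord0)%:R) ->
    (forall l j, mxeval (ider (X l) (Z j)) 1%:M = (j == lift ord0 l)%:R) ->
    mxeval q x != 0 ->
    (forall g, G g -> mxeval q g != 0 -> exists b c, S b /\ forall j, mxeval (Z j) g = c * mxeval (Z j) (b *m x)) ->
  (r <= \dim (lie S))%N.
Proof.
move=> cG cS Gx XG Z1 ZX qx hq; rewrite leqNgt; apply/negP => dr; have [C hC] := growth F0 cS.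
set d := \dim _ in dr hC; pose Zx j := rmove x (Z j).
pose e := \max_j msize (Zx j); have he j : (msize (Zx j) <= e.+1)%N by apply: leqW; apply: (leq_bigmax j).
(* With this [M], the growth bound in degree [r * M * e] is at most [(A * M.+1) ^ d = M * M.+1 ^ d],
   which is less than [M.+1 ^ d.+1] and so than the number [M.+1 ^ r] of exponents. *)
pose A := (C * (r * e) + 1)%N; pose M := (A ^ d)%N.
(* The exponents of the last [r] variables are free up to [M]; that of the variable [ord0] completes
   the degree to [r * M]. *)
pose mn (f : {ffun 'I_r -> 'I_M.+1}) : 'X_{1..r.+1} :=
  [multinom (if unlift ord0 j is Some l then f l : nat else r * M - \sum_l f l)%N | j < r.+1].
have mdn f : mdeg (mn f) = (r * M)%N.
  rewrite mdegE big_ord_recl (_ : \sum_(l < r) _ = \sum_l f l)%N; last first.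
    by apply: eq_bigr => l _; rewrite mnmE liftK.
  rewrite mnmE unlift_none subnK //; apply: (@leq_trans (\sum_(l < r) M)); last by rewrite sum_nat_const card_ord.
  by apply: leq_sum => l _; rewrite -ltnS.
have mn_inj : injective mn.
  move=> f f' E; apply/ffunP => l; apply: val_inj; have := congr1 (fun m : 'X_{1..r.+1} => m (lift ord0 l)) E.
  by rewrite !mnmE liftK.
have [||c [f0 cf0] vc] := hC (r * M * e)%N {ffun 'I_r -> 'I_M.+1} (fun f => subst Zx 'X_[mn f]).
- by move=> f; rewrite -(mdn f); apply: msize_subst_mnm.
- rewrite card_ffun !card_ord; apply: (@leq_ltn_trans ((A * M.+1) ^ d)).
    have mono a b j : (a <= b)%N -> (a ^ j <= b ^ j)%N by move=> ab; elim: j => // j IH; rewrite !expnS leq_mul.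
    by apply: mono; rewrite /A; nia.
  rewrite expnMn -/M; apply: (@leq_trans (M.+1 ^ d.+1)); first by rewrite expnS ltn_pmul2r ?expn_gt0.
  by rewrite leq_pexp2l.
pose H : {mpoly F[r.+1]} := \sum_f c f *: 'X_[mn f].
have hH : H \is (r * M).-homog for mdeg.
  by apply: rpred_sum => f _; apply: rpredZ; rewrite dhomogX; apply/eqP/mdn.
have H0 : H != 0.
  apply: contra_neq cf0 => H0; have := congr1 (fun p : {mpoly F[r.+1]} => p@_(mn f0)) H0.
  rewrite mcoeff0 /H raddf_sum (bigD1 f0) //= mcoeffZ mcoeffX eqxx mulr1 big1 ?addr0 // => f ff.
  by rewrite mcoeffZ mcoeffX (inj_eq mn_inj) (negPf ff) mulr0.
have vH b : S b -> H.@[fun j => mxeval (Z j) (b *m x)] = 0.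
  move=> Sb; rewrite -[RHS](vc b Sb) mxeval_sum raddf_sum; apply: eq_bigr => f _ /=.
  rewrite mevalZ mxevalZ mxeval_subst; congr (_ * _); apply: meval_eq => j.
  by rewrite mxeval_rmove.
case/eqP: H0; apply: (homog_independent cG XG Z1 ZX hH).
apply: (vanish_mul F0 cG Gx qx) => g Gg; rewrite mxevalM.
have [->|qg] := eqVneq (mxeval q g) 0; first by rewrite mul0r.
have [b [a [Sb hb]]] := hq g Gg qg; rewrite mxeval_subst.
by rewrite (meval_eq (v2 := fun j => a * mxeval (Z j) (b *m x))) // (homog_scale _ _ hH) vH // !mulr0.
Qed.
End OrbitDimension.

(** * Highest weight vectors for F4 *)

Section HighestWeight.
Variables (F : closedFieldType) (n : nat).
Hypothesis F0 : char0 F.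
Local Notation N := (n.+1 * n.+1)%N.
Local Notation poly := {mpoly F[N]}.
Local Notation mat := 'M[F]_n.+1.
Implicit Types (X Y e f g x : mat) (K S G B P : set mat).

(** A generic combination of the [H l] has distinct eigenvalues on the [y j], so these are
    independent and admit dual coordinates. *)
Lemma joint_eigenvectors m q r (y : 'I_q -> 'cV[F]_m) (a : 'I_q -> 'rV[int]_r) (H : 'I_r -> 'M[F]_m) :
    injective a -> (forall j, y j != 0) -> (forall l j, H l *m y j = (a j 0 l)%:~R *: y j) ->
  exists Phi : 'M[F]_(q, m), forall j, Phi *m y j = delta_mx j 0.
Proof.
move=> ia y0 hy; pose Y : 'M[F]_(q, m) := \matrix_(j, i) y j i 0.
suff /row_freeP[Psi hPsi] : row_free Y.
  exists Psi^T => j; have -> : y j = (row j Y)^T by apply/colP => i; rewrite !mxE.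
  by rewrite -trmx_mul rowE -mulmxA hPsi mulmx1 trmx_delta.
rewrite -kermx_eq0; apply/eqP/row_matrixP => i; rewrite row0.
have : row i (kermx Y) *m Y = 0 by apply/sub_kermxP; apply: row_sub.
move: (row i (kermx Y)) => c /rowP cY.
have cy : \sum_j c 0 j *: y j = 0.
  apply/colP => l; rewrite summxE [RHS]mxE; have := cY l; rewrite [RHS]mxE mxE => E; rewrite -[RHS]E.
  by apply: eq_bigr => j _; rewrite !mxE.
pose s := [seq a jj.1 - a jj.2 | jj <- enum {: 'I_q * 'I_q} & jj.1 != jj.2].
have [|x hx] := @generic_point F F0 r s.
  move=> _ /mapP[[j k] + ->]; rewrite mem_filter /= => /andP[jk _].
  by rewrite subr_eq0 (inj_eq ia).
pose T (v : 'cV[F]_m) := (\sum_l x l *: H l) *m v.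
pose mu j : F := \sum_l (a j 0 l)%:~R * x l.
have Ty j : T (y j) = mu j *: y j.
  rewrite /T mulmx_suml scaler_suml; apply: eq_bigr => l _.
  by rewrite -scalemxAl hy scalerA mulrC.
have cm j : c 0 j *: y j = 0.
  apply: (@component_mem F _ T (fun v => v = 0) _ _ erefl _ _ _ _ (index_enum 'I_q) mu (fun j => c 0 j *: y j)) => //.
  - by move=> u v; rewrite /T mulmxDr.
  - by move=> b v; rewrite /T -scalemxAr.
  - by move=> u v -> ->; rewrite addr0.
  - by move=> b v ->; rewrite scaler0.
  - by move=> v ->; rewrite /T mulmx0.
  - exact: index_enum_uniq.
  - move=> k l _ _ E; apply/eqP; apply: contraT => kl.
    have /hx/eqP[] : a k - a l \in s by apply/mapP; exists (k, l); rewrite // mem_filter kl mem_enum.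
    rewrite -[RHS](subrr (mu l)) -{1}E /mu -sumrB; apply: eq_bigr => o _.
    by rewrite !mxE rmorphB mulrBl.
  - by move=> k _; exists 1%N; rewrite /= /shift /T -scalemxAr -/(T _) Ty !scalerA mulrC subrr.
apply/rowP => j; rewrite [RHS]mxE; apply/eqP; have /eqP := cm j.
by rewrite scaler_eq0 (negPf (y0 j)) orbF.
Qed.

Lemma det_psg Q (a : 'I_n.+1 -> int) (z : F) : Q \in unitmx -> z != 0 -> \det (psg Q a z) = z ^ (\sum_j a j).
Proof.
move=> uQ z0; rewrite /psg /diagm !det_mulmx det_inv mulrAC mulVf ?mul1r -?unitfE -?unitmxE //.
rewrite det_diag; elim: (index_enum _) => [|j s IH]; first by rewrite !big_nil expr0z.
by rewrite !big_cons IH mxE expfzDr.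
Qed.

Lemma F4_root_sign v : cartan_root cartan_F4 v -> forall k l, 0 < v 0 k -> 0 <= v 0 l.
Proof.
move/listF4P => h k l; rewrite -!nth_rseq => vk.
have /allP/(_ _ h) : all (fun s => all (>= 0) s || all (<= 0) s) listF4 by vm_compute.
case/orP => /allP hs; first by apply: hs; rewrite mem_nth ?size_rseq.
have h1 : (rseq v)`_k <= 0 by apply: hs; rewrite mem_nth ?size_rseq.
by rewrite (lt_geF vk) in h1.
Qed.

(** The positive roots whose negatives are the weights of the tangent space of [G/P_i] at the base
    point; there are 15, 20, 20 and 15 of them. *)
Definition above (i : nat) := [seq s <- listF4 | all (>= 0) s && (0 < s`_i)].

Lemma above_uniq (i : 'I_4) : uniq (above i) && (15 <= size (above i))%N.
Proof.
have /allP h : all (fun i => uniq (above i) && (15 <= size (above i))%N) (iota 0 4) by vm_compute.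
by apply: h; rewrite mem_iota /=.
Qed.

Lemma dot_sumr r (w : 'I_r -> 'I_n.+1 -> int) q (W : 'M[int]_(q, r)) b (u : 'rV[int]_q) :
  dot w b (u *m W) = \sum_l u 0 l * dot w b (row l W).
Proof.
have d0 : dot w b 0 = 0 by have := dotZzr w b b 0; rewrite mulr0z mulr0.
rewrite mulmx_sum_row; elim: (index_enum _) => [|l s IH]; first by rewrite !big_nil d0.
rewrite !big_cons dotDr IH; congr (_ + _); rewrite -[LHS]/(dot w b (u 0 l *: row l W)).
rewrite (_ : u 0 l *: row l W = row l W *~ u 0 l) ?dotZzr 1?mulrC //.
by apply/rowP => o; rewrite [LHS]mxE mulrC -mulrzz; move: (row l W) => v; rewrite -scaler_int mxE intz mulrC mulrzz mulrC.
Qed.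

(** A base only matches the sets of roots, so the Cartan integers must be recovered. Let [m] be the
    true one. Reflecting a simple root by the true and by the combinatorial reflection, in either
    order, gives roots with coefficients 1 and [m - cartan_F4 k l] or its opposite; roots have
    coefficients of one sign, so both are nonnegative. *)
Lemma F4_cartan_dot G t r Q (w : 'I_r -> 'I_n.+1 -> int) (W : 'M[int]_(4, r)) :
    cartan_data G t Q w -> (forall v : 'rV_4, v *m W = 0 -> v = 0) ->
    (forall a, root (lie G) Q w a <-> exists2 v, cartan_root cartan_F4 v & a = v *m W) ->
  forall k l, 2 * dot w (row k W) (row l W) = cartan_F4 k l * dot w (row l W) (row l W).
Proof.
move=> cd Winj hroot k l; have td := cda_tdata cd; have ct := cda_centralizer F0 cd.
have [tk bk nd] := And3 (cda_sub cd) (cda_bracket cd) (cda_nondeg cd).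
have rr v : cartan_root cartan_F4 v -> root (lie G) Q w (v *m W) by move=> cv; apply/hroot; exists v.
have rr' v : root (lie G) Q w (v *m W) -> cartan_root cartan_F4 v.
  move=> /hroot[v' cv' E]; suff -> : v = v' by [].
  by apply/eqP; rewrite -subr_eq0; apply/eqP/Winj; rewrite mulmxBl E subrr.
have [->|kl] := eqVneq k l; first by congr (_ * _); rewrite mxE; case: l => [[|[|[|[|]]]]].
pose dl := delta_mx 0 l : 'rV[int]_4; pose dk := delta_mx 0 k : 'rV[int]_4.
have cl : cartan_root cartan_F4 dl by constructor.
have ck : cartan_root cartan_F4 dk by constructor.
have Wl : dl *m W = row l W by rewrite rowE.
have Wk : dk *m W = row k W by rewrite rowE.
have wl0 : row l W != 0 by rewrite -Wl; apply: contra_neq (oner_neq0 int) => /Winj/rowP/(_ l); rewrite !mxE !eqxx.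
have A2 (c : int) : ((dk + c *: dl) *m cartan_F4) 0 l = cartan_F4 k l + 2 * c.
  rewrite mulmxDl -scalemxAl -!rowE !mxE -/(cartan_F4 l l) mulrC; congr (_ + _ * _).
  by case: (l) => [[|[|[|[|]]]]].
have sg c : cartan_root cartan_F4 (dk + c *: dl) -> 0 <= c.
  move/F4_root_sign/(_ k l); rewrite !mxE !eqxx [l == k]eq_sym !(negPf kl) /=.
  by rewrite mulr0 addr0 add0r mulr1; apply.
have mulz (c : int) (v : 'rV[int]_4) : v *m W - (dl *m W) *~ c = (v - c *: dl) *m W.
  by rewrite mulmxBl -scalemxAl -scaler_int intz.
have refl v : cartan_root cartan_F4 v -> exists2 m : int, 2 * dot w (row l W) (v *m W) = m * dot w (row l W) (row l W) &
    cartan_root cartan_F4 (v - m *: dl).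
  move=> cv; have [m hm] := root_reflection F0 td tk bk nd ct (rr _ cl) (rr _ cv).
  by rewrite mulz Wl in hm * => /rr'; exists m.
have [m Em cm] := refl _ ck; rewrite -scaleNr in cm.
have h1 := sg _ cm; have := cartan_reflection l cm; rewrite A2 -/dl -addrA -scaleNr -scalerDl => /sg h2.
have c3 := cartan_reflection l ck; have Ak : (dk *m cartan_F4) 0 l = cartan_F4 k l by rewrite -rowE mxE.
rewrite Ak -/dl in c3; have [m' Em'] := refl _ c3; rewrite -addrA -!scaleNr -scalerDl => /sg h3.
have Ed : 2 * dot w (row l W) ((dk - cartan_F4 k l *: dl) *m W) =
    (m - 2 * cartan_F4 k l) * dot w (row l W) (row l W).
  rewrite -mulz dotDr (_ : - (_ *~ _) = (dl *m W) *~ (- cartan_F4 k l)); last by rewrite mulrNz.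
  by rewrite dotZzr Wl mulrDr Em; ring.
have Em2 := dot_cancel F0 td tk bk nd ct wl0 (etrans (esym Em') Ed).
rewrite dotC -Wk Em (_ : m = cartan_F4 k l) //; lia.
Qed.

Lemma subst_linear_form m (R : 'M[poly]_m) (phi : 'rV[F]_m) (v : 'cV[F]_m) :
  exists Z : poly, (forall g, mxeval Z g = (phi *m repmx R g *m v) 0 0) /\
    forall X, mxeval (ider X Z) 1%:M = (phi *m drep R X *m v) 0 0.
Proof.
exists (\sum_i \sum_l (phi 0 i * v l 0) *: R i l); split=> [g|X]; rewrite ?ider_sum mxeval_sum -mulmxA mxE.
  apply: eq_bigr => i _; rewrite mxeval_sum mxE mulr_sumr; apply: eq_bigr => l _.
  by rewrite mxevalZ [repmx _ _ _ _]mxE mulrAC mulrA.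
apply: eq_bigr => i _; rewrite ider_sum mxeval_sum mxE mulr_sumr; apply: eq_bigr => l _.
by rewrite iderZ mxevalZ [drep _ _ _ _]mxE mulrAC mulrA.
Qed.

(** The functions [Z] are coordinates of the translate of the highest weight vector [v], dual to [v]
    and to its images under 15 lowering root vectors. These 16 vectors have distinct weights, and
    the images are nonzero because the roots involved pair positively with the fundamental
    weight. *)
Theorem F4_parabolic_orbit G B S i P x : simple_group G -> borel_subgroup G B ->
    fundamental_parabolic cartan_F4 G B i P -> closed_connected S -> (forall g, S g -> G g) -> G x ->
    quotient_open G P (quotient_orbit S P x) ->
  (15 <= \dim (lie S))%N.
Proof.
move=> sG [BG _ _ _] [T [alpha [omega [mT rb bb fw [m [rho [v [[rr _ _] [v0 hB hT] PE]]]]]]]] cS SG Gx [_ hopen].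
have [cG _ _] := sG; have [[sgG _] _] := cG; have uG := subgroup_unit sgG.
have [t [r [Q [w [W [TE cd hW Winj hroot]]]]]] := root_base_data F0 sG mT rb.
have cdot := F4_cartan_dot cd Winj hroot; have Tsub : forall A, tgroup Q w A -> G A by rewrite -TE; case: mT.
have td := cda_tdata cd; have uQ := td_unit td; have ct := cda_centralizer F0 cd.
have [tk bk nd] := And3 (cda_sub cd) (cda_bracket cd) (cda_nondeg cd).
have [k [R hR]] := rational_rep_polynomial uG rr.
have RM g h : G g -> G h -> repmx R (g *m h) = repmx R g *m repmx R h.
  move=> Gg Gh; have Ggh := subgroup_mul sgG Gg Gh; rewrite /repmx !hR // (rep_mul rr) // det_mulmx exprMn.
  by rewrite -scalemxAl -scalemxAr scalerA.
have G1 := subgroup_one sgG.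
have rho1 : rho 1%:M = 1%:M.
  by have u1 := rep_unit rr G1; rewrite -[LHS](mulmxK u1) -(rep_mul rr) // mulmx1 mulmxV.
have R1 : repmx R 1%:M = 1%:M by rewrite /repmx hR // det1 expr1n scale1r.
have P1 : P 1%:M by rewrite PE; split; rewrite // rho1 mul1mx memv_line.
(* [o] is the fundamental weight; the sum is the contribution of the determinant twist. *)
pose o := row i inv_F4 *m W; pose ka : 'rV[int]_r := \row_l (k%:Z * (\sum_j w l j) + o 0 l).
have omv l : drep R (om Q w l) *m v = (ka 0 l)%:~R *: v.
  apply: (drep_weight F0 uQ) => z z0; have Tz : tgroup Q w (psg Q (w l) z) by apply: (tgroup_psg td).
  rewrite /repmx hR; last exact: Tsub.
  rewrite -scalemxAl hT ?TE // scalerA det_psg // (fundamental_weight_comb _ fw) ?TE //.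
  by rewrite (char_comb_weight (row i inv_F4) hW) // -/o [ka _ _]mxE expfzDr // exprnP exprz_exp (mulrC k%:Z).
have omk l : om Q w l \in lie G by apply: (subvP tk); apply: (om_mem td).
have step a X l : X \in lie G -> isw Q w a X ->
    drep R (om Q w l) *m (drep R X *m v) = (ka 0 l + a 0 l)%:~R *: (drep R X *m v).
  move=> Xk hX; have := drep_bracket RM (omk l) Xk; rewrite hX drepZ => /(congr1 (fun M => M *m v)).
  rewrite mulmxBl -!mulmxA omv -scalemxAl => /eqP; rewrite -scalemxAr eq_sym subr_eq => /eqP->.
  by rewrite -scalerDl -rmorphD addrC.
pose s := above i; have /andP[us ss] := above_uniq i; pose sn (l : 'I_15) := nth [::] s l.
have facts (l : 'I_15) : [/\ size (sn l) = 4%N, cartan_positive_root cartan_F4 (srow (sn l)) & 0 < srow (sn l) 0 i].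
  have ls : sn l \in s by rewrite mem_nth // (leq_trans (ltn_ord l)).
  move: ls; rewrite mem_filter => /andP[/andP[pos si] lsF]; set u := srow (sn l).
  have sz : size (sn l) = 4%N by apply/eqP; apply: (allP (_ : all (fun s => size s == 4%N) listF4)) lsF; vm_compute.
  split=> //; last by rewrite mxE.
  split=> [|j]; last by rewrite mxE; apply: (allP pos); rewrite mem_nth ?sz.
  apply/listF4P; rewrite (_ : rseq u = (sn l)) //; apply: (@eq_from_nth _ 0) => [|j]; rewrite size_rseq ?sz // => j4.
  by rewrite -[j]/(nat_of_ord (Ordinal j4)) nth_rseq mxE.
have [ef hef] : exists ef : 'I_15 -> mat, forall l, [/\ ef l \in lie G, isw Q w (- (srow (sn l) *m W)) (ef l) & drep R (ef l) *m v != 0].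
  suff /choice[ef h] l : exists f, [/\ f \in lie G, isw Q w (- (srow (sn l) *m W)) f & drep R f *m v != 0] by exists ef.
  have [sz pu ui] := facts l; set u := srow (sn l) in pu ui *; have [cu _] := pu.
  have [a [a0 [e [eB e0 he]]] ha] : exists2 a, root (lie B) Q w a & weight_of Q w (char_comb alpha u) a.
    by apply: (is_root_weight F0 td); rewrite -TE; apply/(bb.2 _ cu).
  have aE : a = u *m W by apply: (weight_inj F0 ha); apply: char_comb_weight.
  have ek : e \in lie G by apply: (subvP (lie_sub BG)).
  have [f [_ fk _ hf tef]] := dual_vector F0 td tk bk nd ek e0 he.
  exists f; split=> //; first by rewrite -aE.
  (* If [f] kills [v], so does the bracket of [e] and [f], because [e] maps [v] to a vector both
     proportional to it and of another weight. The fundamental weight would then be orthogonal to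
     the root [u *m W], whereas twice their product is the positive coefficient [u 0 i] times the
     square of the simple root. *)
  apply/eqP => fv.
  have [c ec] : exists c, drep R e *m v = c *: v.
    apply: (drep_line v0 (S := B)) eB => g Bg; rewrite /repmx hR; last exact: BG.
    by rewrite -scalemxAl memvZ // hB.
  have ev : drep R e *m v = 0.
    have [l' al] : exists l', a 0 l' != 0.
      apply: contrapT => H; case/eqP: a0; apply/rowP => l'; rewrite mxE.
      by apply/eqP; apply: contraT => hl; case: H; exists l'.
    have := step a e l' ek he; rewrite ec -scalemxAr omv rmorphD scalerDl => /eqP.
    rewrite scalerA [c * _]mulrC -scalerA addrC -subr_eq subrr eq_sym scaler_eq0 char0_intr // (negPf al) /=.
    by move/eqP.
  have := drep_bracket RM ek fk => /(congr1 (fun M => M *m v)).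
  rewrite mulmxBl -!mulmxA ev fv !mulmx0 subrr (lieb_pr F0 td tk bk nd ct ek fk he hf) tef /tau scaler_sumr.
  under eq_bigr do rewrite scalerA.
  rewrite drep_sum mulmx_suml.
  set D := (\det (gram w))%:~R; have D0 : D != 0 :> F by rewrite char0_intr // (det_gram_neq0 F0 td tk bk nd ct).
  set ad := a *m \adj (gram w) => E.
  have zero1 : \sum_l (ad 0 l)%:~R * (ka 0 l)%:~R = 0 :> F.
    apply/eqP; have : (\sum_l (ad 0 l)%:~R * (ka 0 l)%:~R / D) *: v == 0.
      rewrite -[X in _ == X]E scaler_suml; apply/eqP/eq_bigr => l' _; rewrite -scalemxAl omv scalerA; congr (_ *: _).
      by rewrite mul1r mulrC mulrA mulrC mulrCA mulrA.
    by rewrite scaler_eq0 (negPf v0) orbF -mulr_suml mulf_eq0 invr_eq0 (negPf D0) orbF.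
  (* A commutator has trace zero, so the determinant twist does not contribute. *)
  have zero2 : \sum_l (ad 0 l)%:~R * (\sum_j w l j)%:~R = 0 :> F.
    have : \tr (lieb e f) = 0 by rewrite /lieb linearB /= mxtrace_mulC subrr.
    rewrite (lieb_pr F0 td tk bk nd ct ek fk he hf) tef linearZ /= /tau linear_sum /= => /eqP.
    rewrite mulf_eq0 mulf_eq0 oner_eq0 invr_eq0 (negPf D0) /= => /eqP E0; rewrite -[RHS]E0.
    by apply: eq_bigr => l' _; rewrite linearZ /= /om diagm_trace // rmorph_sum.
  have bil0 : bil w a o = 0.
    apply: (char0_intr_inj F0); rewrite /bil -/ad mxE rmorph_sum.
    transitivity (\sum_l (ad 0 l)%:~R * (ka 0 l)%:~R - k%:R * \sum_l (ad 0 l)%:~R * (\sum_j w l j)%:~R : F); last first.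
      by rewrite zero1 zero2 mulr0 subrr.
    rewrite mulr_sumr -sumrB; apply: eq_bigr => l' _; rewrite rmorphM [_^T _ _]mxE [ka _ _]mxE.
    rewrite rmorphD rmorphM /= -pmulrn; move: (_%:~R) (_%:~R) (_%:~R) k%:R => c1 c2 c3 c4; ring.
  have dot0 : dot w o a = 0 by rewrite dotC dotE bil0 mulr0.
  have dl l' : 2 * dot w o (row l' W) = (i == l')%:R * dot w (row l' W) (row l' W).
    rewrite dotC dot_sumr mulr_sumr.
    transitivity (\sum_k' inv_F4 i k' * cartan_F4 k' l' * dot w (row l' W) (row l' W)).
      by apply: eq_bigr => k' _; rewrite [row _ _ _ _]mxE mulrCA dotC cdot mulrA.
    by rewrite -mulr_suml; congr (_ * _); have /matrixP/(_ i l') := inv_F4_mul; rewrite !mxE.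
  have : 2 * dot w o a = u 0 i * dot w (row i W) (row i W).
    rewrite aE dot_sumr mulr_sumr (bigD1 i) //= mulrCA dl eqxx mul1r big1 ?addr0 // => l' li.
    by rewrite mulrCA dl eq_sym (negPf li) mul0r mulr0.
  rewrite dot0 mulr0 => /esym/eqP; rewrite mulf_eq0 gt_eqF //= => /eqP d0.
  have wi0 : row i W != 0 by rewrite rowE; apply: contra_neq (oner_neq0 int) => /Winj/rowP/(_ i); rewrite !mxE !eqxx.
  by have := dot_gt0 F0 td tk bk nd ct wi0; rewrite d0.
pose y (j : 'I_16) := if unlift ord0 j is Some l then drep R (ef l) *m v else v.
pose b (j : 'I_16) := if unlift ord0 j is Some l then - (srow (sn l) *m W) else 0.
have Winj2 (u u' : 'rV_4) : u *m W = u' *m W -> u = u'.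
  by move=> E; apply/eqP; rewrite -subr_eq0; apply/eqP/Winj; rewrite mulmxBl E subrr.
have srow_neq0 l : srow (sn l) != 0 :> 'rV[int]_4.
  by have [_ _] := facts l; apply: contraTneq => ->; rewrite mxE.
have ib : injective (fun j => ka + b j).
  move=> j j' /addrI; rewrite /b; case: unliftP => [l ->|->]; case: unliftP => [l' ->|->] //.
  - move/oppr_inj/Winj2/rowP => E; congr lift; apply: val_inj; apply/eqP.
    have lt (q : 'I_15) : (q < size s)%N by apply: leq_trans (ltn_ord q) ss.
    rewrite -(nth_uniq [::] (lt l) (lt l') us); apply/eqP; have [sz _ _] := facts l; have [sz' _ _] := facts l'.
    by apply: (@eq_from_nth _ 0) => [|q]; rewrite sz ?sz' // => q4; have := E (Ordinal q4); rewrite !mxE.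
  - move/eqP; rewrite oppr_eq0 => /eqP E; have /eqP[] := srow_neq0 l; apply: Winj2; by rewrite mul0mx.
  - move/eqP; rewrite eq_sym oppr_eq0 => /eqP E; have /eqP[] := srow_neq0 l'; apply: Winj2; by rewrite mul0mx.
have [||Phi hPhi] := @joint_eigenvectors m 16 r y (fun j => ka + b j) (fun l => drep R (om Q w l)) ib.
- by move=> j; rewrite /y; case: unliftP => // l _; have [] := hef l.
- move=> l j; rewrite /y /b; case: unliftP => [q _|_]; last by rewrite addr0 omv.
  by have [fk hf _] := hef q; rewrite (step _ _ _ fk hf) [in RHS]mxE.
have /choice[Z hZ] j := subst_linear_form R (row j Phi) v.
have rowPhi (j : 'I_16) (M : 'M[F]_m) : (row j Phi *m M *m v) 0 0 = (Phi *m (M *m v)) j 0.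
  by rewrite -mulmxA -row_mul mxE.
(* Openness of the orbit in the quotient topology, reduced to one equation of the complement that
   does not vanish at [x]. *)
have [q [qx hq]] : exists q : poly, mxeval q x != 0 /\
    forall g, G g -> mxeval q g != 0 -> quotient_orbit S P x (lcoset g P).
  have [Zc [S0 ZcE] UE] := hopen.
  have : (G `\` Zc)%classic x.
    rewrite -UE; split=> //; exists 1%:M; [exact: (subgroup_one (cS.1).1)|by rewrite mul1mx].
  case=> _; rewrite ZcE => nx.
  have [q S0q qx] : exists2 q, S0 q & mxeval q x != 0.
    apply: contrapT => H; apply: nx => q S0q; apply/eqP; apply: contraT => hq; case: H; by exists q.
  exists q; split=> // g Gg qg.
  have : (G `\` Zc)%classic g by split=> //; rewrite ZcE => /(_ q S0q) E; rewrite E eqxx in qg.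
  by rewrite -UE => -[].
apply: (open_orbit_dim F0 cG cS Gx (Z := Z) (X := ef) _ _ _ qx) => [l|j|l j|g Gg qg].
- by have [] := hef l.
- rewrite (hZ j).1 R1 rowPhi mul1mx (_ : v = y ord0); last by rewrite /y unlift_none.
  by rewrite hPhi mxE andbT.
- rewrite (hZ j).2 rowPhi (_ : drep R (ef l) *m v = y (lift ord0 l)); last by rewrite /y liftK.
  by rewrite hPhi mxE andbT.
have [b' Sb E] := hq g Gg qg; have bx : G (b' *m x) by apply: (subgroup_mul sgG) => //; apply: SG.
have : lcoset g P g by exists 1%:M => //; rewrite mulmx1.
rewrite -E => -[p Pp gE]; have : P p by []; rewrite PE => -[Gp /vlineP[c hc]].
exists b', (\det p ^+ k * c); split=> // j.
rewrite !(hZ j).1 !rowPhi -gE RM // -mulmxA {2}/repmx hR // -scalemxAl hc scalerA -scalemxAr -scalemxAr.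
by rewrite mxE.
Qed.
End HighestWeight.

(** * Subgroups of maximal rank *)

Section AdjointStability.
Variables (F : closedFieldType) (n : nat).
Hypothesis F0 : char0 F.
Local Notation mat := 'M[F]_n.+1.
Implicit Types (X Y A e f g u : mat) (K S N : set mat) (U : {vspace mat}).

Lemma linear_entries (L : 'End(mat)) X i j :
  L X i j = \sum_k \sum_l X k l * L (delta_mx k l) i j.
Proof.
rewrite {1}(matrix_sum_delta X) linear_sum summxE; apply: eq_bigr => k _.
by rewrite linear_sum summxE; apply: eq_bigr => l _; rewrite linearZ mxE.
Qed.

Definition coproj U : 'End(mat) := \1%VF - projv U.

Lemma mem_projv U X : X \in U <-> forall i j, coproj U X i j = 0.
Proof.
have E Y : coproj U Y = Y - projv U Y by rewrite add_lfunE opp_lfunE id_lfunE.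
split=> [XU i j|H]; first by rewrite E projv_id // subrr mxE.
rewrite (_ : X = projv U X) ?memv_proj //; apply/eqP; rewrite -subr_eq0; apply/eqP/matrixP => i j.
by rewrite -E H mxE.
Qed.

(** Each equation of [U] along the curve of conjugates is a polynomial without constant term, whose
    derivative is the same polynomial for [lieb e u]; induction on the size makes it zero. *)
Lemma Ad_expm_stable U e u (s : F) : nilmx e -> (forall v, v \in U -> lieb e v \in U) -> u \in U ->
  expm e s *m u *m invmx (expm e s) \in U.
Proof.
move=> ne hU; move: u; pose cv u := ecurve e *m map_mx polyC u *m ecurve (- e).
have cvE u x : curve (cv u) x = expm e x *m u *m invmx (expm e x).
  rewrite /cv !curve_mulmx curve_const (invmx_expm F0) //; congr (_ *m _).
  rewrite -/(expm (- e) x) !expmE; apply: eq_bigr => k _.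
  by rewrite -scaleN1r exprZn scalerA -mulrA [_ * (-1) ^+ k]mulrC -exprNn.
have dM (d d' : 'M[{poly F}]_n.+1) :
    map_mx (@deriv F) (d *m d') = map_mx (@deriv F) d *m d' + d *m map_mx (@deriv F) d'.
  by apply/matrixP => i j; rewrite !mxE raddf_sum -big_split; apply: eq_bigr => k _; rewrite /= derivM !mxE.
have d0 A : map_mx (@deriv F) (map_mx polyC A) = 0 by apply/matrixP => i j; rewrite !mxE derivC.
have com : ecurve (- e) *m map_mx polyC (- e) = map_mx polyC (- e) *m ecurve (- e).
  rewrite /ecurve mulmx_suml mulmx_sumr; apply: eq_bigr => k _.
  have ce : (- e) ^+ k *m (- e) = (- e) *m (- e) ^+ k by rewrite -[LHS]exprSr -[RHS]exprS.
  by rewrite -scalemxAl -scalemxAr -!map_mxM /= ce.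
have dcv u : map_mx (@deriv F) (cv u) = cv (lieb e u).
  have nN : nilmx (- e) by apply: nilmxN.
  rewrite /cv !dM d0 mulmx0 addr0 (ecurve_flow F0 ne) (ecurve_flow F0 nN) com /lieb.
  rewrite map_mxD !map_mxN !map_mxM mulmxDr mulmxDl; congr (_ + _); first by rewrite !mulmxA.
  by rewrite !mulNmx !mulmxN !mulNmx !mulmxA.
pose P i j u : {poly F} := \sum_k \sum_l (coproj U (delta_mx k l) i j) *: cv u k l.
have PE i j u x : (P i j u).[x] = coproj U (expm e x *m u *m invmx (expm e x)) i j.
  rewrite linear_entries -cvE horner_sum; apply: eq_bigr => k _; rewrite horner_sum.
  by apply: eq_bigr => l _; rewrite hornerZ mulrC /curve [map_mx _ _ _ _]mxE.
have dP i j u : (P i j u)^`() = P i j (lieb e u).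
  rewrite /P raddf_sum; apply: eq_bigr => k _; rewrite raddf_sum; apply: eq_bigr => l _ /=.
  by rewrite derivZ -dcv [map_mx _ _ _ _]mxE.
have P0 i j m u : u \in U -> (size (P i j u) <= m)%N -> P i j u = 0.
  elim: m u => [|m IH] u uU sP; first by apply/eqP; rewrite -size_poly_eq0 -leqn0.
  have dP0 : (P i j u)^`() = 0.
    rewrite dP; apply: IH; [exact: hU|rewrite -dP].
    by have [->|p0] := eqVneq (P i j u) 0; rewrite ?deriv0 ?size_poly0 // -ltnS (leq_trans (lt_size_deriv p0)).
  have P00 : (P i j u)`_0 = 0.
    by rewrite -horner_coef0 PE expm0 mul1mx invmx1 mulmx1; apply: (mem_projv U u).1.
  apply/polyP => -[|k]; rewrite coef0 //; have /polyP/(_ k) := dP0; rewrite coef_deriv coef0 => /eqP.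
  by rewrite -mulr_natr mulf_eq0 F0 orbF => /eqP.
by move=> u uU; apply/mem_projv => i j; rewrite -PE (P0 i j _ u uU (leqnn _)) horner0.
Qed.

Lemma Ad_zcl_stable U S : (forall A, S A -> A \in unitmx) ->
    (forall A u, S A -> u \in U -> A *m u *m invmx A \in U) ->
  forall A u, zcl S A -> u \in U -> A *m u *m invmx A \in U.
Proof.
move=> uS hS A u zA uU; apply/mem_projv => i j; move: A zA.
apply: (@regfun_zcl F n S (fun A => coproj U (A *m u *m invmx A) i j)) => // [|A SA]; last first.
  exact: (mem_projv U _).1 (hS _ _ SA uU) i j.
have reg : regmx (fun A => A *m u *m invmx A).
  apply: regmx_mul (@regmx_inv F n); apply: regmx_mul (@regmx_cst F n _ _ _); exact: (@regmx_id F n).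
apply: (@regfun_ext F n (fun A => \sum_k \sum_l (A *m u *m invmx A) k l * coproj U (delta_mx k l) i j)).
  by move=> A _; rewrite linear_entries.
apply: regfun_sum => k; apply: regfun_sum => l.
have -> : (fun A => (A *m u *m invmx A) k l * coproj U (delta_mx k l) i j) =
    (fun A => (A *m u *m invmx A *m ((coproj U (delta_mx k l) i j)%:M : mat)) k l).
  by apply: funext => A; rewrite mul_mx_scalar [RHS]mxE mulrC.
by apply: regmx_mul => //; apply: (@regmx_cst F n).
Qed.

(** The one-parameter subgroups of the replicas of [X] lie in [N] and are diagonalizable as well as
    unipotent, hence trivial. *)
Lemma unipotent_lie_nil N X : closed_subgroup N -> unipotent N -> X \in lie N -> nilmx X.
Proof.
move=> cN uN XN; have [m [c [Q [a [uQ _ _ [k nil] hK]]]]] := replicas F0 X.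
have two : (2 : F) != 0 by rewrite F0.
have a0 j i : a j i = 0.
  have Nj : N (psg Q (a j) 2) by apply: psg_mem => //; apply: hK => //; case: cN.
  have E : psg Q (a j) 2 = 1%:M by apply: unipotent_diagm => //; apply: uN.
  apply: (exprz2_inj F0); rewrite expr0z; have := E; rewrite -(diagm_const 1 uQ) => /(diagm_inj uQ).
  by move/(congr1 (fun h : 'I_n.+1 -> F => h i)).
exists k; move: nil; rewrite big1 ?subr0 // => j _.
rewrite (_ : (fun i => _) = fun=> 0); first by rewrite diagm_const // raddf0 scaler0.
by apply: funext => i; rewrite a0.
Qed.

Lemma normal_lie_ideal N K X Y : closed_subgroup K -> normal_in N K -> X \in lie K -> Y \in lie N ->
  lieb X Y \in lie N.
Proof.
move=> kK [NK nN]; apply: (Ad_stable_lie F0 kK) => g v Kg vN; have ug : g \in unitmx := subgroup_unit kK.1 Kg.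
have uig : invmx g \in unitmx by rewrite unitmx_inv.
have := @lie_Ad_sub F n N N (invmx g) v uig; rewrite invmxK; apply => // A NA.
exact: nN.
Qed.

Lemma lie0_trivial N : closed_connected N -> (forall X, X \in lie N -> X = 0) -> trivial N.
Proof.
move=> cN lN0; have [[sN _] _] := cN; have c1 : closed_subgroup [set (1%:M : mat)]%classic.
  have sub1 : subgroup [set (1%:M : mat)]%classic.
    split=> [A ->|//|A B -> ->|A ->]; rewrite ?unitmx1 //; first by rewrite /set1 /= mul1mx.
    by rewrite /set1 /= invmx1.
  split=> //; exists [set 1%:M : mat]%classic.
    exists (fun p => exists i j, p = xvar F i j - ((1%:M : mat) i j)%:MP); apply/seteqP; split=> [A -> _ [i [j ->]]|A hA].
      by rewrite mxevalB mxeval_xvar mxevalC subrr.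
    apply/matrixP => i j; apply/eqP; rewrite -subr_eq0; apply/eqP.
    by rewrite -(hA _ (ex_intro _ i (ex_intro _ j erefl))) mxevalB mxeval_xvar mxevalC.
  by apply/seteqP; split=> [A ->|A []//]; split=> //; apply: unitmx1.
apply/seteqP; split=> [A NA|A ->]; last exact: (subgroup_one sN).
apply: (connected_sub F0 cN c1) NA; apply/subvP => X /lN0->; exact: mem0v.
Qed.

(** The Lie algebra of a normal unipotent subgroup is an ideal of nilpotent matrices, so it lies in
    the radical of the trace form. *)
Lemma nondegenerate_reductive K : closed_connected K -> nondegenerate K -> reductive K.
Proof.
move=> cK nd; split=> // N cN nN uN; have [kN _] := cN; have [kK _] := cK.
apply: lie0_trivial => // X XN; apply: nd => [|Y YK]; first exact: (subvP (lie_sub nN.1)).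
apply: (nil_ideal_trace (L := lie N)) => // [X' Y'|X'|X' XN'].
- exact: lie_bracket kN.1.
- exact: unipotent_lie_nil.
exact: (normal_lie_ideal kK nN YK XN').
Qed.
End AdjointStability.

(** * Groups attached to closed symmetric sets of roots *)

Section FullRank.
Variables (F : closedFieldType) (n : nat).
Hypothesis F0 : char0 F.
Local Notation mat := 'M[F]_n.+1.
Implicit Types (X Y Z A e f g : mat) (K S : set mat) (U : {vspace mat}).
Variables (G : set mat) (t : {vspace mat}) (Q : mat) (w : 'I_4 -> 'I_n.+1 -> int) (M : 'M[int]_4).
Hypothesis cG : closed_connected G.
Hypothesis nd : nondegenerate G.
Hypothesis td : tdata t Q w.
Hypothesis tk : (t <= lie G)%VS.
Hypothesis ct : forall X, X \in lie G -> isw Q w 0 X -> X \in t.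
Hypothesis dM : \det M != 0.
Hypothesis hG : forall a, root (lie G) Q w a <-> a != 0 /\ exists2 v, cartan_root cartan_F4 v & a = v *m M.
Local Notation isw := (isw Q w).
Local Notation wcomp := (wcomp Q w).
Local Notation om := (om Q w).

Let sG : subgroup G := (cG.1).1.
Let bk : bracket_closed (lie G). Proof. by move=> X Y; apply: lie_bracket. Qed.

Lemma F4_root_neq0 v : cartan_root cartan_F4 v -> v *m M != 0.
Proof.
move=> cv; apply/eqP => E; have v0 : v = 0 by apply: (det_inj dM); rewrite E mul0mx.
have /listF4P := cv; rewrite v0 (_ : rseq 0 = nseq 4 0); first by vm_compute.
by apply: (@eq_from_nth _ 0) => [|j]; rewrite size_rseq // => j4; rewrite -[j]/(nat_of_ord (Ordinal j4)) nth_rseq mxE nth_nseq j4.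
Qed.

Lemma root_F4 v : root (lie G) Q w (v *m M) <-> cartan_root cartan_F4 v.
Proof.
split=> [/hG[_ [v' cv' /(det_inj dM)->]]//|cv]; apply/hG.
by split; [apply: F4_root_neq0|exists v].
Qed.

Variable phi : 'rV[int]_4 -> Prop.
Hypothesis phiF : forall v, phi v -> cartan_root cartan_F4 v.

(** The sum of [t] and the root spaces of [phi], cut out by the vanishing of the other weight
    components. *)
Definition phi_pred X := X \in lie G /\ forall a, a != 0 -> (forall v, phi v -> a <> v *m M) -> wcomp a X = 0.

Fact phi_space_exists : {U : {vspace mat} | forall X, X \in U <-> phi_pred X}.
Proof.
apply: vspace_of_pred => [|c X Y [Xk hX] [Yk hY]]; first by split=> [|a _ _]; [exact: mem0v|exact: (wcomp0 td)].
split=> [|a a0 ha]; first by rewrite memvD ?memvZ.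
apply: (cmx_inj td); apply/matrixP => j k; have := congr1 (fun A => cmx Q A j k) (hX a a0 ha).
have := congr1 (fun A => cmx Q A j k) (hY a a0 ha); rewrite /= !(cmx_wcomp td) cmxD cmxZ cmx0.
by case: ifP => // _ hy hx; rewrite [LHS]mxE [X in X + _]mxE hx hy ![(0 : mat) _ _]mxE mulr0 addr0.
Qed.

Definition phi_space := sval phi_space_exists.

Lemma phi_spaceP X : X \in phi_space <-> phi_pred X.
Proof. exact: (svalP phi_space_exists). Qed.

Lemma isw_phi_space a X : X \in lie G -> isw a X -> (X != 0 -> a != 0 -> exists2 v, phi v & a = v *m M) ->
  X \in phi_space.
Proof.
move=> Xk hX h; apply/phi_spaceP; split=> // b b0 hb; have [->|X0] := eqVneq X 0; first exact: (wcomp0 td).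
have [ba|ba] := eqVneq b a; last exact: (wcomp_other F0 td hX).
by have [v pv E] := h X0 (etrans (congr1 (fun x => x != 0) (esym ba)) b0); case: (hb v pv); rewrite ba.
Qed.

Lemma t_phi_space : (t <= phi_space)%VS.
Proof.
apply/subvP => X Xt; apply: (isw_phi_space (a := 0)) (subvP tk _ Xt) _ _ => [|_]; last by rewrite eqxx.
apply: (isw0P td X).2 => H Ht; apply: (toral_commute _ Ht Xt); exists Q; first exact: (td_unit td).
by move=> Y /(td_span td)[c ->]; rewrite /= diagm_comb; eexists.
Qed.

Lemma phi_space_comp a X : X \in phi_space -> wcomp a X \in phi_space.
Proof.
move=> /phi_spaceP[Xk hX]; apply: (isw_phi_space (a := a)); [exact: (k_wcomp F0 td tk bk)|exact: (wcomp_isw F0 td)|].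
move=> X0 a0; apply: contrapT => H; case/eqP: X0; apply: hX => // v pv E; by case: H; exists v.
Qed.

Lemma phi_space_min U : (t <= U)%VS ->
    (forall v, phi v -> exists e, [/\ e \in lie G, e \in U, e != 0 & isw (v *m M) e]) -> (phi_space <= U)%VS.
Proof.
move=> tU hU; apply/subvP => X /phi_space_comp hX; rewrite (wcomp_decomp td X); apply: memv_suml => a _.
have /phi_spaceP[Xk ha] := hX a; have hi := wcomp_isw F0 td a X.
have [a0|a0] := eqVneq a 0; first by apply: (subvP tU); apply: ct => //; rewrite a0 in hi *.
have [->|X0] := eqVneq (wcomp a X) 0; first exact: mem0v.
have [v pv E] : exists2 v, phi v & a = v *m M.
  apply: contrapT => H; case/eqP: X0; rewrite -(wcomp_id F0 td hi); apply: ha => // v pv E; by case: H; exists v.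
have [e [ek eU e0 he]] := hU v pv; have [f pf] := dual_vector F0 td tk bk nd ek e0 he.
rewrite E in hi Xk *; have [s ->] := root_line F0 td tk bk nd ct (F4_root_neq0 (phiF pv)) pf Xk hi.
exact: memvZ.
Qed.

Lemma lie_phi_space (L : {vspace mat}) : (L <= lie G)%VS -> (t <= L)%VS -> bracket_closed L ->
  (forall v, root L Q w (v *m M) -> phi v) -> (L <= phi_space)%VS.
Proof.
move=> LG tL bL hL; apply/subvP => X XL; apply/phi_spaceP; split=> [|a a0 ha]; first exact: (subvP LG).
apply/eqP; apply: contraT => X0; have wL := k_wcomp F0 td tL bL a XL; have hi := wcomp_isw F0 td a X.
have [|_ [v _ aE]] := (hG a).1; first by split=> //; exists (wcomp a X); split=> //; apply: (subvP LG).
case: (ha v) => //; apply: hL; rewrite -aE; split=> //; by exists (wcomp a X).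
Qed.

Lemma full_root_lie (L : {vspace mat}) : (forall v, cartan_root cartan_F4 v -> phi v) ->
  (t <= L)%VS -> (L <= lie G)%VS -> (forall v, phi v -> root L Q w (v *m M)) -> (lie G <= L)%VS.
Proof.
move=> Fphi tL LG hL; apply: (subv_trans (lie_phi_space (subvv _) tk bk _)) => [v /root_F4/Fphi//|].
by apply: phi_space_min => // v /hL[_ [e [eL e0 he]]]; exists e; split=> //; apply: (subvP LG).
Qed.

Lemma phi_vectors v : phi v -> exists e, [/\ e \in lie G, e != 0 & isw (v *m M) e].
Proof. by move=> /phiF/root_F4[_ [e [ek e0 he]]]; exists e. Qed.

Hypothesis phiN : forall v, phi v -> phi (- v).
Hypothesis phiD : forall u v, phi u -> phi v -> cartan_root cartan_F4 (u + v) -> phi (u + v).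

Lemma phi_space_bracket u e Y : phi u -> e \in lie G -> isw (u *m M) e -> Y \in phi_space -> lieb e Y \in phi_space.
Proof.
move=> pu ek he hY; rewrite (wcomp_decomp td Y) liebN lieb_suml memvN; apply: memv_suml => c _.
rewrite liebN memvN; have /phi_spaceP[Yk hc] := phi_space_comp c hY.
apply: (isw_phi_space (bk ek Yk) (isw_bracket he (wcomp_isw F0 td c Y))) => Z0 d0.
have hi := wcomp_isw F0 td c Y.
have [c0|c0] := eqVneq c 0; first by exists u; rewrite // c0 addr0.
have [v pv E] : exists2 v, phi v & c = v *m M.
  apply: contrapT => H; case/eqP: Z0; rewrite -(wcomp_id F0 td hi) hc ?lieb0 // => v pv E; by case: H; exists v.
exists (u + v); last by rewrite E mulmxDl.
apply: phiD => //; apply/root_F4; rewrite mulmxDl -E; split=> //; exists (lieb e (wcomp c Y)); split=> //.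
  exact: bk.
exact: isw_bracket.
Qed.

Definition phi_vector e := exists v, [/\ phi v, e \in lie G & isw (v *m M) e].

Lemma phi_vector_nil e : phi_vector e -> nilmx e.
Proof. by case=> v [pv ek he]; apply: (isw_nil F0 td (F4_root_neq0 (phiF pv)) he). Qed.

Definition phi_curve (i : 'I_4 + {e | phi_vector e}) : set mat :=
  match i with
  | inl i => fun A => exists2 z : F, z != 0 & A = psg Q (w i) z
  | inr e => fun A => exists2 s : F, True & A = expm (sval e) s
  end.

Definition phi_gen : set mat := fun A => exists i, phi_curve i A.
Definition phi_group : set mat := zcl (generated phi_gen).

Lemma phi_gen_unit A : phi_gen A -> A \in unitmx.
Proof.
case=> -[i [z z0 ->]|[e pe] [s _ ->]]; first exact: (psg_unit _ (td_unit td)).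
exact: (mulmx1_unit (expmV F0 s (phi_vector_nil pe))).1.
Qed.

Lemma phi_group_connected : closed_connected phi_group.
Proof.
apply: generated_connected => [i A Ai|[i|[e pe]]|[i|[e pe]]].
- by apply: phi_gen_unit; exists i.
- exact: (psg_connected F0 _ (td_unit td)).
- exact: (expm_connected F0).
- by exists 1; rewrite ?oner_neq0 // (psg1 _ (td_unit td)).
- by exists 0; rewrite ?expm0.
Qed.

Lemma phi_group_sub A : phi_group A -> G A.
Proof.
apply: (zcl_min cG.1) => B; apply; [exact: sG|move=> C [[i [z z0 ->]|[e pe] [s _ ->]]]].
  by apply: (psg_mem F0 cG.1 (td_unit td) z0); apply: (subvP tk); apply: (om_mem td).
by have [v [_ ek _]] := pe; apply: (expm_mem F0 _ cG.1 (phi_vector_nil pe) ek).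
Qed.

Let gsub A : phi_gen A -> phi_group A.
Proof. by move=> hA; apply: zcl_sub; [exact: subgroup_unit (generated_subgroup phi_gen_unit)|apply: generated_mem]. Qed.

Lemma phi_space_lie : (phi_space <= lie phi_group)%VS.
Proof.
apply: phi_space_min => [|v pv].
  apply/subvP => X /(td_span td)[c ->]; apply: memv_suml => i _; apply: memvZ.
  by apply: (psg_lie F0 (td_unit td)) => z z0; apply: gsub; exists (inl i), z.
have [e [ek e0 he]] := phi_vectors pv; exists e; split=> //.
have pe : phi_vector e by exists v.
by apply: (expm_lie F0 (phi_vector_nil pe)) => s; apply: gsub; exists (inr (exist _ e pe)), s.
Qed.

Lemma phi_gen_stable A u : phi_gen A -> u \in phi_space ->
  A *m u *m invmx A \in phi_space /\ invmx A *m u *m A \in phi_space.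
Proof.
have uQ := td_unit td; case=> -[i [z z0 ->]|[e pe] [s _ ->]] hu.
  have E z' : z' != 0 -> psg Q (w i) z' *m u *m psg Q (w i) z'^-1 \in phi_space.
    move=> z0'; rewrite (wcomp_decomp td u) mulmx_sumr mulmx_suml; apply: memv_suml => c _.
    by rewrite (psg_isw F0 td i z0' (wcomp_isw F0 td c u)) memvZ // phi_space_comp.
  have V : invmx (psg Q (w i) z) = psg Q (w i) z^-1.
    by rewrite -[LHS]mulmx1 -(psgM (w i) uQ z0) mulKmx // psg_unit.
  by rewrite V; split; [exact: E|have := E z^-1; rewrite invr_eq0 invrK; apply].
have ne := phi_vector_nil pe; have hb v : v \in phi_space -> lieb e v \in phi_space.
  by have [v' [pv ek he]] := pe; apply: (phi_space_bracket pv ek he).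
split; first exact: Ad_expm_stable.
have := Ad_expm_stable F0 (- s) ne hb hu; rewrite (invmx_expm F0 _ ne) opprK.
by rewrite (invmx_expm F0 _ ne).
Qed.

(** The generators preserve [phi_space] by conjugation, since [phi] is closed, and so do the group
    and, by bracket, its Lie algebra. Bracketing an element [X] of the latter with [t] thus lands in
    [phi_space], and some [om l] multiplies a given nonzero weight component of [X] by a nonzero
    integer. *)
Lemma lie_phi_group : lie phi_group = phi_space.
Proof.
apply/eqP; rewrite eqEsubv phi_space_lie andbT; apply/subvP => X Xk.
have st A u : phi_group A -> u \in phi_space -> A *m u *m invmx A \in phi_space.
  apply: Ad_zcl_stable => {A u} [|A u hA]; first exact: (subgroup_unit (generated_subgroup phi_gen_unit)).
  pose N : set mat := fun A => A \in unitmx /\ forall u, u \in phi_space ->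
    A *m u *m invmx A \in phi_space /\ invmx A *m u *m A \in phi_space.
  suff [_ h] : N A by move/h => -[].
  apply: hA => [|B hB]; last by split; [exact: phi_gen_unit|move=> v; apply: phi_gen_stable].
  split=> [B []//||B C [uB hB] [uC hC]|B [uB hB]].
  - by split=> [|v]; rewrite ?unitmx1 // invmx1 !mulmx1 mul1mx.
  - split=> [|v hv]; first by rewrite unitmx_mul uB.
    rewrite invmx_mul // !mulmxA; split.
      by have := (hB _ (hC _ hv).1).1; rewrite !mulmxA.
    by have := (hC _ (hB _ hv).2).2; rewrite !mulmxA.
  - by split=> [|v hv]; rewrite ?unitmx_inv // invmxK; have [] := hB v hv.
have ad Y u : Y \in lie phi_group -> u \in phi_space -> lieb Y u \in phi_space.
  by move=> hY hu; apply: (Ad_stable_lie F0 phi_group_connected.1) hY hu => g v; apply: st.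
have XG : X \in lie G by apply: (subvP (lie_sub phi_group_sub)).
apply/phi_spaceP; split=> // a a0 ha; apply: (cmx_inj td); apply/matrixP => j k.
rewrite (cmx_wcomp td) cmx0 [RHS]mxE; case: eqP => // E.
have [l al] : exists l, a 0 l != 0.
  apply: contrapT => H; case/eqP: a0; apply/rowP => l; rewrite mxE.
  by apply/eqP; apply: contraT => hl; case: H; exists l.
have : lieb (om l) X \in phi_space.
  by rewrite liebN memvN; apply: ad => //; apply: (subvP t_phi_space); apply: (om_mem td).
move/phi_spaceP => [_ /(_ a a0 ha)] /(congr1 (fun A => cmx Q A j k)) /=.
rewrite (cmx_wcomp td) E eqxx cmx0 [RHS]mxE (cmx_lieb_om td) E => /eqP.
by rewrite mulf_eq0 char0_intr // (negPf al) => /eqP.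
Qed.

(** Symmetry of [phi] puts the trace-dual of each weight vector of [phi_space] back into
    [phi_space], so the trace form stays nondegenerate. *)
Lemma phi_group_reductive : reductive phi_group.
Proof.
apply: (nondegenerate_reductive F0 phi_group_connected) => X; rewrite lie_phi_group => hX trX.
rewrite (wcomp_decomp td X) big1 // => a _; apply/eqP; apply: contraT => X0.
have /phi_spaceP[Xk ha] := phi_space_comp a hX; have hi := wcomp_isw F0 td a X.
have [f [_ fk _ hf tef]] := dual_vector F0 td tk bk nd Xk X0 hi.
have fP : f \in phi_space.
  apply: (isw_phi_space fk hf) => _ a0; rewrite oppr_eq0 in a0.
  have [v pv E] : exists2 v, phi v & a = v *m M.
    apply: contrapT => H; case/eqP: X0; rewrite -(wcomp_id F0 td hi); apply: ha => // v pv E; by case: H; exists v.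
  by exists (- v); [exact: phiN|rewrite E mulNmx].
have := trace_wcomp F0 td X hf; rewrite opprK mxtrace_mulC trX // mxtrace_mulC tef => /esym/eqP.
by rewrite oner_eq0.
Qed.

Lemma intermediate_group H : closed_connected H -> (t <= lie H)%VS -> (forall A, H A -> G A) ->
    (forall v, root (lie H) Q w (v *m M) -> phi v) ->
  exists K, [/\ reductive K, H `<=` K, K `<=` G & forall v, root (lie K) Q w (v *m M) <-> phi v]%classic.
Proof.
move=> cH tH HG hH; have [[sH _] _] := cH; exists phi_group; split.
- exact: phi_group_reductive.
- apply: (connected_sub F0 cH phi_group_connected.1); rewrite lie_phi_group.
  by apply: lie_phi_space => //; [exact: lie_sub|move=> X Y; apply: lie_bracket].
- exact: phi_group_sub.
move=> v; rewrite lie_phi_group; split=> [[v0 [X [Xk X0 hX]]]|pv].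
  apply: contrapT => nv; case/eqP: X0; rewrite -(wcomp_id F0 td hX); have /phi_spaceP[_] := Xk; apply => // u pu.
  by move/(det_inj dM) => E; apply: nv; rewrite E.
have [e [ek e0 he]] := phi_vectors pv; split; first exact: (F4_root_neq0 (phiF pv)).
by exists e; split=> //; apply: (isw_phi_space ek he) => _ _; exists v.
Qed.
End FullRank.

(** * Semisimplicity, type B4 and the conclusion *)

Section Semisimple.
Variables (F : closedFieldType) (n : nat).
Hypothesis F0 : char0 F.
Local Notation mat := 'M[F]_n.+1.
Implicit Types (X Y A e f : mat) (K N : set mat).

(** A root vector in the ideal [lie N] would bring its coroot direction and its opposite along,
    which [solvable_triple] forbids. So [lie N] lies in [t], and a root nonzero on one of its
    elements would put a root vector into it; hence all roots vanish on it and it is 0. *)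
Lemma spanning_roots_semisimple K t r Q (w : 'I_r -> 'I_n.+1 -> int) : cartan_data K t Q w ->
    (forall c : 'I_r -> F, (forall a, root (lie K) Q w a -> pairing a c = 0) -> forall l, c l = 0) ->
  semisimple K.
Proof.
move=> cd span; have cK := cda_connected cd; split=> // N cN nN solN; have [[sN _] _] := cN.
have td := cda_tdata cd; have uQ := td_unit td; have ct := cda_centralizer F0 cd.
have [tk bk nd] := And3 (cda_sub cd) (cda_bracket cd) (cda_nondeg cd).
have ideal X Y : X \in lie K -> Y \in lie N -> lieb X Y \in lie N by apply: (normal_lie_ideal F0 cK.1 nN).
have NK X : X \in lie N -> X \in lie K by apply: (subvP (lie_sub nN.1)).
have D0 : (\det (gram w))%:~R != 0 :> F by rewrite char0_intr // (det_gram_neq0 F0 td tk bk nd ct).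
have vec a e : a != 0 -> e \in lie N -> isw Q w a e -> e = 0.
  move=> a0 eN he; apply/eqP; apply: contraT => e0; have [f pf] := dual_vector F0 td tk bk nd (NK _ eN) e0 he.
  have [ek fk _ hf tef] := pf; have Na0 : - a != 0 by rewrite oppr_eq0.
  pose al := (\det (gram w))%:~R * hval F w a a.
  have al0 : al != 0 by rewrite mulf_neq0 // (hval_neq0 F0 td tk bk nd ct).
  have tauE : tau Q w a = (\det (gram w))%:~R *: lieb e f.
    by rewrite (lieb_pr F0 td tk bk nd ct ek fk he hf) tef scalerA mul1r mulfV // scale1r.
  have te : lieb (tau Q w a) e = al *: e by rewrite tauE liebZl (lieb_h F0 td tk bk nd ct pf he) scalerA.
  have tf : lieb (tau Q w a) f = - al *: f.
    rewrite tauE liebZl (lieb_h F0 td tk bk nd ct pf hf) scalerA /al -mulrN; congr (_ * _ *: _).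
    have := @hvalB F n r w a a 2; rewrite mulrS mulr1n addrA subrr add0r => ->.
    by rewrite mulr_natl mulr2n opprD addrA subrr add0r.
  have fN : f \in lie N.
    have : lieb (tau Q w a) f \in lie N.
      by rewrite tauE liebZl memvZ // liebN memvN ideal // liebN memvN ideal.
    by rewrite tf => h; rewrite -(scale1r f) -(mulVf (_ : - al != 0)) ?oppr_eq0 // -scalerA memvZ.
  have tauD : tau Q w a = diagm Q (fun l => (\sum_i (a *m \adj (gram w)) 0 i * w i l)%:~R).
    rewrite /tau /om diagm_comb; congr diagm; apply: funext => l; rewrite rmorph_sum.
    by apply: eq_bigr => i _; rewrite rmorphM.
  rewrite tauD in te tf; case/eqP: e0.
  apply: (solvable_triple F0 sN solN uQ (isw_nil F0 td a0 he) (isw_nil F0 td Na0 hf) eN fN _ te tf al0) => K' _ hK'.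
  by rewrite -tauD tauE memvZ.
apply: (lie0_trivial F0 cN) => X XN.
have Xt : X \in t.
  rewrite (wcomp_decomp td X); apply: memv_suml => a _.
  have wN : wcomp Q w a X \in lie N.
    by apply: (wcomp_mem F0 td) => // i Y; apply: ideal; apply: (subvP tk); apply: (om_mem td).
  have hi := wcomp_isw F0 td a X; have [a0|a0] := eqVneq a 0.
    by apply: ct; [exact: NK|rewrite a0 in hi *].
  by rewrite (vec a _ a0 wN hi) mem0v.
have [c Xc] := (td_span td X).1 Xt; rewrite Xc big1 // => l _.
rewrite (span c) ?scale0r // => a [a0 [e [ek e0 he]]]; apply/eqP; apply: contraT => pc.
case/eqP: e0; apply: (vec a) => //; have := lieb_toral c he; rewrite -/(om Q w) -Xc => E.
rewrite -(scale1r e) -(mulVf pc) -scalerA memvZ // -E.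
by rewrite liebN memvN ideal.
Qed.

Lemma cartan_data_type_B4 K t Q (w : 'I_4 -> 'I_n.+1 -> int) (C : 'M[int]_4) : cartan_data K t Q w -> \det C != 0 ->
    (forall a, root (lie K) Q w a <-> exists2 u, cartan_root cartan_B4 u & a = u *m C) ->
  of_type cartan_B4 K.
Proof.
move=> cd dC hK; have td := cda_tdata cd; have kK := (cda_connected cd).1; have sT := tgroup_subgroup F0 td.
have rowC i : root (lie K) Q w (row i C) by apply/hK; exists (delta_mx 0 i); [constructor|rewrite rowE].
split.
  apply: (spanning_roots_semisimple cd) => c hc; apply: (det_kernel_free F0 dC) => i.
  by rewrite -[RHS](hc _ (rowC i)); apply: eq_bigr => j _; rewrite mxE.
have wchar a : root (lie K) Q w a -> exists chi, character (tgroup Q w) chi /\ weight_of Q w chi a.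
  case=> _ [X [Xk X0 hX]].
  have [j [k jk]] : exists j k, cmx Q X j k != 0.
    apply: contrapT => H; case/eqP: X0; apply: (cmx_inj td); apply/matrixP => j k; rewrite cmx0 [RHS]mxE.
    by apply/eqP; apply: contraT => jk; case: H; exists j, k.
  exists (rchar Q j k); split; first exact: (rchar_character F0 td).
  by rewrite -((iswP F0 td a X).1 hX j k jk); apply: (rchar_weight td).
have /choice[alpha ha] i := wchar _ (rowC i).
have hW i : weight_of Q w (alpha i) (row i C) by have [] := ha i.
have cw v := char_comb_weight v hW.
have cc v : character (tgroup Q w) (char_comb alpha v) by apply: (char_comb_character sT) => i; have [] := ha i.
exists (tgroup Q w), alpha; split; first exact: (tgroup_maximal F0 td kK (cda_maxtoral cd)).
split=> [i|v h|v cv|chi ir]; first by have [] := ha i.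
- apply: (det_inj dC); rewrite mul0mx; apply: (weight_inj F0 (cw v)) => l z z0.
  by rewrite h ?mxE ?expr0z //; apply: (tgroup_psg td).
- by apply: (root_is_root F0 td _ (cc v) (cw v)); apply/hK; exists v.
have [a ra wa] := is_root_weight F0 td ir; have [u cu aE] := (hK a).1 ra; exists u => //.
by apply: (weight_eq F0 td _ (cc u) wa); [case: ir|rewrite aE; apply: cw].
Qed.

(** The numerical core is [30 <= 2 * \dim (lie S) <= \dim (lie H) + \dim t0 <= 2 * r + size R]. *)
Theorem F4_not_spherical (G B H : set mat) i P : simple_group G -> simply_connected_of_type cartan_F4 G ->
    borel_subgroup G B -> maximal_reductive G H -> ~ of_type cartan_B4 H ->
  fundamental_parabolic cartan_F4 G B i P -> ~ spherical_quotient G P H.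
Proof.
move=> sG scG bB [HG HnG rH maxH] nB4 fP [S [SH cS solS _] [x Gx op]].
have SG g : S g -> G g by move=> /SH/HG.
have d15 := F4_parabolic_orbit F0 sG bB fP cS SG Gx op.
have [cH _] := rH; have ndH : nondegenerate H by move=> X; apply: (reductive_nondegenerate F0 rH).
have [t0 [[t0S tt0 _] le30]] := solvable_dim F0 ndH (lie_sub SH) cS.1 solS.
(* The toral subalgebra [t0] of the Borel subgroup is enlarged to a maximal one of [lie H], so that
   its dimension is at most the rank [r]. *)
have [t1 mt1 t01] := maxtoral_extend (subv_trans t0S (lie_sub SH)) tt0.
have [Q [w0 td0]] := tdata_exists F0 cH.1.1 mt1.
have [r [w [td rE]]] : exists r (w : 'I_r -> 'I_n.+1 -> int), tdata t1 Q w /\ r = \dim t1 by exists (\dim t1), w0.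
have cdH : cartan_data H t1 Q w by [].
have [tH bH ctH] := And3 (cda_sub cdH) (cda_bracket cdH) (cda_centralizer F0 cdH).
have HGl := lie_sub HG; have tG := subv_trans tH HGl.
have [t [QG [wG [W [cdG dW hG]]]]] := F4_data F0 sG scG.
have [M [kM hM ctG]] := transported_roots F0 cdG dW hG td tG.
have r4 := kernel_free_leq kM; have dimH := dim_roots F0 cdH; set R := roots _ _ _ in dimH.
have dt0 : (\dim t0 <= r)%N by rewrite rE; apply: dimvS.
have RP a : a \in R <-> root (lie H) Q w a by split=> /(rootsP F0 (lie H) td a).
have HGr a : root (lie H) Q w a -> root (lie G) Q w a.
  by case=> a0 [X [Xk X0 hX]]; split=> //; exists X; split=> //; apply: (subvP HGl).
have R48 : (size R <= 48)%N.
  rewrite -size_listF4 -(size_map (fun s => srow s *m M)); apply: uniq_leq_size; first exact: roots_uniq.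
  move=> a /RP/HGr/hM[_ [v cv ->]]; apply/mapP; exists (rseq v); first exact/listF4P.
  by rewrite rseqK.
have r4' : r = 4%N.
  apply/eqP; rewrite eqn_leq r4 ltnNge; apply/negP => r3.
  have dotDl a b c : dot w (a + b) c = dot w a c + dot w b c by rewrite dotC dotDr !(dotC w c).
  have R18 : (size R <= 18)%N.
    apply: (@small_rank_roots r (dot w) R r3 (dotC w) dotDl) => [a|||a|a|a j|a b].
    - exact: (dot_gt0 F0 td tH bH ndH ctH).
    - exact: roots_uniq.
    - exact: leq_trans R48 _.
    - by move/RP => [].
    - by move/RP/(rootN F0 td tH bH ndH)/RP.
    - by move=> /RP ra /RP; apply: (root_multiple F0 td tH bH ndH ctH).
    - move=> /RP ra /RP rb; have [m Em hm] := root_reflection F0 td tH bH ndH ctH ra rb.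
      by exists m => //; apply/RP.
  (* With [r <= 3] the sum is at most 6 + 18, less than 30; for [r = 4] the same inequality leaves
     at least 22 roots. *)
  by clear -d15 le30 dimH dt0 r3 R18; lia.
have R22 : (22 <= size R)%N by clear -d15 le30 dimH dt0 r4; lia.
clear rE; subst r; have dM := kernel_free_det kM; have {}ctG := ctG (leqnn 4).
have cG := cda_connected cdG; have ndG := cda_nondeg cdG; have bG := cda_bracket cdG.
pose psi (v : 'rV[int]_4) := root (lie H) Q w (v *m M).
have rF4 v : root (lie G) Q w (v *m M) <-> cartan_root cartan_F4 v by apply: root_F4.
have psiF v : psi v -> cartan_root cartan_F4 v by move/HGr/rF4.
have psiN v : psi v -> psi (- v) by move/(rootN F0 td tH bH ndH); rewrite /psi mulNmx.
have psiD u v : psi u -> psi v -> cartan_root cartan_F4 (u + v) -> psi (u + v).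
  move=> ru rv /rF4 ruv; rewrite /psi mulmxDl in ruv *.
  have [_ [e [ek e0 he]]] := ru; have [_ [f [fk f0 hf]]] := rv; split; first by case: ruv.
  exists (lieb e f); split; [exact: bH| |exact: isw_bracket].
  by apply: (root_bracket F0 td tG bG ndG ctG (HGr _ ru) (HGr _ rv) ruv) => //; apply: (subvP HGl).
have /choice[un hun] a : exists v, a \in R -> psi v /\ a = v *m M.
  have [/RP ra|] := boolP (a \in R); last by exists 0.
  by have [_ [v _ aE]] := (hM a).1 (HGr a ra); exists v => _; rewrite /psi -aE.
have us : uniq (map un R).
  rewrite map_inj_in_uniq; first exact: roots_uniq.
  by move=> a b /hun[_ Ea] /hun[_ Eb] E; rewrite Ea Eb E.
have spsi v : v \in map un R -> psi v by case/mapP=> a /hun[pa _] ->.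
have s22 : (21 < size (map un R))%N by rewrite size_map.
have [psi_all|[C dC hC]|[phi [psi_phi phiF phiN phiD [[v1 cv1 nv1] [v2 pv2 nv2]]]]] :=
    F4_closed_subsets psiF psiN psiD us s22 spsi.
- apply: HnG; apply/seteqP; split=> //; apply: (connected_sub F0 cG cH.1).
  by apply: (@full_root_lie F n F0 G t1 Q w M cG ndG td tG ctG dM hM psi).
- apply: nB4; apply: (cartan_data_type_B4 (C := C *m M) cdH); first by rewrite det_mulmx mulf_neq0.
  move=> a; split=> [ra|[u cu ->]]; last by rewrite mulmxA; apply/hC; exists u.
  have [_ [v _ aE]] := (hM a).1 (HGr a ra); have /hC[u cu vE] : psi v by rewrite /psi -aE.
  by exists u; rewrite // aE vE mulmxA.
have [K [rK HK KG hK]] : exists K, [/\ reductive K, H `<=` K, K `<=` G & forall v, root (lie K) Q w (v *m M) <-> phi v]%classic.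
  by apply: (@intermediate_group F n F0 G t1 Q w M cG ndG td tG ctG dM hM phi phiF phiN phiD H cH).
have [KE|KE] := maxH K rK HK KG; first by apply: nv2; rewrite /psi -KE; apply/hK.
by apply: nv1; apply/hK; rewrite KE; apply/rF4.
Qed.
End Semisimple.

Theorem proposition12 (R : realType) (n : nat) (G B H : set 'M[R[i]]_n)
  (hsimple : simple_group G)
  (hF4 : simply_connected_of_type cartan_F4 G)
  (hB : borel_subgroup G B)
  (hH : maximal_reductive G H)
  (hB4 : ~ of_type cartan_B4 H) :
  forall (i : 'I_4) (P : set 'M[R[i]]_n),
    fundamental_parabolic cartan_F4 G B i P -> ~ spherical_quotient G P H.
Proof.
case: n G B H hsimple hF4 hB hH hB4 => [|n] G B H sG scG bB mH nB4 i P fP.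
  (* Matrices of size 0 are all equal, so such a group would be commutative, hence not simple. *)
  by case: sG => _ [] x y _ _; rewrite (flatmx0 x) (flatmx0 y).
by apply: (F4_not_spherical _ sG scG bB mH nB4 fP) => k; rewrite pnatr_eq0.
Qed.
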